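(* Suppose $\Theta\subset\mathbb R^{\mathrm p}$ is a compact connected domain with smooth boundary; $\theta$ also denotes the standard coordinate map $\operatorname{id}_\Theta:\Theta\to\mathbb R^{\mathrm p}$, and $\zeta_n,\Upsilon_n,g^{-1},V,b$ are identified with their representations in the standard coordinates. For a connection $D$ with Christoffel coefficients $\Gamma^{D,k}_{ij}$ in these coordinates and a $(2,0)$-tensor $S$ write $\Gamma^D[S]:=(\Gamma^{D,k}_{ij}S^{ij})_{k=1}^{\mathrm p}$, and $\Gamma^{(\pm1)}:=\Gamma^{D^{(\pm1)}}$. The assumptions [A1], [A2], [A3] are stated in the context. (a) Under [A1] and [A2]$(\mu_n)$, $$\begin{aligned}\mu_n(\theta)={}&\theta_0+a_n\{\zeta_n+\Upsilon_n[\zeta_n]\}(\theta_0)\\&+a_n^2\Bigl\{V-\Bigl(\tau\Gamma^\nabla+\frac{1-\tau}{2}\Gamma^{(-1)}\Bigr)[g^{-1}]-\frac12\Gamma^{(-1)}[\zeta_n\otimes\zeta_n-g^{-1}]\Bigr\}(\theta_0)+o_{L^{\infty-}(\theta_0)}(a_n^2).\end{aligned}$$ (b) For two choices $(\tau_j,V_j)$, $j=1,2$, with selected invariant probability measures $\mu_n^{(j)}$, if [A1], [A2]$(\mu_n^{(1)})$ and [A2]$(\mu_n^{(2)})$ hold, then $$\mu_n^{(1)}(\theta)-\mu_n^{(2)}(\theta)=a_n^2\Bigl\{V_1-V_2-(\tau_1-\tau_2)\Bigl(\Gamma^\nabla-\frac12\Gamma^{(-1)}\Bigr)[g^{-1}]\Bigr\}(\theta_0)+o_{L^{\infty-}(\theta_0)}(a_n^2).$$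 If $D^{(1)}$ is torsion-free, the connection coefficient $\Gamma^\nabla-\frac12\Gamma^{(-1)}$ equals $\frac12\Gamma^{(1)}$. (c) If [A1], [A2]$(\mu_n)$ and [A3] hold, then $$\mathbb E_{n,\theta_0}[\mu_n(\theta)]-\theta_0=a_n^2\Bigl[V-b-\Bigl\{\tau\Gamma^\nabla+\frac{1-\tau}{2}\Gamma^{(-1)}\Bigr\}[g^{-1}]\Bigr](\theta_0)+o(a_n^2).$$ In particular, if $V=b+\bigl\{\tau\Gamma^\nabla+\frac{1-\tau}{2}\Gamma^{(-1)}\bigr\}[g^{-1}]$, then $\mathbb E_{n,\theta_0}[\mu_n(\theta)]-\theta_0=o(a_n^2)$.
   Context: **Setting.** $\theta_0\in\Theta^\circ$ (interior) is the true parameter. For each $n\ge1$, $(\mathcal X_n,\mathcal A_n,\{P_{n,\theta}:\theta\in\Theta\})$ is a statistical experiment; $\mathbb E_{n,\theta}$, $\operatorname{Cov}_{n,\theta}$ denote expectation and covariance under $P_{n,\theta}$. The map $\Psi_n:\mathcal X_n\times\Theta\to T^*\Theta$ satisfies $\Psi_n(x,\theta)\in T_\theta^*\Theta$, is measurable in $x$ for each fixed $\theta$, and is a smooth one-form on $\Theta$ for each fixed $x$; $x$ is suppressed, so $\Psi_n$ is a random one-form. $a_n\downarrow0$ is deterministic. $g$ is a smooth Riemannian metric on $\Theta$; $\langle\cdot,\cdot\rangle$ is its inner product, $d$ its distance, $\nabla$ its Levi-Civita connection, $\Delta$ its Laplace-Beltrami operator, and $g^{-1}\alpha$ is the vector field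 dual to a one-form $\alpha$. For a connection $D$ on $T\Theta$ and a one-form $\alpha$, $(D\alpha)[X,Y]=X\{\alpha[Y]\}-\alpha[D_XY]$. Christoffel convention: $D_{\partial_i}\partial_j=\Gamma^{D,k}_{ij}\partial_k$. **Invariant measure determined by $(\tau,V)$.** For $\tau\ge0$ and a smooth vector field $V$, let $$L_nf:=\frac\tau2\Delta f+\frac12\{-a_n^{-2}g^{-1}\Psi_n+V\}(f)$$ act on $f\in C^\infty(\Theta)$ with Neumann condition $\mathbf n(f)=0$ on $\partial\Theta$ ($\mathbf n$ the outward $g$-unit normal). It generates the normally reflected process $\mathrm d\theta_t=\frac12\{-a_n^{-2}g^{-1}\Psi_n(\theta_t)+V(\theta_t)\}\mathrm dt+\sqrt\tau\,\mathrm dB_t-\mathbf n(\theta_t)\mathrm dK_t$, with $B$ a $g$-Brownian motion and $K$ the boundary local time. It is assumed that for every $n$ there is a measurable map $x_n\mapsto\mu_n(x_n,\cdot)$ into the Borel probability measures on $\Theta$ (weak topology) such that $\mu_n(x_n,\cdot)$ is an invariant probability measure of the process with generator $L_n(x_n)$; one such selection $\mu_n$ is fixed. $\mu_n(f):=\int_\Theta f\,\mathrm d\mu_n$; so $\mu_n(\theta)$ is the mean of $\mu_n$. In (a) and (c), $\tau\ge0$ and $V$ are fixed; in (b) the two measures share $\Psi_n,a_n,g$ and the precontrast. **Precontrast.** A family of smooth one-forms $\{\Psi^\theta\}_{\theta\in\Theta}$ on $\Theta$, jointly smooth in all arguments, is fixed, with $\Psi^\theta(\theta)=0$ and $Y\{\Psi^\theta[X]\}(\theta)=\langle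 X,Y\rangle(\theta)$ for all vector fields $X,Y$ and all $\theta$. The connections $D^{(1)},D^{(-1)}$ on $T\Theta$ are defined by $$\langle D^{(1)}_{X_1}X_2,Y\rangle(\theta)=-X_1^{(1)}Y^{(2)}\{\Psi^{\theta_2}[X_2](\theta_1)\}\big|_{\theta_1=\theta_2=\theta},\qquad \langle X,D^{(-1)}_{Y_1}Y_2\rangle(\theta)=-Y_1^{(2)}Y_2^{(2)}\{\Psi^{\theta_2}[X](\theta_1)\}\big|_{\theta_1=\theta_2=\theta},$$ where superscripts $(1),(2)$ on vector fields mean differentiation in $\theta_1,\theta_2$. **Orders.** For random variables $X_n$ in a fixed finite-dimensional space, $X_n=O_{L^{\infty-}(\theta)}(r_n)$ (resp. $o_{L^{\infty-}(\theta)}(r_n)$) means $\||X_n|/r_n\|_{L^p(P_{n,\theta})}=O(1)$ (resp. $o(1)$) for every $p<\infty$. **[A1].** In a chart $x=(x^1,\dots,x^{\mathrm p})$ around $\theta_0$, with $\partial_i=\partial/\partial x^i$: $\max_i|\Psi_n[\partial_i](\theta_0)|=O_{L^{\infty-}(\theta_0)}(a_n)$; $\max_{i,j}|\partial_i\{\Psi_n[\partial_j]\}(\theta_0)-\langle\partial_i,\partial_j\rangle(\theta_0)|=o_{L^{\infty-}(\theta_0)}(a_n^{1/2})$; and for every $p<\infty$, $$\lim_{r\downarrow0}\limsup_{n\to\infty}\max_{i,j,k}\Bigl\|\sup_{d(\theta,\theta_0)\le r}\bigl|\partial_i\partial_j\{\Psi_n[\partial_k]\}(\theta)-\partial_i\partial_j\{\Psi^{\theta_0}[\partial_k]\}(\theta)\bigr|\Bigr\|_{L^p(P_{n,\theta_0})}=0.$$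 **Scaled jets.** $\zeta_n:=-a_n^{-1}g^{-1}\Psi_n$, and the $(1,1)$-tensor field $\Upsilon_n$ is given by $\langle\Upsilon_n[X],Y\rangle:=\langle X,Y\rangle-(D^{(1)}\Psi_n)[X,Y]$. **[A2]$(\mu_n)$.** There is $\kappa\in(0,1)$ such that for every $L>0$, $\mathbb E_{n,\theta_0}[\mu_n(\{\theta:d(\theta,\theta_0)\ge a_n^\kappa\})]=O(a_n^L)$. [A2]$(\mu_n^{(j)})$ is this condition for $\mu_n^{(j)}$. **[A3].** With a given smooth one-form $\beta\in\Omega^1(\Theta)$ and a given connection $D^{\mathrm B}$ on $T\Theta$: $a_n^{-2}\mathbb E_{n,\theta_0}[\Psi_n(\theta_0)]\to\beta(\theta_0)$ in $T^*_{\theta_0}\Theta$, and for all smooth vector fields $X_1,X_2,X_3$ defined near $\theta_0$, $$a_n^{-2}\operatorname{Cov}_{n,\theta_0}\{\Psi_n[X_1](\theta_0),\Psi_n[X_2](\theta_0)\}\to\langle X_1,X_2\rangle(\theta_0),$$ $$a_n^{-2}\operatorname{Cov}_{n,\theta_0}\{X_1(\Psi_n[X_2])(\theta_0),\Psi_n[X_3](\theta_0)\}\to\langle D^{\mathrm B}_{X_1}X_2,X_3\rangle(\theta_0).$$ The vector field $b$ is $b:=g^{-1}\{\beta+\operatorname{tr}(D^{(1)}-D^{\mathrm B})\}$, where for a $(1,2)$-tensor $C$, $(\operatorname{tr}C)_j=C^i{}_{ij}$ (the first covariant index being the differentiation direction). *)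

(* Defs.v *)
From HB Require Import structures.
From mathcomp Require Import all_boot all_order all_algebra.
From mathcomp Require Import all_classical all_reals all_analysis.

Set Implicit Arguments.
Unset Strict Implicit.
Unset Printing Implicit Defensive.

Import Order.TTheory GRing.Theory Num.Theory.
Import numFieldNormedType.Exports.

Local Open Scope classical_set_scope.
Local Open Scope ring_scope.

(** Fields on [Theta] are total functions on R^p that are smooth on some open
    neighbourhood of [Theta] (the usual notion of smoothness on a non-open set).
    Only their values on [Theta] matter: [Theta] is the closure of its interior,
    so derivatives at boundary points do not depend on the extension.
    Points, vectors and covectors are rows of coordinates in the standard chart. *)

Section Smooth.
Context {R : realType} {p : nat}.
Implicit Types (A U : set 'rV[R]_p) (f : 'rV[R]_p -> R).

Definition evec (i : 'I_p) : 'rV[R]_p := delta_mx 0 i.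

Definition partial (i : 'I_p) f : 'rV[R]_p -> R := fun t => 'D_(evec i) f t.

(** All iterated partial derivatives are (Frechet) differentiable on [U]. *)
Definition smooth_on U f :=
  forall (s : seq 'I_p) t, U t -> differentiable (foldr partial f s) t.

Definition smooth_near A f :=
  exists U, [/\ open U, A `<=` U & smooth_on U f].

Definition smoothv_on {q} U (F : 'rV[R]_p -> 'rV[R]_q) :=
  forall i, smooth_on U (fun t => F t 0 i).

Definition smoothv_near {q} A (F : 'rV[R]_p -> 'rV[R]_q) :=
  forall i, smooth_near A (fun t => F t 0 i).

End Smooth.

Section Domain.
Context {R : realType} {p : nat}.
Implicit Types (Theta U : set 'rV[R]_p).

Definition bdry Theta : set 'rV[R]_p := Theta `\` interior Theta.

Definition local_defining Theta (t : 'rV[R]_p) U (rho : 'rV[R]_p -> R) :=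
  [/\ open U, U t, smooth_on U rho,
      forall s, U s -> exists i, partial i rho s != 0 &
      forall s, U s -> (Theta s <-> rho s <= 0)].

Definition smooth_boundary Theta :=
  forall t, bdry Theta t -> exists U rho, local_defining Theta t U rho.

End Domain.

Section Geometry.
Context {R : realType} {p : nat}.
Local Notation pt := 'rV[R]_p.
(** Vector fields and one-forms: [X t 0 i] is the i-th component at [t]. *)
Local Notation field := ('rV[R]_p -> 'rV[R]_p).
Implicit Types (Theta : set pt) (g : pt -> 'M[R]_p) (f : pt -> R).

(** X(f) *)
Definition dirder (X : field) f : pt -> R := fun t => 'D_(X t) f t.

(** alpha[X] *)
Definition form_app (al X : field) : pt -> R := fun t => \sum_i al t 0 i * X t 0 i.

Definition metric_on Theta g :=
  [/\ forall i j, smooth_near Theta (fun t => g t i j),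
      forall t, Theta t -> (g t)^T = g t &
      forall t (v : pt), Theta t -> v != 0 -> 0 < (v *m g t *m v^T) 0 0].

Definition ip g t (u v : pt) : R := (u *m g t *m v^T) 0 0.

Definition ginv g t : 'M[R]_p := invmx (g t).

(** the vector dual to a covector; [ginv] is symmetric *)
Definition sharp g t (al : pt) : pt := al *m ginv g t.

Definition riem_dist Theta g (x y : pt) : R :=
  inf [set l : R | exists c : R -> pt,
    [/\ forall t, derivable c t 1,
        continuous (fun t => derive1 c t),
        forall t, 0 <= t <= 1 -> Theta (c t),
        c 0 = x /\ c 1 = y &
        l = \int[lebesgue_measure]_(t in `[0%R, 1%R])
              Num.sqrt (ip g (c t) (derive1 c t) (derive1 c t))]].

Definition outward_unit_normal Theta g (nu : field) :=
  forall t U rho, bdry Theta t -> local_defining Theta t U rho ->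
  [/\ ip g t (nu t) (nu t) = 1,
      forall v, 'D_v rho t = 0 -> ip g t (nu t) v = 0 &
      0 < 'D_(nu t) rho t].

(** [D t i j 0 k] is the coefficient of d_k in D_{d_i} d_j. *)
Definition connection := pt -> 'I_p -> 'I_p -> pt.
Implicit Types D : connection.

Definition connection_on Theta D :=
  forall i j, smoothv_near Theta (fun t => D t i j).

(** D_X Y *)
Definition cov D (X Y : field) : field := fun t =>
  \row_k dirder X (fun s => Y s 0 k) t
  + \sum_i \sum_j (X t 0 i * Y t 0 j) *: D t i j.

(** (D alpha)[X, Y] *)
Definition cov1 D (al X Y : field) : pt -> R := fun t =>
  dirder X (form_app al Y) t - form_app al (cov D X Y) t.

Definition bracket (X Y : field) : field := fun t =>
  \row_k (dirder X (fun s => Y s 0 k) t - dirder Y (fun s => X s 0 k) t).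

Definition torsion_free Theta D := forall X Y : field,
  smoothv_near Theta X -> smoothv_near Theta Y ->
  forall t, Theta t -> cov D X Y t - cov D Y X t = bracket X Y t.

Definition levi_civita Theta g D :=
  [/\ connection_on Theta D, torsion_free Theta D &
      forall X Y Z : field, smoothv_near Theta X -> smoothv_near Theta Y ->
      smoothv_near Theta Z -> forall t, Theta t ->
      dirder Z (fun s => ip g s (X s) (Y s)) t
      = ip g t (cov D Z X t) (Y t) + ip g t (X t) (cov D Z Y t)].

(** Laplace-Beltrami: the g-trace of the Hessian (nabla df), with [nabla] the
    Levi-Civita connection of [g] *)
Definition laplace g (nabla : connection) f : pt -> R := fun t =>
  \sum_i \sum_j ginv g t i j *
    cov1 nabla (fun s => \row_k partial k f s) (cst (evec i)) (cst (evec j)) t.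

(** Gamma^D[S] at [t] *)
Definition gamma_contract D t (S : 'M[R]_p) : pt := \sum_i \sum_j S i j *: D t i j.

(** [Pc t2 t1] is the covector Psi^{t2}(t1). *)
Definition precontrast Theta g (Pc : pt -> field) :=
  [/\ forall i, smooth_near
        [set z : 'rV[R]_(p + p) | Theta (lsubmx z) /\ Theta (rsubmx z)]
        (fun z => Pc (lsubmx z) (rsubmx z) 0 i),
      forall t, Theta t -> Pc t t = 0 &
      forall X Y : field, smoothv_near Theta X -> smoothv_near Theta Y ->
      forall t, Theta t -> dirder Y (form_app (Pc t) X) t = ip g t (X t) (Y t)].

Definition connection_D1 Theta g (Pc : pt -> field) D :=
  connection_on Theta D /\
  forall X1 X2 Y : field, smoothv_near Theta X1 -> smoothv_near Theta X2 ->
  smoothv_near Theta Y -> forall t, Theta t ->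
  ip g t (cov D X1 X2 t) (Y t)
  = - dirder X1 (fun t1 => dirder Y (fun t2 => form_app (Pc t2) X2 t1) t) t.

Definition connection_Dm1 Theta g (Pc : pt -> field) D :=
  connection_on Theta D /\
  forall X Y1 Y2 : field, smoothv_near Theta X -> smoothv_near Theta Y1 ->
  smoothv_near Theta Y2 -> forall t, Theta t ->
  ip g t (X t) (cov D Y1 Y2 t)
  = - dirder Y1 (fun t2 => dirder Y2 (fun t2' => form_app (Pc t2') X t) t2) t.

(** A chart around [t0] on the open set [U], with inverse [sigma]. *)
Definition chart Theta (t0 : pt) (U : set pt) (phi sigma : field) :=
  [/\ open U /\ open (phi @` U), U t0 /\ U `<=` Theta,
      smoothv_on U phi, smoothv_on (phi @` U) sigma &
      forall t, U t -> sigma (phi t) = t].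

(** the coordinate fields d/dx^i of the chart, in standard coordinates *)
Definition chart_field (phi sigma : field) (i : 'I_p) : field :=
  fun t => 'D_(evec i) sigma (phi t).

End Geometry.
Arguments connection : clear implicits.

Section Borel.
Context {R : realType} {p : nat}.

Definition borelV := g_sigma_algebraType (@open 'rV[R]_p).

(** Open sets of the weak topology on the Borel probability measures on
    [Theta], i.e. those [m] on R^p with [m Theta = 1]. *)
Definition weakly_open (Theta : set 'rV[R]_p) (W : set (probability borelV R)) :=
  forall m : probability borelV R, m Theta = 1%E -> W m ->
  exists (k : nat) (f : 'I_k -> 'rV[R]_p -> R) (e : R),
  [/\ 0 < e, forall i, {within Theta, continuous (f i)} &
      forall m' : probability borelV R, m' Theta = 1%E ->
        (forall i, `|\int[m']_(t in Theta) f i t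
                     - \int[m]_(t in Theta) f i t| < e) -> W m'].

End Borel.
Arguments borelV : clear implicits.

Section Process.
Context {R : realType} {p : nat}.
Local Notation field := ('rV[R]_p -> 'rV[R]_p).

Section Martingale.
Context {d : measure_display} {Om : measurableType d} (Q : probability Om R).

Definition filtration (F : R -> set_system Om) :=
  (forall t, 0 <= t -> sigma_algebra setT (F t) /\ F t `<=` measurable) /\
  (forall s t, 0 <= s -> s <= t -> F s `<=` F t).

Definition martingale (F : R -> set_system Om) (M : R -> Om -> R) :=
  [/\ forall t (B : set R), 0 <= t -> measurable B -> F t (M t @^-1` B),
      forall t, 0 <= t -> Q.-integrable setT (EFin \o M t) &
      forall s t A, 0 <= s -> s <= t -> F s A ->
        \int[Q]_(w in A) M t w = \int[Q]_(w in A) M s w].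

End Martingale.

Definition generator g (nabla : connection R p) (tau : R) (W : field)
    (f : 'rV[R]_p -> R) : 'rV[R]_p -> R :=
  fun t => tau / 2 * laplace g nabla f t + 2^-1 * dirder W f t.

(** Weak (martingale) form of
      d th = W(th)/2 dt + sqrt(tau) dB - nu(th) dK
    on a filtered probability space, with [B] a g-Brownian motion: [th] is a
    continuous adapted [Theta]-valued process, [K_t = dK `[0, t]] is a
    continuous nondecreasing adapted process that grows only when [th] is on
    the boundary, and
      f(th_t) - f(th_0) - int_0^t (L f)(th_s) ds + int_0^t (nu f)(th_s) dK_s
    is a martingale for all smooth [f]; the dK-term vanishes for [f] in the
    Neumann domain of [L]. Testing against Neumann functions alone would admit
    paths stuck on the boundary when [tau = 0]. *)
Definition reflected_process (Theta : set 'rV[R]_p) g nabla (nu : field)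
    (tau : R) (W : field) d (Om : measurableType d) (Q : probability Om R)
    (F : R -> set_system Om) (th : R -> Om -> 'rV[R]_p)
    (dK : Om -> {measure set R -> \bar R}) :=
  [/\ filtration F,
      [/\ forall t w, 0 <= t -> Theta (th t w),
          forall w, {within `[0%R, +oo[, continuous (fun t => th t w)} &
          forall t (B : set (borelV R p)), 0 <= t -> measurable B ->
            F t (th t @^-1` B)],
      [/\ forall t w, 0 <= t -> (dK w `[0%R, t]%classic < +oo)%E /\ dK w [set t] = 0%E,
          forall t c, 0 <= t -> F t [set w | (dK w `[0%R, t]%classic <= c%:E)%E] &
          forall w, dK w [set s | 0 <= s /\ ~ bdry Theta (th s w)] = 0%E] &
      forall f, smooth_near Theta f ->
        martingale Q F (fun t w =>
          f (th t w) - f (th 0 w)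
          - \int[lebesgue_measure]_(s in `[0%R, t])
              generator g nabla tau W f (th s w)
          + \int[dK w]_(s in [set s | 0 <= s <= t /\ bdry Theta (th s w)])
              dirder nu f (th s w))].

(** [m] is invariant: the process started from [m] has law [m] at all times. *)
Definition invariant_prob (Theta : set 'rV[R]_p) g nabla nu tau W
    (m : probability (borelV R p) R) :=
  m Theta = 1%E /\
  exists d (Om : measurableType d) (Q : probability Om R) F th dK,
    @reflected_process Theta g nabla nu tau W d Om Q F th dK /\
    forall t (B : set (borelV R p)), 0 <= t -> measurable B ->
      Q (th t @^-1` B) = m B.

End Process.

Section Statistics.
Context {R : realType} {p : nat}.
Local Notation pt := 'rV[R]_p.
Local Notation field := ('rV[R]_p -> 'rV[R]_p).
Context {dX : nat -> measure_display} {X : forall n, measurableType (dX n)}.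
Implicit Types (Theta : set pt) (g : pt -> 'M[R]_p) (a r : nat -> R).
Implicit Types (P : forall n, probability (X n) R).
Implicit Types (Psi : forall n, X n -> field).
Implicit Types (mu : forall n, X n -> probability (borelV R p) R).

(** ||Y_n||_{L^q(P_n)} for Y_n valued in a space with norm `|.| *)
Definition normLq P (q : R) n {W : normedModType R} (Y : X n -> W) (c : R) :=
  Lnorm (P n) q%:E (fun x => (`|Y x| / c)%:E).

Definition bigO_Linf P {W : normedModType R} (Y : forall n, X n -> W) r :=
  forall q : R, 1 <= q ->
  exists C : R, \forall n \near \oo, (normLq P q (Y n) (r n) <= C%:E)%E.

Definition littleo_Linf P {W : normedModType R} (Y : forall n, X n -> W) r :=
  forall q : R, 1 <= q -> normLq P q (Y n) (r n) @[n --> \oo] --> 0%E.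

Definition random_one_form Theta Psi :=
  (forall n t i, Theta t ->
     measurable_fun setT (fun x : X n => Psi n x t 0 i)) /\
  (forall n x, smoothv_near Theta (Psi n x)).

Definition drift g a Psi (V : field) n (x : X n) : field :=
  fun t => - (a n) ^- 2 *: sharp g t (Psi n x t) + V t.

Definition invariant_selection Theta g nabla nu a Psi tau V mu :=
  (forall n W, weakly_open Theta W -> measurable (mu n @^-1` W)) /\
  (forall n x, invariant_prob Theta g nabla nu tau
                 (drift g a Psi V x) (mu n x)).

(** mu_n(theta) *)
Definition post_mean Theta mu n (x : X n) : pt :=
  \row_i \int[mu n x]_(t in Theta) (t : pt) 0 i.

Definition zeta g a Psi n (x : X n) : field :=
  fun t => - (a n)^-1 *: sharp g t (Psi n x t).

(** the vector field Upsilon_n[Y], obtained by raising the second index of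
    <Y, .> - (D1 Psi_n)[Y, .] *)
Definition Upsilon g (D1 : connection R p) Psi n (x : X n) (Y : field) : field :=
  fun t => sharp g t (\row_l (ip g t (Y t) (evec l)
                              - cov1 D1 (Psi n x) Y (cst (evec l)) t)).

Definition A1 Theta g P Psi a (Pc : pt -> field) (t0 : pt) :=
  exists U phi sigma, chart Theta t0 U phi sigma /\
  let E := chart_field phi sigma in
  [/\ bigO_Linf P (fun n x => \row_i form_app (Psi n x) (E i) t0) a,
      littleo_Linf P (fun n x => \matrix_(i, j)
          (dirder (E i) (form_app (Psi n x) (E j)) t0 - ip g t0 (E i t0) (E j t0)))
        (fun n => a n `^ 2^-1) &
      forall q : R, 1 <= q ->
        limn_esup (fun n =>
          \big[maxe/0%E]_(ijk : 'I_p * 'I_p * 'I_p)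
            let: (i, j, k) := ijk in
            Lnorm (P n) q%:E (fun x =>
              ereal_sup [set `|dirder (E i) (dirder (E j) (form_app (Psi n x) (E k))) t
                         - dirder (E i) (dirder (E j) (form_app (Pc t0) (E k))) t|%:E
                        | t in [set t | Theta t /\ riem_dist Theta g t t0 <= r]]))
        @[r --> (0 : R)^'+] --> 0%E].

Definition A2 Theta g P a mu (t0 : pt) :=
  exists kappa : R, 0 < kappa < 1 /\
  forall L : R, 0 < L ->
    (fun n => fine (\int[P n]_x
       mu n x [set t | Theta t /\ a n `^ kappa <= riem_dist Theta g t t0]%R)%E)
    =O_\oo (fun n => a n `^ L).

Definition A3 g P Psi a (beta : field) (DB : connection R p) (t0 : pt) :=
  [/\ forall i, (((a n) ^- 2)%:E * expectation (P n) (fun x => Psi n x t0 0 i)%R)%E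
        @[n --> \oo] --> (beta t0 0 i)%:E,
      forall X1 X2, smoothv_near [set t0] X1 -> smoothv_near [set t0] X2 ->
        (((a n) ^- 2)%:E * covariance (P n) (fun x => form_app (Psi n x) X1 t0)
                                            (fun x => form_app (Psi n x) X2 t0))%E
        @[n --> \oo] --> (ip g t0 (X1 t0) (X2 t0))%:E &
      forall X1 X2 X3, smoothv_near [set t0] X1 -> smoothv_near [set t0] X2 ->
        smoothv_near [set t0] X3 ->
        (((a n) ^- 2)%:E * covariance (P n)
                              (fun x => dirder X1 (form_app (Psi n x) X2) t0)%R
                              (fun x => form_app (Psi n x) X3 t0))%E
        @[n --> \oo] --> (ip g t0 (cov DB X1 X2 t0) (X3 t0))%:E].

Definition bias_field g (beta : field) (D1 DB : connection R p) : field :=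
  fun t => sharp g t (beta t + \row_j \sum_i (D1 t i j 0 i - DB t i j 0 i)).

End Statistics.

(* Main.v *)
(** The generator applied to a smooth function supported near [theta_0] integrates to
    zero under [mu_n], so testing against truncated polynomials in
    [h = theta - theta_0] gives moment equations.  With the Taylor expansion of the
    random field [g^-1 Psi_n] at [theta_0], whose quadratic part is asymptotically the
    deterministic one of [g^-1 Psi^theta_0] (with [- Gamma^(-1)] at [theta_0] as its
    second order coefficient), the linear test functions express the first moment of
    [h] through its second moment up to order [o(a_n^2)], and the quadratic ones
    determine the second moment.  An a priori bound on the second moment follows by
    bootstrapping: each use of the quadratic equation gains a power of [a_n^kappa'],
    and the mass outside the [a_n^kappa]-ball is negligible by [A2].
    (b) is a difference of two such expansions; that [nabla - Gamma^(-1)/2] equals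
    [Gamma^(1)/2] is the duality of the two connections.  (c) takes expectations:
    the second order terms are covariances with limits given by [A3]. *)

Require Import Defs.
From HB Require Import structures.
From mathcomp Require Import all_boot all_order all_algebra.
From mathcomp Require Import all_classical all_reals all_analysis.
From mathcomp Require Import measurable_realfun ring lra.
Import Order.TTheory GRing.Theory Num.Theory.
Import numFieldNormedType.Exports.
Local Open Scope classical_set_scope.
Local Open Scope ring_scope.

Set Implicit Arguments.
Unset Strict Implicit.
Unset Printing Implicit Defensive.

(** * Calculus *)

Section Calculus.
Context {R : realType}.

(** The obstacle is the double limit in [A1]: the second jet of the fluctuation is small only when
    the radius [r] tends to 0 after [n] tends to infinity, while truncating a test function to the
    [r]-ball costs constants that depend on [r]. Hence every estimate is a deterministic inequality
    at one sample point with two kinds of constants: the coefficient of [S], the size of the second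
    jet, is independent of [r], and the [r]-dependent constants multiply only quantities that vanish
    for fixed [r]. The randomness of the sample enters at the end, through moments of a few size
    variables; a power of their sum [T] dominates the random factors. The rate [a_n^(1/2)] for the
    first jet is what the quadratic error tolerates: the square of the first jet error times the
    first moment of [|h|], itself of order [a_n], has to be [o(a_n^2)]. Differential identities are
    proved in the interior of [Theta]; the identity of connections in (b) reaches the boundary by
    continuity. [A1] is given in an arbitrary chart and is transferred to the standard
    coordinates. *)

Lemma near_eq_differentiable (V W : normedModType R) (f h : V -> W) (x : V) :
  {near x, f =1 h} -> differentiable f x -> differentiable h x.
Proof.
move=> fh df.
suff d0 : differentiable (h - f) x.
  have -> : h = f + (h - f) by rewrite addrC subrK.
  exact: differentiableD.
have fhx : f x = h x by exact: nbhs_singleton fh.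
have e0 : (h - f) \o shift x = cst ((h - f) x) + (0 : V -> W) +o_ (0 : V) id.
  apply/eqaddoE; rewrite addr0 [cst _](_ : _ = 0); last first.
    by apply/funext => y; rewrite /cst/= !fctE fhx subrr.
  rewrite add0r; apply/eqoP => _/posnumP[e].
  have sh : \forall y \near (0 : V), f (y + x) = h (y + x).
    by move: fh; rewrite /prop_near1 [X in X -> _](near_shift 0) subr0.
  near=> y; rewrite /= !fctE /shift/=.
  have -> : f (y + x) = h (y + x) by near: y.
  by rewrite subrr normr0 mulr_ge0.
have Hd : 'd (h - f) x = 0 :> (V -> W).
  by apply/diff_unique; [move=> y; exact: cst_continuous|exact: e0].
by apply/diff_locallyP; rewrite Hd; split; [move=> y; exact: cst_continuous|exact: e0].
Unshelve. all: by end_near. Qed.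

Lemma differentiable_bigsum (V : normedModType R) (I : Type) (r : seq I)
    (F : I -> V -> R) x :
  (forall i, differentiable (F i) x) ->
  differentiable (fun y => \sum_(i <- r) F i y) x.
Proof.
move=> dF; elim: r => [|i r IH].
  rewrite (_ : (fun _ => _) = cst 0); last by apply/funext => y; rewrite big_nil.
  exact: differentiable_cst.
rewrite (_ : (fun _ => _) = F i + (fun y => \sum_(j <- r) F j y)).
  exact: differentiableD.
by apply/funext => y; rewrite big_cons.
Qed.

Lemma is_derive_line (V : normedModType R) (f : V -> R) (t h : V) (s : R) :
  differentiable f (t + s *: h) ->
  is_derive s 1 (fun u => f (t + u *: h)) ('D_h f (t + s *: h)).
Proof.
move=> df.
pose l := fun u : R => t + u *: h.
have dl : is_diff s l (fun u => u *: h).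
  rewrite /l; have -> : (fun u : R => u *: h) = 0 + (fun u => u *: h).
    by rewrite add0r.
  exact: is_diffD.
have dfl : differentiable (f \o l) s.
  by apply: differentiable_comp => //; apply: ex_diff.
apply: DeriveDef; first by apply/derivable1_diffP.
rewrite -derive1E derive1E' // diff_comp //= ?diff_val //.
by rewrite /= deriveE // scale1r.
Qed.

Section Rp.
Context {p : nat}.
Local Notation pt := 'rV[R]_p.
Implicit Types (U : set pt) (f : pt -> R).

Lemma derive_partial f t v : differentiable f t ->
  'D_v f t = \sum_i v 0 i * partial i f t.
Proof.
move=> df; rewrite deriveE //.
rewrite [in LHS](row_sum_delta v) linear_sum; apply: eq_bigr => i _.
by rewrite linearZ /partial deriveE.
Qed.

(** Partial derivatives up to order [n] are differentiable, so [Ck n] is [C^n] with one spare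
    derivative. A finite order makes closure under products, inverses and composition an induction,
    which the arbitrary index words of [smooth_on] do not offer directly. *)
Fixpoint Ck n U f : Prop := match n with
  | 0 => forall t, U t -> differentiable f t
  | n'.+1 => (forall t, U t -> differentiable f t) /\ forall i, Ck n' U (partial i f)
  end.

Lemma Ck_diff n U f t : Ck n U f -> U t -> differentiable f t.
Proof. by case: n => [|n] => [|[]]; auto. Qed.

Lemma CkW n U f : Ck n.+1 U f -> Ck n U f.
Proof.
elim: n f => [|n IH] f [df H] //; split => // i; apply: IH; exact: H.
Qed.

Lemma Ck_partial n U f i : Ck n.+1 U f -> Ck n U (partial i f).
Proof. by move=> [_]; exact. Qed.

Lemma Ck_sub n U U' f : U' `<=` U -> Ck n U f -> Ck n U' f.
Proof.
move=> sU; elim: n f => [|n IH] f /=; first by move=> df t /sU; exact: df.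
by move=> [df H]; split => [t /sU|i]; [exact: df|apply: IH; exact: H].
Qed.

Lemma smooth_Ck n U f : smooth_on U f -> Ck n U f.
Proof.
elim: n f => [|n IH] f sf /=; first by move=> t Ut; exact: (sf [::]).
split=> [t Ut|i]; first exact: (sf [::]).
(* [foldr] applies the last index first and [Ck] peels off the innermost derivative, hence
   [rcons]. *)
by apply: IH => s t Ut; have := sf (rcons s i) t Ut; rewrite foldr_rcons.
Qed.

Lemma partial_eq_on U f h i t : open U -> (forall s, U s -> f s = h s) -> U t ->
  partial i f t = partial i h t.
Proof.
move=> oU fh Ut; rewrite /partial; apply: near_eq_derive.
by apply: filterS (open_nbhs_nbhs (conj oU Ut)) => s /fh.
Qed.

Lemma Ck_eq n U f h : open U -> (forall s, U s -> f s = h s) ->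
  Ck n U f -> Ck n U h.
Proof.
move=> oU; elim: n f h => [|n IH] f h fh /= => [df t Ut|[df H]].
  apply: near_eq_differentiable (df t Ut).
  by apply: filterS (open_nbhs_nbhs (conj oU Ut)) => s /fh.
split=> [t Ut|i].
  apply: near_eq_differentiable (df t Ut).
  by apply: filterS (open_nbhs_nbhs (conj oU Ut)) => s /fh.
by apply: IH (H i) => s Us; exact: partial_eq_on oU fh Us.
Qed.

Lemma partial_cst i (c : R) : partial i (cst c : pt -> R) = cst 0.
Proof. by apply/funext => t; rewrite /partial derive_cst. Qed.

Lemma Ck_cst n U c : Ck n U (cst c).
Proof.
elim: n c => [|n IH] c /=; first by move=> t _; exact: differentiable_cst.
split; first by move=> t _; exact: differentiable_cst.
by move=> i; rewrite partial_cst.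
Qed.

Lemma partialD i f h t : differentiable f t -> differentiable h t ->
  partial i (fun s => f s + h s) t = partial i f t + partial i h t.
Proof.
move=> df dh; rewrite /partial -[fun s => _]/(f + h) deriveD //;
  exact: diff_derivable.
Qed.

Lemma partialM i f h t : differentiable f t -> differentiable h t ->
  partial i (fun s => f s * h s) t = partial i f t * h t + f t * partial i h t.
Proof.
move=> df dh; rewrite /partial (_ : (fun s => _) = f * h) //.
rewrite (deriveM (diff_derivable (v:=evec i) df) (diff_derivable dh)).
by rewrite addrC /GRing.scale/= [h t * _]mulrC.
Qed.

Lemma partial_sum (I : Type) (r : seq I) (F : I -> pt -> R) i t :
  (forall k, differentiable (F k) t) ->
  partial i (fun s => \sum_(k <- r) F k s) t = \sum_(k <- r) partial i (F k) t.
Proof.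
move=> dF; elim: r => [|k r IH].
  rewrite big_nil (_ : (fun _ => _) = cst 0) ?partial_cst //.
  by apply/funext => s; rewrite big_nil.
rewrite big_cons -IH -partialD //; last exact: differentiable_bigsum.
by congr partial; apply/funext => s; rewrite big_cons.
Qed.

Lemma CkD n U f h : open U -> Ck n U f -> Ck n U h -> Ck n U (fun s => f s + h s).
Proof.
move=> oU; elim: n f h => [|n IH] f h /= => [df dh t Ut|[df Hf] [dh Hh]].
  exact: (differentiableD (df t Ut) (dh t Ut)).
split=> [t Ut|i]; first exact: (differentiableD (df t Ut) (dh t Ut)).
apply: Ck_eq (IH _ _ (Hf i) (Hh i)) => // t Ut.
by rewrite partialD; auto.
Qed.

Lemma CkM n U f h : open U -> Ck n U f -> Ck n U h -> Ck n U (fun s => f s * h s).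
Proof.
move=> oU; elim: n f h => [|n IH] f h.
  by move=> /= df dh t Ut; exact: (differentiableM (df t Ut) (dh t Ut)).
move=> Cf Ch; have df t : U t -> differentiable f t by exact: Ck_diff Cf.
have dh t : U t -> differentiable h t by exact: Ck_diff Ch.
split=> [t Ut|i]; first exact: (differentiableM (df t Ut) (dh t Ut)).
apply: (@Ck_eq _ _ (fun s => partial i f s * h s + f s * partial i h s)) => //.
  by move=> t Ut; rewrite partialM; auto.
by apply: CkD => //; apply: IH; (exact: CkW || exact: Ck_partial).
Qed.

Lemma Ck_sum n U (I : Type) (r : seq I) (F : I -> pt -> R) : open U ->
  (forall i, Ck n U (F i)) -> Ck n U (fun s => \sum_(i <- r) F i s).
Proof.
move=> oU HF; elim: r => [|i r IH].
  rewrite (_ : (fun _ => _) = cst 0); first exact: Ck_cst.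
  by apply/funext => s; rewrite big_nil.
rewrite (_ : (fun _ => _) = fun s => F i s + \sum_(j <- r) F j s).
  exact: CkD.
by apply/funext => s; rewrite big_cons.
Qed.

Lemma Ck_prod n U (I : Type) (r : seq I) (F : I -> pt -> R) : open U ->
  (forall i, Ck n U (F i)) -> Ck n U (fun s => \prod_(i <- r) F i s).
Proof.
move=> oU HF; elim: r => [|i r IH].
  rewrite (_ : (fun _ => _) = cst 1); first exact: Ck_cst.
  by apply/funext => s; rewrite big_nil.
rewrite (_ : (fun _ => _) = fun s => F i s * \prod_(j <- r) F j s).
  exact: CkM.
by apply/funext => s; rewrite big_cons.
Qed.

Lemma CkZ n U f c : open U -> Ck n U f -> Ck n U (fun s => c * f s).
Proof. by move=> oU Cf; apply: CkM => //; exact: (Ck_cst _ _ c). Qed.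

Lemma CkB n U f h : open U -> Ck n U f -> Ck n U h -> Ck n U (fun s => f s - h s).
Proof.
move=> oU Cf Ch; rewrite (_ : (fun _ => _) = fun s => f s + (-1) * h s).
  by apply: CkD => //; exact: CkZ.
by apply/funext => s; rewrite mulN1r.
Qed.

(** The derivative [- f^-2 * partial i f] involves [1/f] only to the order already treated. *)
Lemma CkV n U f : open U -> (forall t, U t -> f t != 0) -> Ck n U f ->
  Ck n U (fun s => (f s)^-1).
Proof.
move=> oU f0; elim: n => [|n IH] Cf.
  by move=> t Ut; apply: differentiableV; [exact: Ck_diff Cf Ut|exact: f0].
have df t : U t -> differentiable f t by exact: Ck_diff Cf.
split=> [t Ut|i]; first by apply: differentiableV; [exact: df|exact: f0].
apply: (@Ck_eq _ _ (fun s => -1 * ((f s)^-1 * (f s)^-1) * partial i f s)) => //.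
  move=> t Ut; rewrite [in RHS]/partial deriveV ?f0 //.
    by rewrite mulN1r /GRing.scale/= expr2 invfM.
  exact/diff_derivable/df.
apply: CkM => //; last exact: Ck_partial Cf.
by apply: CkZ => //; apply: CkM => //; apply: IH; exact: CkW.
Qed.

Lemma Ck_continuous n U f t : Ck n U f -> U t -> {for t, continuous f}.
Proof. by move=> Cf Ut; apply: differentiable_continuous; exact: Ck_diff Cf Ut. Qed.

End Rp.

Lemma Ck_comp p q n (U : set 'rV[R]_p) (W : set 'rV[R]_q)
    (phi : 'rV[R]_p -> 'rV[R]_q) f : open U -> open W ->
  (forall t, U t -> W (phi t)) -> (forall k, Ck n U (fun t => phi t 0 k)) ->
  Ck n W f -> Ck n U (fun t => f (phi t)).
Proof.
move=> oU oW UW; elim: n f => [|n IH] f Cphi Cf.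
  have dphi t : U t -> differentiable phi t.
    move=> Ut.
    rewrite (_ : phi = fun t => \sum_k phi t 0 k *: evec k); last first.
      by apply/funext => s; rewrite [LHS]row_sum_delta.
    rewrite -fct_sumE. apply: differentiable_sum => k.
    by apply: differentiableZl; exact: Cphi.
  move=> t Ut; apply: differentiable_comp; first exact: dphi.
  exact/Cf/UW.
have dphi t : U t -> differentiable phi t.
  move=> Ut.
  rewrite (_ : phi = fun t => \sum_k phi t 0 k *: evec k); last first.
    by apply/funext => s; rewrite [LHS]row_sum_delta.
  rewrite -fct_sumE. apply: differentiable_sum => k.
  by apply: differentiableZl; exact: Ck_diff (Cphi k) Ut.
have df t : W t -> differentiable f t by exact: Ck_diff Cf.
split=> [t Ut|i].
  by apply: differentiable_comp; [exact: dphi|exact/df/UW].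
apply: (@Ck_eq _ _ _ (fun t => \sum_k partial i (fun s => phi s 0 k) t
                            * partial k f (phi t))) => //.
  move=> t Ut; rewrite [in RHS]/partial.
  have dft := df _ (UW t Ut).
  rewrite deriveE; last by apply: differentiable_comp => //; exact: dphi.
  rewrite diff_comp //=; last exact: dphi.
  rewrite -deriveE // derive_partial //; apply: eq_bigr => k _; congr (_ * _).
  rewrite -deriveE; last exact: dphi.
  rewrite derive_mx ?mxE //; apply: diff_derivable; exact: dphi.
apply: Ck_sum => // k; apply: CkM => //; first exact: Ck_partial.
by apply: IH => //; [move=> j; exact: CkW|exact: Ck_partial].
Qed.

End Calculus.

(** * Taylor estimates along segments and in R^p *)

Section Taylor.
Context {R : realType}.

Lemma mvt_bound (f f' : R -> R) (s C : R) : 0 <= s ->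
  (forall u : R, 0 <= u <= s -> is_derive u 1 f (f' u)) ->
  (forall u : R, 0 <= u <= s -> `|f' u| <= C) -> `|f s - f 0| <= C * s.
Proof.
rewrite le_eqVlt => /predU1P[<- _ _|s0 df Hf]; first by rewrite subrr normr0 mulr0.
have [u|u us|c cs ->] := @MVT R f f' 0 s s0.
- by rewrite in_itv/= => /andP[/ltW u0 /ltW us]; apply: df; rewrite u0.
- apply/continuous_in_subspaceT : u us => u; rewrite inE/= in_itv/= => us.
  by apply: differentiable_continuous; apply/derivable1_diffP; case: (df u us).
- rewrite subr0 normrM (gtr0_norm s0) ler_pM2r //.
  by apply: Hf; move: cs; rewrite in_itv/= => /andP[/ltW -> /ltW ->].
Qed.

(** Two mean value inequalities; the constant is not sharp, but only orders matter later. *)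
Lemma line_taylor1 (f f1 f2 : R -> R) (C : R) :
  (forall u : R, 0 <= u <= 1 -> is_derive u 1 f (f1 u)) ->
  (forall u : R, 0 <= u <= 1 -> is_derive u 1 f1 (f2 u)) ->
  (forall u : R, 0 <= u <= 1 -> `|f2 u| <= C) -> `|f 1 - f 0 - f1 0| <= C.
Proof.
move=> df df1 Hf.
have := @mvt_bound (fun u => f u - u * f1 0) (fun u => f1 u - f1 0) 1 C ler01.
rewrite mul1r mul0r subr0 mulr1 addrAC; apply.
- move=> u u01; have dfu := df u u01.
  apply: is_derive_eq.
  by rewrite scaler0 add0r /GRing.scale/= mulr1.
- move=> u /andP[u0 u1].
  have : `|f1 u - f1 0| <= C * u.
    by apply: (@mvt_bound _ f2) => // v /andP[v0 vu]; [apply: df1|apply: Hf];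
      rewrite v0 (le_trans vu).
  move/le_trans; apply; have C0 : 0 <= C by rewrite (le_trans _ (Hf 0 _)) // lexx ler01.
  by rewrite ler_piMr.
Qed.

Lemma line_taylor2 (f f1 f2 f3 : R -> R) (C : R) :
  (forall u : R, 0 <= u <= 1 -> is_derive u 1 f (f1 u)) ->
  (forall u : R, 0 <= u <= 1 -> is_derive u 1 f1 (f2 u)) ->
  (forall u : R, 0 <= u <= 1 -> is_derive u 1 f2 (f3 u)) ->
  (forall u : R, 0 <= u <= 1 -> `|f3 u| <= C) ->
  `|f 1 - f 0 - f1 0 - 2^-1 * f2 0| <= C.
Proof.
move=> df df1 df2 Hf.
(* Removing the quadratic term [f2 0 * u^2 / 2] reduces the second order remainder to the first
   order one. *)
have := @line_taylor1 (fun u => f u - 2^-1 * f2 0 * u ^+ 2)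
  (fun u => f1 u - f2 0 * u) (fun u => f2 u - f2 0) C.
rewrite expr1n expr0n/= !mulr0 !subr0 mulr1.
rewrite (_ : f 1 - _ - _ - _ = f 1 - f 0 - f1 0 - 2^-1 * f2 0); last by ring.
apply.
- move=> u u01; have dfu := df u u01.
  apply: is_derive_eq.
  by rewrite /GRing.scale/= !mulr1; field.
- move=> u u01; have dfu := df1 u u01.
  apply: is_derive_eq.
  by rewrite /GRing.scale/= mulr1.
- move=> u /andP[u0 u1].
  have : `|f2 u - f2 0| <= C * u.
    by apply: (@mvt_bound _ f3) => // v /andP[v0 vu]; [apply: df2|apply: Hf];
      rewrite v0 (le_trans vu).
  move/le_trans; apply; have C0 : 0 <= C by rewrite (le_trans _ (Hf 0 _)) // lexx ler01.
  by rewrite ler_piMr.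
Qed.

End Taylor.

Section RowNorm.
Context {R : realType} {p : nat}.
Local Notation pt := 'rV[R]_p.

Lemma coord_le_norm (v : pt) i : `|v 0 i| <= `|v|.
Proof.
rewrite [leRHS]/Num.norm/= mx_normrE.
exact: (le_bigmax _ (fun ij : 'I_1 * 'I_p => `|v ij.1 ij.2|) (0, i)).
Qed.

Lemma norm_le_coord (v : pt) (c : R) : 0 <= c ->
  (forall i, `|v 0 i| <= c) -> `|v| <= c.
Proof.
move=> c0 H; rewrite [leLHS]/Num.norm/= mx_normrE; apply: bigmax_le => // -[i j] _.
by rewrite ord1.
Qed.

(** The norm on rows is the maximum norm, so this is a cube. *)
Definition cball (t : pt) (r : R) : set pt := [set s | `|s - t| <= r].

Lemma cball_center t r : 0 <= r -> cball t r t.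
Proof. by move=> r0; rewrite /cball/= subrr normr0. Qed.

Lemma cballD t r h : `|h| <= r -> cball t r (t + h).
Proof. by rewrite /cball/= addrAC subrr add0r. Qed.

Lemma norm_sub_continuous (t : pt) : continuous (fun s : pt => `|s - t|).
Proof.
move=> s A /nbhs_ballP[e /= e0 eA].
apply: (filterS _ (nbhsx_ballx (s : pt) e e0)) => u; rewrite -ball_normE /= => su.
apply: eA; rewrite -ball_normE /=.
apply: le_lt_trans su; rewrite (le_trans (ler_dist_dist _ _)) //.
by rewrite opprB addrA subrK.
Qed.

Lemma closed_cball t r : closed (cball t r).
Proof.
rewrite (_ : cball t r = (fun s => `|s - t|) @^-1` [set x | x <= r]) //.
by apply: closed_comp (@closed_le _ r) => s _; exact: norm_sub_continuous.
Qed.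

Lemma compact_cball t r : compact (cball t r).
Proof.
apply: bounded_closed_compact; last exact: closed_cball.
exists (`|t| + r); split; first exact: num_real.
move=> x xr s; rewrite /cball/= => st; apply/ltW/le_lt_trans/xr.
by rewrite -[s](subrK t) addrC (le_trans (ler_normD _ _)) // lerD2l.
Qed.

Lemma cball_sub_nbhs (t : pt) (A : set pt) : nbhs t A ->
  exists2 r : R, 0 < r & cball t r `<=` A.
Proof.
move=> /nbhs_normP[e /= e0 eA]; exists (e / 2); first by rewrite divr_gt0.
move=> s; rewrite /cball/= => st; apply: eA; rewrite /ball_/= distrC.
by rewrite (le_lt_trans st) // ltr_pdivrMr // mulr2n mulrDr mulr1 ltrDl.
Qed.

Lemma nbhs_cball (t : pt) (r : R) : 0 < r -> nbhs t (cball t r).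
Proof.
move=> r0; apply: filterS (nbhsx_ballx t r r0) => s.
rewrite -ball_normE /ball_/cball/= distrC; exact: ltW.
Qed.

Lemma compact_bounded_fun (A : set pt) (f : pt -> R) : compact A ->
  {within A, continuous f} -> exists2 C : R, 0 <= C & forall t, A t -> `|f t| <= C.
Proof.
move=> cA cf; have [->|/set0P[t0 At0]] := eqVneq A set0; first by exists 0.
have cg : {within A, continuous (fun t => `|f t|)}.
  move=> t; apply: (@continuous_comp _ _ _ (f : subspace A -> R)); first exact: cf.
  exact: norm_continuous.
have [c Ac Hc] := EVT_max_rV (ex_intro _ _ At0) cA cg.
exists (`|f c| : R); first exact: normr_ge0.
by move=> t At; apply: Hc; rewrite inE.
Qed.

Lemma Ck_bounded n (U A : set pt) (f : pt -> R) : compact A -> A `<=` U ->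
  Ck n U f -> exists2 C : R, 0 <= C & forall t, A t -> `|f t| <= C.
Proof.
move=> cA AU Cf; apply: compact_bounded_fun => //.
apply: continuous_in_subspaceT => t; rewrite inE => At.
by apply: Ck_continuous Cf _; exact: AU.
Qed.

Lemma cball_line t r h (u : R) : `|h| <= r -> 0 <= u <= 1 -> cball t r (t + u *: h).
Proof.
move=> hr /andP[u0 u1]; apply: cballD; rewrite normrZ ger0_norm //.
by rewrite (le_trans _ hr) // ler_piMl.
Qed.

Lemma sum_coord_le (h : pt) (F : 'I_p -> R) (B : R) :
  (forall i, `|F i| <= B) -> `|\sum_i h 0 i * F i| <= p%:R * B * `|h|.
Proof.
move=> FB; rewrite (le_trans (ler_norm_sum _ _ _)) //.
rewrite (_ : p%:R * B * `|h| = \sum_(i < p) B * `|h|); last first.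
  by rewrite sumr_const card_ord -[RHS]mulr_natl mulrA.
apply: ler_sum => i _; rewrite normrM mulrC ler_pM //; exact: coord_le_norm.
Qed.

Lemma Ck_taylor0 (U : set pt) f t r : cball t r `<=` U -> Ck 1 U f ->
  exists2 C : R, 0 <= C & forall h, `|h| <= r -> `|f (t + h) - f t| <= C * `|h|.
Proof.
move=> rU Cf.
have /(choice (P := fun i (B : R) => 0 <= B /\ forall s, cball t r s -> `|partial i f s| <= B))
    [B HB] : forall i, exists B : R, 0 <= B /\ forall s, cball t r s -> `|partial i f s| <= B.
  move=> i; have [B B0 HB] := Ck_bounded (@compact_cball t r) rU (Ck_partial i Cf).
  by exists B.
pose M := \sum_i B i.
have BM i : B i <= M.
  by rewrite /M (bigD1 i) //= lerDl sumr_ge0 // => j _; have [] := HB j.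
have M0 : 0 <= M by apply: sumr_ge0 => i _; have [] := HB i.
exists (p%:R * M); first by rewrite mulr_ge0.
move=> h hr.
have := @mvt_bound _ (fun u => f (t + u *: h)) (fun u => 'D_h f (t + u *: h)) 1
  (p%:R * M * `|h|) ler01.
rewrite scale1r scale0r addr0 mulr1; apply.
  move=> u u01; apply: is_derive_line; apply: (Ck_diff Cf).
  exact/rU/cball_line.
move=> u u01; have ut := cball_line t hr u01.
rewrite derive_partial; last by apply: (Ck_diff Cf); exact: rU.
apply: sum_coord_le => i; have [_ /(_ _ ut)/le_trans] := HB i; exact.
Qed.

Lemma Ck_bounded_fam (I : finType) n (U A : set pt) (F : I -> pt -> R) :
  compact A -> A `<=` U -> (forall i, Ck n U (F i)) ->
  exists2 C : R, 0 <= C & forall i t, A t -> `|F i t| <= C.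
Proof.
move=> cA AU CF.
have /(choice (P := fun i (B : R) => 0 <= B /\ forall s, A s -> `|F i s| <= B))
    [B HB] : forall i, exists B : R, 0 <= B /\ forall s, A s -> `|F i s| <= B.
  by move=> i; have [B B0 HB] := Ck_bounded cA AU (CF i); exists B.
exists (\sum_i B i); first by apply: sumr_ge0 => i _; have [] := HB i.
move=> i t At; have [_ /(_ t At)/le_trans] := HB i; apply.
by rewrite (bigD1 i) //= lerDl sumr_ge0 // => j _; have [] := HB j.
Qed.

Lemma derive_sum_coord (F : 'I_p -> pt -> R) (h t v : pt) :
  (forall i, differentiable (F i) t) ->
  'D_v (fun s => \sum_i h 0 i * F i s) t = \sum_i h 0 i * 'D_v (F i) t.
Proof.
move=> dF; rewrite -fct_sumE derive_sum.
  apply: eq_bigr => i _.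
  rewrite (_ : (fun s => _) = h 0 i *: F i) // deriveZ //.
  exact: diff_derivable.
move=> i; rewrite (_ : (fun s => _) = h 0 i *: F i) //.
apply: derivableZ; exact: diff_derivable.
Qed.

Lemma is_derive_line_sum (F : 'I_p -> pt -> R) (dF : 'I_p -> R) (t h : pt) (u : R) :
  (forall i, differentiable (F i) (t + u *: h)) ->
  (forall i, 'D_h (F i) (t + u *: h) = dF i) ->
  is_derive u 1 (fun v => \sum_i h 0 i * F i (t + v *: h)) (\sum_i h 0 i * dF i).
Proof.
move=> difF DF.
have dS : differentiable (fun s => \sum_i h 0 i * F i s) (t + u *: h).
  apply: differentiable_bigsum => i.
  by rewrite (_ : (fun _ => _) = h 0 i *: F i) //; apply/differentiableZ/difF.
have := is_derive_line dS; rewrite derive_sum_coord //.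
by under eq_bigr do rewrite DF.
Qed.

Lemma derive_quad (F : 'I_p -> 'I_p -> pt -> R) (dF : 'I_p -> 'I_p -> R) (h s : pt) i :
  (forall j, differentiable (F i j) s) -> (forall j, 'D_h (F i j) s = dF i j) ->
  differentiable (fun s => \sum_j h 0 j * F i j s) s /\
  'D_h (fun s => \sum_j h 0 j * F i j s) s = \sum_j h 0 j * dF i j.
Proof.
move=> difF DF; split.
  apply: differentiable_bigsum => j.
  by rewrite (_ : (fun _ => _) = h 0 j *: F i j) //; apply/differentiableZ/difF.
by rewrite derive_sum_coord //; apply: eq_bigr => j _; rewrite DF.
Qed.

Lemma Ck_taylor1 (U : set pt) f (t : pt) (r : R) : cball t r `<=` U -> Ck 2 U f ->
  exists2 C : R, 0 <= C & forall h, `|h| <= r ->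
    `|f (t + h) - f t - \sum_i h 0 i * partial i f t| <= C * `|h| ^+ 2.
Proof.
move=> rU Cf; have Cf1 := CkW Cf.
have [B B0 HB] := @Ck_bounded_fam ('I_p * 'I_p)%type 0 _ _
  (fun ij => partial ij.2 (partial ij.1 f)) (@compact_cball t r) rU
  (fun ij => Ck_partial _ (Ck_partial _ Cf)).
exists (p%:R * (p%:R * B)); first by rewrite !mulr_ge0.
move=> h hr.
have rC (u : R) : 0 <= u <= 1 -> cball t r (t + u *: h) by exact: cball_line.
have df (u : R) : 0 <= u <= 1 -> differentiable f (t + u *: h).
  by move=> /rC/rU; exact: Ck_diff Cf.
have ddf (u : R) i : 0 <= u <= 1 -> differentiable (partial i f) (t + u *: h).
  by move=> /rC/rU; apply: Ck_diff; exact: (Ck_partial i Cf).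
have := @line_taylor1 _ (fun u => f (t + u *: h))
  (fun u => \sum_i h 0 i * partial i f (t + u *: h))
  (fun u => \sum_i h 0 i * \sum_j h 0 j * partial j (partial i f) (t + u *: h))
  (p%:R * (p%:R * B) * `|h| ^+ 2).
rewrite !scale0r !scale1r !addr0; apply.
- by move=> u u01; rewrite -derive_partial; [apply: is_derive_line|]; exact: df.
- move=> u u01; apply: (is_derive_line_sum (F := fun i => partial i f)
    (dF := fun i => \sum_j h 0 j * partial j (partial i f) (t + u *: h))) => i; first exact: ddf.
  by rewrite derive_partial //; exact: ddf.
- move=> u u01; rewrite expr2.
  rewrite (_ : _ * _ = p%:R * (p%:R * B * `|h|) * `|h|); last by ring.
  apply: sum_coord_le => i; apply: sum_coord_le => j.
  by have := HB (i, j) _ (rC _ u01).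
Qed.

Lemma Ck_taylor2 (U : set pt) f (t : pt) (r : R) : cball t r `<=` U -> Ck 3 U f ->
  exists2 C : R, 0 <= C & forall h, `|h| <= r ->
    `|f (t + h) - f t - \sum_i h 0 i * partial i f t
      - 2^-1 * \sum_i h 0 i * \sum_j h 0 j * partial j (partial i f) t|
    <= C * `|h| ^+ 3.
Proof.
move=> rU Cf; have Cf1 := CkW Cf.
have [B B0 HB] := @Ck_bounded_fam ('I_p * 'I_p * 'I_p)%type 0 _ _
  (fun ij => partial ij.2 (partial ij.1.2 (partial ij.1.1 f))) (@compact_cball t r) rU
  (fun ij => Ck_partial _ (Ck_partial _ (Ck_partial _ Cf))).
exists (p%:R * (p%:R * (p%:R * B))); first by rewrite !mulr_ge0.
move=> h hr.
have rC (u : R) : 0 <= u <= 1 -> cball t r (t + u *: h) by exact: cball_line.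
have df (u : R) : 0 <= u <= 1 -> differentiable f (t + u *: h).
  by move=> /rC/rU; exact: Ck_diff Cf.
have ddf (u : R) i : 0 <= u <= 1 -> differentiable (partial i f) (t + u *: h).
  by move=> /rC/rU; apply: Ck_diff; exact: (Ck_partial i Cf).
have dddf (u : R) i j : 0 <= u <= 1 -> differentiable (partial j (partial i f)) (t + u *: h).
  by move=> /rC/rU; apply: Ck_diff; exact: (Ck_partial j (Ck_partial i Cf)).
have := @line_taylor2 _ (fun u => f (t + u *: h))
  (fun u => \sum_i h 0 i * partial i f (t + u *: h))
  (fun u => \sum_i h 0 i * \sum_j h 0 j * partial j (partial i f) (t + u *: h))
  (fun u => \sum_i h 0 i * \sum_j h 0 j * \sum_k h 0 k *
     partial k (partial j (partial i f)) (t + u *: h))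
  (p%:R * (p%:R * (p%:R * B)) * `|h| ^+ 3).
rewrite !scale0r !scale1r !addr0; apply.
- by move=> u u01; rewrite -derive_partial; [apply: is_derive_line|]; exact: df.
- move=> u u01; apply: (is_derive_line_sum (F := fun i => partial i f)
    (dF := fun i => \sum_j h 0 j * partial j (partial i f) (t + u *: h))) => i; first exact: ddf.
  by rewrite derive_partial //; exact: ddf.
- move=> u u01.
  have Q i := @derive_quad (fun i j => partial j (partial i f))
    (fun i j => \sum_k h 0 k * partial k (partial j (partial i f)) (t + u *: h))
    h (t + u *: h) i (fun j => dddf u i j u01)
    (fun j => derive_partial _ (dddf u i j u01)).
  by apply: (is_derive_line_sum
      (F := fun i s => \sum_j h 0 j * partial j (partial i f) s)) => i; have [] := Q i.
- move=> u u01; rewrite exprS expr2.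
  rewrite (_ : _ * _ = p%:R * (p%:R * (p%:R * B * `|h|) * `|h|) * `|h|); last by ring.
  do 3!(apply: sum_coord_le => ?).
  by have := HB (_, _, _) _ (rC _ u01); exact.
Qed.

Lemma sum_evec (F : 'I_p -> R) i x : \sum_k (x *: evec i : pt) 0 k * F k = x * F i.
Proof.
rewrite (bigD1 i) //= big1; first by rewrite !mxE !eqxx mulr1 addr0.
by move=> k /negbTE ki; rewrite !mxE ki andbF mulr0 mul0r.
Qed.

(** The mixed second difference of [f] with step [s] is symmetric in [i] and [j] and equals
    [s^2 * partial j (partial i f) t] up to [O(s^3)]; the two expansions are compared as [s] tends
    to 0. *)
Lemma Ck_schwarz (U : set pt) f t i j : open U -> U t -> Ck 3 U f ->
  partial i (partial j f) t = partial j (partial i f) t.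
Proof.
move=> oU Ut Cf.
have [r r0 rU] := cball_sub_nbhs (open_nbhs_nbhs (conj oU Ut)).
have ev k : `|evec k : pt| <= 1.
  apply: norm_le_coord => // l; rewrite mxE.
  by case: (_ && _) => /=; rewrite ?normr1 ?normr0.
have key : forall i j, exists2 C : R, 0 <= C & forall s : R, 0 < s -> s <= r / 2 ->
   `|f (t + s *: evec i + s *: evec j) - f (t + s *: evec j) - f (t + s *: evec i)
     + f t - s ^+ 2 * partial j (partial i f) t| <= C * s ^+ 3.
  move=> {}i {}j.
  have [C C0 HC] := Ck_taylor1 rU (Ck_partial i Cf).
  exists (8 * C); first by rewrite mulr_ge0.
  move=> s s0 sr.
  have inU (u v : R) : 0 <= u <= s -> 0 <= v <= s -> `|u *: evec i + v *: evec j : pt| <= 2 * s.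
    move=> /andP[u0 us] /andP[v0 vs]; rewrite (le_trans (ler_normD _ _)) //.
    rewrite mulrDl mul1r !normrZ !ger0_norm // lerD //.
      by rewrite (le_trans (ler_wpM2l u0 (ev i))) ?mulr1.
    by rewrite (le_trans (ler_wpM2l v0 (ev j))) ?mulr1.
  have s2r : 2 * s <= r by rewrite mulrC -ler_pdivlMr.
  have df (u v : R) : 0 <= u <= s -> 0 <= v <= s ->
      differentiable f (t + v *: evec j + u *: evec i).
    move=> us vs; apply: (Ck_diff Cf); apply: rU.
    by rewrite -addrA [v *: _ + _]addrC; apply/cballD/(le_trans (inU _ _ us vs)).
  have ss : 0 <= s <= s by rewrite lexx ltW.
  have os : 0 <= (0 : R) <= s by rewrite lexx ltW.
  (* [F s - F 0] is the mixed second difference minus its expected value. The derivative of [F]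
     compares [partial i f] at two points, which the first order Taylor formula of [partial i f] at
     [t] controls. *)
  pose F u := f (t + s *: evec j + u *: evec i) - f (t + u *: evec i)
    - u * (s * partial j (partial i f) t).
  pose F' u := partial i f (t + s *: evec j + u *: evec i) - partial i f (t + u *: evec i)
    - s * partial j (partial i f) t.
  have := @mvt_bound _ F F' s (8 * C * s ^+ 2) (ltW s0).
  rewrite /F scale0r addr0 mul0r subr0 addr0.
  rewrite (_ : 8 * C * s ^+ 2 * s = 8 * C * s ^+ 3); last by ring.
  rewrite (_ : _ - _ - _ - _ = f (t + s *: evec i + s *: evec j) - f (t + s *: evec j)
      - f (t + s *: evec i) + f t - s ^+ 2 * partial j (partial i f) t); last first.
    by rewrite [t + _ + s *: evec i]addrAC; ring.
  apply.
    move=> u us.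
    have d1 := is_derive_line (df u s us ss).
    have := df u 0 us os; rewrite scale0r addr0 => /is_derive_line d2.
    apply: is_derive_eq.
    by rewrite /F' scaler0 add0r /GRing.scale/= mulr1.
  move=> u us; rewrite /F'.
  have H1 := HC _ (le_trans (inU _ _ us ss) s2r).
  have H2 := HC _ (le_trans (inU _ _ us os) s2r).
  move: H1 H2; rewrite scale0r addr0 => H1 H2.
  have sumE (x y : R) : \sum_(k < p) (x *: evec i + y *: evec j : pt) 0 k *
       partial k (partial i f) t =
       x * partial i (partial i f) t + y * partial j (partial i f) t.
    under eq_bigr do rewrite mxE mulrDl.
    by rewrite big_split /= !sum_evec.
  have B2 (x y : R) : 0 <= x <= s -> 0 <= y <= s ->
     C * `|x *: evec i + y *: evec j : pt| ^+ 2 <= 4 * C * s ^+ 2.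
    move=> xs ys; rewrite [4 * C]mulrC -mulrA ler_wpM2l //.
    rewrite (_ : 4 * s ^+ 2 = (2 * s) ^+ 2); last by ring.
    by rewrite lerXn2r ?nnegrE ?mulr_ge0 ?(ltW s0) ?inU.
  have {}H1 := le_trans H1 (B2 _ _ us ss).
  have := B2 _ _ us os; rewrite scale0r addr0 => H3.
  have {H3}H2 := le_trans H2 H3.
  have := sumE u 0; rewrite scale0r addr0 mul0r addr0 => sE2.
  move: H1 H2; rewrite sumE sE2 [u *: _ + _]addrC addrA.
  set a1 := partial i f (t + s *: evec j + u *: evec i).
  set a2 := partial i f (t + u *: evec i).
  move: (partial i f t) (partial i (partial i f) t) => b b' H1 H2.
  rewrite (_ : _ - _ - _ = (a1 - b - (u * b' + s * partial j (partial i f) t))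
    - (a2 - b - u * b')); last by ring.
  rewrite (le_trans (ler_normB _ _)) // (le_trans (lerD H1 H2)) //.
  by rewrite le_eqVlt; apply/orP; left; apply/eqP; ring.
have [C1 C10 H1] := key i j; have [C2 C20 H2] := key j i.
apply/eqP; rewrite -subr_eq0 -normr_eq0 eq_le normr_ge0 andbT.
apply/ler_addgt0Pr => e e0; rewrite add0r.
set d := `|_|.
have [s [s0 sr se]] : exists s : R, [/\ 0 < s, s <= r / 2 & s <= e / (C1 + C2 + 1)].
  exists (Num.min (r / 2) (e / (C1 + C2 + 1))).
  by rewrite lt_min !divr_gt0 ?ltr_wpDl ?addr_ge0 // !ge_min !lexx orbT.
have /H1 {}H1 := s0; have /H2 {}H2 := s0.
have {}H1 := H1 sr; have {}H2 := H2 sr.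
have : s ^+ 2 * d <= (C1 + C2) * s ^+ 3.
  rewrite /d -{1}[s ^+ 2](ger0_norm (sqr_ge0 s)) -normrM mulrBr.
  rewrite mulrDl; apply: le_trans (lerD H1 H2).
  apply: le_trans (ler_normB _ _).
  rewrite [t + s *: evec j + _]addrAC le_eqVlt; apply/orP; left; apply/eqP.
  congr (Num.norm _).
  move: (f (t + s *: evec i + s *: evec j)) (f (t + s *: evec j)) (f (t + s *: evec i)).
  move: (f t) (partial i (partial j f) t) (partial j (partial i f) t).
  by move=> *; ring.
rewrite (_ : (C1 + C2) * s ^+ 3 = s ^+ 2 * (s * (C1 + C2))); last by ring.
rewrite ler_pM2l ?exprn_gt0 //.
move/le_trans; apply.
move: se; rewrite ler_pdivlMr ?ltr_wpDl ?addr_ge0 //; apply: le_trans.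
by rewrite ler_wpM2l ?(ltW s0) // lerDl.
Qed.

End RowNorm.

Lemma Ck_smooth_on {R : realType} {p : nat} (U : set 'rV[R]_p) f :
  (forall n, Ck n U f) -> smooth_on U f.
Proof.
move=> Cf s; elim/last_ind: s f Cf => [|s i IH] f Cf t Ut; first exact: (Cf 0%N).
by rewrite foldr_rcons; apply: IH Ut => n; exact: Ck_partial (Cf n.+1).
Qed.

(** * A smooth bump function with vanishing gradient at its centre *)

Section Bump.
Context {R : realType}.

Lemma is_derive_quadratic_bound (f : R -> R) (x C : R) :
  (forall h, `|h| <= 1 -> `|f (x + h) - f x| <= C * h ^+ 2) -> is_derive x 1 f 0.
Proof.
move=> Hf.
have lim0 : (fun h : R => h^-1 *: ((f \o shift x) (h *: (1 : R)) - f x)) @ 0^' --> (0 : R).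
  apply/cvgrPdist_le => e e0; near=> h.
  have h0 : h != 0 by near: h; exact: nbhs_dnbhs_neq.
  have h1 : `|h| <= 1.
    by near: h; apply: dnbhs0_le.
  rewrite sub0r normrN /= /GRing.scale/= mulr1 [h + x]addrC normrM normfV.
  rewrite ler_pdivrMl ?normr_gt0 // (le_trans (Hf _ h1)) //.
  rewrite -real_normK ?num_real // expr2 mulrA mulrC ler_wpM2l //.
  have C0 : C <= `|C| + 1 by rewrite (le_trans (ler_norm _)) // lerDl.
  rewrite (le_trans (ler_wpM2r _ C0)) // -ler_pdivlMl ?ltr_wpDl //.
  by near: h; apply: dnbhs0_le; rewrite mulr_gt0 // invr_gt0 ltr_wpDl.
by apply: DeriveDef; [apply/cvg_ex; exists 0|exact/cvg_lim].
Unshelve. all: by end_near. Qed.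

(** The functions [P(1/x) exp(-1/x)], extended by 0, form a class closed under differentiation, so
    smoothness is a single derivative computation; [dpsi] is the chain rule in [y = 1/x]. *)
Definition psi (P : {poly R}) (x : R) : R :=
  if 0 < x then P.[x^-1] * expR (- x^-1) else 0.

Definition dpsi (P : {poly R}) : {poly R} := 'X^2 * (P - P^`()).

Lemma horner_bound (P : {poly R}) : exists2 C : R, 0 <= C &
  forall y, 1 <= y -> `|P.[y]| <= C * y ^+ size P.
Proof.
exists (\sum_(i < size P) `|P`_i|); first by apply: sumr_ge0.
move=> y y1; have y0 : 0 <= y by rewrite (le_trans ler01).
rewrite horner_coef (le_trans (ler_norm_sum _ _ _)) // mulr_suml.
apply: ler_sum => i _; rewrite normrM normrX (ger0_norm y0) ler_wpM2l //.
by rewrite ler_weXn2l // ltnW.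
Qed.

Lemma psi_bound (P : {poly R}) : exists C : R,
  forall h, `|h| <= 1 -> `|psi P h| <= C * h ^+ 2.
Proof.
have [C C0 HC] := horner_bound P.
have [k kE] : exists k, k = (size P).+2 by exists (size P).+2.
exists (C * k%:R ^+ k) => h h1; rewrite /psi; case: ifPn => h0; last first.
  by rewrite normr0 mulr_ge0 ?sqr_ge0 // mulr_ge0 // exprn_ge0.
have {h1} hv1 : 1 <= h^-1.
  by rewrite invf_ge1 //; move: h1; rewrite gtr0_norm.
set y := h^-1 in hv1 *; have y0 : 0 < y by rewrite invr_gt0.
have -> : h = y^-1 by rewrite invrK.
rewrite normrM (gtr0_norm (expR_gt0 _)) expRN.
rewrite ler_pdivrMr ?expR_gt0 // (le_trans (HC _ hv1)) //.
have kn0 : k%:R != 0 :> R by rewrite pnatr_eq0 kE.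
(* This is [1 + y/k <= exp(y/k)] raised to the power [k]. Since [k] exceeds [size P] by 2, a factor
   [h^2] is left, which makes the derivative at 0 vanish. *)
have ek : y ^+ k <= k%:R ^+ k * expR y.
  have -> : expR y = expR (y / k%:R) ^+ k.
    by rewrite -expRM_natl mulrC divfK.
  rewrite -exprMn lerXn2r ?nnegrE ?(ltW y0) ?mulr_ge0 ?expR_ge0 //.
  rewrite -ler_pdivrMl ?lt0r ?kn0 ?ler0n // mulrC.
  by rewrite (le_trans _ (expR_ge1Dx _)) // lerDr.
rewrite (_ : _ * expR y = C * (y ^- 2 * (k%:R ^+ k * expR y))); last first.
  by rewrite exprVn; ring.
by rewrite ler_wpM2l // ler_pdivlMl ?exprn_gt0 // -exprD add2n -kE.
Qed.

Lemma is_derive_psi (P : {poly R}) (x : R) : is_derive x 1 (psi P) (psi (dpsi P) x).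
Proof.
have [x0|x0|<-] := ltgtP 0 x.
- have -> : psi (dpsi P) x = - x ^- 2 * P^`().[x^-1] * expR (- x^-1)
      + P.[x^-1] * (x ^- 2 * expR (- x^-1)).
    rewrite /psi x0 /dpsi hornerM hornerXn hornerD hornerN exprVn; ring.
  have xn : x != 0 by rewrite gt_eqF.
  have dV : is_derive x 1 (fun y : R => y^-1) (- x ^- 2).
    apply: DeriveDef; first by apply: derivableV => //; exact: derivable_id.
    by rewrite deriveV // derive_id /GRing.scale/= mulr1.
  have dP : is_derive x 1 (fun y : R => P.[y^-1]) (P^`().[x^-1] * - x ^- 2).
    exact: (@is_derive1_comp _ (horner P) (fun y => y^-1)).
  have dE : is_derive x 1 (fun y : R => expR (- y^-1)) (x ^- 2 * expR (- x^-1)).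
    have dN : is_derive x 1 (fun y : R => - y^-1) (x ^- 2).
      by apply: is_derive_eq; rewrite opprK.
    by rewrite mulrC; exact: (@is_derive1_comp _ expR (fun y => - y^-1)).
  have D : is_derive x 1 (fun x => P.[x^-1] * expR (- x^-1))
     (- x ^- 2 * P^`().[x^-1] * expR (- x^-1) + P.[x^-1] * (x ^- 2 * expR (- x^-1))).
    by apply: is_derive_eq; rewrite /GRing.scale/=; ring.
  apply: near_eq_is_derive D; near=> y; rewrite /psi ifT //; near: y.
  exact: lt_nbhsr.
- rewrite {2}/psi ltNge (ltW x0) /=.
  apply: near_eq_is_derive (is_derive_cst 0 x 1); near=> y.
  rewrite /psi ifF //; apply/negbTE; rewrite -leNgt; apply/ltW; near: y.
  exact: lt_nbhsl.
- rewrite {2}/psi ltxx; have [C HC] := psi_bound P.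
  apply: (@is_derive_quadratic_bound _ _ C) => h h1.
  by rewrite add0r {2}/psi ltxx subr0; exact: HC.
Unshelve. all: by end_near. Qed.

(** A list of pairs [(Q, P)] is a syntactic sum of terms [Q * (psi P \o q)]; [dbump] differentiates
    the syntax, so one lemma yields derivatives of all orders. *)
Definition bumpf (q : {poly R}) (L : seq ({poly R} * {poly R})) (x : R) : R :=
  \sum_(QP <- L) QP.1.[x] * psi QP.2 q.[x].

Definition dbump (q : {poly R}) (L : seq ({poly R} * {poly R})) :=
  flatten [seq [:: (QP.1^`(), QP.2); (QP.1 * q^`(), dpsi QP.2)] | QP <- L].

Lemma is_derive_bumpf q L (x : R) : is_derive x 1 (bumpf q L) (bumpf q (dbump q L) x).
Proof.
elim: L => [|[Q P] L IH].
  rewrite /bumpf /dbump /= big_nil.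
  rewrite (_ : (fun _ => _) = cst 0); first exact: is_derive_cst.
  by apply/funext => y; rewrite big_nil.
have -> : bumpf q ((Q, P) :: L) = (fun x => Q.[x] * psi P q.[x]) + bumpf q L.
  by apply/funext => y; rewrite /bumpf big_cons.
have -> : bumpf q (dbump q ((Q, P) :: L)) x =
    (Q^`().[x] * psi P q.[x] + (Q * q^`()).[x] * psi (dpsi P) q.[x])
    + bumpf q (dbump q L) x.
  by rewrite /bumpf /= !big_cons /= addrA.
have dP : is_derive x 1 (fun y : R => psi P q.[y]) (psi (dpsi P) q.[x] * q^`().[x]).
  have := is_derive_psi P q.[x] => dpq.
  exact: (@is_derive1_comp _ (psi P) (horner q)).
apply: is_derive_eq; rewrite hornerM /GRing.scale/=.
by move: (bumpf _ _ _) (psi _ _) (psi _ _) Q.[x] Q^`().[x] q^`().[x] => *; ring.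
Qed.

Section Tensor.
Context {p : nat} (t0 : 'rV[R]_p) (q : {poly R}).
Local Notation pt := 'rV[R]_p.

(** If [q] is nonpositive off an interval, the product vanishes outside a cube, which is a ball of
    the maximum norm. *)
Definition tensor (L : 'I_p -> seq ({poly R} * {poly R})) (t : pt) : R :=
  \prod_i bumpf q (L i) (t 0 i - t0 0 i).

Definition dtensor j (L : 'I_p -> seq ({poly R} * {poly R})) i :=
  if i == j then dbump q (L i) else L i.

Lemma differentiable_bumpf_coord L i (t : pt) :
  differentiable (fun s : pt => bumpf q L (s 0 i - t0 0 i)) t.
Proof.
apply: (@differentiable_comp _ _ _ _ (fun s : pt => s 0 i - t0 0 i) (bumpf q L)).
  apply: differentiableB; [exact: differentiable_coord|exact: differentiable_cst].
by apply/derivable1_diffP; have [] := is_derive_bumpf q L (t 0 i - t0 0 i).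
Qed.

Lemma tensor_differentiable L t : differentiable (tensor L) t.
Proof.
suff H r : differentiable (fun s : pt => \prod_(i <- r) bumpf q (L i) (s 0 i - t0 0 i)) t.
  exact: H.
elim: r => [|i r IH].
  rewrite (_ : (fun _ => _) = cst 1); first exact: differentiable_cst.
  by apply/funext => y; rewrite big_nil.
rewrite (_ : (fun _ => _) = (fun s : pt => bumpf q (L i) (s 0 i - t0 0 i)) *
   (fun s : pt => \prod_(i <- r) bumpf q (L i) (s 0 i - t0 0 i))).
  apply: differentiableM => //; exact: differentiable_bumpf_coord.
by apply/funext => y; rewrite big_cons.
Qed.

Lemma partial_bumpf_coord L i j (t : pt) :
  partial j (fun s : pt => bumpf q L (s 0 i - t0 0 i)) t =
  if i == j then bumpf q (dbump q L) (t 0 i - t0 0 i) else 0.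
Proof.
have D := differentiable_bumpf_coord L i t.
have := @is_derive_line _ _ _ t (evec j) 0; rewrite scale0r addr0 => /(_ _ D) H.
rewrite /partial; move: H => [_ <-].
have E u : (t + u *: evec j) 0 i - t0 0 i = u * (i == j)%:R + (t 0 i - t0 0 i).
  by rewrite !mxE eqxx /= addrAC addrC.
case: eqP => ij.
  rewrite (_ : (fun _ => _) = bumpf q L \o shift (t 0 i - t0 0 i)); last first.
    by apply/funext => u /=; rewrite E ij eqxx mulr1.
  apply: derive_val.
  rewrite -[X in is_derive _ _ _ X]mulr1.
  apply: is_derive1_comp; last exact: is_derive_shift.
  by rewrite /= add0r; exact: is_derive_bumpf.
rewrite (_ : (fun _ => _) = cst (bumpf q L (t 0 i - t0 0 i))) ?derive_cst //.
by apply/funext => u /=; rewrite E; case: eqP => // _; rewrite mulr0 add0r.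
Qed.

Lemma partial_tensor j L : partial j (tensor L) = tensor (dtensor j L).
Proof.
apply/funext => t.
have D (i : 'I_p) : differentiable (fun s : pt => bumpf q (L i) (s 0 i - t0 0 i)) t.
  exact: differentiable_bumpf_coord.
have Dr (r : seq 'I_p) : differentiable (fun s : pt => \prod_(i <- r) bumpf q (L i) (s 0 i - t0 0 i)) t.
  elim: r => [|i r IH].
    rewrite (_ : (fun _ => _) = cst 1); first exact: differentiable_cst.
    by apply/funext => y; rewrite big_nil.
  rewrite (_ : (fun _ => _) = (fun s : pt => bumpf q (L i) (s 0 i - t0 0 i)) *
     (fun s : pt => \prod_(i <- r) bumpf q (L i) (s 0 i - t0 0 i))).
    exact: differentiableM.
  by apply/funext => y; rewrite big_cons.
have H (r : seq 'I_p) : uniq r ->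
   partial j (fun s : pt => \prod_(i <- r) bumpf q (L i) (s 0 i - t0 0 i)) t =
   if j \in r then \prod_(i <- r) bumpf q (dtensor j L i) (t 0 i - t0 0 i) else 0.
  elim: r => [_|i r IH /= /andP[ir ur]].
    rewrite (_ : (fun _ => _) = cst 1) ?partial_cst //.
    by apply/funext => y; rewrite big_nil.
  rewrite (_ : (fun _ => _) = (fun s : pt => bumpf q (L i) (s 0 i - t0 0 i) *
     (\prod_(i <- r) bumpf q (L i) (s 0 i - t0 0 i)))); last first.
    by apply/funext => y; rewrite big_cons.
  rewrite partialM // IH // partial_bumpf_coord inE big_cons /dtensor.
  rewrite [j == i]eq_sym; case: (eqVneq i j) => [ij|ij] /=.
    subst i; rewrite (negbTE ir) mulr0 addr0; congr (_ * _).
    rewrite big_seq [RHS]big_seq; apply: eq_bigr => k kr; case: eqP => // kj.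
    by rewrite kj (negbTE ir) in kr.
  by rewrite mul0r add0r; case: ifP => _; rewrite ?mulr0.
by have := H _ (index_enum_uniq 'I_p); rewrite mem_index_enum; exact.
Qed.

Lemma smooth_tensor L : smooth_on setT (tensor L).
Proof.
move=> s t _.
suff [L' ->] : exists L', foldr partial (tensor L) s = tensor L' by exact: tensor_differentiable.
elim: s => [|i s [L' /= ->]]; first by exists L.
by exists (dtensor i L'); rewrite partial_tensor.
Qed.

End Tensor.

Lemma bump_exists (p : nat) (t0 : 'rV[R]_p) (r : R) : 0 < r ->
  exists chi : 'rV[R]_p -> R, [/\ smooth_on setT chi, chi t0 = 1,
    forall i, partial i chi t0 = 0 &
    forall t, r <= `|t - t0| -> chi t = 0].
Proof.
move=> r0.
have [q [q0 dq0 qx]] : exists q : {poly R},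
    [/\ q.[0] = 1, q^`().[0] = 0 & forall x, q.[x] = 1 - r ^- 2 * x ^+ 2].
  (* The parabola is positive exactly for [|x| < r], and its derivative at 0 vanishes, which kills
     the gradient of the bump at [t0]. *)
  exists (1 - (r ^- 2)%:P * 'X^2).
  rewrite derivB derivC derivM derivC derivXn; split=> [| |x].
  - by rewrite !(hornerE, hornerXn) /= ?expr0n /= ?(mulr0,mul0r,subr0).
  - by rewrite !hornerE /=; ring.
  - by rewrite !(hornerE, hornerXn).
(* The factor [e] normalises the value [exp(-1/q(0)) = exp(-1)] at the centre. *)
pose L (_ : 'I_p) : seq ({poly R} * {poly R}) := [:: ((expR 1)%:P, 1)].
have b0 : bumpf q [:: ((expR 1)%:P, 1)] 0 = 1.
  rewrite /bumpf big_seq1 /= !hornerE q0 /psi ltr01 hornerC mul1r invr1.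
  by rewrite -expRD subrr expR0.
exists (tensor t0 q L); split; first exact: smooth_tensor.
- by rewrite /tensor big1 // => i _; rewrite subrr b0.
- move=> i; rewrite partial_tensor /tensor (bigD1 i) //= subrr /dtensor eqxx.
  rewrite /bumpf /dbump /= big_cons big_seq1 /= derivC !hornerE dq0.
  by rewrite !(mulr0,mul0r,addr0).
- move=> t; have [->|] := eqVneq t t0.
    by rewrite subrr normr0 leNgt r0.
  rewrite -subr_eq0 -normr_eq0 => tn0.
  have [ij Hij] := mx_norm_neq0 tn0.
  rewrite [`|t - t0|]Hij /= => Hr.
  rewrite /tensor (bigD1 ij.2) //= /bumpf big_seq1 /=.
  move: Hr; rewrite ord1 !mxE; set x := t 0 ij.2 - _ => Hr.
  suff -> : psi 1 q.[x] = 0 by rewrite mulr0 mul0r.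
  rewrite /psi ifF //; apply/negbTE; rewrite -leNgt qx subr_le0.
  rewrite mulrC ler_pdivlMr ?exprn_gt0 // mul1r.
  rewrite -[leRHS]real_normK ?num_real //.
  by apply: lerXn2r Hr; rewrite ?nnegrE ?(ltW r0).
Qed.

End Bump.

(** * Riemannian distance *)

Section Glue.
Context {R : realType} {V : normedModType R}.

(** A bound by [e * |h|] can be checked separately on each side of the point, which is what the
    joint of two curves requires. *)
Lemma is_derive0P (f : R -> V) (x : R) :
  (forall e : R, 0 < e -> \forall h \near (0 : R), `|f (x + h) - f x| <= e * `|h|) <->
  is_derive x 1 f 0.
Proof.
split=> [H|[df f0] e e0].
  have lim0 : (fun h : R => h^-1 *: ((f \o shift x) (h *: (1 : R)) - f x)) @ 0^' --> (0 : V).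
    apply/cvgrPdist_le => e e0.
    have He := H _ e0.
    near=> h.
    have h0 : h != 0 by near: h; exact: nbhs_dnbhs_neq.
    rewrite sub0r normrN /= normrZ normfV [h *: 1]mulr1 [h + x]addrC.
    rewrite ler_pdivrMl ?normr_gt0 // mulrC.
    by near: h; apply: nbhs_dnbhs.
  by apply: DeriveDef; [apply/cvg_ex; exists 0|exact/cvg_lim].
have : (fun h : R => h^-1 *: ((f \o shift x) (h *: (1 : R)) - f x)) @ 0^' --> (0 : V).
  by rewrite -f0; exact: df.
move=> /cvgrPdist_le/(_ _ e0); rewrite near_withinE => Hn.
near=> h.
have [->|h0] := eqVneq h 0; first by rewrite addr0 subrr !normr0 mulr0.
rewrite mulrC -ler_pdivrMl ?normr_gt0 // -normfV -normrZ -normrN -sub0r.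
have := near Hn h; rewrite /= [h *: 1]mulr1 [h + x]addrC => /(_ _)/(_ h0); apply.
by [].
Unshelve. all: by end_near. Qed.

Lemma is_derive_affine (t h : V) (s : R) : is_derive s 1 (fun u : R => t + u *: h) h.
Proof.
have dl : is_diff s (fun u : R => t + u *: h) (fun u => u *: h).
  have -> : (fun u : R => u *: h) = 0 + (fun u => u *: h) by rewrite add0r.
  exact: is_diffD.
apply: DeriveDef; first by apply/derivable1_diffP; exact: ex_diff.
by rewrite deriveE ?diff_val ?scale1r //; exact: ex_diff.
Qed.

Definition glue (f1 f2 : R -> V) (s : R) : V :=
  if s <= 2^-1 then f1 (2 * s) else f2 (2 * s - 1).

Lemma glue_left f1 f2 s : s <= 2^-1 -> glue f1 f2 s = f1 (2 * s).
Proof. by rewrite /glue => ->. Qed.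

Lemma glue_right f1 f2 s : f1 1 = f2 0 -> 2^-1 <= s -> glue f1 f2 s = f2 (2 * s - 1).
Proof.
rewrite /glue le_eqVlt => f12 /predU1P[<-|]; last by rewrite ltNge => /negbTE ->.
by rewrite lexx mulfV // f12 subrr.
Qed.

Lemma glue_continuous (f1 f2 : R -> V) : f1 1 = f2 0 -> continuous f1 -> continuous f2 ->
  continuous (glue f1 f2).
Proof.
move=> f12 c1 c2 s; apply/cvgrPdist_le => e e0.
have C1 : {for s, continuous (fun s : R => f1 (2 * s))}.
  by apply: continuous_comp; [exact: mulrl_continuous|exact: c1].
have C2 : {for s, continuous (fun s : R => f2 (2 * s - 1))}.
  apply: continuous_comp; last exact: c2.
  by apply: cvgB; [exact: mulrl_continuous|exact: cvg_cst].
have {C1} := C1 => /cvgrPdist_le/(_ _ e0) N1.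
have {C2} := C2 => /cvgrPdist_le/(_ _ e0) N2.
have [sl|sl|sE] := ltgtP s 2^-1.
- near=> u; rewrite !glue_left ?(ltW sl) //; last by apply/ltW; near: u; exact: lt_nbhsl.
  by near: u.
- near=> u; rewrite !glue_right ?(ltW sl) //; last by apply/ltW; near: u; exact: lt_nbhsr.
  by near: u.
- near=> u; have [ul|ul] := leP u 2^-1.
    by rewrite !glue_left ?sE //; near: u; rewrite -sE.
  by rewrite !glue_right ?sE ?(ltW ul) //; near: u; rewrite -sE.
Unshelve. all: by end_near. Qed.

(** Both velocities vanish at the joint, so the one-sided derivatives agree there whatever the
    directions of the two curves. *)
Lemma is_derive_glue (f1 f2 d1 d2 : R -> V) : f1 1 = f2 0 ->
  (forall s : R, is_derive s 1 f1 (d1 s)) -> (forall s : R, is_derive s 1 f2 (d2 s)) ->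
  d1 1 = 0 -> d2 0 = 0 ->
  forall s : R, is_derive s 1 (glue f1 f2) (2 *: glue d1 d2 s).
Proof.
move=> f12 D1 D2 d10 d20 s.
have dc (f d : R -> V) (k : R) : (forall s : R, is_derive s 1 f (d s)) ->
    is_derive s 1 (fun u : R => f (2 * u - k)) (2 *: d (2 * s - k)).
  move=> Df; have D := Df (2 * s - k).
  pose l := fun u : R => 2 * u - k.
  have dl : is_derive s 1 l 2.
    by apply: is_derive_eq; rewrite /GRing.scale/= mulr1 subr0.
  have dfl : differentiable f (l s) by apply/derivable1_diffP; case: D.
  have dll : differentiable l s by apply/derivable1_diffP; case: dl.
  rewrite -[fun u => _]/(f \o l); apply: DeriveDef.
    by apply/derivable1_diffP; exact: differentiable_comp.
  rewrite deriveE; last exact: differentiable_comp.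
  rewrite diff_comp //=.
  have -> : 'd l s 1 = 2 *: (1 : R).
    by rewrite -deriveE // derive_val /GRing.scale/= mulr1.
  by rewrite linearZ /= -deriveE // derive_val.
have [sl|sl|sE] := ltgtP s 2^-1.
- rewrite glue_left ?(ltW sl) //.
  have := dc f1 d1 0 D1; rewrite subr0; apply: near_eq_is_derive.
  near=> u; rewrite subr0 glue_left //; apply/ltW; near: u; exact: lt_nbhsl.
- rewrite [glue d1 d2 s]/glue leNgt sl /=.
  have := dc f2 d2 1 D2; apply: near_eq_is_derive.
  near=> u; rewrite glue_right //; apply/ltW; near: u; exact: lt_nbhsr.
- rewrite glue_left ?sE // mulfV // d10 scaler0; apply/is_derive0P => e e0.
  have N1 : \forall h \near (0 : R), `|f1 (2 * (2^-1 + h)) - f1 (2 / 2)| <= e * `|h|.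
    have := dc f1 d1 0 D1; rewrite sE subr0 mulfV // d10 scaler0.
    by move=> /is_derive0P/(_ e e0); apply: filterS => h; rewrite !subr0 mulfV.
  have := dc f2 d2 1 D2; rewrite sE mulfV // subrr d20 scaler0.
  move=> /is_derive0P/(_ e e0) N2.
  near=> h; have [h0|h0] := leP h 0.
    rewrite !glue_left ?gerDl //.
    by near: h.
  rewrite !glue_right ?lerDl ?(ltW h0) //.
  by have := near N2 h; apply.
Unshelve. all: by end_near. Qed.

End Glue.

Section Dist.
Context {R : realType} {p : nat} (Theta : set 'rV[R]_p) (g : 'rV[R]_p -> 'M[R]_p).
Local Notation pt := 'rV[R]_p.
Context (gm : metric_on Theta g).

Lemma ipE t (u v : pt) : ip g t u v = \sum_j (\sum_i u 0 i * g t i j) * v 0 j.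
Proof. by rewrite /ip mxE; apply: eq_bigr => j _; rewrite !mxE. Qed.

Lemma continuous_bigsum (T : topologicalType) (I : Type) (r : seq I) (F : I -> T -> R) (x : T) :
  (forall i, {for x, continuous (F i)}) ->
  {for x, continuous (fun y => \sum_(i <- r) F i y)}.
Proof.
move=> cF; elim: r => [|i r IH].
  rewrite (_ : (fun _ => _) = cst 0); first exact: cst_continuous.
  by apply/funext => y; rewrite big_nil.
rewrite (_ : (fun _ => _) = fun y => F i y + \sum_(j <- r) F j y).
  by apply: continuousD; [exact: cF|exact: IH].
by apply/funext => y; rewrite big_cons.
Qed.

Lemma metric_continuous t i j : Theta t -> {for t, continuous (fun s => g s i j)}.
Proof.
case: gm => gs _ _ Tt; have [U [oU TU sU]] := gs i j.
by apply: differentiable_continuous; exact: (sU [::] t (TU _ Tt)).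
Qed.

Lemma ip_continuous (T : topologicalType) (c u v : T -> pt) (s : T) :
  {for s, continuous c} -> Theta (c s) ->
  (forall i, {for s, continuous (fun x => u x 0 i)}) ->
  (forall i, {for s, continuous (fun x => v x 0 i)}) ->
  {for s, continuous (fun x => ip g (c x) (u x) (v x))}.
Proof.
move=> cc Tc cu cv.
rewrite (_ : (fun _ => _) = fun x => \sum_j (\sum_i u x 0 i * g (c x) i j) * v x 0 j).
  apply: continuous_bigsum => j; apply: continuousM; last exact: cv.
  apply: continuous_bigsum => i; apply: continuousM; first exact: cu.
  apply: (@continuous_comp _ _ _ c (fun t => g t i j)); first exact: cc.
  exact: metric_continuous.
by apply/funext => x; rewrite ipE.
Qed.

Lemma ip_ge0 t v : Theta t -> 0 <= ip g t v v.
Proof.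
case: gm => _ _ pd Tt; have [->|v0] := eqVneq v 0; last exact/ltW/pd.
by rewrite /ip !mul0mx mxE.
Qed.

Lemma ipZ t (k : R) v : ip g t (k *: v) (k *: v) = k ^+ 2 * ip g t v v.
Proof. by rewrite /ip linearZ /= -!scalemxAl -scalemxAr !mxE mulrA -expr2. Qed.

(** Compactness of [Theta] times the unit sphere, then homogeneity of degree 2. *)
Lemma metric_elliptic : compact Theta ->
  exists2 lam : R, 0 < lam & forall t v, Theta t -> lam * `|v| ^+ 2 <= ip g t v v.
Proof.
move=> cT.
pose S : set pt := [set v | `|v| = 1].
have cS : compact S.
  apply: (@subclosed_compact _ _ (cball 0 1)); last 2 first.
  - exact: compact_cball.
  - by move=> v /= Sv; rewrite /cball/= subr0 Sv.
  rewrite (_ : S = (fun s => `|s - 0|) @^-1` [set 1]).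
    by apply: closed_comp (@closed_eq _ _) => s _; exact: norm_sub_continuous.
  by apply/seteqP; split=> v /=; rewrite subr0.
have cK : compact (Theta `*` S) by exact: compact_setX.
have red (lam : R) : (forall t v, Theta t -> S v -> lam <= ip g t v v) ->
    forall t v, Theta t -> lam * `|v| ^+ 2 <= ip g t v v.
  move=> H t v Tt; have [->|v0] := eqVneq v 0.
    by rewrite normr0 expr0n /= mulr0 ip_ge0.
  have nv0 : `|v| != 0 by rewrite normr_eq0.
  have := H t (`|v|^-1 *: v) Tt.
  rewrite ipZ exprVn ler_pdivlMl ?exprn_even_gt0 // mulrC; apply.
  by rewrite /S /= normrZ normfV normr_id mulVf.
have [K0|/set0P[x0 Kx0]] := eqVneq (Theta `*` S) set0.
  exists 1 => //; apply: red => t v Tt Sv.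
  by have : (Theta `*` S) (t, v) by []; rewrite K0.
have [|z0] := @compact_EVT_min _ R
    (fun z : pt * pt => ip g z.1 z.2 z.2) _ (ex_intro _ _ Kx0) cK.
  apply: continuous_in_subspaceT => z; rewrite inE => -[Tz Sz].
  have c2 i : {for z, continuous (fun x : pt * pt => x.2 0 i)}.
    by apply: (@continuous_comp _ _ _ snd (fun v : pt => v 0 i));
      [exact: cvg_snd|exact: coord_continuous].
  have c1 : {for z, continuous (fst : pt * pt -> pt)} by exact: cvg_fst.
  exact: (@ip_continuous _ fst snd snd z c1 Tz c2 c2).
rewrite inE; case: z0 => t v [/= Tt Sv] Hmin.
exists (ip g t v v); last first.
  by apply: red => t' v' Tt' Sv'; apply: (Hmin (t', v')); rewrite inE.
case: gm => _ _ pd; apply: pd => //; apply/eqP => v0.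
by move: Sv; rewrite /S /= v0 normr0 => /eqP; rewrite eq_sym oner_eq0.
Qed.

Lemma metric_upper : compact Theta ->
  exists2 Lam : R, 0 <= Lam & forall t v, Theta t -> ip g t v v <= Lam * `|v| ^+ 2.
Proof.
move=> cT.
have [B B0 HB] : exists2 B : R, 0 <= B & forall i j t, Theta t -> `|g t i j| <= B.
  have /(choice (P := fun ij (B : R) => 0 <= B /\ forall t, Theta t -> `|g t ij.1 ij.2| <= B))
      [B HB] : forall ij : 'I_p * 'I_p, exists B : R,
      0 <= B /\ forall t, Theta t -> `|g t ij.1 ij.2| <= B.
    move=> [i j]; have [|B B0 HB] := @compact_bounded_fun _ _ _ (fun t => g t i j) cT.
      by apply: continuous_in_subspaceT => t; rewrite inE; exact: metric_continuous.
    by exists B.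
  exists (\sum_ij B ij); first by apply: sumr_ge0 => i _; have [] := HB i.
  move=> i j t Tt; have [_ /(_ t Tt)/le_trans] := HB (i, j); apply.
  by rewrite (bigD1 (i, j)) //= lerDl sumr_ge0 // => k _; have [] := HB k.
exists (p%:R * (p%:R * B)); first by rewrite !mulr_ge0.
move=> t v Tt; rewrite ipE (le_trans (ler_norm _)) //.
under eq_bigr do rewrite mulrC.
rewrite (_ : _ * `|v| ^+ 2 = p%:R * (p%:R * B * `|v|) * `|v|); last by ring.
by apply: sum_coord_le => j; apply: sum_coord_le => i; exact: HB.
Qed.

Definition curve_speed (c c' : R -> pt) (s : R) : R := Num.sqrt (ip g (c s) (c' s) (c' s)).

Definition admissible x y (c c' : R -> pt) :=
  [/\ forall s : R, is_derive s 1 c (c' s), continuous c',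
      forall s : R, 0 <= s <= 1 -> Theta (c s) & c 0 = x /\ c 1 = y].

(** The length is recorded by a primitive [F] of the speed instead of an integral: reparametrisation
    and concatenation then need only the chain rule. *)
Definition reach x y (l : R) := exists (c c' : R -> pt) (F : R -> R),
  [/\ admissible x y c c',
      forall s : R, 0 <= s <= 1 -> is_derive s 1 F (curve_speed c c' s) &
      F 1 - F 0 = l].

Lemma speed_continuous x y c c' s : admissible x y c c' -> 0 <= s <= 1 ->
  {for s, continuous (curve_speed c c')}.
Proof.
move=> [dc cc' Tc _] s01.
apply: (@continuous_comp _ _ _ (fun s => ip g (c s) (c' s) (c' s)) Num.sqrt);
  last exact: sqrt_continuous.
have c's i : {for s, continuous (fun x => c' x 0 i)}.
  apply: (@continuous_comp _ _ _ c' (fun v : pt => v 0 i)); first exact: cc'.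
  exact: coord_continuous.
apply: ip_continuous => //; last exact: Tc.
by apply: differentiable_continuous; apply/derivable1_diffP; case: (dc s).
Qed.

Lemma speed_primitive_integral x y c c' (F : R -> R) : admissible x y c c' ->
  (forall s : R, 0 <= s <= 1 -> is_derive s 1 F (curve_speed c c' s)) ->
  \int[lebesgue_measure]_(t in `[0%R, 1%R]) curve_speed c c' t = F 1 - F 0.
Proof.
move=> adm dF; rewrite /Rintegral (@continuous_FTC2 _ _ F) //.
- apply: continuous_in_subspaceT => s; rewrite inE/= in_itv/= => s01.
  exact: speed_continuous adm _.
- have cF (s : R) : 0 <= s <= 1 -> {for s, continuous F}.
    move=> s01; apply: differentiable_continuous; apply/derivable1_diffP.
    by case: (dF s s01).
  split.
  + move=> s; rewrite in_itv/= => /andP[/ltW s0 /ltW s1].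
    by case: (dF s); rewrite ?s0.
  + by apply: cvg_at_right_filter; apply: cF; rewrite lexx ler01.
  + by apply: cvg_at_left_filter; apply: cF; rewrite lexx ler01.
- move=> s; rewrite in_itv/= => /andP[/ltW s0 /ltW s1].
  have s01 : 0 <= s <= 1 by rewrite s0.
  by rewrite derive1E; have D := dF s s01; rewrite derive_val.
Qed.

Lemma speed_primitive x y c c' : admissible x y c c' ->
  exists F : R -> R, forall s : R, 0 <= s <= 1 -> is_derive s 1 F (curve_speed c c' s).
Proof.
move=> adm.
(* Outside [[0, 1]] the curve may leave [Theta], where nothing is known about [g]; freezing the
   parameter keeps the speed continuous on the whole line. *)
pose cl (s : R) := Num.max 0 (Num.min s 1).
have cl01 s : 0 <= cl s <= 1.
  by rewrite /cl le_max lexx /= ge_max ler01 /= ge_min lexx orbT.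
have clE s : 0 <= s <= 1 -> cl s = s.
  by move=> /andP[s0 s1]; rewrite /cl min_l // max_r.
have ccl : continuous cl.
  move=> s; apply: (@continuous_max R R (cst 0) (fun s => Num.min s 1)).
    exact: cst_continuous.
  apply: (@continuous_min R R id (cst 1)); last exact: cst_continuous.
  by move=> A.
pose v s := curve_speed c c' (cl s).
have cv : continuous v.
  move=> s; apply: (@continuous_comp _ _ _ cl (curve_speed c c')); first exact: ccl.
  exact: speed_continuous adm (cl01 s).
(* On [[-1, 2]] the points 0 and 1 are interior, so the derivatives there are two-sided. *)
exists (fun x => \int[lebesgue_measure]_(t in `[-1, x]) v t) => s s01.
have iv : lebesgue_measure.-integrable `[-1, 2] (EFin \o v).
  apply: continuous_compact_integrable; first exact: segment_compact.
  exact: continuous_subspaceT.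
have [] := @continuous_FTC1_closed _ v (-1) s 2 _ iv _ (cv s).
- by case/andP: s01 => _ s1; rewrite (le_lt_trans s1) // ltr1n.
- by case/andP: s01 => s0 _; rewrite (lt_le_trans _ s0) // ltrN10.
by move=> d1 dE; apply: DeriveDef => //; rewrite -derive1E dE /v clE.
Qed.

Definition lengths x y := [set l : R | exists c : R -> pt,
    [/\ forall t, derivable c t 1,
        continuous (fun t => derive1 c t),
        forall t, 0 <= t <= 1 -> Theta (c t),
        c 0 = x /\ c 1 = y &
        l = \int[lebesgue_measure]_(t in `[0%R, 1%R])
              Num.sqrt (ip g (c t) (derive1 c t) (derive1 c t))]].

Lemma reach_lengths x y l : reach x y l <-> lengths x y l.
Proof.
split=> [[c [c' [F [adm dF <-]]]]|[c [dc cc' Tc cxy ->]]].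
  have [dc cc' Tc cxy] := adm.
  have E : (fun t => derive1 c t) = c'.
    by apply/funext => t; rewrite derive1E; have D := dc t; rewrite derive_val.
  exists c; split; [by move=> t; case: (dc t)|by rewrite E|exact: Tc|exact: cxy|].
  rewrite -(speed_primitive_integral adm dF); congr (Rintegral _ _ _).
  by apply/funext => t; rewrite /curve_speed -E.
have adm : admissible x y c (fun t => derive1 c t).
  split; [move=> s; rewrite derive1E; exact: derivableP | exact: cc' | exact: Tc | exact: cxy].
have [F dF] := speed_primitive adm.
exists c, (fun t => derive1 c t), F; split=> //.
by rewrite -(speed_primitive_integral adm dF).
Qed.

Lemma reach_dist_le x y l : reach x y l -> riem_dist Theta g x y <= l.
Proof.
move=> /reach_lengths Sl; apply: ge_inf Sl.
by exists 0 => _ [c [_ _ _ _ ->]]; apply: Rintegral_ge0 => t _; exact: sqrtr_ge0.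
Qed.

Lemma dist_reach_lt x y (a : R) : (exists l, reach x y l) ->
  riem_dist Theta g x y < a -> exists2 l, reach x y l & l < a.
Proof.
move=> [l /reach_lengths Sl] /inf_lt[|l' Sl' la]; first by exists l.
by exists l' => //; apply/reach_lengths.
Qed.

(** Each coordinate, taken with either sign [k], changes by at most the length divided by
    [sqrt lam]; the maximum norm picks the worst coordinate. *)
Lemma reach_lower (lam : R) x y l : 0 <= lam ->
  (forall t v, Theta t -> lam * `|v| ^+ 2 <= ip g t v v) ->
  reach x y l -> Num.sqrt lam * `|y - x| <= l.
Proof.
move=> lam0 Hlam [c [c' [F [[dc cc' Tc [<- <-]] dF <-]]]].
have key i (k : R) : `|k| = 1 -> Num.sqrt lam * (k * (c 1 0 i - c 0 0 i)) <= F 1 - F 0.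
  move=> k1; rewrite -subr_ge0.
  pose K := fun s => F s - Num.sqrt lam * (k * c s 0 i).
  have dK (s : R) : 0 <= s <= 1 ->
      is_derive s 1 K (curve_speed c c' s - Num.sqrt lam * (k * c' s 0 i)).
    move=> s01; have D1 := dF s s01.
    have D2 : is_derive s 1 (fun s => c s 0 i) (c' s 0 i).
      have [dcs <-] := dc s; apply: DeriveDef; first by move/derivable_mxP : dcs.
      by rewrite derive_mx // mxE.
    by apply: is_derive_eq; rewrite /GRing.scale/= mulrA.
  have [//|s|s s01|] := @MVT R K (fun s => curve_speed c c' s - Num.sqrt lam * (k * c' s 0 i)) 0 1.
  - by rewrite in_itv/= => /andP[/ltW s0 /ltW s1]; apply: dK; rewrite s0.
  - apply/continuous_in_subspaceT : s s01 => s; rewrite inE/= in_itv/= => s01.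
    by apply: differentiable_continuous; apply/derivable1_diffP; case: (dK s s01).
  - move=> s; rewrite in_itv/= subr0 mulr1 => /andP[/ltW s0 /ltW s1].
    rewrite /K => E.
    rewrite (_ : _ - _ = curve_speed c c' s - Num.sqrt lam * (k * c' s 0 i)); last first.
      by rewrite -E; ring.
    rewrite subr_ge0.
    have s01 : 0 <= s <= 1 by rewrite s0.
    apply: (@le_trans _ _ (Num.sqrt lam * `|c' s|)).
      rewrite ler_wpM2l ?sqrtr_ge0 // (le_trans (ler_norm _)) // normrM k1 mul1r.
      exact: coord_le_norm.
    rewrite -[leLHS]ger0_norm ?mulr_ge0 ?sqrtr_ge0 // -sqrtr_sqr ler_wsqrtr //.
    by rewrite exprMn sqr_sqrtr // Hlam //; exact: Tc.
have F0 : 0 <= F 1 - F 0.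
  have [|s|s|] := @MVT R F (curve_speed c c') 0 1.
  - exact: ltr01.
  - by rewrite in_itv/= => /andP[/ltW s0 /ltW s1]; apply: dF; rewrite s0.
  - apply/continuous_in_subspaceT : s => s; rewrite inE/= in_itv/= => s01.
    by apply: differentiable_continuous; apply/derivable1_diffP; case: (dF s s01).
  - by move=> s _ ->; rewrite subr0 mulr1; exact: sqrtr_ge0.
have [s0|s0] := eqVneq (Num.sqrt lam) 0; first by rewrite s0 mul0r.
have sp : 0 < Num.sqrt lam by rewrite lt0r s0 sqrtr_ge0.
rewrite mulrC -ler_pdivlMr //; apply: norm_le_coord; first by rewrite divr_ge0 // ltW.
move=> i; rewrite ler_pdivlMr // mulrC !mxE.
have := key i 1; have := key i (-1); rewrite normrN normr1 => /(_ erefl) H1 /(_ erefl) H2.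
rewrite mul1r in H2; rewrite mulN1r in H1.
have [h0|h0] := lerP 0 (c 1 0 i - c 0 0 i).
  by rewrite ger0_norm.
by rewrite ltr0_norm.
Qed.

Lemma admissible_reparam x y c c' (phi phi' : R -> R) : admissible x y c c' ->
  (forall s : R, is_derive s 1 phi (phi' s)) -> continuous phi' ->
  (forall s, 0 <= s <= 1 -> 0 <= phi s <= 1) -> phi 0 = 0 -> phi 1 = 1 ->
  admissible x y (c \o phi) (fun s => phi' s *: c' (phi s)).
Proof.
move=> [dc cc' Tc [c0 c1]] dphi cphi' p01 p0 p1.
have cphi : continuous phi.
  by move=> s; apply: differentiable_continuous; apply/derivable1_diffP; case: (dphi s).
split.
- move=> s; have Dc := dc (phi s); have Dp := dphi s.
  have difc : differentiable c (phi s) by apply/derivable1_diffP; case: Dc.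
  have difp : differentiable phi s by apply/derivable1_diffP; case: Dp.
  apply: DeriveDef; first by apply/derivable1_diffP; exact: differentiable_comp.
  rewrite deriveE; last exact: differentiable_comp.
  rewrite diff_comp //=.
  have -> : 'd phi s 1 = phi' s *: (1 : R).
    by rewrite -deriveE // derive_val /GRing.scale/= mulr1.
  by rewrite linearZ /= -deriveE // derive_val.
- move=> s; apply: cvgZ; first exact: cphi'.
  by apply: (@continuous_comp _ _ _ phi c'); [exact: cphi|exact: cc'].
- by move=> s s01; apply: Tc; exact: p01.
- by rewrite /= p0 p1.
Qed.

(** Curves have to stay [C^1] through a joint. The reparametrisation [3 s^2 - 2 s^3] keeps the
    length and makes the velocity vanish at both ends, so that any two curves can be joined. *)
Lemma reach_smoothstep x y l : reach x y l -> exists (c c' : R -> pt) (F F' : R -> R),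
  [/\ admissible x y c c', c' 0 = 0 /\ c' 1 = 0, F' 0 = 0 /\ F' 1 = 0,
    forall s : R, 0 <= s <= 1 -> is_derive s 1 F (F' s) /\ F' s = curve_speed c c' s &
    F 1 - F 0 = l].
Proof.
move=> [c [c' [F [adm dF FE]]]].
pose phi (s : R) := 3 * s ^+ 2 - 2 * s ^+ 3.
pose phi' (s : R) := 6 * (s * (1 - s)).
have dphi (s : R) : is_derive s 1 phi (phi' s).
  by apply: is_derive_eq; rewrite /phi' /GRing.scale/= !mulr1; ring.
have cphi' : continuous phi'.
  move=> s; apply: differentiable_continuous; apply/derivable1_diffP.
  have : is_derive s 1 phi' (6 * (1 - 2 * s)).
    by apply: is_derive_eq; rewrite /GRing.scale/= !mulr1; ring.
  by case.
have p01 s : 0 <= s <= 1 -> 0 <= phi s <= 1.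
  move=> /andP[s0 s1]; rewrite /phi; apply/andP; split.
    rewrite (_ : _ - _ = s ^+ 2 * (3 - 2 * s)); last by ring.
    by rewrite mulr_ge0 ?sqr_ge0 // subr_ge0; lra.
  rewrite -subr_ge0 (_ : _ - _ = (1 - s) ^+ 2 * (1 + 2 * s)); last by ring.
  by rewrite mulr_ge0 ?sqr_ge0 //; lra.
have p0 : phi 0 = 0 by rewrite /phi !expr0n /= !mulr0 subr0.
have p1 : phi 1 = 1 by rewrite /phi !expr1n; ring.
have adm' := admissible_reparam adm dphi cphi' p01 p0 p1.
have speedE (s : R) : 0 <= s <= 1 -> curve_speed (c \o phi) (fun s => phi' s *: c' (phi s)) s
    = phi' s * curve_speed c c' (phi s).
  move=> /andP[s0 s1]; rewrite /curve_speed /= ipZ sqrtrM ?sqr_ge0 // sqrtr_sqr ger0_norm //.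
  by rewrite /phi' !mulr_ge0 // subr_ge0.
have ph0 : phi' 0 = 0 by rewrite /phi' mul0r mulr0.
have ph1 : phi' 1 = 0 by rewrite /phi' subrr !mulr0.
exists (c \o phi), (fun s => phi' s *: c' (phi s)), (F \o phi),
  (fun s => curve_speed c c' (phi s) * phi' s); split=> //.
- by rewrite ph0 ph1 !scale0r.
- by rewrite ph0 ph1 !mulr0.
- move=> s s01; split; last by rewrite speedE // mulrC.
  have D1 := dF _ (p01 _ s01); have D2 := dphi s.
  exact: is_derive1_comp.
- by rewrite /= p0 p1.
Qed.

Lemma curve_speedZ c c' (k s : R) : 0 <= k ->
  curve_speed c (fun s => k *: c' s) s = k * curve_speed c c' s.
Proof.
by move=> k0; rewrite /curve_speed ipZ sqrtrM ?sqr_ge0 // sqrtr_sqr ger0_norm.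
Qed.

Lemma reach_concat x y z l1 l2 : reach x y l1 -> reach y z l2 -> reach x z (l1 + l2).
Proof.
move=> /reach_smoothstep[c1 [c1' [F1 [F1' [a1 [c10 c11] [F10 F11] dF1 <-]]]]].
move=> /reach_smoothstep[c2 [c2' [F2 [F2' [a2 [c20 c21] [F20 F21] dF2 <-]]]]].
have [dc1 cc1 T1 [s1 e1]] := a1; have [dc2 cc2 T2 [s2 e2]] := a2.
have h0 : (0 : R) <= 2^-1 by rewrite invr_ge0.
have h1 : 2^-1 <= (1 : R) by rewrite invf_le1 // ler1n.
have h2 : 2 * 1 - 1 = 1 :> R by ring.
exists (glue c1 c2), (fun s => 2 *: glue c1' c2' s), (glue F1 (fun s => F2 s - F2 0 + F1 1)).
have e12 : c1 1 = c2 0 by rewrite e1 s2.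
have e12' : c1' 1 = c2' 0 by rewrite c11 c20.
split.
- split.
  + exact: is_derive_glue.
  + by move=> s; apply: cvgZr; exact: glue_continuous.
  + move=> s /andP[s0 s1']; have [sl|sl] := leP s 2^-1.
      rewrite glue_left //; apply: T1; rewrite mulr_ge0 //=.
      by rewrite -ler_pdivlMl // mulr1.
    rewrite glue_right ?(ltW sl) //; apply: T2.
    rewrite subr_ge0 -ler_pdivrMl // mulr1 (ltW sl) /= lerBlDl.
    by rewrite (_ : 1 + 1 = 2 * 1) ?ler_pM2l // mulr1.
  + by rewrite glue_left // mulr0 glue_right // h2.
- move=> s s01.
  have step1 (u : R) : 0 <= u <= 2^-1 ->
      is_derive u 1 (fun s => F1 (2 * s)) (2 * F1' (2 * u)).
    move=> /andP[u0 u1].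
    have u01 : 0 <= 2 * u <= 1 by rewrite mulr_ge0 //= -ler_pdivlMl // mulr1.
    have [D1 _] := dF1 _ u01.
    have D2 : is_derive u 1 (fun u : R => 2 * u) 2.
      by apply: is_derive_eq; rewrite /GRing.scale/= mulr1.
    by rewrite mulrC; exact: (@is_derive1_comp _ F1 (fun u => 2 * u)).
  have step2 (u : R) : 2^-1 <= u <= 1 ->
      is_derive u 1 (fun s => F2 (2 * s - 1) - F2 0 + F1 1) (2 * F2' (2 * u - 1)).
    move=> /andP[u0 u1].
    have u01 : 0 <= 2 * u - 1 <= 1.
      rewrite subr_ge0 -ler_pdivrMl // mulr1 u0 /= lerBlDl.
      by rewrite (_ : 1 + 1 = 2 * 1) ?ler_pM2l // mulr1.
    have [D1 _] := dF2 _ u01.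
    have D2 : is_derive u 1 (fun u : R => 2 * u - 1) 2.
      by apply: is_derive_eq; rewrite /GRing.scale/= mulr1 subr0.
    have D3 : is_derive u 1 (fun s => F2 (2 * s - 1)) (F2' (2 * u - 1) * 2).
      exact: (@is_derive1_comp _ F2 (fun u => 2 * u - 1)).
    by apply: is_derive_eq; rewrite subr0 addr0 mulrC.
  have G12 : F1 1 = (fun s => F2 s - F2 0 + F1 1) 0 by rewrite subrr add0r.
  rewrite curve_speedZ //.
  move: (s01) => /andP[s0 s1'].
  have [sl|sl|sE] := ltgtP s 2^-1.
  + have u01 : 0 <= 2 * s <= 1 by rewrite mulr_ge0 //= -ler_pdivlMl // mulr1 ltW.
    rewrite /curve_speed !glue_left ?(ltW sl) // -/(curve_speed c1 c1' _).
    have [_ <-] := dF1 _ u01.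
    have s0l : 0 <= s <= 2^-1 by rewrite s0 ltW.
    apply: near_eq_is_derive (step1 s s0l).
    near=> u; rewrite glue_left //; apply/ltW; near: u; exact: lt_nbhsl.
  + have u01 : 0 <= 2 * s - 1 <= 1.
      rewrite subr_ge0 -ler_pdivrMl // mulr1 ltW //= lerBlDl.
      by rewrite (_ : 1 + 1 = 2 * 1) ?ler_pM2l // mulr1.
    rewrite /curve_speed !glue_right ?(ltW sl) // -/(curve_speed c2 c2' _).
    have [_ <-] := dF2 _ u01.
    have s0l : 2^-1 <= s <= 1 by rewrite s1' ltW.
    apply: near_eq_is_derive (step2 s s0l).
    near=> u; rewrite glue_right //; apply/ltW; near: u; exact: lt_nbhsr.
  + rewrite /curve_speed !glue_left ?sE // mulfV // -/(curve_speed c1 c1' _).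
    have [_ <-] := dF1 1 (introT andP (conj ler01 (lexx _))).
    rewrite F11 mulr0; apply/is_derive0P => e e0.
    have N1 : \forall h \near (0 : R), `|F1 (2 * (2^-1 + h)) - F1 (2 / 2)| <= e * `|h|.
      have := step1 2^-1; rewrite h0 lexx mulfV // F11 mulr0 => /(_ isT).
      by move=> /is_derive0P/(_ e e0); rewrite mulfV.
    have N2 : \forall h \near (0 : R), `|(F2 (2 * (2^-1 + h) - 1) - F2 0 + F1 1)
         - (F2 (2 / 2 - 1) - F2 0 + F1 1)| <= e * `|h|.
      have := step2 2^-1; rewrite h1 lexx mulfV // subrr F20 mulr0 => /(_ isT).
      by move=> /is_derive0P/(_ e e0); rewrite mulfV // subrr.
    near=> h; have [hn|hp] := leP h 0.
      by rewrite !glue_left ?gerDl //; near: h.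
    by rewrite !glue_right ?lerDl ?(ltW hp) //; near: h.
- have G12 : F1 1 = (fun s => F2 s - F2 0 + F1 1) 0 by rewrite subrr add0r.
  by rewrite [X in _ - X]glue_left // mulr0 (glue_right G12) // h2; ring.
Unshelve. all: by end_near. Qed.

Lemma reach_segment (Lam : R) x y : 0 <= Lam ->
  (forall t v, Theta t -> ip g t v v <= Lam * `|v| ^+ 2) ->
  (forall s : R, 0 <= s <= 1 -> Theta (x + s *: (y - x))) ->
  exists2 l, reach x y l & l <= Num.sqrt Lam * `|y - x|.
Proof.
move=> Lam0 HLam Txy.
have adm : admissible x y (fun s => x + s *: (y - x)) (fun _ => y - x).
  split=> //.
  - by move=> s; exact: is_derive_affine.
  - by move=> s; exact: cst_continuous.
  - by rewrite scale0r addr0 scale1r addrCA subrr addr0.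
have [F dF] := speed_primitive adm.
exists (F 1 - F 0); first by exists (fun s => x + s *: (y - x)), (fun _ => y - x), F.
have [|s|s|s] := @MVT R F (curve_speed (fun s => x + s *: (y - x)) (fun _ => y - x)) 0 1.
- exact: ltr01.
- by rewrite in_itv/= => /andP[/ltW s0 /ltW s1]; apply: dF; rewrite s0.
- apply/continuous_in_subspaceT : s => s; rewrite inE/= in_itv/= => s01.
  by apply: differentiable_continuous; apply/derivable1_diffP; case: (dF s s01).
- rewrite in_itv/= subr0 mulr1 => /andP[/ltW s0 /ltW s1] ->.
  have Ts : Theta (x + s *: (y - x)) by apply: Txy; rewrite s0.
  rewrite /curve_speed -[leRHS]ger0_norm ?mulr_ge0 ?sqrtr_ge0 // -sqrtr_sqr ler_wsqrtr //.
  by rewrite exprMn sqr_sqrtr // HLam.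
Qed.

Lemma riem_dist_upper : compact Theta -> exists2 C : R, 0 < C &
  forall x y, (forall s : R, 0 <= s <= 1 -> Theta (x + s *: (y - x))) ->
  riem_dist Theta g x y <= C * `|y - x|.
Proof.
move=> cT; have [Lam Lam0 HLam] := metric_upper cT.
exists (Num.sqrt Lam + 1); first by rewrite ltr_wpDl ?sqrtr_ge0.
move=> x y /(reach_segment Lam0 HLam)[l H1 H2].
by rewrite (le_trans (reach_dist_le H1)) // (le_trans H2) // ler_wpM2r // lerDl.
Qed.

End Dist.

(** * Distance on a domain with smooth boundary *)

Section Domain.
Context {R : realType} {p : nat} (Theta : set 'rV[R]_p).
Local Notation pt := 'rV[R]_p.
Context (sb : smooth_boundary Theta).

Lemma norm_evec_le1 (k : 'I_p) : `|evec k : pt| <= 1.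
Proof.
apply: norm_le_coord => // l; rewrite mxE.
by case: (_ && _) => /=; rewrite ?normr1 ?normr0.
Qed.

(* Near a boundary point the defining function decreases along a fixed direction. *)
Lemma inward_direction t (eps : R) : Theta t -> 0 < eps ->
  exists e : pt, [/\ `|e| <= eps, interior Theta (t - e) &
    \forall s \near t, Theta s ->
      (forall u : R, 0 <= u <= 1 -> Theta (s - u *: e)) /\
      (forall u : R, 0 <= u <= 1 -> Theta (s - e + u *: (t - s)))].
Proof.
move=> Tt e0.
have [It|nIt] := pselect (interior Theta t).
  exists 0; rewrite normr0 subr0; split=> //; first exact: ltW.
  have [r r0 rT] := cball_sub_nbhs It.
  near=> s => Ts; split=> u u01; first by rewrite scaler0 subr0.
  apply: rT; rewrite subr0 /cball/=.
  have -> : s + u *: (t - s) - t = (1 - u) *: (s - t).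
    by rewrite scalerBl scale1r -[t - s]opprB scalerN addrAC.
  have sr : `|s - t| <= r by near: s; exact: nbhs_cball.
  move: u01 => /andP[u0 u1].
  rewrite normrZ ger0_norm ?subr_ge0 // (le_trans _ sr) // ler_piMl //.
  by rewrite gerBl.
have [U [rho [oU Ut srho drho HU]]] := sb (conj Tt nIt).
have [i di] := drho t Ut.
pose k : R := Num.sg (partial i rho t).
pose v : pt := k *: evec i.
have dU s : U s -> differentiable rho s by exact: (srho [::]).
have Dv s : U s -> 'D_v rho s = k * partial i rho s.
  move=> Us.
  exact: (etrans (derive_partial v (dU s Us)) (sum_evec (fun j => partial j rho s) i k)).
have D0 : 0 < 'D_v rho t.
  by rewrite Dv // /k -normrEsg normr_gt0.
have cD : {for t, continuous (fun s => k * partial i rho s)}.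
  apply: differentiable_continuous; apply: differentiableM => //.
  exact: (srho [:: i]).
have [r1 r10 rN] : exists2 r : R, 0 < r & cball t r `<=` [set s | U s /\ 0 < 'D_v rho s].
  apply: cball_sub_nbhs; apply: filterI; first exact: open_nbhs_nbhs.
  have N1 : \forall s \near t, 0 < k * partial i rho s.
    have := cD; rewrite /continuous_at => /cvgr_gt; apply.
    by rewrite -Dv.
  have N2 : \forall s \near t, U s by exact: open_nbhs_nbhs.
  by near=> s => /=; rewrite Dv; near: s.
pose del := Num.min eps (r1 / 2).
have del0 : 0 < del by rewrite lt_min e0 divr_gt0.
have deleps : del <= eps by rewrite ge_min lexx.
have delr : del <= r1 / 2 by rewrite ge_min lexx orbT.
have nv : `|v| <= 1.
  rewrite normrZ /k (le_trans (ler_piMr _ (norm_evec_le1 i))) //.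
  by rewrite normr_sg; case: (_ != 0).
have inB s (u : R) : `|s - t| <= r1 / 2 -> 0 <= u <= del -> cball t r1 (s - u *: v).
  move=> st /andP[u0 ud]; rewrite /cball/= addrAC (le_trans (ler_normB _ _)) //.
  rewrite [leRHS](splitr r1) lerD // normrZ ger0_norm // (le_trans _ delr) //.
  by rewrite (le_trans _ ud) // ler_piMr.
have dec s (u : R) : `|s - t| <= r1 / 2 -> 0 < u <= del -> rho (s - u *: v) < rho s.
  move=> st /andP[u0 ud].
  have [//|w|w|w ww E] := @MVT R (fun w => rho (s + w *: - v)) (fun w => - 'D_v rho (s + w *: - v)) 0 u.
  - rewrite in_itv/= => /andP[w0 wu].
    have inw : cball t r1 (s + w *: - v).
      by rewrite scalerN; apply: inB; rewrite // (ltW w0) (le_trans (ltW wu)).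
    have [Uw _] := rN _ inw.
    have <- : 'D_(- v) rho (s + w *: - v) = - 'D_v rho (s + w *: - v).
      rewrite (derive_partial _ (dU _ Uw)) (derive_partial v (dU _ Uw)) -sumrN.
      by apply: eq_bigr => j _; rewrite mxE mulNr.
    exact: is_derive_line (dU _ Uw).
  - apply/continuous_in_subspaceT : w => w; rewrite inE/= in_itv/= => /andP[w0 wu].
    have inw : cball t r1 (s + w *: - v).
      by rewrite scalerN; apply: inB; rewrite // w0 (le_trans wu).
    have [Uw _] := rN _ inw.
    apply: differentiable_continuous; apply/derivable1_diffP.
    by case: (is_derive_line (dU _ Uw)).
  - move: E; rewrite scale0r addr0 scalerN subr0 => /eqP.
    rewrite subr_eq => /eqP ->; rewrite gtrDr mulNr oppr_lt0 mulr_gt0 //.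
    move: ww; rewrite in_itv/= => /andP[w0 wu].
    have inw : cball t r1 (s - w *: v).
      by apply: inB; rewrite // (ltW w0) (le_trans (ltW wu)).
    by have [] := rN _ inw; rewrite scalerN.
have r12 : 0 <= r1 / 2 by rewrite divr_ge0 // ltW.
have tt : `|t - t| <= r1 / 2 by rewrite subrr normr0.
have del01 : 0 < del <= del by rewrite del0 lexx.
have Ue : U (t - del *: v) by have [] := rN _ (inB t del tt (introT andP (conj (ltW del0) (lexx _)))).
have re : rho (t - del *: v) < 0.
  by rewrite (lt_le_trans (dec t del tt del01)) //; apply/HU.
have Ie : nbhs (t - del *: v) Theta.
  have N1 : \forall s \near (t - del *: v), U s by exact: open_nbhs_nbhs.
  have N2 : \forall s \near (t - del *: v), rho s < 0.
    have : {for (t - del *: v), continuous rho}.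
      by apply: differentiable_continuous; exact: dU.
    by rewrite /continuous_at => /cvgr_lt; exact.
  near=> s; apply/HU; first by near: s.
  by apply/ltW; near: s.
have [r2 r20 r2T] := cball_sub_nbhs Ie.
exists (del *: v); split=> //.
  by rewrite normrZ gtr0_norm // (le_trans _ deleps) // ler_piMr // ltW.
near=> s => Ts.
have sr1 : `|s - t| <= r1 / 2 by near: s; apply: nbhs_cball; rewrite divr_gt0.
have sr2 : `|s - t| <= r2 by near: s; exact: nbhs_cball.
split=> u /andP[u0 u1].
  have [->|un0] := eqVneq u 0; first by rewrite scale0r subr0.
  have ug0 : 0 < u by rewrite lt0r un0.
  have ud : 0 < u * del <= del by rewrite mulr_gt0 //= ler_piMl // ltW.
  rewrite scalerA; apply/HU.
    have [] := rN _ (inB s (u * del) sr1 _) => //.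
    by case/andP: ud => /ltW -> ->.
  apply/ltW/(lt_le_trans (dec s _ sr1 ud)); apply/HU => //.
  have [] := rN _ (inB s 0 sr1 _); rewrite ?lexx ?ltW //.
  by rewrite scale0r subr0.
apply: r2T; rewrite /cball/=.
have -> : s - del *: v + u *: (t - s) - (t - del *: v) = (1 - u) *: (s - t).
  rewrite scalerBl scale1r -[t - s]opprB scalerN opprB addrA.
  by rewrite [_ + del *: v]addrAC [s - _ - _]addrAC subrK addrAC.
rewrite normrZ ger0_norm ?subr_ge0 // (le_trans _ sr2) // ler_piMl //.
by rewrite gerBl.
Unshelve. all: by end_near. Qed.

Lemma closure_interior t : Theta t -> closure (interior Theta) t.
Proof.
move=> Tt B /cball_sub_nbhs[r r0 rB].
have [e [er Ie _]] := inward_direction Tt r0.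
exists (t - e); split=> //; apply: rB.
by rewrite /cball/= addrAC subrr sub0r normrN.
Qed.

Context (g : pt -> 'M[R]_p) (gm : metric_on Theta g).
Context (cT : compact Theta) (kT : connected Theta).

(** A straight segment from [s] to [t] could leave [Theta]. The path [s], [s - e], [t - e], [t] goes
    inward, crosses inside a small ball of the interior and comes back; each of its three segments
    has length at most [eps / 3]. *)
Lemma reach_local t (eps : R) : Theta t -> 0 < eps ->
  \forall s \near t, Theta s ->
    (exists2 l, reach Theta g s t l & l <= eps) /\
    (exists2 l, reach Theta g t s l & l <= eps).
Proof.
move=> Tt e0; have [Lam Lam0 HLam] := metric_upper gm cT.
pose K := Num.sqrt Lam + 1.
have K0 : 0 < K by rewrite ltr_wpDl ?sqrtr_ge0.
have seg x y : (forall u : R, 0 <= u <= 1 -> Theta (x + u *: (y - x))) ->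
    exists2 l, reach Theta g x y l & l <= K * `|y - x|.
  move=> /(reach_segment gm Lam0 HLam)[l H1 H2]; exists l => //.
  by rewrite (le_trans H2) // ler_wpM2r // lerDl.
pose eps' := eps / (3 * K).
have e'0 : 0 < eps' by rewrite divr_gt0 // mulr_gt0.
have [e [ee _ HN]] := inward_direction Tt e'0.
have [Nt1 _] := nbhs_singleton HN Tt.
have bnd (a b c l1 l2 l3 : R) : a <= eps' -> b <= eps' -> c <= eps' ->
    l1 <= K * a -> l2 <= K * b -> l3 <= K * c -> l1 + (l2 + l3) <= eps.
  move=> ae be ce H1 H2 H3.
  have : eps = K * eps' + (K * eps' + K * eps').
    by rewrite /eps'; field; rewrite gt_eqF.
  move=> ->; rewrite !lerD //.
  - by rewrite (le_trans H1) // ler_pM2l.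
  - by rewrite (le_trans H2) // ler_pM2l.
  - by rewrite (le_trans H3) // ler_pM2l.
have u1 (u : R) : 0 <= u <= 1 -> 0 <= 1 - u <= 1.
  by move=> /andP[u0 u1]; rewrite subr_ge0 u1 gerBl.
near=> s => Ts.
have st : `|t - s| <= eps' by rewrite distrC; near: s; exact: nbhs_cball.
have [Ns1 Ns2] : (forall u : R, 0 <= u <= 1 -> Theta (s - u *: e)) /\
      (forall u : R, 0 <= u <= 1 -> Theta (s - e + u *: (t - s))).
  by move: Ts; near: s.
split.
- have [|l1 R1 L1] := seg s (s - e).
    by move=> u u01; rewrite addrAC subrr sub0r scalerN; exact: Ns1.
  have [|l2 R2 L2] := seg (s - e) (t - e).
    by move=> u u01; rewrite opprB addrA subrK; exact: Ns2.
  have [|l3 R3 L3] := seg (t - e) t.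
    move=> u u01; have := Nt1 _ (u1 u u01); rewrite opprB addrCA subrr addr0.
    by rewrite scalerBl scale1r opprB addrA addrAC.
  exists (l1 + (l2 + l3)); first exact: reach_concat R1 (reach_concat R2 R3).
  apply: (bnd _ _ _ _ _ _ _ _ _ L1 L2 L3).
  + by rewrite addrAC subrr sub0r normrN.
  + by rewrite opprB addrA subrK.
  + by rewrite opprB addrCA subrr addr0.
- have [|l1 R1 L1] := seg t (t - e).
    by move=> u u01; rewrite addrAC subrr sub0r scalerN; exact: Nt1.
  have [|l2 R2 L2] := seg (t - e) (s - e).
    move=> u u01; rewrite opprB addrA subrK.
    have := Ns2 _ (u1 u u01); congr Theta.
    by apply/rowP => i; rewrite !mxE; ring.
  have [|l3 R3 L3] := seg (s - e) s.
    move=> u u01; have := Ns1 _ (u1 u u01); rewrite opprB addrCA subrr addr0.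
    by rewrite scalerBl scale1r opprB addrA addrAC.
  exists (l1 + (l2 + l3)); first exact: reach_concat R1 (reach_concat R2 R3).
  apply: (bnd _ _ _ _ _ _ _ _ _ L1 L2 L3).
  + by rewrite addrAC subrr sub0r normrN.
  + by rewrite opprB addrA subrK distrC.
  + by rewrite opprB addrCA subrr addr0.
Unshelve. all: by end_near. Qed.

(** The set of points that reach [y] is open and closed in the connected [Theta]. *)
Lemma reach_all x y : Theta x -> Theta y -> exists l, reach Theta g x y l.
Proof.
move=> Tx Ty.
pose B := [set t | Theta t /\ exists l, reach Theta g t y l].
suff BT : B = Theta by have [] : B x by rewrite BT.
apply: kT.
- exists y; split=> //.
  have [[l Rl _] _] := nbhs_singleton (reach_local Ty ltr01) Ty.
  by exists l.
- exists (interior [set s | Theta s -> exists l, reach Theta g s y l]).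
    exact: open_interior.
  apply/seteqP; split=> [t [Tt [l Rl]]|t [Tt /nbhs_singleton/(_ Tt)]] //.
  split=> //; apply: filterS (reach_local Tt ltr01) => s Hs /Hs[[l' Rl' _] _].
  by exists (l' + l); exact: reach_concat Rl' Rl.
- exists (closure B); first exact: closed_closure.
  apply/seteqP; split=> [t Bt|t [Tt Ct]]; first by split; [case: Bt|exact: subset_closure].
  have [s [[Ts [l Rl]] Hs]] := Ct _ (reach_local Tt ltr01).
  have [_ [l' Rl' _]] := Hs Ts.
  by split=> //; exists (l' + l); exact: reach_concat Rl' Rl.
Qed.

(** Without a connecting curve [riem_dist] would be 0, the infimum of the empty set; [reach_all]
    excludes this, and the bound holds for every curve. *)
Lemma riem_dist_lower : exists2 c : R, 0 < c &
  forall x y, Theta x -> Theta y -> c * `|y - x| <= riem_dist Theta g x y.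
Proof.
have [lam lam0 Hlam] := metric_elliptic gm cT.
exists (Num.sqrt lam); first by rewrite sqrtr_gt0.
move=> x y Tx Ty; apply: lb_le_inf.
  by have [l /(reach_lengths gm)] := reach_all Tx Ty; exists l.
move=> l Hl; have Rl := (reach_lengths gm x y l).2 Hl.
exact: (reach_lower (ltW lam0) Hlam Rl).
Qed.

(** Short paths and concatenation make the distance upper semicontinuous: distance below [r]
    persists in a neighbourhood. Closedness is what makes the set in [A2] Borel. *)
Lemma closed_dist_ge y (r : R) : Theta y ->
  closed [set t | Theta t /\ r <= riem_dist Theta g t y].
Proof.
move=> Ty t Ct.
have Tt : Theta t.
  have cl : closed Theta by apply: compact_closed => //; exact: norm_hausdorff.
  by apply: cl => B /Ct[s [[Ts _] Bs]]; exists s.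
split=> //; rewrite leNgt; apply/negP => lt.
have [l Rl lr] := dist_reach_lt gm (reach_all Tt Ty) lt.
have e0 : 0 < (r - l) / 2 by rewrite divr_gt0 // subr_gt0.
have [s [[Ts rs] Hs]] := Ct _ (reach_local Tt e0).
have [[l' Rl' Hl'] _] := Hs Ts.
have := reach_dist_le gm (reach_concat Rl' Rl).
rewrite leNgt => /negP; apply; apply: lt_le_trans rs.
rewrite -ltrBrDr (le_lt_trans Hl') // ltr_pdivrMr //.
by rewrite mulr2n mulrDr mulr1 ltrDl subr_gt0.
Qed.

End Domain.

(** * Invariant measures *)

Section BorelIntegral.
Context {R : realType} {p : nat}.
Local Notation pt := 'rV[R]_p.

Lemma continuous_measurable_borelV (f : pt -> R) : continuous f ->
  measurable_fun setT (f : borelV R p -> R).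
Proof.
move=> cf; apply: (measurability _ (RGenOpens.measurableE R)).
move=> _ [_ [a [b ->] <-]]; rewrite setTI; apply: sub_sigma_algebra.
by apply: open_comp; [move=> x _; exact: cf|exact: interval_open].
Qed.

Lemma closed_measurable_borelV (A : set pt) : closed A ->
  measurable (A : set (borelV R p)).
Proof.
move=> cA; rewrite -[A]setCK; apply: measurableC; apply: sub_sigma_algebra.
exact: closed_openC.
Qed.

Context (Theta : set pt) (cT : compact Theta).
Context (m : probability (borelV R p) R) (mT : m Theta = 1%E).

Lemma measurable_Theta : measurable (Theta : set (borelV R p)).
Proof.
apply: closed_measurable_borelV; apply: compact_closed => //; exact: norm_hausdorff.
Qed.

Definition mI (f : pt -> R) : R := \int[m]_(t in Theta) f t.

Lemma mI_integrable (f : pt -> R) : continuous f -> m.-integrable Theta (EFin \o f).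
Proof.
move=> cf.
have [C C0 HC] := compact_bounded_fun cT (continuous_subspaceT (A:=Theta) cf).
apply: measurable_bounded_integrable.
- exact: measurable_Theta.
- by rewrite [X in (X < _)%E](_ : _ = 1%E) ?ltry //; exact: mT.
- apply: (measurable_funS measurableT (@subsetT _ _)).
  exact: continuous_measurable_borelV.
- exists C; split; first exact: num_real.
  by move=> x Cx t Tt /=; exact: (le_trans (HC t Tt) (ltW Cx)).
Qed.

Lemma mI_cst (c : R) : mI (cst c) = c.
Proof.
rewrite /mI Rintegral_cst; last exact: measurable_Theta.
by rewrite [X in fine X](_ : _ = 1%E) ?mulr1 //; exact: mT.
Qed.

Lemma mID (f h : pt -> R) : continuous f -> continuous h -> mI (fun t => f t + h t) = mI f + mI h.
Proof.
by move=> cf ch; rewrite /mI RintegralD //;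
  [exact: measurable_Theta|exact: mI_integrable|exact: mI_integrable].
Qed.

Lemma mIZ (c : R) (f : pt -> R) : continuous f -> mI (fun t => c * f t) = c * mI f.
Proof.
by move=> cf; rewrite /mI RintegralZl //; [exact: measurable_Theta|exact: mI_integrable].
Qed.

Lemma mI_le (f h : pt -> R) : continuous f -> continuous h -> (forall t, Theta t -> f t <= h t) ->
  mI f <= mI h.
Proof.
by move=> cf ch fh; apply: le_Rintegral => //;
  [exact: measurable_Theta|exact: mI_integrable|exact: mI_integrable].
Qed.

Lemma mI_eq (f h : pt -> R) : (forall t, Theta t -> f t = h t) -> mI f = mI h.
Proof. by move=> fh; apply: eq_Rintegral => t; rewrite inE; exact: fh. Qed.

Lemma mI_norm (f : pt -> R) : continuous f -> `|mI f| <= mI (fun t => `|f t|).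
Proof.
by move=> cf; apply: le_normr_Rintegral; [exact: measurable_Theta|exact: mI_integrable].
Qed.

Lemma mI_sum (I : Type) (r : seq I) (F : I -> pt -> R) : (forall i, continuous (F i)) ->
  mI (fun t => \sum_(i <- r) F i t) = \sum_(i <- r) mI (F i).
Proof.
move=> cF; elim: r => [|i r IH].
  rewrite big_nil -[RHS](mI_cst 0); apply: mI_eq => t _; by rewrite big_nil.
rewrite big_cons -IH -mID //.
  by apply: mI_eq => t _; rewrite big_cons.
rewrite (_ : (fun _ => _) = \sum_(j <- r) F j); last first.
  by apply/funext => t; rewrite fct_sumE.
elim/big_ind : _ => [|f h cf ch|j _]; last exact: cF.
  by move=> t; exact: cst_continuous.
by move=> t; apply: continuousD; [exact: cf|exact: ch].
Qed.

End BorelIntegral.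

(** * Stationarity of the generator *)

Section Invariance.
Context {R : realType} {p : nat}.
Local Notation pt := 'rV[R]_p.

(** Left endpoint step functions of mesh [1/(k+1)] are jointly measurable and converge by path
    continuity; the mesh tiles the half-open interval exactly. *)
Lemma caratheodory_measurable d (Om : measurableType d) (K : R -> Om -> R) :
  (forall s, 0 <= s -> measurable_fun setT (K s)) ->
  (forall w, {within `[0%R, +oo[, continuous (fun s => K s w)}) ->
  measurable_fun setT (fun z : measurableTypeR R * Om => \1_(`[0, 1[%classic : set R) z.1 * K z.1 z.2).
Proof.
move=> mK cK.
pose I k j : set R := `[j%:R / k.+1%:R, j.+1%:R / k.+1%:R[%classic.
pose h (k : nat) (z : measurableTypeR R * Om) : R :=
  \sum_(j < k.+1) \1_(I k j) z.1 * K (j%:R / k.+1%:R) z.2.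
apply: (@measurable_fun_cvg _ _ _ _ h).
  move=> k; apply: measurable_sum => j; apply: measurable_funM.
    apply: (@measurableT_comp _ _ _ _ _ _ (\1_(I k j) : measurableTypeR R -> R) _ fst) => //.
    by apply: measurable_indic; exact: measurable_itv.
  apply: (@measurableT_comp _ _ _ _ _ _ (K (j%:R / k.+1%:R)) _ snd) => //.
  by apply: mK; rewrite divr_ge0.
move=> [s w] _ /=.
have [s01|s01] := boolP (s \in `[0, 1[); last first.
  rewrite indicE mem_setE (negbTE s01) mul0r.
  rewrite (_ : (fun k => h k (s, w)) = cst 0); first exact: cvg_cst.
  apply/funext => k; rewrite /h big1 // => j _; rewrite indicE mem_setE.
  case E : (_ \in _); last by rewrite mul0r.
  move: E; rewrite in_itv/= => /andP[s0 s1]; move: s01; rewrite in_itv/= negb_and -!ltNge -leNgt.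
  case/orP => [sn|sn].
    by move: (lt_le_trans sn (divr_ge0 (ler0n _ j) (ler0n _ k.+1))); rewrite ltNge s0.
  move: (le_lt_trans sn s1); rewrite ltr_pdivlMr // mul1r ltr_nat ltnS.
  by rewrite ltnNge -ltnS ltn_ord.
rewrite indicE mem_setE s01 mul1r; move: s01; rewrite in_itv/= => /andP[s0 s1].
pose J k := Num.truncn (s * k.+1%:R).
have Jlt k : (J k < k.+1)%N.
  have := s1; rewrite -(@ltr_pM2r _ k.+1%:R) // mul1r => H.
  by rewrite -(ltr_nat R) (le_lt_trans _ H) // truncn_le ?mulr_ge0.
have Jle k : (J k)%:R / k.+1%:R <= s.
  by rewrite ler_pdivrMr // truncn_le ?mulr_ge0.
have Jgt k : s < (J k).+1%:R / k.+1%:R.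
  by rewrite ltr_pdivlMr // truncnS_gt.
have hE k : h k (s, w) = K ((J k)%:R / k.+1%:R) w.
  rewrite /h (bigD1 (Ordinal (Jlt k))) //= big1 ?addr0.
    by rewrite indicE mem_setE in_itv/= Jle Jgt mul1r.
  move=> j jJ; rewrite indicE mem_setE in_itv/=; case E : (_ && _); last by rewrite mul0r.
  move: E => /andP[j0 j1]; case/eqP: jJ; apply/val_inj => /=; apply/eqP.
  rewrite eqn_leq; apply/andP; split;
    rewrite -ltnS -(ltr_nat R) -(@ltr_pM2r _ k.+1%:R^-1) ?invr_gt0 //.
    exact: le_lt_trans j0 (Jgt k).
  exact: le_lt_trans (Jle k) j1.
rewrite (_ : (fun k => h k (s, w)) = (fun k => K ((J k)%:R / k.+1%:R) w)); last first.
  by apply/funext => k; exact: hE.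
have cv : (fun k : nat => (J k)%:R / k.+1%:R : R) @ \oo --> s.
  apply/cvgrPdist_le => e e0.
  have [N HN] : exists N : nat, e^-1 < N%:R.
    by exists (Num.truncn e^-1).+1; rewrite truncnS_gt.
  near=> k; rewrite ger0_norm ?subr_ge0 // lerBlDl.
  rewrite (le_trans (ltW (Jgt k))) // -natr1 mulrDl lerD2l mul1r.
  rewrite -[e]invrK lef_pV2 ?posrE ?invr_gt0 //.
  rewrite (le_trans (ltW HN)) // ler_nat; near: k.
  by exists N => // k /= /leqW.
have sin : `[0%R, +oo[%classic s by rewrite /= in_itv/= s0.
have NK : forall e : R, 0 < e -> \forall y \near s, 0 <= y -> `|K s w - K y w| <= e.
  move=> e e0; have := (subspace_continuousP _ _).1 (cK w) s sin.
  move=> /cvgrPdist_le/(_ e e0); rewrite near_withinE; apply: filterS => y Hy y0.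
  by apply: Hy; rewrite /= in_itv/= y0.
apply/cvgrPdist_le => e /NK Ne.
have Ck := cv _ Ne; near=> k.
have : 0 <= (J k)%:R / k.+1%:R :> R by rewrite divr_ge0.
by near: k; exact: Ck.
Unshelve. all: by end_near. Qed.

(** This is the martingale identity between the times 0 and 1 on the whole space. The laws of [th 0]
    and [th 1] agree, the boundary integral vanishes by the Neumann condition, and Fubini turns the
    time integral into [mI] of the generator. Continuity makes all integrands bounded on the compact
    [Theta]. *)
Lemma invariant_generator0 (Theta : set pt) g nabla nu (tau : R) W
    (m : probability (borelV R p) R) (f : pt -> R) :
  compact Theta -> smooth_near Theta f ->
  (forall t, bdry Theta t -> dirder nu f t = 0) ->
  continuous f -> continuous (generator g nabla tau W f) ->
  invariant_prob Theta g nabla nu tau W m ->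
  mI Theta m (generator g nabla tau W f) = 0.
Proof.
move=> cT sf nf cf cG [mT [d [Om [Q [F [th [dK [[filt [thT thc thm] _ mart] law]]]]]]]].
set G := generator g nabla tau W f in cG *.
have mth (t : R) : 0 <= t -> measurable_fun setT (th t : Om -> borelV R p).
  move=> t0 _ B mB; rewrite setTI; apply: (filt.1 t t0).2; exact: thm.
have FT : F 0 setT.
  by have [[F00 FC _] _] := filt.1 0 (lexx 0); have := FC _ F00; rewrite setD0.
have mG (h : pt -> R) (t : R) : continuous h -> 0 <= t ->
    measurable_fun setT (fun w => h (th t w)).
  move=> ch t0.
  exact: (measurableT_comp (continuous_measurable_borelV ch) (mth t t0)).
have iG (h : pt -> R) (t : R) : continuous h -> 0 <= t ->
    Q.-integrable setT (EFin \o (fun w => h (th t w))).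
  move=> ch t0.
  have [C C0 HC] := compact_bounded_fun cT (continuous_subspaceT (A:=Theta) ch).
  apply: measurable_bounded_integrable => //.
  - by rewrite [X in (X < _)%E](_ : _ = 1%E) ?ltry //; exact: probability_setT.
  - exact: mG.
  - exists C; split; first exact: num_real.
    by move=> x Cx w _ /=; exact: (le_trans (HC _ (thT _ _ t0)) (ltW Cx)).
have EG (h : pt -> R) (t : R) : continuous h -> 0 <= t ->
    (\int[Q]_w (h (th t w))%:E = (mI Theta m h)%:E)%E.
  move=> ch t0.
  have preT : th t @^-1` Theta = setT.
    by apply/seteqP; split=> // w _; exact: thT.
  have mTh := measurable_Theta cT.
  have mh : measurable_fun setT (EFin \o h : borelV R p -> \bar R).
    by apply/measurable_EFinP; exact: continuous_measurable_borelV.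
  have ih : Q.-integrable (th t @^-1` Theta) ((EFin \o h : borelV R p -> \bar R) \o th t).
    by rewrite preT; exact: iG.
  have E := integral_pushforward (mth t t0) mh ih mTh.
  rewrite preT in E; rewrite -[LHS]E /mI /Rintegral fineK; last first.
    exact: (integrable_fin_num mTh (mI_integrable cT mT ch)).
  apply: eq_measure_integral => [|mf A mA _]; first exact: mth.
  exact: (law t A t0 mA).
have [_ iM EM] := mart f sf.
have {EM} := EM 0 1 setT (lexx 0) ler01 FT.
have dK0 t w : \int[dK w]_(s in [set s | 0 <= s <= t /\ bdry Theta (th s w)])
           dirder nu f (th s w) = 0.
  rewrite (@eq_Rintegral _ _ _ _ _ (cst 0)); first by rewrite /Rintegral integral0.
  by move=> s; rewrite inE /= => -[_]; exact: nf.
pose I w := \int[lebesgue_measure]_(s in `[0, 1]) G (th s w).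
under eq_Rintegral do rewrite dK0 addr0.
under [in RHS]eq_Rintegral do rewrite dK0 addr0 subrr sub0r set_itv1 Rintegral_set1 oppr0.
rewrite [RHS](_ : _ = 0); last by rewrite /Rintegral integral0.
have iX1 := iG f 1 cf ler01; have iX0 := iG f 0 cf (lexx 0).
have iI : Q.-integrable setT (EFin \o I).
  have iM1 := iM 1 ler01.
  have := integrableB measurableT (integrableB measurableT iX1 iX0) iM1.
  apply: eq_integrable => // w _ /=.
  by rewrite dK0 addr0 -!EFinD; congr EFin; rewrite opprB [LHS]addrC subrK.
rewrite RintegralB //; last first.
  exact: (integrableB measurableT iX1 iX0).
rewrite RintegralB //.
rewrite {1 2}/Rintegral (EG f 1 cf ler01) (EG f 0 cf (lexx 0)) subrr sub0r.
move=> /eqP; rewrite oppr_eq0 => /eqP EI; rewrite -{}EI /Rintegral.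
(* The indicator of [[0, 1)] extends the integrand by 0, since [th] is controlled at nonnegative
   times only. *)
pose phi (z : measurableTypeR R * Om) : \bar R :=
  (\1_(`[0, 1[%classic : set R) z.1 * G (th z.1 z.2))%:E.
have cGth w : {within `[0%R, +oo[, continuous (fun s => G (th s w))}.
  apply/subspace_continuousP => s sin.
  exact: (cvg_comp _ _ ((subspace_continuousP _ _).1 (thc w) s sin) (cG (th s w))).
have mphi : measurable_fun setT phi.
  apply/measurable_EFinP; apply: (@caratheodory_measurable _ _ (fun s w => G (th s w))).
    by move=> s s0; exact: mG.
  exact: cGth.
have [C C0 HC] := compact_bounded_fun cT (continuous_subspaceT (A:=Theta) cG).
have phiC z : (`|phi z| <= (C * \1_(`[0, 1[%classic : set R) z.1)%:E)%E.
  rewrite /phi /= lee_fin normrM indicE mem_setE.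
  case E : (_ \in _); last by rewrite normr0 mul0r mulr0.
  rewrite normr1 mul1r mulr1; apply: HC; apply: thT.
  by move: E; rewrite in_itv/= => /andP[].
have m01 : measurable (`[0, 1[%classic : set (measurableTypeR R)) by exact: measurable_itv.
have l01 : lebesgue_measure (`[0, 1[%classic : set R) = 1%E.
  by rewrite lebesgue_measure_itv/= lte_fin ltr01 oppr0 adde0.
have iphi : (lebesgue_measure \x Q)%E.-integrable setT phi.
  apply/integrable12ltyP => //.
  apply: (@le_lt_trans _ _ (\int[lebesgue_measure]_x (C * \1_(`[0, 1[%classic : set R) x)%:E)%E).
    apply: ge0_le_integral => //.
    - by move=> x _; apply: integral_ge0.
    - apply: (measurable_fun_fubini_tonelli_F (abse \o phi)) => //=.
      exact: measurableT_comp.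
    - apply/measurable_EFinP; apply: measurable_funM => //; exact: measurable_indic.
    move=> x _; rewrite -[leRHS]mule1 -(probability_setT Q) -integral_cst //.
    apply: ge0_le_integral => //.
    apply: measurableT_comp => //.
    exact: (measurableT_comp mphi (pair1_measurable x)).
  under eq_integral do rewrite EFinM.
  rewrite ge0_integralZl //; last by apply/measurable_EFinP; exact: measurable_indic.
  by rewrite integral_indic // setIT [X in (_ * X)%E]l01 mule1 ltry.
have FU := Fubini iphi.
have inner1 x : fubini_F Q phi x = (\1_(`[0, 1[%classic : set R) x * mI Theta m G)%:E.
  rewrite /fubini_F /phi /= indicE mem_setE.
  case E : (_ \in _).
    rewrite mul1r -(EG G x) //; last by move: E; rewrite in_itv/= => /andP[].
    by apply: eq_integral => w _; rewrite mul1r.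
  by rewrite mul0r; apply: integral0_eq => w _; rewrite mul0r.
have inner2 w : fubini_G lebesgue_measure phi w = (I w)%:E.
  have cGw : {within `[0%R, 1%R], continuous (fun s => G (th s w))}.
    apply: continuous_subspaceW (cGth w).
    by move=> s /=; rewrite !in_itv/= => /andP[->].
  have iGw := continuous_compact_integrable (@segment_compact R 0 1) cGw.
  rewrite /I /Rintegral fineK; last first.
    exact: integrable_fin_num iGw.
  rewrite -integral_itv_bndo_bndc; last first.
    apply: (measurable_funS _ _ (measurable_int _ iGw)) => //.
    by move=> s /=; rewrite !in_itv/= => /andP[-> /ltW].
  rewrite [RHS]integral_mkcond /fubini_G; apply: eq_integral => s _.
  by rewrite /phi /= patchE indicE; case: ifP => _; rewrite ?mul1r ?mul0r.
have E1 : (\int[lebesgue_measure]_x fubini_F Q phi x = (mI Theta m G)%:E)%E.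
  transitivity (\int[lebesgue_measure]_(x in (`[0%R, 1%R[%classic : set R))
      (cst (mI Theta m G)%:E) x)%E.
    rewrite [RHS]integral_mkcond; apply: eq_integral => x _.
    rewrite inner1 patchE indicE.
    by case: ifP => _; rewrite ?mul1r ?mul0r.
  rewrite integral_cst //.
  by rewrite [X in (_ * X)%E]l01 mule1.
have -> : (\int[Q]_x (I x)%:E = (mI Theta m G)%:E)%E; last by [].
rewrite -E1 [RHS]FU; apply: eq_integral => w _; exact/esym/inner2.
Qed.

End Invariance.

(** * Geometry of the precontrast *)

Section Interior.
Context {R : realType} {p : nat}.
Local Notation pt := 'rV[R]_p.
Implicit Types (Theta : set pt) (g : pt -> 'M[R]_p) (f : pt -> R).

Lemma smooth_near_Ck n q (A U : set 'rV[R]_q) (f : 'rV[R]_q -> R) :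
  U `<=` A -> smooth_near A f -> Ck n U f.
Proof.
move=> UA [W [_ AW sf]]; apply: Ck_sub (smooth_Ck n sf).
exact: subset_trans AW.
Qed.

Lemma smoothv_near_cst (A : set pt) (v : pt) : smoothv_near A (cst v : pt -> pt).
Proof.
move=> i; exists setT; split=> //; first exact: openT.
by apply: Ck_smooth_on => n; exact: (Ck_cst n _ (v 0 i)).
Qed.

Lemma form_app_evec (al : pt -> pt) l : form_app al (cst (evec l)) = fun t => al t 0 l.
Proof.
apply/funext => t; rewrite /form_app (bigD1 l) //= big1 ?addr0.
  by rewrite /evec mxE !eqxx mulr1.
by move=> k kl; rewrite /evec mxE (negbTE kl) andbF mulr0.
Qed.

Lemma ip_sum g t (u v : pt) : ip g t u v = \sum_i \sum_j u 0 i * g t i j * v 0 j.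
Proof.
rewrite /ip mxE exchange_big /=; apply: eq_bigr => j _.
by rewrite !mxE mulr_suml.
Qed.

Lemma sum_delta (F : 'I_p -> R) i : \sum_k (evec i : pt) 0 k * F k = F i.
Proof.
rewrite (bigD1 i) //= big1 ?addr0; first by rewrite /evec mxE !eqxx mul1r.
by move=> k ki; rewrite /evec mxE (negbTE ki) andbF mul0r.
Qed.

Lemma ip_evecr g t (u : pt) l : ip g t u (evec l) = \sum_i u 0 i * g t i l.
Proof.
rewrite ip_sum; apply: eq_bigr => i _; rewrite -(sum_delta (fun j => u 0 i * g t i j)).
by apply: eq_bigr => j _; rewrite mulrC.
Qed.

Lemma ip_evec g t i j : ip g t (evec i) (evec j) = g t i j.
Proof. by rewrite ip_evecr sum_delta. Qed.

Lemma dirder_evec i f : dirder (cst (evec i)) f = partial i f.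
Proof. by []. Qed.


Lemma cov_evec (D : connection R p) i j t : cov D (cst (evec i)) (cst (evec j)) t = D t i j.
Proof.
apply/rowP => k; rewrite /cov !mxE /dirder derive_cst add0r.
rewrite summxE (bigD1 i) //= [X in _ + X]big1 ?addr0.
  rewrite summxE (bigD1 j) //= big1 ?addr0.
    by rewrite !mxE !eqxx mulr1 mul1r.
  by move=> l li; rewrite !mxE (negbTE li) andbF mulr0 mul0r.
move=> l li; rewrite summxE big1 // => m _.
by rewrite !mxE (negbTE li) andbF !mul0r.
Qed.

Section Metric.
Context {Theta : set pt} {g : pt -> 'M[R]_p} (hg : metric_on Theta g).
Local Notation IT := (interior Theta).

Lemma metric_sym t i j : Theta t -> g t i j = g t j i.
Proof. by move=> Tt; have [_ s _] := hg; rewrite -[in LHS](s t Tt) mxE. Qed.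

Lemma metric_unit t : Theta t -> g t \in unitmx.
Proof.
move=> Tt; have [_ _ pos] := hg.
rewrite -row_free_unit -kermx_eq0; apply/eqP/row_matrixP => i.
rewrite row0; apply/eqP; apply/negP => /negP /(pos _ _ Tt).
have -> : row i (kermx (g t)) *m g t = 0.
  by rewrite -row_mul mulmx_ker row0.
by rewrite mul0mx mxE ltxx.
Qed.

Lemma ginvK t k j : Theta t -> \sum_i ginv g t k i * g t i j = (k == j)%:R.
Proof.
by move=> /metric_unit gu; have /matrixP/(_ k j) := mulVmx gu; rewrite !mxE.
Qed.


Lemma ginv_sym t i j : Theta t -> ginv g t i j = ginv g t j i.
Proof.
move=> Tt; have [_ s _] := hg.
by rewrite /ginv -[in LHS](s t Tt) -trmx_inv mxE.
Qed.

Lemma sharpE t (al : pt) k : sharp g t al 0 k = \sum_i al 0 i * ginv g t i k.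
Proof. by rewrite mxE. Qed.

Lemma sharp_flat t (al : pt) l : Theta t -> \sum_k sharp g t al 0 k * g t k l = al 0 l.
Proof.
move=> /metric_unit gu.
have /rowP/(_ l) : sharp g t al *m g t = al by rewrite -mulmxA mulVmx // mulmx1.
by rewrite mxE.
Qed.

Lemma flat_sharp t (v : pt) k : Theta t ->
  \sum_l (\sum_j v 0 j * g t j l) * ginv g t l k = v 0 k.
Proof.
move=> /metric_unit gu.
have /rowP/(_ k) : v *m g t *m invmx (g t) = v by rewrite -mulmxA mulmxV // mulmx1.
by move=> <-; rewrite [RHS]mxE; apply: eq_bigr => l _; rewrite mxE.
Qed.

Lemma metric_Ck n i j : Ck n IT (fun t => g t i j).
Proof. have [s _ _] := hg; apply: smooth_near_Ck (s i j); exact: interior_subset. Qed.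

Lemma det_Ck n q (M : pt -> 'M[R]_q) U : open U -> (forall i j, Ck n U (fun t => M t i j)) ->
  Ck n U (fun t => \det (M t)).
Proof.
move=> oU CM; rewrite /determinant; apply: Ck_sum => // s.
by apply: CkM => //; [exact: Ck_cst|apply: Ck_prod => // i; exact: CM].
Qed.

(** Cramer's rule: cofactors over a determinant without zeros. *)
Lemma ginv_Ck n i j : Ck n IT (fun t => ginv g t i j).
Proof.
have oI : open IT by exact: open_interior.
have E t : IT t -> (\det (g t))^-1 * cofactor (g t) j i = ginv g t i j.
  by move=> /interior_subset /metric_unit gu; rewrite /ginv /invmx gu !mxE.
apply: (Ck_eq oI E).
apply: (CkM oI).
  apply: (CkV oI) => //; last first.
    by apply: det_Ck => // k l; exact: metric_Ck.
  by move=> t /interior_subset /metric_unit; rewrite unitmxE unitfE.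
rewrite /cofactor; apply: CkZ => //; apply: det_Ck => // k l.
apply: (@Ck_eq _ _ _ _ (fun t => g t (lift j k) (lift i l))) => //; last exact: metric_Ck.
by move=> t _; rewrite !mxE.
Qed.

Lemma sharp_Ck n (al : pt -> pt) U k : open U -> U `<=` IT -> (forall i, Ck n U (fun t => al t 0 i)) ->
  Ck n U (fun t => sharp g t (al t) 0 k).
Proof.
move=> oU UI Cal; apply: (@Ck_eq _ _ _ _ (fun t => \sum_i al t 0 i * ginv g t i k)) => //.
  by move=> t _; rewrite sharpE.
apply: Ck_sum => // i; apply: CkM => //; apply: Ck_sub UI _; exact: ginv_Ck.
Qed.

(* Products of two nondegenerate factors are avoided by differentiating al = (sharp al) g. *)
Lemma partial_flat (al : pt -> pt) U t i l : open U -> U `<=` IT -> U t ->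
  (forall k, Ck 0 U (fun s => al s 0 k)) ->
  partial i (fun s => al s 0 l) t =
  \sum_k (partial i (fun s => sharp g s (al s) 0 k) t * g t k l
          + sharp g t (al t) 0 k * partial i (fun s => g s k l) t).
Proof.
move=> oU UI Ut Cal.
have dS k : differentiable (fun s => sharp g s (al s) 0 k) t.
  by apply: Ck_diff Ut; exact: sharp_Ck.
have dG k : differentiable (fun s => g s k l) t.
  by apply: Ck_diff (UI _ Ut); exact: (metric_Ck 0).
rewrite (@partial_eq_on _ _ U _ (fun s => \sum_k sharp g s (al s) 0 k * g s k l)) //.
  rewrite partial_sum; first by apply: eq_bigr => k _; rewrite partialM.
  by move=> k; apply: differentiableM.
by move=> s /UI /interior_subset Ts; rewrite sharp_flat.
Qed.

End Metric.
Section Precontrast.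
Context {Theta : set pt} {g : pt -> 'M[R]_p} (hg : metric_on Theta g).
Context {Pc : pt -> pt -> pt} (hPc : precontrast Theta g Pc).
Local Notation IT := (interior Theta).
Local Notation F l := (fun z : 'rV[R]_(p + p) => Pc (lsubmx z) (rsubmx z) 0 l).

(** A pair of points is one row of [R^(p+p)]: the left half is the parameter of the precontrast, the
    right half the point where the form is evaluated. Differentiation with superscript (2) acts on
    the left half. *)
Definition two_points (A : set pt) : set 'rV[R]_(p + p) :=
  [set z | A (lsubmx z) /\ A (rsubmx z)].

Lemma open_two_points A : open A -> open (two_points A).
Proof.
move=> oA.
have cl : continuous (fun z : 'rV[R]_(p + p) => lsubmx z).
  move=> z; apply: differentiable_continuous.
  rewrite (_ : (fun _ => _) = fun z : 'rV[R]_(p + p) => \sum_k z 0 (lshift p k) *: (evec k : pt)).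
    rewrite -fct_sumE; apply: differentiable_sum => k; apply: differentiableZl.
    exact: differentiable_coord.
  by apply/funext => s; rewrite [LHS]row_sum_delta; apply: eq_bigr => k _; rewrite mxE.
have cr : continuous (fun z : 'rV[R]_(p + p) => rsubmx z).
  move=> z; apply: differentiable_continuous.
  rewrite (_ : (fun _ => _) = fun z : 'rV[R]_(p + p) => \sum_k z 0 (rshift p k) *: (evec k : pt)).
    rewrite -fct_sumE; apply: differentiable_sum => k; apply: differentiableZl.
    exact: differentiable_coord.
  by apply/funext => s; rewrite [LHS]row_sum_delta; apply: eq_bigr => k _; rewrite mxE.
apply: openI; [move/continuousP : cl|move/continuousP : cr]; exact.
Qed.

Lemma pc_Ck n l : Ck n (two_points IT) (F l).
Proof.
have [s _ _] := hPc; apply: smooth_near_Ck (s l).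
by move=> z [/interior_subset ? /interior_subset].
Qed.

Lemma derive_affine (L : pt -> 'rV[R]_(p + p)) (f : 'rV[R]_(p + p) -> R) v w t :
  (forall h : R, L (h *: v + t) = h *: w + L t) ->
  'D_v (fun t => f (L t)) t = 'D_w f (L t).
Proof.
move=> LE; rewrite /derive.
by under eq_fun do rewrite /= LE.
Qed.

Lemma partial_right (f : 'rV[R]_(p + p) -> R) i s t :
  partial i (fun t => f (row_mx s t)) t = partial (rshift p i) f (row_mx s t).
Proof.
rewrite /partial; apply: derive_affine => h; rewrite -[evec (rshift p i)]/(delta_mx 0 (rshift p i)).
apply/rowP => k; rewrite !mxE; case: splitP => j kj.
  have /negbTE -> : k != rshift p i.
    apply/negP => /eqP ki; have := ltn_ord j; rewrite -kj ki /=.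
    by rewrite ltnNge leq_addr.
  by rewrite andbF mulr0 add0r.
by rewrite !mxE -!val_eqE /= kj eqn_add2l.
Qed.

Lemma partial_left (f : 'rV[R]_(p + p) -> R) i s t :
  partial i (fun s => f (row_mx s t)) s = partial (lshift p i) f (row_mx s t).
Proof.
rewrite /partial; apply: derive_affine => h; rewrite -[evec (lshift p i)]/(delta_mx 0 (lshift p i)).
apply/rowP => k; rewrite !mxE; case: splitP => j kj.
  by rewrite !mxE -!val_eqE /= kj.
have /negbTE -> : k != lshift p i.
  apply/negP => /eqP ki; have := ltn_ord i.
  have -> : nat_of_ord i = (p + j)%N by rewrite -kj ki.
  by rewrite ltnNge leq_addr.
by rewrite andbF mulr0 add0r.
Qed.

Lemma partial_diag (f : 'rV[R]_(p + p) -> R) i t : differentiable f (row_mx t t) ->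
  partial i (fun t => f (row_mx t t)) t
  = partial (lshift p i) f (row_mx t t) + partial (rshift p i) f (row_mx t t).
Proof.
move=> df.
have -> : partial i (fun t => f (row_mx t t)) t
        = 'D_(evec (lshift p i) + evec (rshift p i)) f (row_mx t t).
  rewrite /partial; apply: (derive_affine f (L := fun t => row_mx t t)) => h; apply/rowP => k; rewrite !mxE -!val_eqE /=.
  case: splitP => j kj; rewrite !mxE kj eqxx /=.
    have /negbTE -> : nat_of_ord j != (p + i)%N.
      by rewrite neq_ltn (leq_trans (ltn_ord j)) // leq_addr.
    by rewrite addr0 -val_eqE.
  have /negbTE -> : (p + j)%N != i.
    by rewrite neq_ltn (leq_trans (ltn_ord i)) ?orbT // leq_addr.
  by rewrite add0r eqn_add2l -val_eqE.
by rewrite deriveE // linearD /= -!deriveE.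
Qed.

Lemma pc_pair s t l : Pc s t 0 l = F l (row_mx s t).
Proof. by rewrite /= row_mxKl row_mxKr. Qed.

Lemma pc_right s l : (fun t => Pc s t 0 l) = fun t => F l (row_mx s t).
Proof. by apply/funext => t; rewrite -pc_pair. Qed.

Lemma pc_left t l : (fun s => Pc s t 0 l) = fun s => F l (row_mx s t).
Proof. by apply/funext => s; rewrite -pc_pair. Qed.

Lemma pc_lpart s t i l :
  partial i (fun s => Pc s t 0 l) s = partial (lshift p i) (F l) (row_mx s t).
Proof. by rewrite pc_left; exact: partial_left. Qed.

Lemma pc_partial1 t i l : Theta t -> partial i (fun s => Pc t s 0 l) t = g t l i.
Proof.
move=> Tt; have [_ _ H] := hPc.
have := H _ _ (smoothv_near_cst _ (evec l)) (smoothv_near_cst _ (evec i)) t Tt.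
by rewrite form_app_evec ip_evec.
Qed.

Lemma two_points_diag t : IT t -> two_points IT (row_mx t t).
Proof. by rewrite /two_points /= row_mxKl row_mxKr. Qed.

Lemma pc_rpartial t i l : IT t -> partial (rshift p i) (F l) (row_mx t t) = g t l i.
Proof.
move=> It; rewrite -partial_right -(pc_partial1 i l (interior_subset It)).
by rewrite pc_right.
Qed.

(** Differentiation of [Psi^t(t) = 0] along the diagonal. *)
Lemma pc_lpartial t i l : IT t -> partial (lshift p i) (F l) (row_mx t t) = - g t l i.
Proof.
move=> It; have df := Ck_diff (pc_Ck 0 l) (two_points_diag It).
have := partial_diag i df; rewrite pc_rpartial //.
rewrite (@partial_eq_on _ _ IT _ (cst 0)) ?partial_cst //; last 2 first.
- exact: open_interior.
- move=> s /interior_subset Ts; rewrite -pc_pair; have [_ H _] := hPc.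
  by rewrite H // mxE.
by move/eqP; rewrite eq_sym addr_eq0 => /eqP.
Qed.

Lemma pc_2partial (D1 Dm1 : connection R p) t i j l :
  connection_D1 Theta g Pc D1 -> connection_Dm1 Theta g Pc Dm1 -> IT t ->
  \sum_k D1 t i j 0 k * g t k l = - partial (rshift p i) (partial (lshift p l) (F j)) (row_mx t t)
  /\ \sum_k Dm1 t i j 0 k * g t k l = - partial (lshift p i) (partial (lshift p j) (F l)) (row_mx t t).
Proof.
move=> [_ H1] [_ Hm1] It; have Tt := interior_subset It; split.
  rewrite -ip_evecr -(cov_evec D1).
  have sc v := smoothv_near_cst Theta v.
  rewrite (H1 _ _ _ (sc (evec i)) (sc (evec j)) (sc (evec l)) _ Tt).
  under eq_fun => t1 do under eq_fun => t2 do rewrite form_app_evec.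
  rewrite -partial_right dirder_evec.
  by under eq_fun => t1 do rewrite dirder_evec pc_lpart.
rewrite -ip_evecr -(cov_evec Dm1).
have -> : ip g t (cov Dm1 (cst (evec i)) (cst (evec j)) t) (evec l)
        = ip g t (evec l) (cov Dm1 (cst (evec i)) (cst (evec j)) t).
  rewrite !ip_sum exchange_big; apply: eq_bigr => a _; apply: eq_bigr => b _.
  by rewrite (metric_sym hg b a Tt); move: (cov _ _ _ _ _ _) (evec _ _ _) (g _ _ _) => u v w; ring.
have sc v := smoothv_near_cst Theta v.
rewrite (Hm1 _ _ _ (sc (evec l)) (sc (evec i)) (sc (evec j)) _ Tt).
under eq_fun => t1 do under eq_fun => t2 do rewrite form_app_evec.
rewrite -partial_left dirder_evec.
by under eq_fun => t1 do rewrite dirder_evec pc_lpart.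
Qed.

(** Derivative along the diagonal of [partial (lshift j) Psi_l = - g_lj]: the right half produces
    [D1], the left half [Dm1]. *)
Lemma duality (D1 Dm1 : connection R p) t i j l :
  connection_D1 Theta g Pc D1 -> connection_Dm1 Theta g Pc Dm1 -> IT t ->
  partial i (fun s => g s j l) t
  = \sum_k D1 t i l 0 k * g t k j + \sum_k Dm1 t i j 0 k * g t k l.
Proof.
move=> h1 hm1 It; have [-> _] := pc_2partial i l j h1 hm1 It.
have [_ ->] := pc_2partial i j l h1 hm1 It.
rewrite -opprD addrC -partial_diag; last first.
  by apply: Ck_diff (two_points_diag It); apply: Ck_partial; exact: (pc_Ck 1).
rewrite [in RHS](@partial_eq_on _ _ IT _ (fun s => - g s l j)) //; last 2 first.
- exact: open_interior.
- by move=> s Is; rewrite pc_lpartial.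
rewrite [in LHS](@partial_eq_on _ _ IT _ (fun s => g s l j)) //; last 2 first.
- exact: open_interior.
- by move=> s Is; exact: (metric_sym hg _ _ (interior_subset Is)).
rewrite /partial -[fun s => - _]/(- (fun s => g s l j)) deriveN ?opprK //.
by apply: diff_derivable; apply: Ck_diff It; exact: (metric_Ck hg 0).
Qed.
End Precontrast.

End Interior.

Lemma Ck_coord {R : realType} {p : nat} n (U : set 'rV[R]_p) j : Ck n U (fun s => s 0 j).
Proof.
case: n => [|n] /=; first by move=> t _; exact: differentiable_coord.
split=> [t _|i]; first exact: differentiable_coord.
suff -> : partial i (fun s : 'rV[R]_p => s 0 j) = cst ((evec i : 'rV[R]_p) 0 j) by exact: Ck_cst.
apply/funext => t; rewrite /partial /=.
have := derive_mx (@derivable_id _ _ t (evec i)); rewrite derive_id => /matrixP/(_ 0 j).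
by rewrite [in X in _ = X -> _]mxE => ->.
Qed.

(** * The jet of [g^-1 Psi^theta0] and the dual connections *)

Section Duality.
Context {R : realType} {p : nat}.
Local Notation pt := 'rV[R]_p.
Context {Theta : set pt} {g : pt -> 'M[R]_p} (hg : metric_on Theta g).
Context {Pc : pt -> pt -> pt} (hPc : precontrast Theta g Pc).
Local Notation IT := (interior Theta).
Local Notation F l := (fun z : 'rV[R]_(p + p) => Pc (lsubmx z) (rsubmx z) 0 l).

Lemma flat_inj t (u v : 'I_p -> R) : Theta t ->
  (forall l, \sum_k u k * g t k l = \sum_k v k * g t k l) -> u =1 v.
Proof.
move=> Tt uv k.
have := flat_sharp hg (\row_k u k) k Tt; rewrite mxE => <-.
have := flat_sharp hg (\row_k v k) k Tt; rewrite mxE => <-.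
apply: eq_bigr => l _; congr (_ * _).
under eq_bigr do rewrite mxE. under [RHS]eq_bigr do rewrite mxE.
exact: uv.
Qed.

Let oI : open IT. Proof. exact: open_interior. Qed.

Lemma pc_Ck1 n t0 l : IT t0 -> Ck n IT (fun t => Pc t0 t 0 l).
Proof.
move=> It; rewrite pc_right.
apply: (Ck_comp (W := two_points IT) (phi := fun t => row_mx t0 t) (f := F l)) => //.
- exact: open_two_points.
- by move=> t It'; rewrite /two_points /= row_mxKl row_mxKr.
- move=> k; case: (split_ordP k) => j ->.
    apply: (Ck_eq oI _ (Ck_cst n IT (t0 0 j))) => s _.
    by rewrite row_mxEl.
  apply: (Ck_eq (f := fun s : pt => s 0 j)) => //; first by move=> s _; rewrite row_mxEr.
  exact: Ck_coord.
- exact: (pc_Ck hPc).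
Qed.

Local Notation Phi0 t0 k := (fun t => sharp g t (Pc t0 t) 0 k).

Lemma pc_sharp_partial t0 i k : IT t0 -> partial i (Phi0 t0 k) t0 = (k == i)%:R.
Proof.
move=> It; have Tt := interior_subset It.
move: k; apply: (flat_inj Tt) => l.
have := partial_flat hg i l oI (@subset_refl _ _) It (fun l => pc_Ck1 0 l It).
rewrite (pc_partial1 hPc) // (metric_sym hg _ _ Tt).
have [_ P0 _] := hPc; rewrite P0 // /sharp mul0mx => E.
rewrite [RHS](bigD1 i) //= eqxx mul1r [X in _ + X]big1 ?addr0; last first.
  by move=> k /negbTE ->; rewrite mul0r.
by rewrite E; apply: eq_bigr => k _; rewrite mxE mul0r addr0.
Qed.

(** The second derivative of [Psi^t0] is computed twice: by the product rule for [g] times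
    [g^-1 Psi^t0], which shows the wanted Hessian and derivatives of [g], and by differentiating
    [partial (rshift j) Psi_l = g_lj] along the diagonal, which shows [D1]. [duality] trades [D1]
    for [Dm1], and the derivatives of [g] cancel. *)
Lemma pc_sharp_hess (D1 Dm1 : connection R p) t0 i j k :
  connection_D1 Theta g Pc D1 -> connection_Dm1 Theta g Pc Dm1 -> IT t0 ->
  partial i (partial j (Phi0 t0 k)) t0 = - Dm1 t0 j i 0 k.
Proof.
move=> h1 hm1 It; have Tt := interior_subset It.
have CP n m : Ck n IT (Phi0 t0 m).
  by apply: (sharp_Ck hg) => // l; exact: pc_Ck1.
move: k; apply: (flat_inj Tt) => l.
have dP m : differentiable (Phi0 t0 m) t0 by exact: Ck_diff (CP 0%N m) It.
have dpP m a : differentiable (partial a (Phi0 t0 m)) t0.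
  by apply: Ck_diff It; exact: Ck_partial (CP 1%N m).
have dg m : differentiable (fun s => g s m l) t0.
  exact: Ck_diff (metric_Ck hg 0 m l) It.
have dpg m a : differentiable (partial a (fun s => g s m l)) t0.
  by apply: Ck_diff It; exact: Ck_partial (metric_Ck hg 1 m l).
have E1 : partial i (partial j (fun t => Pc t0 t 0 l)) t0 =
   \sum_m partial i (partial j (Phi0 t0 m)) t0 * g t0 m l
   + partial i (fun s => g s j l) t0 + partial j (fun s => g s i l) t0.
  rewrite (partial_eq_on i oI (h := fun t => \sum_m (partial j (Phi0 t0 m) t * g t m l
          + Phi0 t0 m t * partial j (fun s => g s m l) t))) //; last first.
    move=> s Is; exact: (partial_flat hg j l oI (@subset_refl _ _) Is (fun m => pc_Ck1 0 m It)).
  rewrite partial_sum; last first.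
    by move=> m; apply: differentiableD; apply: differentiableM.
  rewrite (eq_bigr (fun m => partial i (partial j (Phi0 t0 m)) t0 * g t0 m l
    + (m == j)%:R * partial i (fun s => g s m l) t0
    + (m == i)%:R * partial j (fun s => g s m l) t0)).
    rewrite !big_split /=; congr (_ + _ + _).
      rewrite (bigD1 j) //= eqxx mul1r big1 ?addr0 //.
      by move=> m /negbTE ->; rewrite mul0r.
    rewrite (bigD1 i) //= eqxx mul1r big1 ?addr0 //.
    by move=> m /negbTE ->; rewrite mul0r.
  move=> m _; rewrite partialD; [|exact: differentiableM|exact: differentiableM].
  rewrite !partialM // !pc_sharp_partial //.
  have [_ P0 _] := hPc; rewrite P0 // /sharp mul0mx mxE mul0r addr0.
  by rewrite -addrA.
have E2 : partial i (partial j (fun t => Pc t0 t 0 l)) t0 =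
    partial i (fun s => g s l j) t0 + \sum_m D1 t0 j l 0 m * g t0 m i.
  rewrite pc_right.
  have -> : partial j (fun t => F l (row_mx t0 t)) = fun t => partial (rshift p j) (F l) (row_mx t0 t).
    by apply/funext => t; exact: partial_right.
  rewrite partial_right.
  have C2 := pc_Ck hPc 4 l.
  have := partial_diag i (Ck_diff (Ck_partial (rshift p j) C2) (two_points_diag It)).
  rewrite (partial_eq_on i oI (h := fun s => g s l j)) //; last first.
    by move=> s Is; exact: (pc_rpartial hPc).
  rewrite (Ck_schwarz (f := F l) _ _ (open_two_points oI) (two_points_diag It) (pc_Ck hPc 3 l)).
  have [-> _] := pc_2partial hg j l i h1 hm1 It.
  move=> ->; exact: (esym (etrans (addrC _ _) (addKr _ _))).
have sym m a : partial m (fun s => g s l a) t0 = partial m (fun s => g s a l) t0.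
  apply: (partial_eq_on m oI) => // s Is.
  exact: (metric_sym hg _ _ (interior_subset Is)).
have := duality hg hPc j i l h1 hm1 It.
move: E1; rewrite E2 sym; under [X in _ -> _ -> _ = X]eq_bigr do rewrite mulNr.
rewrite sumrN.
have key (a b c d e : R) : d + a = c + d + e -> e = a + b -> c = - b.
  by move=> *; lra.
exact: key.
Qed.

(** Both derivatives in [Dm1] act on the parameter, so Schwarz applies: [D^(-1)] is always
    torsion-free. *)
Lemma dm1_sym (D1 Dm1 : connection R p) t i j :
  connection_D1 Theta g Pc D1 -> connection_Dm1 Theta g Pc Dm1 -> IT t ->
  forall k, Dm1 t i j 0 k = Dm1 t j i 0 k.
Proof.
move=> h1 hm1 It; apply: (flat_inj (interior_subset It)) => l.
have [_ ->] := pc_2partial hg i j l h1 hm1 It.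
have [_ ->] := pc_2partial hg j i l h1 hm1 It.
by rewrite (Ck_schwarz (f := F l) _ _ (open_two_points oI) (two_points_diag It) (pc_Ck hPc 3 l)).
Qed.

Lemma torsion_free_sym (D : connection R p) t i j : torsion_free Theta D -> Theta t ->
  D t i j = D t j i.
Proof.
move=> H Tt; have sc v := smoothv_near_cst Theta v.
have := H _ _ (sc (evec i)) (sc (evec j)) t Tt.
rewrite !cov_evec => /eqP; rewrite subr_eq => /eqP ->.
rewrite (_ : bracket _ _ _ = 0) ?add0r //; apply/rowP => k.
by rewrite [LHS]mxE [RHS]mxE /dirder (derive_cst) derive_cst subrr.
Qed.

(** By [duality] the mean of [D1] and [Dm1] is compatible with [g], and it is symmetric here. The
    permutations of the metric identity [K] then determine it as in Koszul's argument. *)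
Lemma lc_interior (nabla D1 Dm1 : connection R p) t i j k :
  levi_civita Theta g nabla ->
  connection_D1 Theta g Pc D1 -> connection_Dm1 Theta g Pc Dm1 ->
  torsion_free Theta D1 -> IT t ->
  nabla t i j 0 k = 2^-1 * (D1 t i j 0 k + Dm1 t i j 0 k).
Proof.
move=> [_ tfn lc] h1 hm1 tf1 It; have Tt := interior_subset It.
have sc v := smoothv_near_cst Theta v.
pose N i j l := \sum_k nabla t i j 0 k * g t k l.
pose A i j l := \sum_k D1 t i j 0 k * g t k l.
pose B i j l := \sum_k Dm1 t i j 0 k * g t k l.
have Ns a b l : N a b l = N b a l by rewrite /N (torsion_free_sym _ _ tfn Tt).
have As a b l : A a b l = A b a l by rewrite /A (torsion_free_sym _ _ tf1 Tt).
have Bs a b l : B a b l = B b a l.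
  by apply: eq_bigr => m _; rewrite (dm1_sym _ _ h1 hm1 It).
have sym m a b : partial m (fun s => g s a b) t = partial m (fun s => g s b a) t.
  apply: (partial_eq_on m oI) => // s Is.
  exact: (metric_sym hg _ _ (interior_subset Is)).
have E1 a b l : partial a (fun s => g s b l) t = A a l b + B a b l.
  exact: (duality hg hPc a b l h1 hm1 It).
have E2 a b l : partial a (fun s => g s b l) t = N a b l + N a l b.
  have := lc _ _ _ (sc (evec b)) (sc (evec l)) (sc (evec a)) t Tt.
  rewrite !cov_evec dirder_evec.
  under eq_fun do rewrite ip_evec.
  move=> ->; rewrite ip_evecr; congr (_ + _).
  rewrite /N -ip_evecr !ip_sum exchange_big; apply: eq_bigr => u _; apply: eq_bigr => v _.
  by rewrite (metric_sym hg v u Tt); move: (nabla _ _ _ _ _) (evec _ _ _) (g _ _ _) => x y z; ring.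
move: k; apply: (flat_inj Tt) => l; rewrite -/(N i j l).
have -> : \sum_k 2^-1 * (D1 t i j 0 k + Dm1 t i j 0 k) * g t k l = 2^-1 * (A i j l + B i j l).
  rewrite /A /B -big_split mulr_sumr; apply: eq_bigr => m _.
  by rewrite -mulrA mulrDl.
have K a b c : N a b c + N a c b = A a c b + B a b c by rewrite -E1 -E2.
have := (K i j l, K i l j, K j i l, K j l i, K l i j, K l j i).
rewrite [N j i l]Ns [N l i j]Ns [N l j i]Ns [A j i l]As [A l i j]As [A l j i]As.
rewrite [B j i l]Bs [B l i j]Bs [B l j i]Bs => -[[[[[]]]]].
lra.
Qed.

(** Derivatives along the diagonal are computed in the interior only; both sides are continuous and
    the interior is dense in [Theta]. *)
Lemma lc_boundary (nabla D1 Dm1 : connection R p) t i j :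
  smooth_boundary Theta ->
  levi_civita Theta g nabla ->
  connection_D1 Theta g Pc D1 -> connection_Dm1 Theta g Pc Dm1 ->
  torsion_free Theta D1 -> Theta t ->
  nabla t i j - 2^-1 *: Dm1 t i j = 2^-1 *: D1 t i j.
Proof.
move=> sb lc h1 hm1 tf Tt; apply/rowP => k; rewrite !mxE.
apply/eqP; rewrite -subr_eq0; apply/eqP.
pose f s := nabla s i j 0 k - 2^-1 * Dm1 s i j 0 k - 2^-1 * D1 s i j 0 k.
have cf : {for t, continuous f}.
  have [cn _ _] := lc; have [c1 _] := h1; have [cm _] := hm1.
  have df (h : pt -> R) : smooth_near Theta h -> differentiable h t.
    by move=> [U [_ AU sf]]; exact: (sf [::]) (AU _ Tt).
  apply: differentiable_continuous; apply: differentiableB; first apply: differentiableB.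
  - exact: df (cn i j k).
  - by apply: differentiableM; [exact: differentiable_cst|exact: df (cm i j k)].
  - by apply: differentiableM; [exact: differentiable_cst|exact: df (c1 i j k)].
rewrite -[LHS]/(f t); apply/eqP; apply/negP => /negP f0.
have e0 : 0 < `|f t| by rewrite normr_gt0.
have [s [Is]] := closure_interior sb Tt (cf _ (nbhsx_ballx (f t) _ e0)).
rewrite /= -ball_normE /= /f (lc_interior _ _ _ lc h1 hm1 tf Is).
by rewrite mulrDr addrK subrr subr0 ltxx.
Qed.

Section UpsilonCoord.
Context {dX : nat -> measure_display} {X : forall n, measurableType (dX n)}.
Context (Psi : forall n, X n -> pt -> pt) (n : nat) (x : X n).
Context (sPsi : smoothv_near Theta (Psi x)).
Context (D1 Dm1 : connection R p) (h1 : connection_D1 Theta g Pc D1)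
  (hm1 : connection_Dm1 Theta g Pc Dm1).

Lemma one_form_Ck m l : Ck m IT (fun t => Psi x t 0 l).
Proof. apply: smooth_near_Ck (sPsi l); exact: interior_subset. Qed.

Lemma Upsilon_flat (Y : pt -> pt) t l : IT t ->
  ip g t (Y t) (evec l) - cov1 D1 (Psi x) Y (cst (evec l)) t
  = \sum_j Y t 0 j * g t j l - \sum_i Y t 0 i *
      (partial i (fun s => Psi x s 0 l) t - \sum_m D1 t i l 0 m * Psi x t 0 m).
Proof.
move=> It; rewrite ip_evecr; congr (_ - _).
rewrite /cov1 form_app_evec {1}/dirder derive_partial; last first.
  exact: Ck_diff (one_form_Ck 0 l) It.
under [RHS]eq_bigr do rewrite mulrBr.
rewrite sumrB; congr (_ - _).
rewrite /form_app (eq_bigr (fun m => \sum_i Y t 0 i * (D1 t i l 0 m * Psi x t 0 m))).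
  by rewrite exchange_big; apply: eq_bigr => i _; rewrite mulr_sumr.
move=> m _; rewrite /cov !mxE /dirder derive_cst add0r summxE mulr_sumr.
apply: eq_bigr => i _; rewrite summxE (bigD1 l) //= big1 ?addr0.
  by rewrite !mxE !eqxx mulr1 mulrCA mulrA [_ * Psi _ _ _ _]mulrC mulrA.
by move=> j /negbTE jl; rewrite !mxE jl andbF mulr0 mul0r.
Qed.

(** The form used for (c): only [Psi] and its first derivatives occur, and [A3] speaks of these. *)
Lemma Upsilon_coord (Y : pt -> pt) t k : IT t ->
  Upsilon g D1 Psi x Y t 0 k =
  \sum_l (\sum_j Y t 0 j * g t j l - \sum_i Y t 0 i *
      (partial i (fun s => Psi x s 0 l) t - \sum_m D1 t i l 0 m * Psi x t 0 m)) * ginv g t l k.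
Proof.
move=> It; rewrite /Upsilon sharpE; apply: eq_bigr => l _; rewrite mxE.
by rewrite Upsilon_flat.
Qed.

(** The form used for (a): it contains derivatives of [g^-1 Psi], as the moment equations do. The
    derivatives of [g] that appear are removed by [duality], which replaces [D1] by [Dm1]. *)
Lemma Upsilon_dual (Y : pt -> pt) t k : IT t ->
  Upsilon g D1 Psi x Y t 0 k =
  Y t 0 k - \sum_i Y t 0 i * partial i (fun s => sharp g s (Psi x s) 0 k) t
  - \sum_i \sum_j Y t 0 i * sharp g t (Psi x t) 0 j * Dm1 t i j 0 k.
Proof.
move=> It; have Tt := interior_subset It.
rewrite Upsilon_coord //.
pose U k := Y t 0 k - \sum_i Y t 0 i * partial i (fun s => sharp g s (Psi x s) 0 k) t
  - \sum_i \sum_j Y t 0 i * sharp g t (Psi x t) 0 j * Dm1 t i j 0 k.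
rewrite -[RHS]/(U k).
have := flat_sharp hg (\row_k U k) k Tt; rewrite mxE => <-.
apply: eq_bigr => l _; congr (_ * _).
under [RHS]eq_bigr do rewrite mxE /U !mulrBl.
rewrite !sumrB -addrA; congr (_ + _); rewrite -opprD; congr (- _).
rewrite [X in _ = X + _](eq_bigr (fun a => \sum_i Y t 0 i * (partial i (fun s => sharp g s (Psi x s) 0 a) t * g t a l))); last first.
  by move=> a _; rewrite mulr_suml; apply: eq_bigr => i _; rewrite mulrA.
rewrite [X in _ = X + _]exchange_big.
rewrite [X in _ = _ + X](eq_bigr (fun a => \sum_i Y t 0 i * (\sum_j sharp g t (Psi x t) 0 j * Dm1 t i j 0 a * g t a l))); last first.
  move=> a _; rewrite mulr_suml; apply: eq_bigr => i _; rewrite mulr_suml mulr_sumr.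
  by apply: eq_bigr => j _; rewrite !mulrA.
rewrite [X in _ = _ + X]exchange_big -big_split; apply: eq_bigr => i _ /=.
rewrite -mulr_sumr -mulr_sumr -mulrDr; congr (_ * _).
rewrite (partial_flat hg i l oI (@subset_refl _ _) It (one_form_Ck 0)).
rewrite big_split /= -addrA; congr (_ + _).
rewrite [X in _ = X]exchange_big /=.
rewrite [X in _ - X](eq_bigr (fun m => \sum_a D1 t i l 0 m * (sharp g t (Psi x t) 0 a * g t a m))); last first.
  by move=> m _; rewrite -mulr_sumr (sharp_flat hg).
rewrite exchange_big -sumrB /=; apply: eq_bigr => a _.
rewrite (duality hg hPc i a l h1 hm1 It) mulrDr.
rewrite [X in X + _ - _](_ : _ = \sum_m D1 t i l 0 m * (sharp g t (Psi x t) 0 a * g t a m)); last first.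
  rewrite mulr_sumr; apply: eq_bigr => m _.
  by rewrite (metric_sym hg m a Tt) mulrCA.
rewrite addrAC addrN add0r mulr_sumr.
by apply: eq_bigr => m _; rewrite mulrA.
Qed.

End UpsilonCoord.
End Duality.

(** * Test functions *)

Section TestFunctions.
Context {R : realType} {p : nat}.
Local Notation pt := 'rV[R]_p.
Implicit Types (t : pt) (f q : pt -> R).

Let oT : open [set: pt]. Proof. exact: openT. Qed.

(** [f] is [q] times a bump. The bump is [1 + O(|h|^2)] with no linear term, so [f] has the 2-jet of
    [q] at [t0] and its gradient errs by two orders more than the size of [partial j q]. The
    constant depends on [r]; the estimate covers the ball of radius [D], which will contain
    [Theta]. *)
Lemma test_function (t0 : pt) (r D : R) (m : nat) q : 0 < r ->
  (forall n, Ck n setT q) -> q t0 = 0 ->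
  (forall t, `|q t| <= `|t - t0| ^+ m.+1) ->
  (forall j t, `|partial j q t| <= 2 * `|t - t0| ^+ m) ->
  exists f, [/\ smooth_on setT f, forall t, r <= `|t - t0| -> f t = 0,
    forall j, partial j f t0 = partial j q t0,
    forall i j, partial i (partial j f) t0 = partial i (partial j q) t0 &
    exists2 C : R, 0 <= C & forall j t, `|t - t0| <= D ->
      `|partial j f t - partial j q t| <= C * `|t - t0| ^+ m.+2].
Proof.
move=> r0 Cq q0 Hq Hdq.
have [chi [schi chi0 dchi0 chiz]] := bump_exists t0 r0.
have Cchi n : Ck n setT chi by exact: smooth_Ck.
have dq t : differentiable q t by exact: Ck_diff (Cq 0%N) I.
have dchi t : differentiable chi t by exact: Ck_diff (Cchi 0%N) I.
have dpq j t : differentiable (partial j q) t.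
  by apply: Ck_diff (I : setT t); exact: Ck_partial (Cq 1%N).
have dpchi j t : differentiable (partial j chi) t.
  by apply: Ck_diff (I : setT t); exact: Ck_partial (Cchi 1%N).
have pf j : partial j (fun t => q t * chi t) = fun t => partial j q t * chi t + q t * partial j chi t.
  by apply/funext => t; rewrite partialM.
exists (fun t => q t * chi t); split.
- by apply: Ck_smooth_on => n; exact: CkM.
- by move=> t /chiz ->; rewrite mulr0.
- by move=> j; rewrite pf chi0 q0 mulr1 mul0r addr0.
- move=> i j; rewrite pf partialD; [|exact: differentiableM|exact: differentiableM].
  by rewrite !partialM // chi0 !dchi0 q0 !mulr0 mul0r !addr0 mulr1.
have [C1 C10 H1] := Ck_taylor1 (@subsetT _ (cball t0 D)) (Cchi 2%N).
have [C2 C20 H2] : exists2 C : R, 0 <= C & forall j t, cball t0 D t -> `|partial j chi t| <= C * `|t - t0|.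
  have HC j := Ck_taylor0 (@subsetT _ (cball t0 D)) (Ck_partial j (Cchi 2%N)).
  have [Cj HCj] : exists Cj : 'I_p -> R, forall j, 0 <= Cj j /\
      forall h : pt, `|h| <= D -> `|partial j chi (t0 + h) - partial j chi t0| <= Cj j * `|h|.
    have {}HC (j : 'I_p) : exists c : R, 0 <= c /\ forall h : pt, `|h| <= D ->
      `|partial j chi (t0 + h) - partial j chi t0| <= c * `|h| by have [c ? ?] := HC j; exists c.
    by have [Cj HCj] := choice HC; exists Cj.
  have Cj0 j : 0 <= Cj j by have [] := HCj j.
  have CjH j := (HCj j).2.
  exists (\sum_j Cj j); first by rewrite sumr_ge0.
  move=> j t Dt; have := CjH j (t - t0) Dt; rewrite subrKC dchi0 subr0 => H; apply: (le_trans H).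
  apply: ler_wpM2r => //; rewrite (bigD1 j) //= lerDl sumr_ge0 //.
exists (2 * C1 + C2); first by rewrite addr_ge0 // mulr_ge0.
move=> j t Dt; rewrite pf.
have -> : partial j q t * chi t + q t * partial j chi t - partial j q t
        = partial j q t * (chi t - 1) + q t * partial j chi t.
  by move: (partial j q t) (chi t) (q t) (partial j chi t) => x y z w; ring.
rewrite (le_trans (ler_normD _ _)) // !normrM mulrDl.
have H3 : `|chi t - 1| <= C1 * `|t - t0| ^+ 2.
  have := H1 (t - t0) Dt; rewrite subrKC chi0 big1 ?subr0 // => i _.
  by rewrite dchi0 mulr0.
apply: lerD.
  apply: (le_trans (ler_pM _ _ (Hdq j t) H3)) => //.
  by rewrite -[m.+2]addn2 exprD; move: (_ ^+ m) (_ ^+ 2) => x y; rewrite le_eqVlt; apply/orP; left; apply/eqP; ring.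
apply: (le_trans (ler_pM _ _ (Hq t) (H2 j t Dt))) => //.
by rewrite [_ ^+ m.+2]exprSr mulrCA.
Qed.

Lemma partial_outside (t0 : pt) (r : R) f : (forall t, r <= `|t - t0| -> f t = 0) ->
  forall t, r < `|t - t0| ->
  [/\ forall j, partial j f t = 0 & forall i j, partial i (partial j f) t = 0].
Proof.
move=> f0.
have oO : open [set t : pt | r < `|t - t0|].
  apply: (@open_comp _ _ (fun t : pt => `|t - t0|) [set x | r < x]); last exact: open_gt.
  by move=> t _; exact: norm_sub_continuous.
have p0 j t : r < `|t - t0| -> partial j f t = 0.
  move=> rt; rewrite (partial_eq_on j oO (h := cst 0)) ?partial_cst //.
  by move=> s /ltW /f0.
move=> t rt; split=> [j|i j]; first exact: p0.
rewrite (partial_eq_on i oO (h := cst 0)) ?partial_cst // => s; exact: p0.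
Qed.

Lemma laplaceE (g : pt -> 'M[R]_p) (nabla : connection R p) f t :
  laplace g nabla f t = \sum_i \sum_j ginv g t i j *
    (partial i (partial j f) t - \sum_k partial k f t * nabla t i j 0 k).
Proof.
apply: eq_bigr => i _; apply: eq_bigr => j _; congr (_ * _).
rewrite /cov1 form_app_evec dirder_evec; congr (_ - _).
  by congr partial; apply/funext => s; rewrite mxE.
by rewrite /form_app cov_evec; apply: eq_bigr => k _; rewrite mxE.
Qed.

Lemma dirderE (W : pt -> pt) f t : differentiable f t ->
  dirder W f t = \sum_i W t 0 i * partial i f t.
Proof. by move=> df; rewrite /dirder derive_partial. Qed.

End TestFunctions.

(** * The generator on truncated test functions *)

Section Generator.
Context {R : realType} {p : nat}.
Local Notation pt := 'rV[R]_p.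
Context {Theta : set pt} {g : pt -> 'M[R]_p} (hg : metric_on Theta g).
Context {nabla : connection R p} (cn : connection_on Theta nabla).
Local Notation IT := (interior Theta).
Let oI : open IT. Proof. exact: open_interior. Qed.
Implicit Types (f : pt -> R) (W : pt -> pt).

Lemma smoothv_near_Ck n W i : smoothv_near Theta W -> Ck n IT (fun t => W t 0 i).
Proof. by move=> sW; apply: smooth_near_Ck (sW i); exact: interior_subset. Qed.

Lemma laplace_Ck n f : smooth_on setT f -> Ck n IT (laplace g nabla f).
Proof.
move=> sf; have Cf k : Ck k IT f by apply: Ck_sub (smooth_Ck k sf).
apply: (Ck_eq oI (fun t _ => esym (laplaceE g nabla f t))).
apply: Ck_sum => // i; apply: Ck_sum => // j; apply: CkM => //; first exact: (ginv_Ck hg).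
apply: CkB => //; first by do 2!apply: Ck_partial; exact: Cf n.+2.
apply: Ck_sum => // k; apply: CkM => //; first by apply: Ck_partial; exact: Cf n.+1.
exact: smoothv_near_Ck (cn i j).
Qed.

Lemma dirder_Ck n W f : smooth_on setT f -> (forall i, Ck n IT (fun t => W t 0 i)) ->
  Ck n IT (dirder W f).
Proof.
move=> sf sW; have Cf k : Ck k IT f by apply: Ck_sub (smooth_Ck k sf).
apply: (Ck_eq (f := fun t => \sum_i W t 0 i * partial i f t) oI).
  by move=> t _; rewrite dirderE //; exact: (sf [::] t I).
apply: Ck_sum => // i; apply: CkM => //.
by apply: Ck_partial; exact: Cf n.+1.
Qed.

Context {t0 : pt} {r : R} (r0 : 0 < r) (rI : cball t0 r `<=` IT).
Context {f : pt -> R} (sf : smooth_on setT f) (f0 : forall t, r <= `|t - t0| -> f t = 0).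

Lemma generator_outside W (t : pt) : r < `|t - t0| ->
  laplace g nabla f t = 0 /\ dirder W f t = 0.
Proof.
move=> /(partial_outside f0)[p1 p2]; split.
  rewrite laplaceE big1 // => i _; rewrite big1 // => j _.
  by rewrite p2 big1 ?subr0 ?mulr0 // => k _; rewrite p1 mul0r.
have df : differentiable f t by apply: (sf [::]).
rewrite dirderE //.
by rewrite big1 // => i _; rewrite p1 mulr0.
Qed.

(** The coefficients are smooth near [Theta] only, while integration asks for continuity on R^p;
    vanishing off the ball bridges the gap. *)
Lemma outside_continuous (F : pt -> R) : Ck 0 IT F ->
  (forall t, r < `|t - t0| -> F t = 0) -> continuous F.
Proof.
move=> CF F0 t; have [tr|rt] := leP `|t - t0| r.
  by apply: Ck_continuous CF _; exact: rI.
have oO : open [set t : pt | r < `|t - t0|].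
  apply: (@open_comp _ _ (fun t : pt => `|t - t0|) [set x | r < x]); last exact: open_gt.
  by move=> s _; exact: norm_sub_continuous.
apply: differentiable_continuous.
apply: (near_eq_differentiable (f := cst 0)); last exact: differentiable_cst.
by apply: filterS (open_nbhs_nbhs (conj oO rt)) => s /F0 ->.
Qed.

Lemma generator_continuous (tau : R) W : (forall i, Ck 0 IT (fun t => W t 0 i)) ->
  continuous (generator g nabla tau W f).
Proof.
move=> sW; apply: outside_continuous.
  apply: CkD => //; first by apply: CkZ => //; exact: laplace_Ck.
  by apply: CkZ => //; exact: dirder_Ck.
by move=> t rt; rewrite /generator; have [-> ->] := generator_outside W rt; rewrite !mulr0 addr0.
Qed.

Lemma drift_free_lipschitz (tau : R) W : smoothv_near Theta W ->
  exists2 C : R, 0 <= C & forall t : pt,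
    `|(tau * laplace g nabla f t + dirder W f t)
      - (tau * laplace g nabla f t0 + dirder W f t0)| <= C * `|t - t0|.
Proof.
move=> sW; pose F t := tau * laplace g nabla f t + dirder W f t.
have CF : Ck 1 IT F.
  apply: CkD => //; first by apply: CkZ => //; exact: laplace_Ck.
  by apply: dirder_Ck => // i; exact: smoothv_near_Ck.
have [C C0 HC] := Ck_taylor0 rI CF.
(* Off the ball [F] vanishes, and [|F t0|] is at most [|F t0| / r] times the distance to [t0]. *)
exists (C + `|F t0| / r); first by rewrite addr_ge0 // divr_ge0 // ltW.
move=> t; rewrite -/(F t) -/(F t0) mulrDl; have [tr|rt] := leP `|t - t0| r.
  have := HC (t - t0) tr; rewrite subrKC => /le_trans; apply.
  by rewrite lerDl mulr_ge0 // divr_ge0 // ltW.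
have [L0 d0] := generator_outside W rt.
rewrite {1}/F L0 d0 mulr0 addr0 sub0r normrN -mulrA ler_wpDl ?mulr_ge0 //.
rewrite ler_peMr // mulrC ler_pdivlMr // mul1r; exact: ltW.
Qed.

End Generator.

(** * Pointwise estimate of the drift against a test function *)

Section Pointwise.
Context {R : realType} {p : nat}.
Local Notation pt := 'rV[R]_p.

Lemma sum_le_card (F : 'I_p -> R) (B : R) : (forall i, F i <= B) -> \sum_i F i <= p%:R * B.
Proof.
move=> H; apply: (le_trans (ler_sum _ (fun i _ => H i))).
by rewrite sumr_const card_ord mulr_natl.
Qed.

Lemma norm_sum_le_card (F : 'I_p -> R) (B : R) : (forall i, `|F i| <= B) ->
  `|\sum_i F i| <= p%:R * B.
Proof. by move=> H; apply: (le_trans (ler_norm_sum _ _ _)); exact: sum_le_card. Qed.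

(** Taylor polynomial of [g^-1 Psi_n] at [theta0], component [k], with value [A] and gradient [M];
    [c] will be the Hessian of the deterministic part [g^-1 Psi^theta0] alone. *)
Definition jet (c : 'I_p -> 'I_p -> 'I_p -> R) (A : 'I_p -> R) (M : 'I_p -> 'I_p -> R)
    (h : pt) (k : 'I_p) : R :=
  A k + \sum_i h 0 i * M i k + 2^-1 * \sum_i \sum_j h 0 i * h 0 j * c i j k.

(** [u], [e] and [S] measure the 0-, 1- and 2-jets of the fluctuation. Its second derivatives are
    not in the polynomial, so they are an error of order [(S + e + u) |h|^2]; the cubic term is the
    Taylor remainder of the deterministic part. *)
Definition jet_bound (C0 r u e S : R) c (A : 'I_p -> R) (M : 'I_p -> 'I_p -> R)
    (Phi : pt -> pt) (t0 : pt) :=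
  [/\ forall k, `|A k| <= C0 * u,
      forall i k, `|M i k - (i == k)%:R| <= C0 * (u + e) &
      forall t, `|t - t0| <= r -> forall k,
        `|Phi t 0 k - jet c A M (t - t0) k|
        <= C0 * ((S + e + u) * `|t - t0| ^+ 2 + `|t - t0| ^+ 3)].

Lemma jet_le (C0 r u e S : R) c A M Phi (t0 h : pt) (C2 : R) k :
  0 <= C0 -> 0 <= u -> 0 <= e -> 0 <= C2 ->
  (forall i j k, `|c i j k| <= C2) -> jet_bound C0 r u e S c A M Phi t0 ->
  `|jet c A M h k| <= C0 * u + p%:R * (1 + C0 * (u + e)) * `|h|
                      + p%:R ^+ 2 * C2 * `|h| ^+ 2.
Proof.
move=> C00 u0 e0 C20 Hc [HA HM _]; rewrite /jet.
have hM i : `|M i k| <= 1 + C0 * (u + e).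
  rewrite -[M i k](subrK (i == k)%:R) addrC (le_trans (ler_normD _ _)) // lerD //.
  by case: (i == k); rewrite ?normr1 ?normr0.
rewrite (le_trans (ler_normD _ _)) // lerD //.
  rewrite (le_trans (ler_normD _ _)) // lerD //.
  rewrite -mulrA; apply: norm_sum_le_card => i.
  by rewrite normrM mulrC ler_pM //; exact: coord_le_norm.
rewrite normrM ger0_norm //; apply: (le_trans (ler_piMl _ _)) => //.
  by rewrite invf_le1 // ler1n.
have -> : p%:R ^+ 2 * C2 * `|h| ^+ 2 = p%:R * (p%:R * (C2 * `|h| ^+ 2)) by rewrite expr2 !mulrA.
apply: norm_sum_le_card => i; apply: norm_sum_le_card => j.
by rewrite !normrM mulrC ler_pM // expr2 ler_pM //; exact: coord_le_norm.
Qed.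

(** The decisive point is the first term: its coefficient does not involve [C1], which depends on
    the truncation radius. It arises from the error [C0 * S * |h|^2] against the gradient bound
    [2 |h|^m], summed over [p] components. [C1] enters only [K], which comes with a factor [e + u]
    or one more power of [|h|]. *)
Lemma drift_test_bound (D C0 C1 C2 : R) (m : nat) : 0 <= D -> 0 <= C0 -> 0 <= C1 -> 0 <= C2 ->
  exists2 K : R, 0 <= K & forall (r u e S : R) c A M Phi (t0 : pt) (df dq : 'I_p -> pt -> R),
  0 <= u -> 0 <= e -> 0 <= S -> (forall i j k, `|c i j k| <= C2) ->
  jet_bound C0 r u e S c A M Phi t0 ->
  (forall j t, r < `|t - t0| -> df j t = 0) ->
  (forall j t, `|dq j t| <= 2 * `|t - t0| ^+ m) ->
  (forall j t, `|t - t0| <= D -> `|df j t - dq j t| <= C1 * `|t - t0| ^+ m.+2) ->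
  forall t, `|t - t0| <= D ->
  `|\sum_j Phi t 0 j * df j t - \sum_j jet c A M (t - t0) j * dq j t|
  <= 2 * p%:R * C0 * S * `|t - t0| ^+ m.+2
     + K * ((e + u) * `|t - t0| ^+ m.+2 + (1 + S + e + u) * `|t - t0| ^+ m.+3).
Proof.
move=> D0 C00 C10 C20.
pose K := 2 * C0 + C0 * C1 + 2 * C0 + C0 * C1 * D + C0 * C1 * D ^+ 2 + p%:R * C1
          + p%:R * C0 * C1 + p%:R ^+ 2 * C1 * C2 * D.
have K0 : 0 <= K by rewrite /K !addr_ge0 // !mulr_ge0 // ?exprn_ge0 // ?ler0n.
exists (p%:R * K); first by rewrite mulr_ge0.
move=> r u e S c A M Phi t0 df dq u0 e0 S0 Hc J Hdf Hdq Hd t tD.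
set x := `|t - t0|; have x0 : 0 <= x := normr_ge0 _.
rewrite -sumrB.
pose b := C0 * ((S + e + u) * x ^+ 2 + x ^+ 3) * (2 * x ^+ m + C1 * x ^+ m.+2)
  + (C0 * u + p%:R * (1 + C0 * (u + e)) * x + p%:R ^+ 2 * C2 * x ^+ 2) * (C1 * x ^+ m.+2).
have b1 : 0 <= C0 * ((S + e + u) * x ^+ 2 + x ^+ 3).
  by rewrite mulr_ge0 // addr_ge0 ?exprn_ge0 // mulr_ge0 ?exprn_ge0 // !addr_ge0.
have Hb j : `|Phi t 0 j * df j t - jet c A M (t - t0) j * dq j t| <= b.
  have -> : Phi t 0 j * df j t - jet c A M (t - t0) j * dq j t =
    (Phi t 0 j - jet c A M (t - t0) j) * df j t + jet c A M (t - t0) j * (df j t - dq j t).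
    by move: (Phi t 0 j) (jet _ _ _ _ _) (df j t) (dq j t) => y1 y2 y3 y4; ring.
  rewrite (le_trans (ler_normD _ _)) // !normrM lerD //; last first.
    by apply: ler_pM => //; [exact: (jet_le _ _ C00 u0 e0 C20 Hc J)|exact: Hd].
  (* Outside the [r]-ball nothing is known about [Phi], but [df] vanishes there. *)
  have [xr|rx] := leP x r; last first.
    by rewrite Hdf // normr0 mulr0 mulr_ge0 // addr_ge0 // mulr_ge0 // exprn_ge0.
  have [_ _ HJ] := J.
  apply: ler_pM => //; first exact: HJ.
  rewrite -[df j t](subrK (dq j t)) (le_trans (ler_normD _ _)) // addrC lerD //.
  exact: Hd.
apply: (le_trans (norm_sum_le_card Hb)).
suff : b <= 2 * C0 * S * x ^+ m.+2 + K * ((e + u) * x ^+ m.+2 + (1 + S + e + u) * x ^+ m.+3).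
  move=> /(ler_wpM2l (ler0n _ p))/le_trans; apply.
  have key (q k y1 y2 s v w : R) :
    q * (2 * C0 * s * y1 + k * (v * y1 + w * y2)) = 2 * q * C0 * s * y1 + q * k * (v * y1 + w * y2).
    by ring.
  by rewrite key.
have -> : b = x ^+ m.+2 * (C0 * ((S + e + u) + x) * (2 + C1 * x ^+ 2)
  + (C0 * u + p%:R * (1 + C0 * (u + e)) * x + p%:R ^+ 2 * C2 * x ^+ 2) * C1).
  rewrite /b -[m.+2]addn2 exprD; move: (x ^+ m) (p%:R : R) => y q; ring.
have -> : 2 * C0 * S * x ^+ m.+2 + K * ((e + u) * x ^+ m.+2 + (1 + S + e + u) * x ^+ m.+3)
  = x ^+ m.+2 * (2 * C0 * S + K * ((e + u) + (1 + S + e + u) * x)).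
  rewrite [x ^+ m.+3]exprSr.
  have key (k y s v w z : R) : 2 * C0 * s * y + k * (v * y + w * (y * z))
    = y * (2 * C0 * s + k * (v + w * z)) by ring.
  exact: key.
apply: ler_wpM2l; first exact: exprn_ge0.
have xD : x <= D by [].
clearbody x; clear -x0 xD u0 e0 S0 C00 C10 C20 D0.
have q0 := ler0n R p; rewrite /K; move: (p%:R : R) q0 => q q0.
set w := 1 + S + e + u; have w1 : 1 <= w by rewrite /w -!addrA lerDl !addr_ge0.
have w0 : 0 <= w by apply: le_trans w1.
have xx : x ^+ 2 <= D * x by rewrite expr2 ler_wpM2r.
have xxx : x ^+ 3 <= D ^+ 2 * x.
  by rewrite exprSr ler_wpM2r // !expr2 ler_pM.
have xw : x <= w * x by rewrite ler_peMl.
have uex : (u + e) * x <= w * x by rewrite ler_wpM2r // /w; lra.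
have suex : (S + e + u) * x ^+ 2 <= D * (w * x).
  rewrite [leRHS]mulrCA; apply: ler_pM; [by rewrite !addr_ge0|exact: exprn_ge0| |exact: xx].
  by rewrite /w; lra.
have xx' : x ^+ 2 <= D * (w * x) by rewrite (le_trans xx) // ler_wpM2l.
have xxx' : x ^+ 3 <= D ^+ 2 * (w * x) by rewrite (le_trans xxx) // ler_wpM2l // exprn_ge0.
have C01 : 0 <= C0 * C1 by rewrite mulr_ge0.
have T1 := ler_wpM2l (mulr_ge0 (ler0n R 2) C00) xw.
have T2 := ler_wpM2l C01 suex.
have T3 := ler_wpM2l C01 xxx'.
have T4 := ler_wpM2l (mulr_ge0 q0 C10) xw.
have T5 := ler_wpM2l (mulr_ge0 q0 C01) uex.
have T6 := ler_wpM2l (mulr_ge0 (mulr_ge0 (exprn_ge0 2 q0) C10) C20) xx'.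
have eu0 : 0 <= e + u by rewrite addr_ge0.
have wx0 : 0 <= w * x by rewrite mulr_ge0.
have P1 : 0 <= (2 * C0 + C0 * C1 * D + C0 * C1 * D ^+ 2 + q * C1 + q * C0 * C1 + q ^+ 2 * C1 * C2 * D) * (e + u).
  by rewrite mulr_ge0 // !addr_ge0 // !mulr_ge0 // ?exprn_ge0.
have P2 : 0 <= (2 * C0 + C0 * C1) * (w * x) by rewrite mulr_ge0 // !addr_ge0 // mulr_ge0.
have P3 : C0 * C1 * u <= C0 * C1 * (e + u) by rewrite ler_wpM2l // lerDr.
move: (w * x) T1 T2 T3 T4 T5 T6 P2 wx0 => W T1 T2 T3 T4 T5 T6 P2 wx0.
lra.
Qed.

End Pointwise.

Section Monomials.
Context {R : realType} {p : nat}.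
Local Notation pt := 'rV[R]_p.

Lemma partial_coord (t0 : pt) k j t : partial j (fun s => (s - t0) 0 k) t = (j == k)%:R.
Proof.
have df (s : pt) : differentiable (fun s : pt => s 0 k) s by exact: differentiable_coord.
have -> : (fun s : pt => (s - t0) 0 k) = fun s => s 0 k + cst (- t0 0 k) s.
  by apply/funext => s; rewrite !mxE.
have dc : differentiable (cst (- t0 0 k) : pt -> R) t by exact: differentiable_cst.
rewrite partialD //.
rewrite partial_cst addr0 /partial.
have := derive_mx (@derivable_id _ _ t (evec j)); rewrite derive_id => /matrixP/(_ 0 k).
by rewrite [in X in _ = X -> _]mxE => <-; rewrite !mxE eqxx /= eq_sym.
Qed.

Lemma coord_sub_Ck n U (t0 : pt) k : open U -> Ck n U (fun s => (s - t0) 0 k).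
Proof.
move=> oU; apply: (Ck_eq (f := fun s => s 0 k - cst (t0 0 k) s) oU).
  by move=> s _; rewrite !mxE.
by apply: CkB => //; [exact: Ck_coord|exact: Ck_cst].
Qed.

Lemma partial_coord2 (t0 : pt) k l j t :
  partial j (fun s => (s - t0) 0 k * (s - t0) 0 l) t
  = (j == k)%:R * (t - t0) 0 l + (t - t0) 0 k * (j == l)%:R.
Proof.
have d a : differentiable (fun s : pt => (s - t0) 0 a) t.
  exact: Ck_diff (coord_sub_Ck 0 t0 a openT) I.
by rewrite partialM // !partial_coord.
Qed.

Lemma norm_pow_continuous (t0 : pt) d : continuous (fun t : pt => `|t - t0| ^+ d).
Proof.
move=> t; apply: (@continuous_comp _ _ _ (fun t : pt => `|t - t0|) (fun x => x ^+ d)).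
  exact: norm_sub_continuous.
exact: exprn_continuous.
Qed.

Lemma Ck_continuousT n (f : pt -> R) : Ck n setT f -> continuous f.
Proof. by move=> Cf t; exact: (Ck_continuous Cf I). Qed.

Lemma contD (f h : pt -> R) : continuous f -> continuous h -> continuous (fun t : pt => f t + h t).
Proof. by move=> cf ch t; apply: (cvgD (cf t) (ch t)). Qed.

Lemma contM (f h : pt -> R) : continuous f -> continuous h -> continuous (fun t : pt => f t * h t).
Proof. by move=> cf ch t; apply: (cvgM (cf t) (ch t)). Qed.

Lemma contZ (k : R) (f : pt -> R) : continuous f -> continuous (fun t : pt => k * f t).
Proof. by move=> cf; apply: contM => // t; exact: cst_continuous. Qed.

Lemma contB (f h : pt -> R) : continuous f -> continuous h -> continuous (fun t : pt => f t - h t).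
Proof. by move=> cf ch t; apply: (cvgB (cf t) (ch t)). Qed.

Lemma cont_norm (f : pt -> R) : continuous f -> continuous (fun t : pt => `|f t|).
Proof. by move=> cf t; apply: (cvg_norm (cf t)). Qed.

Lemma cont_sum (I : Type) (r : seq I) (F : I -> pt -> R) : (forall i, continuous (F i)) ->
  continuous (fun t : pt => \sum_(i <- r) F i t).
Proof.
move=> cF; elim: r => [|i r IH].
  by under eq_fun do rewrite big_nil; move=> t; exact: cst_continuous.
by under eq_fun do rewrite big_cons; exact: contD.
Qed.

Lemma bool_norm_le1 (b : bool) : `|b%:R| <= 1 :> R.
Proof. by case: b; rewrite ?normr1 ?normr0. Qed.

End Monomials.

Section Moments.
Context {R : realType} {p : nat}.
Local Notation pt := 'rV[R]_p.
Context {Theta : set pt} (cT : compact Theta) {g : pt -> 'M[R]_p} (hg : metric_on Theta g).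
Context {nabla : connection R p} (cn : connection_on Theta nabla) (nu : pt -> pt).
Local Notation IT := (interior Theta).
Context {t0 : pt} (It : IT t0) {r0 : R} (rI : cball t0 r0 `<=` IT)
  {D : R} (D0 : 0 <= D) (TD : Theta `<=` cball t0 D).
Context (tau : R) (V : pt -> pt) (sV : smoothv_near Theta V).
Context (C0 C2 : R) (C00 : 0 <= C0) (C20 : 0 <= C2)
  (c : 'I_p -> 'I_p -> 'I_p -> R) (Hc : forall i j k, `|c i j k| <= C2).

Let oI : open IT. Proof. exact: open_interior. Qed.

Definition reg_drift (a : R) (al : pt -> pt) : pt -> pt :=
  fun t => - a ^- 2 *: sharp g t (al t) + V t.

Definition Nmom (m : probability (borelV R p) R) d := mI Theta m (fun t => `|t - t0| ^+ d).

Lemma Nmom_ge0 (m : probability (borelV R p) R) d : m Theta = 1%E -> 0 <= Nmom m d.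
Proof.
move=> mT; rewrite -(mI_cst cT mT 0); apply: (mI_le cT mT) => //.
- by move=> t; exact: cst_continuous.
- exact: norm_pow_continuous.
- by move=> t _; rewrite exprn_ge0.
Qed.

Lemma mIB (m : probability (borelV R p) R) (f h : pt -> R) : m Theta = 1%E ->
  continuous f -> continuous h ->
  mI Theta m (fun t => f t - h t) = mI Theta m f - mI Theta m h.
Proof.
move=> mT cf ch; have cn1 := @contZ R p (-1) h ch.
rewrite -[in RHS]mulN1r -(mIZ cT mT (-1) ch) -(mID cT mT cf cn1).
by apply: mI_eq => t _; rewrite mulN1r.
Qed.

Lemma mI_norm_le (m : probability (borelV R p) R) (f : pt -> R) (b1 b2 b3 : R) d1 d2 d3 :
  m Theta = 1%E -> continuous f ->
  (forall t, Theta t -> `|f t| <= b1 * `|t - t0| ^+ d1 + b2 * `|t - t0| ^+ d2 + b3 * `|t - t0| ^+ d3) ->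
  `|mI Theta m f| <= b1 * Nmom m d1 + b2 * Nmom m d2 + b3 * Nmom m d3.
Proof.
move=> mT cf H.
have cN b d : continuous (fun t : pt => b * `|t - t0| ^+ d) by apply: contZ; exact: norm_pow_continuous.
have cN' d : continuous (fun t : pt => `|t - t0| ^+ d) by exact: norm_pow_continuous.
have cN2 : continuous (fun t : pt => b1 * `|t - t0| ^+ d1 + b2 * `|t - t0| ^+ d2) by exact: contD.
rewrite /Nmom -!(mIZ cT mT) // -(mID cT mT) // -(mID cT mT) //.
apply: (le_trans (mI_norm cT mT cf)); apply: (mI_le cT mT) => //; first exact: cont_norm.
exact: contD.
Qed.

(** Twice the generator without its [a_n^-2] drift, applied to [q] at [t0]. *)
Definition Q0 (q : pt -> R) : R :=
  tau * (\sum_i \sum_j ginv g t0 i j *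
    (partial i (partial j q) t0 - \sum_k partial k q t0 * nabla t0 i j 0 k))
  + \sum_i V t0 0 i * partial i q t0.

Lemma jet_Ck n (A : 'I_p -> R) M k : Ck n setT (fun t => jet c A M (t - t0) k).
Proof.
have oT : open [set: pt] by exact: openT.
rewrite /jet; apply: CkD => //; first apply: CkD => //.
- exact: (Ck_cst n _ (A k)).
- apply: Ck_sum => // i; apply: CkM => //; [exact: coord_sub_Ck|exact: (Ck_cst n _ (M i k))].
- apply: CkZ => //; apply: Ck_sum => // i; apply: Ck_sum => // j; apply: CkM => //; last exact: (Ck_cst n _ (c i j k)).
  by apply: CkM => //; exact: coord_sub_Ck.
Qed.

(** Twice the generator is [F - a^-2 Phi] with [F] free of [a], so stationarity gives
    [mI (Phi f) = a^2 * mI F]. On the left [Phi f] is replaced by the jet against the gradient of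
    [q], on the right [F] by its value at [t0], which is [Q0 q] because [f] and [q] share their
    2-jet. [K] depends on [r]; the coefficient of [S] does not. *)
Lemma test_moment (r : R) q (d : nat) : 0 < r -> r <= r0 ->
  (forall n, Ck n setT q) -> q t0 = 0 ->
  (forall t, `|q t| <= `|t - t0| ^+ d.+1) ->
  (forall j t, `|partial j q t| <= 2 * `|t - t0| ^+ d) ->
  exists2 K : R, 0 <= K & forall (m : probability (borelV R p) R) (al : pt -> pt) (a u e S : R) A M,
    m Theta = 1%E -> 0 < a -> (forall i, Ck 0 IT (fun t => al t 0 i)) ->
    invariant_prob Theta g nabla nu tau (reg_drift a al) m ->
    0 <= u -> 0 <= e -> 0 <= S ->
    jet_bound C0 r u e S c A M (fun t => sharp g t (al t)) t0 ->
    `|mI Theta m (fun t => \sum_j jet c A M (t - t0) j * partial j q t) - a ^+ 2 * Q0 q|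
    <= 2 * p%:R * C0 * S * Nmom m d.+2
     + K * ((e + u) * Nmom m d.+2 + (1 + S + e + u) * Nmom m d.+3 + a ^+ 2 * Nmom m 1).
Proof.
move=> rp rr0 Cq q0 Hq Hdq.
have rI' : cball t0 r `<=` IT by move=> t tr; apply: rI; exact: le_trans rr0.
have [f [sf f0 df0 ddf0 [C1 C10 HC1]]] := test_function D rp Cq q0 Hq Hdq.
have [K1 K10 HK1] := @drift_test_bound R p D C0 C1 C2 d D0 C00 C10 C20.
have [K2 K20 HK2] := drift_free_lipschitz hg cn rp rI' sf f0 tau sV.
exists (K1 + K2); first exact: addr_ge0.
move=> m al a u e S A M mT a0 Cal inv u0 e0 S0 J.
pose Phi t := sharp g t (al t).
have CPhi i : Ck 0 IT (fun t => Phi t 0 i) by apply: (sharp_Ck hg).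
pose F t := tau * laplace g nabla f t + dirder V f t.
have CV i : Ck 0 IT (fun t => V t 0 i) by exact: smoothv_near_Ck.
have cF : continuous F.
  apply: (outside_continuous rI').
    apply: CkD => //; first by apply: CkZ => //; exact: (laplace_Ck hg cn).
    exact: dirder_Ck.
  move=> t rt; rewrite /F; have [-> ->] := generator_outside (g := g) (nabla := nabla) sf f0 V rt.
  by rewrite mulr0 addr0.
have cP : continuous (dirder Phi f).
  apply: (outside_continuous rI'); first exact: dirder_Ck.
  by move=> t rt; have [_ ->] := generator_outside (g := g) (nabla := nabla) sf f0 Phi rt.
have difff t : differentiable f t by apply: (sf [::]).
have genE t : generator g nabla tau (reg_drift a al) f t
   = 2^-1 * (F t + (- a ^- 2) * dirder Phi f t).
  rewrite /generator /F !dirderE //.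
  rewrite (eq_bigr (fun i => - a ^- 2 * (Phi t 0 i * partial i f t) + V t 0 i * partial i f t)).
    by rewrite big_split -mulr_sumr /=; move: (laplace _ _ _ _) (\sum_i _) (\sum_i _) => x y z; ring.
  by move=> i _; rewrite !mxE mulrDl mulrA.
have CW i : Ck 0 IT (fun t => reg_drift a al t 0 i).
  apply: (Ck_eq (f := fun t => - a ^- 2 * Phi t 0 i + V t 0 i) oI).
    by move=> t _; rewrite !mxE.
  by apply: CkD => //; apply: CkZ.
have gen0 : mI Theta m (generator g nabla tau (reg_drift a al) f) = 0.
  apply: (invariant_generator0 cT _ _ _ _ inv).
  - by exists setT; split => //; exact: openT.
  - move=> t [Tt nIt].
    have rt : r < `|t - t0|.
      by rewrite ltNge; apply/negP => tr; apply: nIt; exact: rI'.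
    by have [_ ->] := generator_outside (g := g) (nabla := nabla) sf f0 nu rt.
  - by move=> t; apply: differentiable_continuous.
  - exact: (generator_continuous hg cn rI' sf f0).
have E1 : mI Theta m (dirder Phi f) = a ^+ 2 * mI Theta m F.
  move: gen0; rewrite (_ : generator g nabla tau _ f = fun t => 2^-1 * (F t + (- a ^- 2) * dirder Phi f t)); last exact/funext.
  have cP' : continuous (fun t : pt => - a ^- 2 * dirder Phi f t) by exact: contZ.
  rewrite (mIZ cT mT 2^-1 (contD cF cP')) (mID cT mT cF cP') (mIZ cT mT _ cP).
  set x := mI Theta m F; set y := mI Theta m _.
  move=> /eqP; rewrite mulf_eq0 invr_eq0 pnatr_eq0 /= => /eqP H.
  have a2 : a ^+ 2 != 0 by rewrite expf_neq0 // gt_eqF.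
  have : a ^+ 2 * (x + - a ^- 2 * y) = 0 by rewrite H mulr0.
  by rewrite mulrDr mulNr mulrN mulrA divff // mul1r => /subr0_eq.
pose J0 t := \sum_j jet c A M (t - t0) j * partial j q t.
have cJ : continuous J0.
  apply: cont_sum => j; apply: contM; first exact: (Ck_continuousT (jet_Ck 0 A M j)).
  exact: (Ck_continuousT (Ck_partial j (Cq 1%N))).
have FQ : F t0 = Q0 q.
  have e1 : laplace g nabla f t0 = \sum_i \sum_j ginv g t0 i j *
    (partial i (partial j q) t0 - \sum_k partial k q t0 * nabla t0 i j 0 k).
    rewrite laplaceE; apply: eq_bigr => i _; apply: eq_bigr => j _; rewrite ddf0.
    by under eq_bigr do rewrite df0.
  have e2 : dirder V f t0 = \sum_i V t0 0 i * partial i q t0.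
    by rewrite dirderE //; apply: eq_bigr => i _; rewrite df0.
  by rewrite /F /Q0 e1 e2.
have B1 : `|mI Theta m J0 - mI Theta m (dirder Phi f)| <=
   0 * Nmom m 0 + (2 * p%:R * C0 * S + K1 * (e + u)) * Nmom m d.+2
   + (K1 * (1 + S + e + u)) * Nmom m d.+3.
  rewrite -(mIB mT cJ cP); apply: mI_norm_le => //; first exact: (contB cJ cP).
  move=> t Tt; rewrite distrC (dirderE Phi (difff t)).
  have Hdf0 j s : r < `|s - t0| -> partial j f s = 0.
    by move=> rs; have [-> _] := partial_outside f0 rs.
  have := HK1 r u e S c A M Phi t0 (fun j t => partial j f t) (fun j t => partial j q t)
    u0 e0 S0 Hc J Hdf0 Hdq HC1 t (TD Tt).
  move=> H; apply: (le_trans H); rewrite mul0r add0r.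
  move: (_ ^+ d.+2) (_ ^+ d.+3) => x y.
  by rewrite le_eqVlt; apply/orP; left; apply/eqP; ring.
have B2 : `|mI Theta m F - F t0| <= 0 * Nmom m 0 + 0 * Nmom m 0 + K2 * Nmom m 1.
  have cc : continuous (cst (F t0) : pt -> R) by move=> t; exact: cst_continuous.
  have -> : mI Theta m F - F t0 = mI Theta m (fun t => F t - cst (F t0) t).
    by rewrite (mIB mT cF cc) (mI_cst cT mT).
  apply: mI_norm_le => //; first exact: (contB cF cc).
  by move=> t _; rewrite !mul0r !add0r expr1; exact: HK2.
rewrite -FQ (_ : _ - _ = (mI Theta m J0 - mI Theta m (dirder Phi f)) + a ^+ 2 * (mI Theta m F - F t0)); last first.
  by rewrite E1; move: (mI _ _ _) (mI _ _ _) (F t0) => x y z; ring.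
apply: (le_trans (ler_normD _ _)).
have a20 : 0 <= a ^+ 2 by rewrite exprn_ge0 // ltW.
rewrite [X in _ + X <= _]normrM (ger0_norm a20).
apply: (le_trans (lerD B1 (ler_wpM2l a20 B2))).
have N1 := Nmom_ge0 d.+2 mT; have N2 := Nmom_ge0 d.+3 mT; have N3 := Nmom_ge0 1 mT.
have T1 : 0 <= K2 * ((e + u) * Nmom m d.+2 + (1 + S + e + u) * Nmom m d.+3).
  by rewrite mulr_ge0 // addr_ge0 // mulr_ge0 // !addr_ge0.
have T2 : 0 <= K1 * (a ^+ 2 * Nmom m 1) by apply: mulr_ge0 => //; exact: mulr_ge0.
move: (Nmom m d.+2) (Nmom m d.+3) (Nmom m 1) T1 T2 => x y z T1 T2.
by move: (a ^+ 2) (p%:R : R) T2 => a2 q' T2; lra.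
Qed.

Definition H1m (m : probability (borelV R p) R) k := mI Theta m (fun t => (t - t0) 0 k).
Definition H2m (m : probability (borelV R p) R) k l :=
  mI Theta m (fun t => (t - t0) 0 k * (t - t0) 0 l).

Lemma cont_coord k : continuous (fun t : pt => (t - t0) 0 k).
Proof. exact: (Ck_continuousT (coord_sub_Ck 0 t0 k openT)). Qed.

Lemma mI_jet (m : probability (borelV R p) R) A M k : m Theta = 1%E ->
  mI Theta m (fun t => jet c A M (t - t0) k) =
  A k + \sum_i H1m m i * M i k + 2^-1 * \sum_i \sum_j H2m m i j * c i j k.
Proof.
move=> mT; have ch := cont_coord.
have ch2 i j : continuous (fun t : pt => (t - t0) 0 i * (t - t0) 0 j) by exact: contM.
have c1 i : continuous (fun t : pt => (t - t0) 0 i * M i k).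
  by under eq_fun do rewrite mulrC; exact: contZ.
have c2 i j : continuous (fun t : pt => (t - t0) 0 i * (t - t0) 0 j * c i j k).
  by under eq_fun do rewrite mulrC; exact: contZ.
rewrite /jet (mID cT mT); last 2 first.
- apply: contD; last by apply: cont_sum => i.
  by move=> t; exact: cst_continuous.
- by apply: contZ; do 2!apply: cont_sum => ?.
rewrite (mID cT mT); last 2 first.
- by move=> t; exact: cst_continuous.
- exact: cont_sum.
rewrite (mI_cst cT mT) (mIZ cT mT); last by do 2!apply: cont_sum => ?.
rewrite !(mI_sum cT mT) //; last by move=> i; exact: cont_sum.
congr (_ + _ + _ * _).
  by apply: eq_bigr => i _; under eq_fun do rewrite mulrC; rewrite (mIZ cT mT) // mulrC.
apply: eq_bigr => i _; rewrite (mI_sum cT mT) //; apply: eq_bigr => j _.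
by under eq_fun do rewrite mulrC; rewrite (mIZ cT mT) // mulrC.
Qed.

(** The value of [Q0] on a coordinate function; this is where [V - tau * Gamma^nabla[g^-1]] in the
    expansion comes from. *)
Definition vconst k : R := V t0 0 k - tau * gamma_contract nabla t0 (ginv g t0) 0 k.

Lemma Q0_coord k : Q0 (fun s => (s - t0) 0 k) = vconst k.
Proof.
rewrite /Q0 /vconst addrC; congr (_ + _).
  rewrite (bigD1 k) //= partial_coord eqxx mulr1 big1 ?addr0 //.
  by move=> i /negbTE ik; rewrite partial_coord ik mulr0.
rewrite -mulrN; congr (_ * _).
rewrite /gamma_contract summxE -sumrN; apply: eq_bigr => i _.
rewrite summxE -sumrN; apply: eq_bigr => j _; rewrite !mxE -mulrN; congr (_ * _).
have -> : partial j (fun s : pt => (s - t0) 0 k) = cst (j == k)%:R.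
  by apply/funext => s; exact: partial_coord.
rewrite partial_cst sub0r; congr (- _).
rewrite (bigD1 k) //= partial_coord eqxx mul1r big1 ?addr0 //.
by move=> l /negbTE lk; rewrite partial_coord lk mul0r.
Qed.

Lemma Q0_coord2 k l : Q0 (fun s => (s - t0) 0 k * (s - t0) 0 l) = 2 * tau * ginv g t0 k l.
Proof.
have Tt := interior_subset It.
rewrite /Q0 [X in _ + X]big1 ?addr0; last first.
  by move=> i _; rewrite partial_coord2 subrr !mxE mulr0 mul0r addr0 mulr0.
rewrite [2 * tau]mulrC -mulrA; congr (_ * _).
transitivity (\sum_i \sum_j ginv g t0 i j * ((j == k)%:R * (i == l)%:R + (i == k)%:R * (j == l)%:R)).
  apply: eq_bigr => i _; apply: eq_bigr => j _; congr (_ * _).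
  rewrite [X in _ - X]big1 ?subr0; last first.
    by move=> a _; rewrite partial_coord2 subrr !mxE mulr0 mul0r addr0 mul0r.
  have -> : partial j (fun s : pt => (s - t0) 0 k * (s - t0) 0 l) =
    fun t => cst (j == k)%:R t * (t - t0) 0 l + (t - t0) 0 k * cst (j == l)%:R t.
    by apply/funext => s; exact: partial_coord2.
  have d a : differentiable (fun s : pt => (s - t0) 0 a) t0.
    exact: Ck_diff (coord_sub_Ck 0 t0 a openT) I.
  have dc (b : R) : differentiable (cst b : pt -> R) t0 by exact: differentiable_cst.
  rewrite partialD; [|exact: differentiableM|exact: differentiableM].
  by rewrite !partialM // !partial_coord !partial_cst subrr !mxE /= !(mul0r, mulr0, add0r, addr0).
have key (a b : 'I_p) : \sum_i \sum_j ginv g t0 i j * ((j == a)%:R * (i == b)%:R) = ginv g t0 b a.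
  rewrite (bigD1 b) //= [X in _ + X]big1 ?addr0; last first.
    by move=> i /negbTE ib; rewrite big1 // => j _; rewrite ib !mulr0.
  rewrite (bigD1 a) //= big1 ?addr0 ?eqxx ?mulr1 //.
  by move=> j /negbTE ja; rewrite ja mul0r mulr0.
rewrite (eq_bigr (fun i => \sum_j ginv g t0 i j * ((j == k)%:R * (i == l)%:R)
   + \sum_j ginv g t0 i j * ((j == l)%:R * (i == k)%:R))); last first.
  by move=> i _; rewrite -big_split; apply: eq_bigr => j _; rewrite /= mulrDr [(i == k)%:R * _]mulrC.
by rewrite big_split /= !key (ginv_sym hg _ _ Tt) mulr2n mulrDl mul1r.
Qed.

End Moments.

(** * Moment equations *)

(** Making a finite family of bounds uniform enlarges only the constant in front of [X]; the term
    [B], which will hold the [S]-term, keeps its coefficient. *)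
Lemma uniform_constant {R : realType} (I : finType) (T : Type) (Q : T -> Prop)
    (L : I -> T -> R) (B X : T -> R) :
  (forall x, Q x -> 0 <= X x) ->
  (forall k, exists2 K : R, 0 <= K & forall x, Q x -> L k x <= B x + K * X x) ->
  exists2 K : R, 0 <= K & forall k x, Q x -> L k x <= B x + K * X x.
Proof.
move=> X0 H.
have {}H (k : I) : exists K : R, 0 <= K /\ forall x, Q x -> L k x <= B x + K * X x.
  by have [K ? ?] := H k; exists K.
have [K HK] := choice H.
have K0 k : 0 <= K k by have [] := HK k.
exists (\sum_k K k); first exact: sumr_ge0.
move=> k x Qx; have [_ /(_ x Qx)/le_trans] := HK k; apply.
by rewrite lerD2l ler_wpM2r ?X0 // (bigD1 k) //= lerDl sumr_ge0.
Qed.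

Section MomentBounds.
Context {R : realType} {p : nat}.
Local Notation pt := 'rV[R]_p.
Context {Theta : set pt} (cT : compact Theta) {g : pt -> 'M[R]_p} (hg : metric_on Theta g).
Context {nabla : connection R p} (cn : connection_on Theta nabla) (nu : pt -> pt).
Local Notation IT := (interior Theta).
Context {t0 : pt} (It : IT t0) {r0 : R} (rI : cball t0 r0 `<=` IT)
  {D : R} (D0 : 0 <= D) (TD : Theta `<=` cball t0 D).
Context (tau : R) (V : pt -> pt) (sV : smoothv_near Theta V).
Context (C0 C2 : R) (C00 : 0 <= C0) (C20 : 0 <= C2)
  (c : 'I_p -> 'I_p -> 'I_p -> R) (Hc : forall i j k, `|c i j k| <= C2).
Local Notation N m d := (Nmom (Theta := Theta) (t0 := t0) m d).
Local Notation H1 m := (H1m (Theta := Theta) (t0 := t0) m).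
Local Notation H2 m := (H2m (Theta := Theta) (t0 := t0) m).
Local Notation v := (vconst (g := g) (nabla := nabla) (t0 := t0) tau V).
Local Notation G := (ginv g t0).

(** The part of the error of [test_moment], at [d = 0], that carries an [r]-dependent constant. *)
Definition xi (m : probability (borelV R p) R) (a u e S : R) : R :=
  (e + u) * N m 2 + (1 + S + e + u) * N m 3 + a ^+ 2 * N m 1.

Lemma NmomS (m : probability (borelV R p) R) d : m Theta = 1%E -> N m d.+1 <= D * N m d.
Proof.
move=> mT; rewrite /Nmom -(mIZ cT mT) ?(mI_le cT mT) //.
- exact: norm_pow_continuous.
- by apply: contZ; exact: norm_pow_continuous.
- by move=> t Tt; rewrite exprS ler_wpM2r // ?exprn_ge0 //; exact: TD.
- exact: norm_pow_continuous.
Qed.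

Lemma xi_ge0 (m : probability (borelV R p) R) (a u e S : R) : m Theta = 1%E -> 0 <= u -> 0 <= e -> 0 <= S -> 0 <= xi m a u e S.
Proof.
move=> mT u0 e0 S0; rewrite /xi !addr_ge0 // mulr_ge0 ?Nmom_ge0 // ?addr_ge0 //.
by rewrite sqr_ge0.
Qed.

Lemma jet_coord_bound (r u e S : R) A M Phi (k l : 'I_p) (t : pt) : 0 <= u -> 0 <= e ->
  jet_bound C0 r u e S c A M Phi t0 ->
  `|jet c A M (t - t0) k * (t - t0) 0 l - (A k * (t - t0) 0 l + (t - t0) 0 k * (t - t0) 0 l)|
  <= p%:R * C0 * (u + e) * `|t - t0| ^+ 2 + p%:R ^+ 2 * C2 * `|t - t0| ^+ 3.
Proof.
move=> u0 e0 [HA HM _]; set h := t - t0.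
have -> : jet c A M h k * h 0 l - (A k * h 0 l + h 0 k * h 0 l)
   = (\sum_i h 0 i * (M i k - (i == k)%:R)) * h 0 l
     + 2^-1 * (\sum_i \sum_j h 0 i * h 0 j * c i j k) * h 0 l.
  have -> : \sum_i h 0 i * (M i k - (i == k)%:R) = \sum_i h 0 i * M i k - h 0 k.
    under eq_bigr do rewrite mulrBr.
    rewrite sumrB; congr (_ - _); rewrite (bigD1 k) //= eqxx mulr1 big1 ?addr0 //.
    by move=> i /negbTE ->; rewrite mulr0.
  by rewrite /jet; move: (\sum_i _) (\sum_i _) => x y; ring.
have hl : `|h 0 l| <= `|h| by exact: coord_le_norm.
rewrite (le_trans (ler_normD _ _)) // !normrM lerD //.
  rewrite expr2 mulrA ler_pM //.
  rewrite -mulrA -mulrA; apply: norm_sum_le_card => i.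
  by rewrite normrM mulrC mulrA ler_pM //; exact: coord_le_norm.
rewrite [`|h| ^+ 3]exprSr mulrA; apply: ler_pM => //.
rewrite ger0_norm //; apply: (le_trans (ler_piMl _ _)) => //.
  by rewrite invf_le1 // ler1n.
have -> : p%:R ^+ 2 * C2 * `|h| ^+ 2 = p%:R * (p%:R * (C2 * `|h| ^+ 2)) by rewrite expr2 !mulrA.
apply: norm_sum_le_card => i; apply: norm_sum_le_card => j.
by rewrite !normrM mulrC ler_pM // expr2 ler_pM //; exact: coord_le_norm.
Qed.

(* One realisation of the data at a fixed sample point: the invariant probability, the
   random one-form, the scale [a_n], the size of the 0-, 1- and 2-jets of the fluctuation
   and the 1-jet of the dual vector field. *)
Record datum := Datum {
  d_m : probability (borelV R p) R; d_al : pt -> pt;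
  d_a : R; d_u : R; d_e : R; d_S : R;
  d_A : 'I_p -> R; d_M : 'I_p -> 'I_p -> R }.

Definition valid (r : R) (x : datum) :=
  [/\ d_m x Theta = 1%E, 0 < d_a x, forall i, Ck 0 IT (fun t => d_al x t 0 i),
    invariant_prob Theta g nabla nu tau (reg_drift (g := g) V (d_a x) (d_al x)) (d_m x) &
    [/\ 0 <= d_u x, 0 <= d_e x, 0 <= d_S x &
      jet_bound C0 r (d_u x) (d_e x) (d_S x) c (d_A x) (d_M x)
        (fun t => sharp g t (d_al x t)) t0]].

Local Notation XI x := (xi (d_m x) (d_a x) (d_u x) (d_e x) (d_S x)).

Lemma valid_xi_ge0 r x : valid r x -> 0 <= XI x.
Proof. by move=> [mT a0 _ _ [? ? ? _]]; exact: xi_ge0. Qed.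

Lemma first_moment_equation (r : R) : 0 < r -> r <= r0 ->
  exists2 K : R, 0 <= K & forall k x, valid r x ->
    `|d_A x k + \sum_i H1 (d_m x) i * d_M x i k + 2^-1 * \sum_i \sum_j H2 (d_m x) i j * c i j k - d_a x ^+ 2 * v k|
       <= 2 * p%:R * C0 * d_S x * N (d_m x) 2 + K * XI x.
Proof.
move=> rp rr0; have oT : open [set: pt] by exact: openT.
apply: (uniform_constant (Q := valid r)
  (L := fun k x => `|d_A x k + \sum_i H1 (d_m x) i * d_M x i k + 2^-1 * \sum_i \sum_j H2 (d_m x) i j * c i j k - d_a x ^+ 2 * v k|)
  (B := fun x => 2 * p%:R * C0 * d_S x * N (d_m x) 2)
  (X := fun x => XI x)) => [x|k]; first exact: valid_xi_ge0.
have [|||K K0 HK] := test_moment cT hg cn nu rI D0 TD tau sV C00 C20 Hc (q := fun s => (s - t0) 0 k) (d := 0) rp rr0 (fun n => coord_sub_Ck n t0 k oT).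
- by rewrite subrr mxE.
- by move=> t; rewrite expr1; exact: coord_le_norm.
- move=> j t; rewrite partial_coord expr0 mulr1 (le_trans (bool_norm_le1 _)) //.
  by rewrite ler1n.
exists K => // x [mT a0 Cal inv [u0 e0 S0 J]].
have := HK _ _ _ _ _ _ _ _ mT a0 Cal inv u0 e0 S0 J.
rewrite Q0_coord /xi.
rewrite (_ : (fun t => _) = fun t => jet c (d_A x) (d_M x) (t - t0) k); last first.
  apply/funext => t; rewrite (bigD1 k) //= partial_coord eqxx mulr1 big1 ?addr0 //.
  by move=> j /negbTE jk; rewrite partial_coord jk mulr0.
by rewrite (mI_jet cT).
Qed.

Lemma second_moment_equation (r : R) : 0 < r -> r <= r0 ->
  exists2 K : R, 0 <= K & forall k l x, valid r x ->
    `|d_A x k * H1 (d_m x) l + d_A x l * H1 (d_m x) k + 2 * H2 (d_m x) k l - d_a x ^+ 2 * (2 * tau * G k l)|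
       <= K * XI x.
Proof.
move=> rp rr0; have oT : open [set: pt] by exact: openT.
suff [K K0 HK] : exists2 K : R, 0 <= K & forall (kl : 'I_p * 'I_p) x, valid r x ->
    `|d_A x kl.1 * H1 (d_m x) kl.2 + d_A x kl.2 * H1 (d_m x) kl.1 + 2 * H2 (d_m x) kl.1 kl.2 - d_a x ^+ 2 * (2 * tau * G kl.1 kl.2)|
       <= 0 + K * XI x.
  by exists K => // k l x vx; have := HK (k, l) x vx; rewrite add0r.
apply: (uniform_constant (Q := valid r)
  (L := fun kl x => `|d_A x kl.1 * H1 (d_m x) kl.2 + d_A x kl.2 * H1 (d_m x) kl.1 + 2 * H2 (d_m x) kl.1 kl.2 - d_a x ^+ 2 * (2 * tau * G kl.1 kl.2)|)
  (B := fun x => 0) (X := fun x => XI x)) => [x|[k l]]; first exact: valid_xi_ge0.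
rewrite /=.
have [||||K K0 HK] := test_moment cT hg cn nu rI D0 TD tau sV C00 C20 Hc
  (q := fun s => (s - t0) 0 k * (s - t0) 0 l) (d := 1) rp rr0.
- by move=> n; apply: CkM => //; exact: coord_sub_Ck.
- by rewrite subrr mxE mul0r.
- by move=> t; rewrite normrM expr2 ler_pM //; exact: coord_le_norm.
- move=> j t; rewrite partial_coord2 expr1 (le_trans (ler_normD _ _)) // mulr2n mulrDl mul1r.
  by rewrite !normrM lerD //; [rewrite -[leRHS]mul1r|rewrite -[leRHS]mulr1];
    rewrite ler_pM // ?bool_norm_le1 //; exact: coord_le_norm.
(* For quadratic test functions the [S]-term carries the third moment, which [xi] already contains,
   so [2 * p * C0] may go into the constant. The factor [1 + D] covers the fourth moment by
   [N 4 <= D * N 3]; the last summand pays for replacing the jet by [A + h]. *)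
pose K' := 2 * p%:R * C0 + K * (1 + D) + 2 * (p%:R * C0 + p%:R ^+ 2 * C2).
exists K' => [|x [mT a0 Cal inv [u0 e0 S0 J]]].
  by rewrite /K' !addr_ge0 // !mulr_ge0 // ?addr_ge0 // ?mulr_ge0 // ?exprn_ge0.
have := HK _ _ _ _ _ _ _ _ mT a0 Cal inv u0 e0 S0 J.
rewrite (Q0_coord2 hg It).
set m := d_m x; set A := d_A x; set M := d_M x.
rewrite (_ : (fun t => \sum_j _) = fun t => jet c A M (t - t0) k * (t - t0) 0 l
   + jet c A M (t - t0) l * (t - t0) 0 k); last first.
  apply/funext => t.
  under eq_bigr do rewrite partial_coord2 mulrDr.
  rewrite big_split /=; congr (_ + _).
    rewrite (bigD1 k) //= eqxx mul1r big1 ?addr0 //.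
    by move=> j /negbTE ->; rewrite mul0r mulr0.
  rewrite (bigD1 l) //= eqxx mulr1 big1 ?addr0 //.
  by move=> j /negbTE ->; rewrite !mulr0.
have ch := @cont_coord R p t0.
have cj a b : continuous (fun t : pt => jet c A M (t - t0) a * (t - t0) 0 b).
  by apply: contM => //; exact: (Ck_continuousT (jet_Ck c 0 A M a)).
have ca a b : continuous (fun t : pt => A a * (t - t0) 0 b + (t - t0) 0 a * (t - t0) 0 b).
  by apply: contD; [exact: contZ|exact: contM].
have HJ a b : `|mI Theta m (fun t => jet c A M (t - t0) a * (t - t0) 0 b) - (A a * H1 m b + H2 m a b)|
   <= 0 * N m 0 + p%:R * C0 * (d_u x + d_e x) * N m 2 + p%:R ^+ 2 * C2 * N m 3.
  have -> : A a * H1 m b + H2 m a b = mI Theta m (fun t => A a * (t - t0) 0 b + (t - t0) 0 a * (t - t0) 0 b).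
    by rewrite (mID cT mT (@contZ _ _ (A a) _ (ch b)) (contM (ch a) (ch b))) (mIZ cT mT _ (ch b)).
  rewrite -(mIB cT mT (cj a b) (ca a b)); apply: (mI_norm_le cT) => //; first exact: (contB (cj a b) (ca a b)).
  by move=> t _; rewrite mul0r add0r; exact: (jet_coord_bound _ _ _ u0 e0 J).
rewrite (mID cT mT (cj k l) (cj l k)).
have := HJ k l; have := HJ l k; rewrite !mul0r !add0r.
have HS : H2 m l k = H2 m k l by apply: mI_eq => t _; rewrite mulrC.
rewrite HS.
set z := mI Theta m (fun t => jet c A M (t - t0) k * (t - t0) 0 l).
set y := mI Theta m (fun t => jet c A M (t - t0) l * (t - t0) 0 k) => B2 B1 B3.
have -> : A k * H1 m l + A l * H1 m k + 2 * H2 m k l - d_a x ^+ 2 * (2 * tau * G k l)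
  = (z + y - d_a x ^+ 2 * (2 * tau * G k l)) - (z - (A k * H1 m l + H2 m k l)) - (y - (A l * H1 m k + H2 m k l)).
  by move: (H1 m l) (H1 m k) (H2 m k l) (d_a x ^+ 2 * _) y z {B1 B2 B3} => *; ring.
apply: (le_trans (ler_normB _ _)); apply: (le_trans (lerD (ler_normB _ _) (lexx _))).
have N4 : N m 4 <= D * N m 3 by exact: NmomS.
have N2 : 0 <= N m 2 := Nmom_ge0 cT 2 mT; have N3 : 0 <= N m 3 := Nmom_ge0 cT 3 mT.
have N1 : 0 <= N m 1 := Nmom_ge0 cT 1 mT.
rewrite /xi -/m.
have S0' := S0; have u0' := u0; have e0' := e0.
move: (N m 1) (N m 2) (N m 3) (N m 4) N1 N2 N3 N4 B1 B2 B3 => n1 n2 n3 n4 n10 n20 n30 n4D B1 B2 B3.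
apply: (le_trans (lerD (lerD B3 B1) B2)); rewrite {}/K' {B1 B2 B3}.
have q0 := ler0n R p; have a20 : 0 <= d_a x ^+ 2 by exact: sqr_ge0.
move: (d_e x) (d_u x) (d_S x) (d_a x ^+ 2) (p%:R : R) S0' u0' e0' q0 a20 => e u S a2 q S0' u0' e0' q0 a20.
clear - D0 C00 C20 K0 n10 n20 n30 n4D S0' u0' e0' q0 a20.
set w := 1 + S + e + u; have w0 : 0 <= w by rewrite /w !addr_ge0.
have W3 : 0 <= w * n3 by rewrite mulr_ge0.
have Sw : S * n3 <= w * n3 by rewrite ler_wpM2r // /w; lra.
have ew : (e + u) * n3 <= w * n3 by rewrite ler_wpM2r // /w; lra.
have w4 : w * n4 <= D * (w * n3) by rewrite mulrCA ler_wpM2l.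
have w3 : n3 <= w * n3 by rewrite ler_peMl // /w; lra.
have T1 := ler_wpM2l (mulr_ge0 q0 C00) Sw.
have T2 := ler_wpM2l K0 ew.
have T3 := ler_wpM2l K0 w4.
have T4 := ler_wpM2l (mulr_ge0 (exprn_ge0 2 q0) C20) w3.
have P1 : 0 <= (2 * q * C0 + K * (1 + D) + 2 * q ^+ 2 * C2) * ((e + u) * n2).
  by rewrite !mulr_ge0 // ?addr_ge0 // ?mulr_ge0 // ?exprn_ge0 // ?addr_ge0.
have P2 : 0 <= 2 * (q * C0) * (w * n3) by rewrite !mulr_ge0.
have P3 : 0 <= (2 * q * C0 + K * D + 2 * (q * C0 + q ^+ 2 * C2)) * (a2 * n1).
  by rewrite !mulr_ge0 // !addr_ge0 // !mulr_ge0 // ?addr_ge0 // ?mulr_ge0 // ?exprn_ge0.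
move: (w * n3) (w * n4) W3 Sw ew w4 w3 T1 T2 T3 T4 P1 P2 P3 => W1 W2 *.
lra.
Qed.

Lemma sqr_norm_le_sum (h : pt) : `|h| ^+ 2 <= \sum_k h 0 k * h 0 k.
Proof.
have s0 : 0 <= \sum_k h 0 k * h 0 k by apply: sumr_ge0 => k _; rewrite -expr2 sqr_ge0.
rewrite -[leRHS]sqr_sqrtr // ler_sqr ?nnegrE ?sqrtr_ge0 //.
apply: norm_le_coord; first exact: sqrtr_ge0.
move=> i; rewrite -sqrtr_sqr ler_wsqrtr // (bigD1 i) //= -expr2 lerDl.
by apply: sumr_ge0 => k _; rewrite -expr2 sqr_ge0.
Qed.

Lemma N2_le_sum (m : probability (borelV R p) R) : m Theta = 1%E ->
  N m 2 <= \sum_k H2 m k k.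
Proof.
move=> mT.
have ch2 k : continuous (fun t : pt => (t - t0) 0 k * (t - t0) 0 k).
  by apply: contM; exact: cont_coord.
rewrite -(mI_sum cT mT) //; apply: (mI_le cT mT).
- exact: norm_pow_continuous.
- exact: cont_sum.
- by move=> t _; exact: sqr_norm_le_sum.
Qed.

Lemma H1_le (m : probability (borelV R p) R) k : m Theta = 1%E -> `|H1 m k| <= N m 1.
Proof.
move=> mT; have := mI_norm_le (t0 := t0) cT (b1 := 1) (b2 := 0) (b3 := 0) (d1 := 1) (d2 := 0) (d3 := 0) mT (@cont_coord R p t0 k).
rewrite !mul0r !addr0 mul1r; apply => t _.
by rewrite !mul0r !addr0 mul1r expr1; exact: coord_le_norm.
Qed.

Lemma H2_le (m : probability (borelV R p) R) k l : m Theta = 1%E -> `|H2 m k l| <= N m 2.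
Proof.
move=> mT; have cc : continuous (fun t : pt => (t - t0) 0 k * (t - t0) 0 l).
  by apply: contM; exact: cont_coord.
have := mI_norm_le (t0 := t0) cT (b1 := 1) (b2 := 0) (b3 := 0) (d1 := 2) (d2 := 0) (d3 := 0) mT cc.
rewrite !mul0r !addr0 mul1r; apply => t _.
by rewrite !mul0r !addr0 mul1r normrM expr2 ler_pM //; exact: coord_le_norm.
Qed.

(** Sum of the diagonal second moment equations. The first moment is not yet known, so its product
    with the score is only bounded by [u * N 1]. *)
Lemma second_moment_bound (r : R) : 0 < r -> r <= r0 ->
  exists2 K : R, 0 <= K & forall x, valid r x ->
    N (d_m x) 2 <= K * (d_a x ^+ 2 + d_u x * N (d_m x) 1 + XI x).
Proof.
move=> rp rr0; have [K K0 HK] := second_moment_equation rp rr0.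
pose Gb := \sum_k `|tau * G k k|.
have Gb0 : 0 <= Gb by exact: sumr_ge0.
exists (p%:R * (Gb + C0 + K)); first by rewrite mulr_ge0 // !addr_ge0.
move=> x vx; have [mT a0 _ _ [u0 e0 S0 [HA _ _]]] := vx.
apply: (le_trans (N2_le_sum mT)); rewrite -mulrA.
apply: sum_le_card => k; have := HK k k x vx.
set X := XI x; set A := d_A x k; set h1 := H1 _ k; set h2 := H2 _ k k; set n1 := N _ 1.
move=> H.
have X0 : 0 <= X by exact: valid_xi_ge0 vx.
have n10 : 0 <= n1 := Nmom_ge0 cT 1 mT.
have B1 : `|A * h1| <= C0 * (d_u x * n1).
  by rewrite normrM mulrA ler_pM //; [exact: HA|exact: H1_le].
have B2 : d_a x ^+ 2 * (tau * G k k) <= d_a x ^+ 2 * Gb.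
  rewrite ler_wpM2l ?sqr_ge0 // (le_trans (ler_norm _)) // /Gb (bigD1 k) //= lerDl.
  exact: sumr_ge0.
have := ler_norm (A * h1 + A * h1 + 2 * h2 - d_a x ^+ 2 * (2 * tau * G k k)).
have := ler_norm (- (A * h1)); rewrite normrN => B3 B4.
have a20 := sqr_ge0 (d_a x).
have un0 : 0 <= d_u x * n1 by rewrite mulr_ge0.
have P1 := mulr_ge0 Gb0 un0; have P2 := mulr_ge0 Gb0 X0; have P3 := mulr_ge0 C00 a20.
have P4 := mulr_ge0 C00 X0; have P5 := mulr_ge0 K0 a20; have P6 := mulr_ge0 K0 un0.
have P7 := mulr_ge0 K0 X0.
move: (A * h1) B1 B3 B4 H => Ah B1 B3 B4 H.
move: (G k k) (d_u x * n1) (d_a x ^+ 2) B1 B2 B4 H P1 P3 P5 P6 => gk w a2 B1 B2 B4 H P1 P3 P5 P6.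
by move: X X0 P2 P4 P7 H => X1 X0 P2 P4 P7 H; lra.
Qed.

(* The bracket of the stochastic expansion, with [z = - Phi(theta0)] in place of
   [a_n zeta_n] and [delta - M] in place of the covariant derivative of the fluctuation. *)
Definition expansion (x : datum) k : R :=
  let z i := - d_A x i in
  z k + \sum_i z i * ((i == k)%:R - d_M x i k)
  - 2^-1 * \sum_i \sum_j c i j k * (z i * z j + tau * d_a x ^+ 2 * G i j)
  + d_a x ^+ 2 * v k.

(** The two moment equations are solved by perturbation around [H1 = - A] and
    [H2 = A A + tau a^2 g^-1]. The deviation [Rk] of the first moment enters only multiplied by [A]
    or by [delta - M], which are of size [u + e], so a crude bound on it suffices; this is the
    product in the conclusion. *)
Lemma expansion_error (r : R) : 0 < r -> r <= r0 ->
  exists2 K : R, 0 <= K & forall k x, valid r x ->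
    `|H1 (d_m x) k - expansion x k| <= 2 * p%:R * C0 * d_S x * N (d_m x) 2
      + K * (XI x + (d_u x + d_e x) * ((d_u x + d_e x) * N (d_m x) 1 + N (d_m x) 2
                       + d_a x ^+ 2 + d_S x * N (d_m x) 2 + XI x)).
Proof.
move=> rp rr0; have [K1 K10 HK1] := first_moment_equation rp rr0.
have [K2 K20 HK2] := second_moment_equation rp rr0.
pose vb := \sum_k `|v k|.
have vb0 : 0 <= vb by exact: sumr_ge0.
pose q : R := p%:R; have q0 : 0 <= q by exact: ler0n.
pose B := q * C0 + q ^+ 2 * C2 * C0; have B0 : 0 <= B by rewrite addr_ge0 // !mulr_ge0 // exprn_ge0.
pose L := q * C0 + q ^+ 2 * C2 + vb + 2 * q * C0 + K1.
have L0 : 0 <= L by rewrite /L !addr_ge0 // !mulr_ge0 // exprn_ge0.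
exists (K1 + q ^+ 2 * C2 * K2 + B * L).
  by rewrite !addr_ge0 // !mulr_ge0 // exprn_ge0.
move=> k x vx; have [mT a0 _ _ [u0 e0 S0 [HA HM _]]] := vx.
set ue := d_u x + d_e x; set n1 := N _ 1; set n2 := N _ 2.
have X0 : 0 <= XI x by exact: valid_xi_ge0 vx.
have n10 : 0 <= n1 := Nmom_ge0 cT 1 mT; have n20 : 0 <= n2 := Nmom_ge0 cT 2 mT.
pose e1 k := d_A x k + \sum_i H1 (d_m x) i * d_M x i k
  + 2^-1 * \sum_i \sum_j H2 (d_m x) i j * c i j k - d_a x ^+ 2 * v k.
pose e2 k l := d_A x k * H1 (d_m x) l + d_A x l * H1 (d_m x) k
  + 2 * H2 (d_m x) k l - d_a x ^+ 2 * (2 * tau * G k l).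
have He1 j : `|e1 j| <= 2 * q * C0 * d_S x * n2 + K1 * XI x by exact: HK1.
have He2 i j : `|e2 i j| <= K2 * XI x by exact: HK2.
pose E i j : R := (i == j)%:R - d_M x i j.
have HE i j : `|E i j| <= C0 * ue by rewrite /E distrC.
pose Rk j := H1 (d_m x) j + d_A x j.
have HME j (F : 'I_p -> R) : \sum_i F i * E i j = F j - \sum_i F i * d_M x i j.
  rewrite /E; under eq_bigr do rewrite mulrBr.
  rewrite sumrB; congr (_ - _); rewrite (bigD1 j) //= eqxx mulr1 big1 ?addr0 //.
  by move=> i /negbTE ->; rewrite mulr0.
have I1 j : Rk j = \sum_i H1 (d_m x) i * E i j - 2^-1 * \sum_i \sum_l H2 (d_m x) i l * c i l j
    + d_a x ^+ 2 * v j + e1 j.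
  rewrite HME /Rk /e1; move: (\sum_i _) (\sum_i _) (d_a x ^+ 2 * _) => y1 y2 y3.
  by move: (H1 _ j) (d_A x j) => y4 y5; ring.
pose Dd i j := H2 (d_m x) i j - d_A x i * d_A x j - tau * d_a x ^+ 2 * G i j.
(* The quadratic equation expresses the deviation of the second moment through that of the first,
   multiplied by the score. *)
have I2 i j : Dd i j = 2^-1 * (- (d_A x i * Rk j + d_A x j * Rk i) + e2 i j).
  rewrite /Dd /Rk /e2; move: (H1 _ i) (H1 _ j) (H2 _ i j) (d_A x i) (d_A x j) (G i j) (d_a x ^+ 2) => y1 y2 y3 y4 y5 y6 y7.
  by field.
have I3 : H1 (d_m x) k - expansion x k
    = \sum_i Rk i * E i k - 2^-1 * \sum_i \sum_j c i j k * Dd i j + e1 k.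
  have -> : \sum_i Rk i * E i k = \sum_i H1 (d_m x) i * E i k + \sum_i d_A x i * E i k.
    by rewrite -big_split; apply: eq_bigr => i _; rewrite mulrDl.
  have -> : \sum_i \sum_j c i j k * Dd i j = \sum_i \sum_j H2 (d_m x) i j * c i j k
     - \sum_i \sum_j c i j k * (- d_A x i * - d_A x j + tau * d_a x ^+ 2 * G i j).
    rewrite -sumrB; apply: eq_bigr => i _; rewrite -sumrB; apply: eq_bigr => j _.
    by rewrite /Dd mulrNN; move: (H2 _ i j) (c i j k) (tau * _ * _) (d_A x i * _) => y1 y2 y3 y4; ring.
  have := I1 k; rewrite /Rk /expansion -/(E _ _).
  have -> : \sum_i - d_A x i * ((i == k)%:R - d_M x i k) = - \sum_i d_A x i * E i k.
    by rewrite -sumrN; apply: eq_bigr => i _; rewrite mulNr.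
  have key (h b s1 s2 s3 s4 w e : R) : h + b = s1 - 2^-1 * s2 + w + e ->
    h - (- b - s3 - 2^-1 * s4 + w) = s1 + s3 - 2^-1 * (s2 - s4) + e by lra.
  exact: key.
have hinv (y : R) : `|2^-1 * y| <= `|y|.
  by rewrite normrM ger0_norm // ler_piMl // invf_le1 // ler1n.
pose rho := L * (ue * n1 + n2 + d_a x ^+ 2 + d_S x * n2 + XI x).
have ue0 : 0 <= ue by exact: addr_ge0.
have a20 := sqr_ge0 (d_a x).
have Z0 : 0 <= ue * n1 + n2 + d_a x ^+ 2 + d_S x * n2 + XI x.
  by do !apply: addr_ge0 => //; apply: mulr_ge0.
have rho0 : 0 <= rho by apply: mulr_ge0.
have HR j : `|Rk j| <= rho.
  rewrite I1.
  have T1 : `|\sum_i H1 (d_m x) i * E i j| <= q * (n1 * (C0 * ue)).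
    by apply: norm_sum_le_card => i; rewrite normrM ler_pM //; exact: H1_le.
  have T2 : `|2^-1 * \sum_i \sum_l H2 (d_m x) i l * c i l j| <= q * (q * (n2 * C2)).
    apply: (le_trans (hinv _)); apply: norm_sum_le_card => i; apply: norm_sum_le_card => l.
    by rewrite normrM ler_pM //; exact: H2_le.
  have T3 : `|d_a x ^+ 2 * v j| <= d_a x ^+ 2 * vb.
    rewrite normrM ger0_norm // ler_wpM2l // /vb (bigD1 j) //= lerDl.
    exact: sumr_ge0.
  have T4 := He1 j.
  rewrite (le_trans (ler_normD _ _)) // (le_trans (lerD (ler_normD _ _) (lexx _))) //.
  rewrite (le_trans (lerD (lerD (ler_normB _ _) (lexx _)) (lexx _))) //.
  rewrite (le_trans (lerD (lerD (lerD T1 T2) T3) T4)) // /rho /L.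
  move: (XI x) X0 => X X0; move: (d_a x ^+ 2) (d_S x) a20 S0 => a2 S a20 S0.
  move: n10 n20 q0 ue0; clear - X0 a20 S0 C00 C20 vb0 K10.
  move: n1 n2 q ue vb vb0 => n1 n2 q ue vb vb0 n10 n20 q0 ue0.
  have un : 0 <= ue * n1 by exact: mulr_ge0.
  have sn : 0 <= S * n2 by exact: mulr_ge0.
  have Q1 : 0 <= q * C0 by exact: mulr_ge0.
  have Q2 : 0 <= q ^+ 2 * C2 by rewrite mulr_ge0 // exprn_ge0.
  (* Right side minus left side, expanded; all terms are visibly nonnegative. *)
  pose Y := (q * C0) * (2 * (ue * n1) + 3 * n2 + 3 * a2 + S * n2 + 3 * X)
    + (q ^+ 2 * C2) * (ue * n1 + a2 + S * n2 + X)
    + vb * (ue * n1 + n2 + S * n2 + X) + K1 * (ue * n1 + n2 + a2 + S * n2).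
  have : 0 <= Y by rewrite /Y !addr_ge0 // !mulr_ge0 // !addr_ge0 // !mulr_ge0.
  by rewrite /Y; lra.
have HD i j : `|Dd i j| <= C0 * ue * rho + K2 * XI x.
  have Au : forall l, `|d_A x l| <= C0 * ue.
    by move=> l; rewrite (le_trans (HA l)) // ler_wpM2l // lerDl.
  have HAR a b : `|d_A x a * Rk b| <= C0 * ue * rho by rewrite normrM ler_pM.
  rewrite I2 normrM ger0_norm // ler_pdivrMl //.
  rewrite (le_trans (ler_normD _ _)) // normrN.
  have := ler_normD (d_A x i * Rk j) (d_A x j * Rk i).
  have := HAR i j; have := HAR j i; have := He2 i j.
  have := mulr_ge0 K20 X0.
  move: (`|_ + _|) (`|_ * _|) (`|_ * _|) (`|e2 i j|) (K2 * _) (C0 * ue * _) => y1 y2 y3 y4 y5 y6.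
  lra.
rewrite I3.
have T1 : `|\sum_i Rk i * E i k| <= q * (rho * (C0 * ue)).
  by apply: norm_sum_le_card => i; rewrite normrM ler_pM.
have T2 : `|2^-1 * \sum_i \sum_j c i j k * Dd i j| <= q * (q * (C2 * (C0 * ue * rho + K2 * XI x))).
  apply: (le_trans (hinv _)); apply: norm_sum_le_card => i; apply: norm_sum_le_card => l.
  by rewrite normrM ler_pM.
rewrite (le_trans (ler_normD _ _)) // (le_trans (lerD (ler_normB _ _) (lexx _))) //.
rewrite (le_trans (lerD (lerD T1 T2) (He1 k))) //.
have -> : q * (rho * (C0 * ue)) + q * (q * (C2 * (C0 * ue * rho + K2 * XI x)))
    + (2 * q * C0 * d_S x * n2 + K1 * XI x)
  = 2 * q * C0 * d_S x * n2 + (K1 + q ^+ 2 * C2 * K2) * XI x + B * (ue * rho).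
  have key (y1 y2 y3 y4 : R) : q * (y1 * (C0 * y3)) + q * (q * (C2 * (C0 * y3 * y1 + K2 * y2)))
    + (y4 + K1 * y2) = y4 + (K1 + q ^+ 2 * C2 * K2) * y2 + (q * C0 + q ^+ 2 * C2 * C0) * (y3 * y1) by ring.
  exact: key.
rewrite -addrA lerD2l /rho.
move: (ue * n1 + n2 + d_a x ^+ 2 + d_S x * n2 + XI x) Z0 => Z Z0.
move: (XI x) X0 => X X0.
have W1 : 0 <= B * L * X by rewrite !mulr_ge0.
have W2 : 0 <= (K1 + q ^+ 2 * C2 * K2) * (ue * Z).
  apply: mulr_ge0; last exact: mulr_ge0.
  by apply: addr_ge0 => //; rewrite !mulr_ge0 // exprn_ge0.
have -> : B * (ue * (L * Z)) = B * L * (ue * Z) by ring.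
move: (B * L) (q ^+ 2 * C2 * K2) (ue * Z) W1 W2 => y1 y2 y3 W1 W2; lra.
Qed.

End MomentBounds.

(** * Jets in a chart *)

Section ChartJet.
Context {R : realType} {p : nat}.
Local Notation pt := 'rV[R]_p.
Implicit Types (U : set pt) (f : pt -> R).

Lemma increment_bound U f (t h : pt) (B : R) : cball t `|h| `<=` U -> Ck 0 U f ->
  (forall l s, cball t `|h| s -> `|partial l f s| <= B) ->
  `|f (t + h) - f t| <= p%:R * B * `|h|.
Proof.
move=> hU Cf HB.
have := @mvt_bound _ (fun u => f (t + u *: h)) (fun u => 'D_h f (t + u *: h)) 1
  (p%:R * B * `|h|) ler01.
rewrite scale1r scale0r addr0 mulr1; apply.
  move=> u u01; apply: is_derive_line; apply: (Ck_diff Cf).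
  exact/hU/cball_line.
move=> u u01; have ut := cball_line t (lexx `|h|) u01.
rewrite derive_partial; last by apply: (Ck_diff Cf); exact: hU.
by apply: sum_coord_le => i; exact: HB.
Qed.

Lemma increment_bound1 U f (t h : pt) (B : R) : cball t `|h| `<=` U -> Ck 0 U f ->
  (forall l s, cball t `|h| s -> `|partial l f s - partial l f t| <= B) ->
  `|f (t + h) - f t - \sum_l h 0 l * partial l f t| <= p%:R * B * `|h|.
Proof.
move=> hU Cf HB.
have := @mvt_bound _ (fun u => f (t + u *: h) - u * \sum_l h 0 l * partial l f t)
  (fun u => 'D_h f (t + u *: h) - \sum_l h 0 l * partial l f t) 1 (p%:R * B * `|h|) ler01.
rewrite scale1r scale0r addr0 mulr1 mul1r mul0r subr0 addrAC; apply.
  move=> u u01.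
  have df : is_derive u 1 (fun u => f (t + u *: h)) ('D_h f (t + u *: h)).
    by apply: is_derive_line; apply: (Ck_diff Cf); exact/hU/cball_line.
  apply: is_derive_eq; congr (_ - _).
  by rewrite scaler0 add0r /GRing.scale/= mulr1.
move=> u u01; have ut := cball_line t (lexx `|h|) u01.
rewrite derive_partial; last by apply: (Ck_diff Cf); exact: hU.
rewrite -sumrB; under eq_bigr do rewrite -mulrBr.
by apply: sum_coord_le => i; exact: HB.
Qed.

Lemma partial_comp q (phi : pt -> 'rV[R]_q) (f : 'rV[R]_q -> R) i t :
  (forall k, differentiable (fun s => phi s 0 k) t) -> differentiable f (phi t) ->
  partial i (fun s => f (phi s)) t
  = \sum_k partial i (fun s => phi s 0 k) t * partial k f (phi t).
Proof.
move=> dphik dft.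
have dphi : differentiable phi t.
  rewrite (_ : phi = fun t => \sum_k phi t 0 k *: evec k); last first.
    by apply/funext => s; rewrite [LHS]row_sum_delta.
  rewrite -fct_sumE; apply: differentiable_sum => k.
  by apply: differentiableZl; exact: dphik.
rewrite [in LHS]/partial deriveE; last exact: differentiable_comp.
rewrite diff_comp //= -deriveE // derive_partial //; apply: eq_bigr => k _; congr (_ * _).
rewrite -deriveE; last exact: dphi.
rewrite derive_mx ?mxE //; apply: diff_derivable; exact: dphi.
Qed.

Section Chart.
Context {Theta : set pt} {t0 : pt} {U : set pt} {phi sigma : pt -> pt}
  (ch : chart Theta t0 U phi sigma).
Local Notation E := (chart_field phi sigma).
Local Notation IT := (interior Theta).
Local Notation B i k := (partial i (fun s => phi s 0 k)).

Lemma chart_open : open U. Proof. by have [[]] := ch. Qed.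
Lemma chart_interior : U `<=` IT.
Proof.
have [[oU _] [_ UT] _ _ _] := ch => t Ut.
by apply: (filterS UT); apply: open_nbhs_nbhs.
Qed.

Lemma chart_Ck n k : Ck n U (fun s => phi s 0 k).
Proof. by have [_ _ H _ _] := ch; exact: smooth_Ck. Qed.

Lemma chart_field_coord t k l : U t ->
  E k t 0 l = partial k (fun s => sigma s 0 l) (phi t).
Proof.
move=> Ut; have [[_ oV] _ _ sV _] := ch.
have d m : differentiable (fun s => sigma s 0 m) (phi t).
  by apply: (Ck_diff (smooth_Ck 0 (sV m))); exists t.
have ds : differentiable sigma (phi t).
  rewrite (_ : sigma = fun t => \sum_k sigma t 0 k *: evec k); last first.
    by apply/funext => s; rewrite [LHS]row_sum_delta.
  by rewrite -fct_sumE; apply: differentiable_sum => m; apply: differentiableZl.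
rewrite /chart_field derive_mx ?mxE //; exact: diff_derivable.
Qed.

Lemma chart_field_Ck n k l : Ck n U (fun s => E k s 0 l).
Proof.
have [[_ oV] _ _ sV _] := ch.
apply: (Ck_eq (f := fun t => partial k (fun s => sigma s 0 l) (phi t)) chart_open).
  by move=> t Ut; rewrite chart_field_coord.
apply: (Ck_comp (W := phi @` U) chart_open oV) => [t Ut|m|].
- by exists t.
- exact: chart_Ck.
- by apply: Ck_partial; exact: (smooth_Ck n.+1 (sV l)).
Qed.

(** Chain rule for [sigma \o phi = id]: the Jacobian [B] of the chart inverts the matrix of the
    coordinate fields [E]. [A1] is stated with [E], the expansion in standard coordinates. *)
Lemma chart_inverse t i l : U t -> \sum_k B i k t * E k t 0 l = (i == l)%:R.
Proof.
move=> Ut; have [_ _ _ sV sK] := ch.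
rewrite -(partial_coord 0 l i t).
rewrite (partial_eq_on i chart_open (h := fun s => sigma (phi s) 0 l)) //; last first.
  by move=> s Us; rewrite sK // subr0.
rewrite (partial_comp (f := fun s => sigma s 0 l)).
- by apply: eq_bigr => k _; rewrite chart_field_coord.
- by move=> k; exact: Ck_diff (chart_Ck 0 k) Ut.
- by apply: (Ck_diff (smooth_Ck 0 (sV l))); exists t.
Qed.

Lemma form_app_chart (al : pt -> pt) t i : U t ->
  al t 0 i = \sum_k B i k t * form_app al (E k) t.
Proof.
move=> Ut; rewrite /form_app.
under eq_bigr do rewrite mulr_sumr.
rewrite exchange_big /=.
rewrite (eq_bigr (fun l => al t 0 l * (i == l)%:R)).
  rewrite (bigD1 i) //= eqxx mulr1 big1 ?addr0 // => l li.
  by rewrite eq_sym (negbTE li) mulr0.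
by move=> l _; rewrite -(chart_inverse i l Ut) mulr_sumr; apply: eq_bigr => k _; rewrite mulrCA.
Qed.

Lemma dirder_chart f t i : U t -> differentiable f t ->
  partial i f t = \sum_k B i k t * dirder (E k) f t.
Proof.
move=> Ut df; transitivity (\sum_k B i k t * \sum_l E k t 0 l * partial l f t).
  under eq_bigr do rewrite mulr_sumr.
  rewrite exchange_big /=.
  rewrite (eq_bigr (fun l => (i == l)%:R * partial l f t)).
    rewrite (bigD1 i) //= eqxx mul1r big1 ?addr0 // => l li.
    by rewrite eq_sym (negbTE li) mul0r.
  by move=> l _; rewrite -(chart_inverse i l Ut) mulr_suml; apply: eq_bigr => k _; rewrite mulrA.
by apply: eq_bigr => k _; rewrite dirderE.
Qed.

Lemma dirder_chart_Ck n f i : Ck n.+1 U f -> Ck n U (dirder (E i) f).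
Proof.
move=> Cf; apply: (Ck_eq (f := fun t => \sum_l E i t 0 l * partial l f t) chart_open).
  by move=> t Ut; rewrite dirderE //; exact: Ck_diff Cf Ut.
apply: Ck_sum; first exact: chart_open.
move=> l; apply: CkM; [exact: chart_open|exact: chart_field_Ck|exact: Ck_partial].
Qed.

Lemma form_app_Ck n (al : pt -> pt) k : (forall i, Ck n U (fun t => al t 0 i)) ->
  Ck n U (form_app al (E k)).
Proof.
move=> Cal; apply: Ck_sum; first exact: chart_open.
by move=> l; apply: CkM; [exact: chart_open|exact: Cal|exact: chart_field_Ck].
Qed.

Lemma form_appB (al be : pt -> pt) k : form_app (fun t => al t - be t) (E k)
  = fun t => form_app al (E k) t - form_app be (E k) t.
Proof.
apply/funext => t; rewrite /form_app -sumrB; apply: eq_bigr => i _.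
by rewrite !mxE mulrBl.
Qed.

Lemma dirderB (X : pt -> pt) f h t : differentiable f t -> differentiable h t ->
  dirder X (fun s => f s - h s) t = dirder X f t - dirder X h t.
Proof.
move=> df dh; rewrite /dirder -[fun s => _]/(f - h) deriveB //; exact: diff_derivable.
Qed.

End Chart.
Section JetBound.
Context {Theta : set pt} {g : pt -> 'M[R]_p} (hg : metric_on Theta g).
Context {Pc : pt -> pt -> pt} (hPc : precontrast Theta g Pc).
Context {D1 Dm1 : connection R p} (h1 : connection_D1 Theta g Pc D1)
  (hm1 : connection_Dm1 Theta g Pc Dm1).
Context {t0 : pt} {U : set pt} {phi sigma : pt -> pt} (ch : chart Theta t0 U phi sigma).
Local Notation E := (chart_field phi sigma).
Local Notation IT := (interior Theta).
Local Notation B i k := (partial i (fun s => phi s 0 k)).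
Context {r0 : R} (r00 : 0 < r0) (rU : cball t0 r0 `<=` U).

Let oI : open IT. Proof. exact: open_interior. Qed.
Let oU : open U. Proof. exact: chart_open ch. Qed.
Let UI : U `<=` IT. Proof. exact: chart_interior ch. Qed.
Let Ut0 : U t0. Proof. by have [_ [? _] _ _ _] := ch. Qed.

Definition hess_coef (i j k : 'I_p) : R := - Dm1 t0 i j 0 k.

Definition fluct (al : pt -> pt) (t : pt) : pt := al t - Pc t0 t.

Lemma fluct_Ck n (al : pt -> pt) : (forall i, Ck n IT (fun t => al t 0 i)) ->
  forall i, Ck n U (fun t => fluct al t 0 i).
Proof.
move=> Cal i; apply: (Ck_eq (f := fun t => al t 0 i - Pc t0 t 0 i) oU).
  by move=> t _; rewrite !mxE.
apply: CkB => //; first exact: Ck_sub (Cal i).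
by apply: (Ck_sub UI); apply: (pc_Ck1 hPc); exact: UI.
Qed.

(* The C^2-size of the chart components of a one-form controls its second order Taylor
   remainder: first along [d/dx^i] derivatives, then for the components themselves. *)
Lemma chart_jet_remainder : exists2 K : R, 0 <= K & forall (w : pt -> R) (r e S : R),
  0 < r -> r <= r0 -> 0 <= e -> 0 <= S -> Ck 2 U w ->
  (forall i, `|dirder (E i) w t0| <= e) ->
  (forall i j t, `|t - t0| <= r -> `|dirder (E i) (dirder (E j) w) t| <= S) ->
  (forall l, `|partial l w t0| <= K * e) /\
  (forall h : pt, `|h| <= r ->
    `|w (t0 + h) - w t0 - \sum_l h 0 l * partial l w t0| <= K * (S + e) * `|h| ^+ 2).
Proof.
have [Bb Bb0 HB] := Ck_bounded_fam (@compact_cball _ _ t0 r0) rU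
  (fun ik : 'I_p * 'I_p => Ck_partial ik.1 (chart_Ck ch 1 ik.2)).
have [Lb Lb0 HL] : exists2 L : R, 0 <= L & forall i k (h : pt), `|h| <= r0 ->
    `|B i k (t0 + h) - B i k t0| <= L * `|h|.
  have [L L0 HL] := Ck_bounded_fam (@compact_cball _ _ t0 r0) rU
    (fun ikl : 'I_p * 'I_p * 'I_p => Ck_partial ikl.2 (Ck_partial ikl.1.1 (chart_Ck ch 2 ikl.1.2))).
  exists (p%:R * L); first by rewrite mulr_ge0.
  move=> i k h hr; have sub : cball t0 `|h| `<=` U.
    by move=> s sh; apply: rU; exact: le_trans sh hr.
  apply: (increment_bound sub (Ck_partial i (chart_Ck ch 1 k))) => l s sh.
  by apply: (HL (i, k, l)); exact: le_trans sh hr.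
pose q : R := p%:R; have q0 : 0 <= q by exact: ler0n.
exists (q * Bb + q * (q * (Bb * (q * (q * Bb)) + Lb))).
  by rewrite addr_ge0 ?mulr_ge0 // addr_ge0 // !mulr_ge0.
move=> w r e S rp rr0 e0 S0 Cw He HS.
have dw t : U t -> differentiable w t by exact: Ck_diff Cw.
have CW i : Ck 1 U (dirder (E i) w) by exact: (dirder_chart_Ck ch).
have Hw l : `|partial l w t0| <= q * (Bb * e).
  rewrite (dirder_chart ch l Ut0 (dw _ Ut0)); apply: norm_sum_le_card => i.
  rewrite normrM ler_pM //; apply: (HB (l, i)); exact: cball_center (ltW r00).
split.
  move=> l; apply: (le_trans (Hw l)); rewrite mulrDl -mulrA lerDl.
  by rewrite !mulr_ge0 // addr_ge0 // !mulr_ge0.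
move=> h hr; have hr0 := le_trans hr rr0.
have sub : cball t0 `|h| `<=` U.
  by move=> s sh; apply: rU; exact: le_trans sh hr0.
have HW i s : cball t0 `|h| s -> `|dirder (E i) w s - dirder (E i) w t0| <= q * (q * (Bb * S)) * `|h|.
  move=> sh; have sub' : cball t0 `|s - t0| `<=` U.
    by move=> s' s'h; apply: sub; exact: le_trans s'h sh.
  have := increment_bound (B := q * (Bb * S)) sub' (CkW (CW i)); rewrite subrKC => H.
  apply: (le_trans (H _)); last by rewrite ler_wpM2l // !mulr_ge0.
  move=> l s' s'h; have Us' : U s' by exact: sub'.
  rewrite (dirder_chart ch l Us' (Ck_diff (CW i) Us')).
  apply: norm_sum_le_card => k; rewrite normrM.
  have s'r : `|s' - t0| <= r by rewrite (le_trans s'h) // (le_trans sh).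
  apply: ler_pM => //; last exact: HS.
  by apply: (HB (l, k)); exact: le_trans s'r rr0.
have := increment_bound1 (B := q * (Bb * (q * (q * (Bb * S))) + Lb * e) * `|h|) sub (CkW (CkW Cw)).
move=> H; apply: (le_trans (H _)).
  move=> l s sh; have Us := sub _ sh.
  rewrite (dirder_chart ch l Ut0 (dw _ Ut0)) (dirder_chart ch l Us (dw _ Us)) -sumrB -mulrA.
  apply: norm_sum_le_card => i.
  have -> : B l i s * dirder (E i) w s - B l i t0 * dirder (E i) w t0
    = B l i s * (dirder (E i) w s - dirder (E i) w t0) + (B l i s - B l i t0) * dirder (E i) w t0.
    by move: (B l i s) (B l i t0) (dirder _ w s) (dirder _ w t0) => *; ring.
  rewrite (le_trans (ler_normD _ _)) // !normrM mulrDl lerD //.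
    rewrite -[leRHS]mulrA; apply: ler_pM => //; last exact: HW.
    by apply: (HB (l, i)); exact: le_trans sh hr0.
  rewrite -[leRHS]mulrA [e * _]mulrC mulrA; apply: ler_pM => //.
  have := HL l i (s - t0); rewrite subrKC => HL'.
  by rewrite (le_trans (HL' (le_trans sh hr0))) // ler_wpM2l.
rewrite -/q expr2; move: `|h| (normr_ge0 h) => x x0.
have -> : q * (q * (Bb * (q * (q * (Bb * S))) + Lb * e) * x) * x
  = (q * (q * (Bb * (q * (q * (Bb * S))) + Lb * e))) * (x * x) by ring.
apply: ler_wpM2r; first exact: mulr_ge0.
have P1 : 0 <= q * Bb * (S + e) by rewrite !mulr_ge0 // addr_ge0.
have P2 : 0 <= q * (q * (Bb * (q * (q * (Bb * e))) + Lb * S)).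
  by rewrite !mulr_ge0 // addr_ge0 // !mulr_ge0.
lra.
Qed.

Lemma dirder_pc_chart i j :
  dirder (E i) (form_app (Pc t0) (E j)) t0 = ip g t0 (E i t0) (E j t0).
Proof.
have It : IT t0 := UI Ut0; have Tt := interior_subset It.
have dP m : differentiable (fun s => Pc t0 s 0 m) t0 by exact: Ck_diff (pc_Ck1 hPc 0 m It) It.
have dE m : differentiable (fun s => E j s 0 m) t0 by exact: Ck_diff (chart_field_Ck ch 0 j m) Ut0.
have df : differentiable (form_app (Pc t0) (E j)) t0.
  by apply: differentiable_bigsum => m; exact: differentiableM.
rewrite dirderE // ip_sum; apply: eq_bigr => l _.
under [RHS]eq_bigr do rewrite -mulrA.
rewrite -mulr_sumr; congr (_ * _); rewrite /form_app partial_sum; last by move=> m; exact: differentiableM.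
apply: eq_bigr => m _; rewrite partialM // (pc_partial1 hPc) //.
by have [_ -> //] := hPc; rewrite mxE mul0r addr0 (metric_sym hg l m Tt).
Qed.

Lemma fluct_dirder2 (al : pt -> pt) i j k t : (forall i, Ck 2 IT (fun t => al t 0 i)) -> U t ->
  dirder (E i) (dirder (E j) (form_app (fluct al) (E k))) t =
  dirder (E i) (dirder (E j) (form_app al (E k))) t
  - dirder (E i) (dirder (E j) (form_app (Pc t0) (E k))) t.
Proof.
move=> Cal Ut.
have C1 : Ck 2 U (form_app al (E k)).
  by apply: (form_app_Ck ch) => m; exact: (Ck_sub UI (Cal m)).
have C2 : Ck 2 U (form_app (Pc t0) (E k)).
  by apply: (form_app_Ck ch) => m; apply: (Ck_sub UI); apply: (pc_Ck1 hPc); exact: UI.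
have d1 s : U s -> differentiable (form_app al (E k)) s by exact: Ck_diff C1.
have d2 s : U s -> differentiable (form_app (Pc t0) (E k)) s by exact: Ck_diff C2.
have dd1 := dirder_chart_Ck ch j C1; have dd2 := dirder_chart_Ck ch j C2.
rewrite -dirderB; [|exact: Ck_diff dd1 Ut|exact: Ck_diff dd2 Ut].
have E1 s : U s -> dirder (E j) (form_app (fluct al) (E k)) s =
  dirder (E j) (form_app al (E k)) s - dirder (E j) (form_app (Pc t0) (E k)) s.
  by move=> Us; rewrite /fluct form_appB dirderB //; [exact: d1|exact: d2].
rewrite /dirder; apply: near_eq_derive.
by apply: filterS (open_nbhs_nbhs (conj oU Ut)) => s /E1.
Qed.

Lemma sharp_fluct (al : pt -> pt) t j : U t ->
  sharp g t (al t) 0 j = sharp g t (Pc t0 t) 0 j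
   + \sum_k form_app (fluct al) (E k) t * \sum_i B i k t * ginv g t i j.
Proof.
move=> Ut.
have -> : al t = Pc t0 t + fluct al t by rewrite /fluct subrKC.
rewrite /sharp mulmxDl mxE; congr (_ + _); rewrite mxE.
under [RHS]eq_bigr do rewrite mulr_sumr.
rewrite exchange_big /=; apply: eq_bigr => i _.
rewrite (form_app_chart ch (fluct al) i Ut) mulr_suml; apply: eq_bigr => k _.
by rewrite mulrA [_ * form_app _ _ _]mulrC.
Qed.

(** [g^-1 Psi] is split into [P0 = g^-1 Psi^theta0], whose value, gradient and Hessian at [theta0]
    are 0, the identity and [- Gamma^(-1)], and [De], the fluctuation read in the chart. All
    constants come from the compact ball of radius [r0], so one [C0] serves every [r <= r0]. *)
Lemma chart_jet_bound : exists2 C0 : R, 0 <= C0 & forall (al : pt -> pt) (r u e S : R),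
  0 < r -> r <= r0 -> 0 <= u -> 0 <= e -> 0 <= S ->
  (forall i, Ck 2 IT (fun t => al t 0 i)) ->
  (forall k, `|form_app al (E k) t0| <= u) ->
  (forall i j, `|dirder (E i) (form_app al (E j)) t0 - ip g t0 (E i t0) (E j t0)| <= e) ->
  (forall i j k t, `|t - t0| <= r ->
    `|dirder (E i) (dirder (E j) (form_app al (E k))) t
      - dirder (E i) (dirder (E j) (form_app (Pc t0) (E k))) t| <= S) ->
  jet_bound C0 r u e S hess_coef (fun k => sharp g t0 (al t0) 0 k)
    (fun i k => partial i (fun t => sharp g t (al t) 0 k) t0) (fun t => sharp g t (al t)) t0.
Proof.
have It : IT t0 := UI Ut0; have Tt := interior_subset It.
pose P0 j t := sharp g t (Pc t0 t) 0 j.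
pose Nn k j t := \sum_i B i k t * ginv g t i j.
have CP0 n j : Ck n U (P0 j).
  by apply: (sharp_Ck hg) => // i; apply: (Ck_sub UI); exact: (pc_Ck1 hPc).
have CN n k j : Ck n U (Nn k j).
  apply: Ck_sum => // i; apply: CkM => //; first by apply: Ck_partial; exact: (chart_Ck ch).
  by apply: (Ck_sub UI); exact: (ginv_Ck hg).
have [K1 K10 HK1] : exists2 K : R, 0 <= K & forall j (h : pt), `|h| <= r0 ->
  `|P0 j (t0 + h) - P0 j t0 - \sum_i h 0 i * partial i (P0 j) t0
    - 2^-1 * \sum_i h 0 i * \sum_l h 0 l * partial l (partial i (P0 j)) t0| <= 0 + K * `|h| ^+ 3.
  apply: (uniform_constant (Q := fun h : pt => `|h| <= r0) (B := fun=> 0) (X := fun h : pt => `|h| ^+ 3)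
   (L := fun j (h : pt) => `|P0 j (t0 + h) - P0 j t0 - \sum_i h 0 i * partial i (P0 j) t0
    - 2^-1 * \sum_i h 0 i * \sum_l h 0 l * partial l (partial i (P0 j)) t0|)).
    by move=> h _; exact: exprn_ge0.
  move=> j; have [C C00 HC] := Ck_taylor2 rU (CP0 3%N j).
  by exists C => // h hr; rewrite add0r; exact: HC.
have [Nb Nb0 HNb] := Ck_bounded_fam (@compact_cball _ _ t0 r0) rU
  (fun kj : 'I_p * 'I_p => CN 0%N kj.1 kj.2).
have [Nd Nd0 HNd] := Ck_bounded_fam (@compact_cball _ _ t0 r0) rU
  (fun kjl : 'I_p * 'I_p * 'I_p => Ck_partial kjl.2 (CN 1%N kjl.1.1 kjl.1.2)).
have [N2 N20 HN2] : exists2 K : R, 0 <= K & forall (kj : 'I_p * 'I_p) (h : pt), `|h| <= r0 ->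
  `|Nn kj.1 kj.2 (t0 + h) - Nn kj.1 kj.2 t0 - \sum_i h 0 i * partial i (Nn kj.1 kj.2) t0| <= 0 + K * `|h| ^+ 2.
  apply: (uniform_constant (Q := fun h : pt => `|h| <= r0) (B := fun=> 0) (X := fun h : pt => `|h| ^+ 2)
   (L := fun (kj : 'I_p * 'I_p) (h : pt) => `|Nn kj.1 kj.2 (t0 + h) - Nn kj.1 kj.2 t0 - \sum_i h 0 i * partial i (Nn kj.1 kj.2) t0|)).
    by move=> h _; exact: exprn_ge0.
  move=> kj; have [C C00 HC] := Ck_taylor1 rU (CN 2%N kj.1 kj.2).
  by exists C => // h hr; rewrite add0r; exact: HC.
have [K K0 HK] := chart_jet_remainder.
pose q : R := p%:R; have q0 : 0 <= q by exact: ler0n.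
pose CA := q * Nb; pose CM := q * (K * Nb + Nd); pose CJ := q * (K * Nb + q * K * (q * Nd) + N2).
have CA0 : 0 <= CA by rewrite mulr_ge0.
have CM0 : 0 <= CM by rewrite mulr_ge0 // addr_ge0 // mulr_ge0.
have CJ0 : 0 <= CJ by rewrite mulr_ge0 // !addr_ge0 // !mulr_ge0.
exists (CA + CM + CJ + K1); first by rewrite !addr_ge0.
move=> al r u e S rp rr0 u0 e0 S0 Cal Hu He HS.
pose w k := form_app (fluct al) (E k).
have Cw k : Ck 2 U (w k) by apply: (form_app_Ck ch); exact: fluct_Ck.
have Hw0 k : `|w k t0| <= u.
  rewrite /w /fluct form_appB; have -> : form_app (Pc t0) (E k) t0 = 0.
    by rewrite /form_app big1 // => i _; have [_ -> //] := hPc; rewrite mxE mul0r.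
  by rewrite subr0.
have Hw1 i k : `|dirder (E i) (w k) t0| <= e.
  rewrite /w /fluct form_appB dirderB.
  - by rewrite dirder_pc_chart.
  - apply: (Ck_diff (n := 0) (U := U)) Ut0; apply: (form_app_Ck ch) => m.
    exact: (Ck_sub UI (CkW (CkW (Cal m)))).
  - apply: (Ck_diff (n := 0) (U := U)) Ut0; apply: (form_app_Ck ch) => m.
    by apply: (Ck_sub UI); exact: (pc_Ck1 hPc).
have Hw k := HK (w k) r e S rp rr0 e0 S0 (Cw k) (Hw1^~ k).
have {HS} HS i j k t : `|t - t0| <= r -> `|dirder (E i) (dirder (E j) (w k)) t| <= S.
  move=> tr; rewrite fluct_dirder2 //; first exact: HS.
  by apply: rU; exact: le_trans tr rr0.
have Hwl k l : `|partial l (w k) t0| <= K * e by have [] := Hw k (fun i j => HS i j k).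
have Hwr k (h : pt) : `|h| <= r ->
  `|w k (t0 + h) - w k t0 - \sum_l h 0 l * partial l (w k) t0| <= K * (S + e) * `|h| ^+ 2.
  by have [_] := Hw k (fun i j => HS i j k); exact.
pose De j t := \sum_k w k t * Nn k j t.
have PhiE j t : U t -> sharp g t (al t) 0 j = P0 j t + De j t by exact: sharp_fluct.
have P00 j : P0 j t0 = 0.
  by rewrite /P0; have [_ -> //] := hPc; rewrite /sharp mul0mx mxE.
have dw k : differentiable (w k) t0 by exact: Ck_diff (Cw k) Ut0.
have dN k j : differentiable (Nn k j) t0 by exact: Ck_diff (CN 0%N k j) Ut0.
have dDe j l : partial l (De j) t0 =
    \sum_k (partial l (w k) t0 * Nn k j t0 + w k t0 * partial l (Nn k j) t0).
  rewrite /De partial_sum; first by apply: eq_bigr => k _; rewrite partialM.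
  by move=> k; exact: differentiableM.
have dPhi l j : partial l (fun t => sharp g t (al t) 0 j) t0 = (j == l)%:R + partial l (De j) t0.
  rewrite (partial_eq_on l oU (h := fun t => P0 j t + De j t)) //; last by move=> s; exact: PhiE.
  rewrite partialD; first by rewrite (pc_sharp_partial hg hPc).
    exact: Ck_diff (CP0 0%N j) Ut0.
  by apply: differentiable_bigsum => k; exact: differentiableM.
have ct0 : cball t0 r0 t0 := cball_center t0 (ltW r00).
split.
- move=> k; rewrite PhiE // P00 add0r.
  apply: (@le_trans _ _ (CA * u)); last by rewrite ler_wpM2r // -!addrA lerDl !addr_ge0.
  rewrite /CA -mulrA; apply: norm_sum_le_card => i; rewrite normrM mulrC ler_pM //.
  exact: (HNb (i, k)).
- move=> i k; rewrite dPhi [k == i]eq_sym addrAC subrr add0r dDe.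
  apply: (@le_trans _ _ (CM * (u + e))); last first.
    by rewrite ler_wpM2r ?addr_ge0 // [CA + CM]addrC -!addrA lerDl !addr_ge0.
  rewrite /CM -mulrA; apply: norm_sum_le_card => l.
  rewrite (le_trans (ler_normD _ _)) // !normrM.
  apply: (le_trans (lerD (ler_pM _ _ (Hwl l i) (HNb (l, k) _ ct0)) (ler_pM _ _ (Hw0 l) (HNd (l, k, i) _ ct0)))) => //.
  have := mulr_ge0 (mulr_ge0 K0 Nb0) u0; have := mulr_ge0 Nd0 e0.
  move: K Nb Nd {CA CM CJ CA0 CM0 CJ0 HNb HNd K0 HK Hw Hwl Hwr Nb0 Nd0} => *; lra.
move=> t tr j; set h := t - t0.
have tE : t = t0 + h by rewrite /h subrKC.
have hr : `|h| <= r by []. have hr0 := le_trans hr rr0.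
have Ut : U t by exact: rU.
have -> : sharp g t (al t) 0 j - jet hess_coef (fun k => sharp g t0 (al t0) 0 k)
    (fun i k => partial i (fun s => sharp g s (al s) 0 k) t0) h j
  = (P0 j t - P0 j t0 - \sum_i h 0 i * partial i (P0 j) t0
     - 2^-1 * \sum_i h 0 i * \sum_l h 0 l * partial l (partial i (P0 j)) t0)
    + (De j t - De j t0 - \sum_l h 0 l * partial l (De j) t0).
  have E1 : \sum_i h 0 i * partial i (fun s => sharp g s (al s) 0 j) t0
      = \sum_i h 0 i * partial i (P0 j) t0 + \sum_l h 0 l * partial l (De j) t0.
    rewrite -big_split; apply: eq_bigr => i _.
    by rewrite /= dPhi (pc_sharp_partial hg hPc) // mulrDr.
  have E2 : \sum_i \sum_l h 0 i * h 0 l * hess_coef i l j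
      = \sum_i h 0 i * \sum_l h 0 l * partial l (partial i (P0 j)) t0.
    apply: eq_bigr => i _; rewrite mulr_sumr; apply: eq_bigr => l _.
    by rewrite (pc_sharp_hess hg hPc _ _ _ h1 hm1 It) mulrA.
  rewrite /jet E1 E2 (PhiE j t Ut) (PhiE j t0 Ut0).
  have key (x1 x2 y1 y2 s1 s2 s3 : R) : x1 + x2 - (y1 + y2 + (s1 + s2) + s3)
    = (x1 - y1 - s1 - s3) + (x2 - y2 - s2) by ring.
  exact: key.
(* Product rule for Taylor remainders: [w k] has a remainder of size [S + e], the smooth factor [Nn]
   an ordinary one multiplied by [u], and the cross term is of order [e |h|^2]. *)
have De_rem : `|De j t - De j t0 - \sum_l h 0 l * partial l (De j) t0|
    <= CJ * ((S + e + u) * `|h| ^+ 2).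
  have -> : De j t - De j t0 - \sum_l h 0 l * partial l (De j) t0 =
    \sum_k ((w k t - w k t0 - \sum_l h 0 l * partial l (w k) t0) * Nn k j t
            + (\sum_l h 0 l * partial l (w k) t0) * (Nn k j t - Nn k j t0)
            + w k t0 * (Nn k j t - Nn k j t0 - \sum_l h 0 l * partial l (Nn k j) t0)).
    have -> : \sum_l h 0 l * partial l (De j) t0 = \sum_k
       ((\sum_l h 0 l * partial l (w k) t0) * Nn k j t0
        + w k t0 * \sum_l h 0 l * partial l (Nn k j) t0).
      rewrite (eq_bigr (fun l => \sum_k (h 0 l * partial l (w k) t0 * Nn k j t0
         + w k t0 * (h 0 l * partial l (Nn k j) t0)))).
        rewrite exchange_big /=; apply: eq_bigr => k _.
        by rewrite big_split /= mulr_suml mulr_sumr.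
      by move=> l _; rewrite dDe mulr_sumr; apply: eq_bigr => k _; rewrite mulrDr mulrA; congr (_ + _); rewrite mulrCA.
    rewrite /De -!sumrB; apply: eq_bigr => k _.
    have key (x1 x2 y1 y2 s1 s2 : R) : x1 * y1 - x2 * y2 - (s1 * y2 + x2 * s2)
      = (x1 - x2 - s1) * y1 + s1 * (y1 - y2) + x2 * (y1 - y2 - s2) by ring.
    exact: key.
  rewrite /CJ -mulrA; apply: norm_sum_le_card => k.
  rewrite (le_trans (ler_normD _ _)) // (le_trans (lerD (ler_normD _ _) (lexx _))) // !normrM.
  have B1 : `|w k t - w k t0 - \sum_l h 0 l * partial l (w k) t0| <= K * (S + e) * `|h| ^+ 2.
    by rewrite {1}tE; exact: Hwr.
  have B2 : `|\sum_l h 0 l * partial l (w k) t0| <= q * (K * e) * `|h| by exact: sum_coord_le.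
  have B3 : `|Nn k j t - Nn k j t0| <= q * Nd * `|h|.
    have sub : cball t0 `|h| `<=` U by move=> s sh; apply: rU; exact: le_trans sh hr0.
    rewrite tE; apply: (increment_bound sub (CN 0%N k j)) => l s sh.
    by apply: (HNd (k, j, l)); exact: le_trans sh hr0.
  have B4 : `|Nn k j t - Nn k j t0 - \sum_l h 0 l * partial l (Nn k j) t0| <= N2 * `|h| ^+ 2.
    by have := HN2 (k, j) h hr0; rewrite -tE add0r.
  have B5 : `|Nn k j t| <= Nb by exact: (HNb (k, j)).
  apply: (le_trans (lerD (lerD (ler_pM _ _ B1 B5) (ler_pM _ _ B2 B3)) (ler_pM _ _ (Hw0 k) B4))) => //.
  clear - K0 Nb0 Nd0 N20 q0 u0 e0 S0.
  rewrite expr2; move: `|h| (normr_ge0 h) => x x0.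
  have -> : K * (S + e) * (x * x) * Nb + q * (K * e) * x * (q * Nd * x) + u * (N2 * (x * x))
    = (K * Nb * (S + e) + q * K * (q * Nd) * e + N2 * u) * (x * x) by ring.
  rewrite [leRHS]mulrA; apply: ler_wpM2r; first exact: mulr_ge0.
  have Q1 : 0 <= K * Nb * u by rewrite !mulr_ge0.
  have Q2 : 0 <= q * K * (q * Nd) * (S + u) by rewrite !mulr_ge0 // addr_ge0.
  have Q3 : 0 <= N2 * (S + e) by rewrite mulr_ge0 // addr_ge0.
  move: (q * K * (q * Nd)) Q2 => y Q2; lra.
have P_rem := HK1 j h hr0; rewrite -tE add0r in P_rem.
rewrite (le_trans (ler_normD _ _)) // (le_trans (lerD P_rem De_rem)) //.
clear - CA0 CM0 CJ0 K10 u0 e0 S0.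
have Z2 : 0 <= (S + e + u) * `|h| ^+ 2 by rewrite mulr_ge0 ?exprn_ge0 // !addr_ge0.
have Z3 : 0 <= `|h| ^+ 3 by rewrite exprn_ge0.
move: ((S + e + u) * _) (`|h| ^+ 3) Z2 Z3 => z2 z3 Z2 Z3.
have := mulr_ge0 CA0 Z2; have := mulr_ge0 CA0 Z3; have := mulr_ge0 CM0 Z2; have := mulr_ge0 CM0 Z3.
have := mulr_ge0 CJ0 Z3; have := mulr_ge0 K10 Z2.
move: CA CM CJ {CA0 CM0 CJ0} => *; lra.
Qed.

End JetBound.
End ChartJet.

(** * Deterministic inequalities between the scales *)

Section ScaleAlgebra.
Context {R : realType}.

(** The iteration is condensed into a dichotomy on [G * b * T]. If it is at most 1/2, the term
    [G * (b * T * n2)] is absorbed on the left. Otherwise [(2 G b T)^N >= 1], and by [b^N <= a^2]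
    the trivial bound [n2 <= D^2] is already a constant times [a^2 T^N]. The estimate thus holds at
    every sample point, with a power of [T] instead of an exceptional event. *)
Lemma bootstrap_second_moment (K Cd D : R) (N : nat) : 0 <= K -> 0 <= Cd -> 0 <= D ->
  exists2 L : R, 0 <= L & forall a s b al e' S rho del n1 n2 n3 T : R,
  0 < a -> a <= s -> s <= b -> b <= 1 -> b ^+ N <= a ^+ 2 ->
  0 <= al -> 0 <= e' -> 0 <= S -> 0 <= rho -> 0 <= del -> del <= Cd * b ->
  T = 1 + S + al + e' + rho ->
  0 <= n1 -> n1 <= D -> 0 <= n2 -> n2 <= D ^+ 2 ->
  (forall y : R, 0 < y -> n1 <= y + n2 / y) ->
  0 <= n3 -> n3 <= 2 * del * n2 + D ^+ 3 * (a ^+ 2 * rho) ->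
  n2 <= K * (a ^+ 2 + a * al * n1 +
    ((s * e' + a * al) * n2 + (1 + S + s * e' + a * al) * n3 + a ^+ 2 * n1)) ->
  n2 <= L * (a ^+ 2 * T ^+ N.+2).
Proof.
move=> K0 Cd0 D0.
pose G := 2 * K * (1 + 2 * Cd).
pose L0 := 2 * (K + 2 * K * (K + 1) + K * (D ^+ 3 + D)).
have G0 : 0 <= G by rewrite !mulr_ge0 // addr_ge0 // mulr_ge0.
have D30 : 0 <= D ^+ 3 by rewrite exprn_ge0.
have L00 : 0 <= L0 by rewrite mulr_ge0 // !addr_ge0 // !mulr_ge0 // addr_ge0.
exists (2 * L0 + D ^+ 2 * (2 * G) ^+ N).
  apply: addr_ge0; first exact: mulr_ge0.
  by apply: mulr_ge0; apply: exprn_ge0 => //; exact: mulr_ge0.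
move=> a s b al e' S rho del n1 n2 n3 T a0 as_ sb b1 bN al0 e0 S0 rho0 del0 delb TE n10 n1D n20 n2D n1y n30 n3b H.
have s0 : 0 <= s by rewrite (le_trans (ltW a0)).
have b0 : 0 <= b by rewrite (le_trans s0).
have T1 : 1 <= T by rewrite TE; clear -S0 al0 e0 rho0; lra.
have T0 : 0 <= T by exact: le_trans ler01 T1.
have s1 : s <= 1 by rewrite (le_trans sb).
have a1 : a <= 1 by rewrite (le_trans as_).
have ab : a <= b by rewrite (le_trans as_).
have se : s * e' <= e' by rewrite ler_piMl.
have aal : a * al <= al by rewrite ler_piMl.
have eu : s * e' + a * al <= b * T.
  have -> : b * T = b * e' + b * al + b * (1 + S + rho) by rewrite TE; ring.
  have := ler_wpM2r e0 sb; have := ler_wpM2r al0 ab.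
  have : 0 <= b * (1 + S + rho) by rewrite mulr_ge0 // !addr_ge0.
  lra.
have w : 1 + S + s * e' + a * al <= T by rewrite TE; lra.
have w0 : 0 <= 1 + S + s * e' + a * al by rewrite !addr_ge0 // mulr_ge0 // ltW.
have a20 : 0 <= a ^+ 2 by rewrite sqr_ge0.
have TT : T <= T ^+ 2 by rewrite expr2 ler_peMl.
have T21 : 1 <= T ^+ 2 by rewrite (le_trans T1).
have T20 : 0 <= T ^+ 2 by exact: exprn_ge0.
have rT : rho <= T by rewrite TE; clear -S0 al0 e0; lra.
have aT : al <= T by rewrite TE; clear -S0 e0 rho0; lra.
have X1 : (s * e' + a * al) * n2 <= b * T * n2 by rewrite ler_wpM2r.
have X2 : (1 + S + s * e' + a * al) * n3 <= 2 * Cd * (b * T * n2) + D ^+ 3 * (a ^+ 2 * T ^+ 2).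
  apply: (le_trans (ler_pM w0 n30 w n3b)); rewrite mulrDr lerD //.
    have -> : T * (2 * del * n2) = 2 * T * n2 * del by ring.
    have -> : 2 * Cd * (b * T * n2) = 2 * T * n2 * (Cd * b) by ring.
    by rewrite ler_wpM2l // !mulr_ge0.
  rewrite mulrCA ler_wpM2l // mulrCA ler_wpM2l // expr2 ler_wpM2l //.
have X3 : a ^+ 2 * n1 <= D * (a ^+ 2 * T ^+ 2).
  rewrite mulrC; apply: ler_pM => //; exact: ler_peMr.
have X4 : K * (a * al * n1) <= 2 * K * (K + 1) * (a ^+ 2 * T ^+ 2) + n2 / 2.
  (* With this [y] the bound [n1 <= y + n2 / y] turns [K * a * al * n1] into [O(a^2 T^2)] plus one
     half of [n2], which is moved to the left; [K + 1] keeps [y] positive. *)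
  pose y := 2 * (K + 1) * (a * T).
  have aT0 : 0 < a * T by rewrite mulr_gt0 // (lt_le_trans ltr01 T1).
  have K10 : 0 < K + 1 by rewrite ltr_wpDl.
  have y0 : 0 < y by rewrite /y mulr_gt0 // mulr_gt0.
  have ka0 : 0 <= K * (a * al) by rewrite !mulr_ge0 // ltW.
  rewrite mulrA; apply: (le_trans (ler_wpM2l ka0 (n1y y y0))).
  rewrite mulrDr lerD //.
    have -> : K * (a * al) * y = 2 * K * (K + 1) * a ^+ 2 * T * al by rewrite /y; ring.
    have -> : 2 * K * (K + 1) * (a ^+ 2 * T ^+ 2) = 2 * K * (K + 1) * a ^+ 2 * T * T by ring.
    by rewrite ler_wpM2l // !mulr_ge0 // ltW.
  rewrite mulrCA ler_wpM2l // ler_pdivrMr // /y.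
  have -> : 2^-1 * (2 * (K + 1) * (a * T)) = (K + 1) * (a * T) by field.
  by apply: ler_pM => //; [rewrite mulr_ge0 // ltW|lra|rewrite ler_wpM2l // ltW].
have X5 : K * a ^+ 2 <= K * (a ^+ 2 * T ^+ 2) by rewrite ler_wpM2l // ler_peMr.
have main : n2 <= L0 * (a ^+ 2 * T ^+ 2) + G * (b * T * n2).
  have := ler_wpM2l K0 X1; have := ler_wpM2l K0 X2; have := ler_wpM2l K0 X3.
  rewrite /L0 /G; move: H X4 X5.
  move: (a ^+ 2 * T ^+ 2) (b * T * n2) ((s * e' + a * al) * n2) ((1 + S + s * e' + a * al) * n3).
  move: (a ^+ 2 * n1) (a * al * n1) (D ^+ 3) (a ^+ 2) => *; lra.
have at2 : 0 <= a ^+ 2 * T ^+ 2 by rewrite mulr_ge0.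
have TN : T ^+ 2 <= T ^+ N.+2 by rewrite ler_weXn2l.
have [small|big] := leP (G * (b * T)) 2^-1.
  have : n2 <= 2 * L0 * (a ^+ 2 * T ^+ 2).
    have small' := ler_wpM2r n20 small.
    have key (x y z v : R) : v = 2^-1 * x -> x <= y + z -> z <= v -> x <= 2 * y by move=> *; lra.
    rewrite -[leRHS]mulrA; apply: (key _ _ _ _ erefl main).
    by rewrite mulrA.
  move/le_trans; apply; rewrite [leRHS]mulrDl ler_wpDr //.
    apply: mulr_ge0; first by apply: mulr_ge0; apply: exprn_ge0 => //; exact: mulr_ge0.
    by apply: mulr_ge0 => //; exact: exprn_ge0.
  by apply: ler_wpM2l; [exact: mulr_ge0|exact: ler_wpM2l].
have one : 1 <= (2 * G * (b * T)) ^+ N.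
  by rewrite exprn_ege1 //; move: big; rewrite -mulrA; lra.
apply: (le_trans n2D); rewrite mulrDl ler_wpDl //.
  by apply: mulr_ge0; [exact: mulr_ge0|apply: mulr_ge0 => //; exact: exprn_ge0].
rewrite -mulrA ler_peMr ?exprn_ge0 //.
apply: (le_trans one); rewrite [leLHS]exprMn.
apply: ler_wpM2l; first by apply: exprn_ge0; exact: mulr_ge0.
rewrite exprMn; apply: ler_pM; rewrite ?exprn_ge0 //.
by rewrite ler_weXn2l // -addn2 leq_addr.
Qed.

(** Up to powers of [T], [n2] is [O(a^2)] and [n1] is [O(a)]. Each error term is then [a^2] times
    [S] or times one of the vanishing [b], [e'], [rho], collected in [vp]. The coefficient of [S] is
    [c0 * L]; [K], which depends on the radius, enters only [C]. *)
Lemma remainder_scale (L K c0 Cd D : R) (M : nat) :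
  0 <= L -> 0 <= K -> 0 <= c0 -> 0 <= Cd -> 0 <= D ->
  exists2 C : R, 0 <= C & forall a s b al e' S rho del n1 n2 n3 T rem : R,
  0 < a -> a = s ^+ 2 -> 0 <= s -> s <= b -> b <= 1 ->
  0 <= al -> 0 <= e' -> 0 <= S -> 0 <= rho -> 0 <= del -> del <= Cd * b ->
  1 + S + al + e' + rho <= T ->
  0 <= n1 -> 0 <= n2 -> n2 <= L * (a ^+ 2 * T ^+ M) ->
  (forall y : R, 0 < y -> n1 <= y + n2 / y) ->
  0 <= n3 -> n3 <= 2 * del * n2 + D ^+ 3 * (a ^+ 2 * rho) ->
  let u := a * al in let e := s * e' in
  let X := (e + u) * n2 + (1 + S + e + u) * n3 + a ^+ 2 * n1 in
  rem <= c0 * S * n2 + K * (X + (u + e) * ((u + e) * n1 + n2 + a ^+ 2 + S * n2 + X)) ->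
  rem <= a ^+ 2 * ((c0 * L * S + C * (b + e' + rho)) * T ^+ M.+3).
Proof.
move=> L0 K0 c00 Cd0 D0.
have D30 : 0 <= D ^+ 3 by rewrite exprn_ge0.
pose q := (1 + 2 * Cd) * L + D ^+ 3 + 1 + L.
have q0 : 0 <= q by rewrite /q !addr_ge0 // mulr_ge0 // addr_ge0 // mulr_ge0.
exists (K * (q + 4 * (1 + L) + L + 1 + L + q)).
  by apply: mulr_ge0 => //; move: q q0 => y y0; lra.
move=> a s b al e' S rho del n1 n2 n3 T rem a0 aE s0 sb b1 al0 e0 S0 rho0 del0 delb Tge n10 n20 n2b n1y n30 n3b.
move=> u e X H.
have s1 : s <= 1 by rewrite (le_trans sb).
have b0 : 0 <= b by rewrite (le_trans s0).
have as_ : a <= s by rewrite aE expr2 ler_piMl.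
have ab : a <= b by rewrite (le_trans as_).
have a1 : a <= 1 by rewrite (le_trans ab).
have T1 : 1 <= T by apply: le_trans Tge; rewrite -!addrA lerDl !addr_ge0.
have T0 : 0 <= T by lra.
set vp := b + e' + rho.
have vp0 : 0 <= vp by rewrite !addr_ge0.
have bvp : b <= vp by rewrite /vp -addrA lerDl addr_ge0.
have vpT : vp <= T by rewrite (le_trans _ Tge) // /vp; lra.
have aT : al <= T by rewrite (le_trans _ Tge) //; clear -S0 e0 rho0; lra.
have eT : e' <= T by rewrite (le_trans _ Tge) //; clear -S0 al0 rho0; lra.
have ST : S <= T by rewrite (le_trans _ Tge) //; clear -al0 e0 rho0; lra.
have u0 : 0 <= u by rewrite mulr_ge0 // ltW.
have ee0 : 0 <= e by rewrite mulr_ge0.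
have ue : u + e <= vp * T.
  apply: (@le_trans _ _ (b * (al + e'))).
    by rewrite mulrDr lerD // ler_wpM2r.
  by apply: ler_pM => //; [rewrite addr_ge0|rewrite (le_trans _ Tge) //; lra].
have w : 1 + S + e + u <= T.
  have : e <= e' by rewrite ler_piMl.
  have : u <= al by rewrite ler_piMl.
  by move=> *; rewrite (le_trans _ Tge) //; lra.
have w0 : 0 <= 1 + S + e + u by rewrite !addr_ge0.
pose nu := L * T ^+ M.
have nu0 : 0 <= nu by rewrite mulr_ge0 // exprn_ge0.
have a20 : 0 <= a ^+ 2 by rewrite sqr_ge0.
have n2nu : n2 <= a ^+ 2 * nu by rewrite /nu mulrCA.
have n1a : n1 <= a * (1 + nu).
  apply: (le_trans (n1y a a0)); rewrite mulrDr mulr1 lerD2l ler_pdivrMr //.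
  by rewrite mulrC mulrA -expr2.
have a2nu : 0 <= a ^+ 2 * nu by rewrite mulr_ge0.
have n3nu : n3 <= a ^+ 2 * (vp * (2 * Cd * nu + D ^+ 3)).
  apply: (le_trans n3b).
  have B1 : 2 * del * n2 <= 2 * (Cd * vp) * (a ^+ 2 * nu).
    apply: ler_pM => //; first by rewrite mulr_ge0.
    by rewrite ler_wpM2l // (le_trans delb) // ler_wpM2l.
  have B2 : D ^+ 3 * (a ^+ 2 * rho) <= D ^+ 3 * (a ^+ 2 * vp).
    by rewrite !ler_wpM2l // /vp lerDr addr_ge0.
  have -> : a ^+ 2 * (vp * (2 * Cd * nu + D ^+ 3)) = 2 * (Cd * vp) * (a ^+ 2 * nu) + D ^+ 3 * (a ^+ 2 * vp) by ring.
  exact: lerD.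
pose Q := (1 + 2 * Cd) * T * nu + D ^+ 3 * T + 1 + nu.
have Q0 : 0 <= Q.
  have Cd1 : 0 <= 1 + 2 * Cd by lra.
  have : 0 <= (1 + 2 * Cd) * T * nu := mulr_ge0 (mulr_ge0 Cd1 T0) nu0.
  by have := mulr_ge0 D30 T0; rewrite /Q => *; lra.
have XQ : X <= a ^+ 2 * (vp * Q).
  have B1 : (e + u) * n2 <= vp * T * (a ^+ 2 * nu).
    by apply: ler_pM => //; [rewrite addr_ge0|rewrite addrC].
  have B2 : (1 + S + e + u) * n3 <= T * (a ^+ 2 * (vp * (2 * Cd * nu + D ^+ 3))) by exact: ler_pM.
  have B3 : a ^+ 2 * n1 <= a ^+ 2 * (vp * (1 + nu)).
    rewrite ler_wpM2l // (le_trans n1a) // ler_wpM2r ?addr_ge0 //.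
    exact: le_trans bvp.
  have -> : a ^+ 2 * (vp * Q) = vp * T * (a ^+ 2 * nu)
     + T * (a ^+ 2 * (vp * (2 * Cd * nu + D ^+ 3))) + a ^+ 2 * (vp * (1 + nu)) by rewrite /Q; ring.
  by rewrite /X !lerD.
have X0 : 0 <= X by rewrite /X !addr_ge0 // mulr_ge0 // addr_ge0.
(* The rate [a^(1/2)] of the first jet is used here: [e^2 = a * e'^2], and [n1] supplies the second
   factor [a]. *)
have UE : (u + e) ^+ 2 * n1 <= a ^+ 2 * (vp * (4 * T ^+ 2 * (1 + nu))).
  have B1 : (u + e) ^+ 2 <= a * (vp * (4 * T ^+ 2)).
    apply: (@le_trans _ _ (2 * (u ^+ 2 + e ^+ 2))).
      by rewrite -subr_ge0 (_ : _ - _ = (u - e) ^+ 2) ?sqr_ge0 //; ring.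
    have -> : 2 * (u ^+ 2 + e ^+ 2) = a * (2 * (a * al ^+ 2 + e' ^+ 2)).
      by rewrite /u /e aE; ring.
    rewrite ler_wpM2l //; first exact: ltW.
    have B2 : a * al ^+ 2 <= vp * T ^+ 2.
      apply: ler_pM => //; [exact: ltW|exact: sqr_ge0|exact: le_trans bvp|].
      by rewrite ler_sqr ?nnegrE.
    have B3 : e' ^+ 2 <= vp * T ^+ 2.
      rewrite expr2; apply: ler_pM => //; first by rewrite /vp; lra.
      by rewrite (le_trans eT) // expr2 ler_peMl.
    lra.
  apply: (le_trans (ler_pM _ _ B1 n1a)) => //; first exact: sqr_ge0.
  by rewrite le_eqVlt; apply/orP; left; apply/eqP; ring.
have UE2 : (u + e) * (n2 + a ^+ 2 + S * n2 + X) <= a ^+ 2 * (vp * (T * (nu + 1 + T * nu + T * Q))).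
  have B1 : n2 + a ^+ 2 + S * n2 + X <= a ^+ 2 * (nu + 1 + T * nu + T * Q).
    have C1 : S * n2 <= T * (a ^+ 2 * nu) by exact: ler_pM.
    have C2 : X <= a ^+ 2 * (T * Q) by rewrite (le_trans XQ) // ler_wpM2l // ler_wpM2r.
    have -> : a ^+ 2 * (nu + 1 + T * nu + T * Q) = a ^+ 2 * nu + a ^+ 2 + T * (a ^+ 2 * nu) + a ^+ 2 * (T * Q) by ring.
    by rewrite !lerD.
  have B0 : 0 <= n2 + a ^+ 2 + S * n2 + X.
    exact: (addr_ge0 (addr_ge0 (addr_ge0 n20 a20) (mulr_ge0 S0 n20)) X0).
  apply: (le_trans (ler_pM _ B0 ue B1)); first by rewrite addr_ge0.
  by rewrite le_eqVlt; apply/orP; left; apply/eqP; ring.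
have main : rem <= a ^+ 2 * (c0 * S * nu
    + K * (vp * (Q + 4 * T ^+ 2 * (1 + nu) + T * (nu + 1 + T * nu + T * Q)))).
  apply: (le_trans H); rewrite [leRHS]mulrDr; apply: lerD.
    by rewrite [leRHS]mulrCA ler_wpM2l // mulr_ge0.
  rewrite [leRHS]mulrCA; apply: ler_wpM2l => //.
  have -> : X + (u + e) * ((u + e) * n1 + n2 + a ^+ 2 + S * n2 + X)
    = X + (u + e) ^+ 2 * n1 + (u + e) * (n2 + a ^+ 2 + S * n2 + X) by ring.
  apply: (le_trans (lerD (lerD XQ UE) UE2)).
  by rewrite le_eqVlt; apply/orP; left; apply/eqP; ring.
apply: (le_trans main); rewrite ler_wpM2l //.
have TP : T ^+ M <= T ^+ M.+3 by rewrite ler_weXn2l // -addn3 leq_addr.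
have TP1 : T * T ^+ M <= T ^+ M.+3 by rewrite -exprS ler_weXn2l // -addn2 leq_addr.
have TP2 : T ^+ 2 * T ^+ M <= T ^+ M.+3 by rewrite -exprD ler_weXn2l.
have TP3 : T ^+ 2 * (T * T ^+ M) = T ^+ M.+3 by rewrite -exprS -exprD.
have TM1 : 1 <= T ^+ M by rewrite exprn_ege1.
have T2P : T ^+ 2 <= T ^+ M.+3 by rewrite ler_weXn2l.
have TTP : T <= T ^+ M.+3 by rewrite -[leLHS]expr1 ler_weXn2l.
have QP : Q <= q * (T * T ^+ M).
  have : D ^+ 3 * T <= D ^+ 3 * (T * T ^+ M) by rewrite ler_wpM2l // ler_peMr.
  have : 1 <= T * T ^+ M by rewrite -exprS exprn_ege1.
  have : nu <= L * (T * T ^+ M) by rewrite /nu ler_wpM2l // ler_peMl // exprn_ge0.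
  rewrite /Q /q (_ : (1 + 2 * Cd) * T * nu = (1 + 2 * Cd) * L * (T * T ^+ M)); last by rewrite /nu; ring.
  move: (T * T ^+ M) nu (D ^+ 3) {nu0 n2nu n1a a2nu n3nu Q Q0 XQ UE UE2 main q q0 D30 n3b TP1 TP3} => *; lra.
have L1 := ler_wpM2l L0 TP; have L2 := ler_wpM2l L0 TP1; have L3 := ler_wpM2l L0 TP2.
have Q1 : Q <= q * T ^+ M.+3 by rewrite (le_trans QP) // ler_wpM2l.
have Q2 : T * (T * Q) <= q * T ^+ M.+3.
  by rewrite mulrA -expr2 -TP3 mulrCA ler_wpM2l // exprn_ge0.
rewrite [leRHS]mulrDl; apply: lerD.
  have -> : c0 * S * nu = c0 * L * S * T ^+ M by rewrite /nu; ring.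
  by rewrite ler_wpM2l // !mulr_ge0.
have E1 : T ^+ 2 * nu = L * (T ^+ 2 * T ^+ M) by rewrite /nu; ring.
have E2 : T * nu = L * (T * T ^+ M) by rewrite /nu; ring.
have E3 : T * (T * nu) = L * (T ^+ 2 * T ^+ M) by rewrite /nu; ring.
have -> : K * (q + 4 * (1 + L) + L + 1 + L + q) * vp * T ^+ M.+3
  = K * (vp * ((q + 4 * (1 + L) + L + 1 + L + q) * T ^+ M.+3)).
  by move: q (T ^+ M.+3) {q0 TP TP1 TP2 TP3 T2P TTP QP L1 L2 L3 Q1 Q2} => y z; ring.
rewrite ler_wpM2l // ler_wpM2l //.
have -> : Q + 4 * T ^+ 2 * (1 + nu) + T * (nu + 1 + T * nu + T * Q)
  = Q + 4 * T ^+ 2 + 4 * (T ^+ 2 * nu) + T * nu + T + T * (T * nu) + T * (T * Q) by ring.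
rewrite E1 E3 E2.
move: L1 L2 L3 Q1 Q2 T2P TTP; move: (L * (T ^+ 2 * T ^+ M)) (L * (T * T ^+ M)) (T * (T * Q)) => x1 x2 x3.
move: q Q (T ^+ M.+3) (T ^+ 2) {q0 Q0 XQ UE UE2 main TP TP1 TP2 TP3 QP T0 E1 E2 E3} => y1 y2 y3 y4 *.
lra.
Qed.

End ScaleAlgebra.

(** * Moments of random families *)

Section Moments.
Context {R : realType}.

Lemma sum_pow_le (I : finType) (y : I -> R) (q : nat) : (forall i, 0 <= y i) ->
  (\sum_i y i) ^+ q.+1 <= #|I|%:R ^+ q.+1 * \sum_i y i ^+ q.+1.
Proof.
move=> y0; have S0 : 0 <= \sum_i y i ^+ q.+1 by apply: sumr_ge0 => i _; exact: exprn_ge0.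
have [i|I0] := pickP I; last first.
  by rewrite big_pred0 // expr0n /= mulr_ge0 // exprn_ge0.
pose m := [arg max_(j > i) y j]%O.
have ym j : y j <= y m by rewrite /m; case: arg_maxP => // k _; exact.
have H : \sum_j y j <= #|I|%:R * y m.
  by rewrite (le_trans (ler_sum _ (fun j _ => ym j))) // sumr_const mulr_natl.
rewrite (@le_trans _ _ ((#|I|%:R * y m) ^+ q.+1)) //.
  by rewrite lerXn2r // nnegrE ?mulr_ge0 ?sumr_ge0.
rewrite exprMn ler_wpM2l ?exprn_ge0 // (bigD1 m) //= lerDl sumr_ge0 // => j _.
exact: exprn_ge0.
Qed.

(** A weighted substitute for Cauchy-Schwarz that takes no square roots of integrals. *)
Lemma young_pow (x y lam : R) (q : nat) : 0 < lam ->
  `|x * y| ^+ q <= lam^-1 * `|x| ^+ (2 * q) + lam * `|y| ^+ (2 * q).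
Proof.
move=> l0; rewrite normrM exprMn mulnC !exprM.
move: (`|x| ^+ q) (`|y| ^+ q) (exprn_ge0 q (normr_ge0 x)) (exprn_ge0 q (normr_ge0 y)) => u v u0 v0.
have : 0 <= lam^-1 * (u - lam * v) ^+ 2 by rewrite mulr_ge0 ?sqr_ge0 // invr_ge0 ltW.
have -> : lam^-1 * (u - lam * v) ^+ 2 = lam^-1 * u ^+ 2 - 2 * (u * v) + lam * v ^+ 2.
  by field; rewrite gt_eqF.
have := mulr_ge0 u0 v0; move: (u * v) (lam^-1 * _) (lam * _) => *; lra.
Qed.

Section Mom.
Context d (T : measurableType d) (P : probability T R).
Implicit Types (f : T -> R).

(* No measurability: the integral of a nonnegative function is a supremum over simple
   functions below it. *)
Lemma ge0_integral_mono (F G : T -> \bar R) :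
  (forall x, (0 <= F x)%E) -> (forall x, (F x <= G x)%E) ->
  (\int[P]_x F x <= \int[P]_x G x)%E.
Proof.
move=> F0 FG; rewrite !ge0_integralTE //; last by move=> x; exact: le_trans (FG x).
apply: ereal_sup_le => _ [h hF <-]; exists h => //= x.
exact: le_trans (FG x).
Qed.

(** Natural exponents without the final root: pointwise polynomial bounds integrate directly. The
    value may be infinite. *)
Definition mom f (q : nat) : \bar R := (\int[P]_x (`|f x| ^+ q)%:E)%E.


Lemma mom_mono f h q : (forall x, `|f x| <= `|h x|) -> (mom f q <= mom h q)%E.
Proof.
move=> fh; apply: ge0_integral_mono => x; rewrite lee_fin ?exprn_ge0 //.
by rewrite lerXn2r // nnegrE.
Qed.

Lemma mom_measurable f q : measurable_fun setT f ->
  measurable_fun setT (fun x => (`|f x| ^+ q)%:E).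
Proof.
move=> mf; apply/measurable_EFinP; apply: measurable_funX.
exact: measurableT_comp mf.
Qed.

Lemma momZ (c : R) f q : measurable_fun setT f ->
  mom (fun x => c * f x) q = ((`|c| ^+ q)%:E * mom f q)%E.
Proof.
move=> mf; rewrite /mom; under eq_integral do rewrite normrM exprMn EFinM.
rewrite ge0_integralZl //; exact: mom_measurable.
Qed.

Lemma mom_pow f M q : mom (fun x => f x ^+ M) q = mom f (M * q).
Proof. by apply: eq_integral => x _; rewrite normrX exprM. Qed.

(** Linearity of the integral is applied to the dominating functions, which are measurable; [F] is
    arbitrary. *)
Lemma mom_dom2 (F f1 f2 : T -> R) (c1 c2 : R) (q q1 q2 : nat) : 0 <= c1 -> 0 <= c2 ->
  measurable_fun setT f1 -> measurable_fun setT f2 ->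
  (forall x, `|F x| ^+ q <= c1 * `|f1 x| ^+ q1 + c2 * `|f2 x| ^+ q2) ->
  (mom F q <= c1%:E * mom f1 q1 + c2%:E * mom f2 q2)%E.
Proof.
move=> c10 c20 m1 m2 H.
rewrite /mom -!ge0_integralZl //; try by move=> x _; rewrite lee_fin exprn_ge0.
- rewrite -ge0_integralD //.
  + by apply: ge0_integral_mono => x; rewrite ?lee_fin ?exprn_ge0 // -!EFinM -EFinD lee_fin.
  + by move=> x _; rewrite -EFinM lee_fin mulr_ge0 // exprn_ge0.
  + by apply: measurable_funeM; exact: mom_measurable.
  + by move=> x _; rewrite -EFinM lee_fin mulr_ge0 // exprn_ge0.
  + by apply: measurable_funeM; exact: mom_measurable.
- exact: mom_measurable.
- exact: mom_measurable.
Qed.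

Lemma mom_young f h q (lam : R) : 0 < lam -> measurable_fun setT f -> measurable_fun setT h ->
  (mom (fun x => f x * h x)%R q <= lam^-1%:E * mom f (2 * q) + lam%:E * mom h (2 * q))%E.
Proof.
move=> l0 mf mh; apply: mom_dom2 => //; [by rewrite invr_ge0 ltW|exact: ltW|].
by move=> x; exact: young_pow.
Qed.

Lemma mom_sum (I : finType) (F : I -> T -> R) q : (forall i, measurable_fun setT (F i)) ->
  (mom (fun x => \sum_i `|F i x|)%R q.+1 <= (#|I|%:R ^+ q.+1)%:E * \sum_i mom (F i) q.+1)%E.
Proof.
move=> mF; have -> : (\sum_i mom (F i) q.+1 = \int[P]_x \sum_i (`|F i x| ^+ q.+1)%:E)%E.
  rewrite ge0_integral_sum //; first by move=> i; exact: mom_measurable.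
rewrite /mom.
rewrite -ge0_integralZl //; try (by rewrite lee_fin exprn_ge0);
  try (by move=> x _; apply: sume_ge0 => i _; rewrite lee_fin exprn_ge0);
  try (by apply: emeasurable_sum => i; exact: mom_measurable).
apply: ge0_integral_mono => x; first by rewrite lee_fin exprn_ge0.
rewrite sumEFin -EFinM lee_fin ger0_norm ?sumr_ge0 //.
by apply: (le_trans (sum_pow_le _ _)).
Qed.

Lemma mom_add f h q : measurable_fun setT f -> measurable_fun setT h ->
  (mom (fun x => f x + h x)%R q.+1 <= (2 ^+ q.+1)%:E * mom f q.+1 + (2 ^+ q.+1)%:E * mom h q.+1)%E.
Proof.
move=> mf mh; apply: mom_dom2; rewrite ?exprn_ge0 // => x.
have y0 (b : bool) : 0 <= (if b then `|f x| else `|h x|) by case: b.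
have := sum_pow_le q y0; rewrite !big_bool card_bool mulrDr => H2.
apply: le_trans H2; rewrite lerXn2r ?nnegrE ?addr_ge0 //; exact: ler_normD.
Qed.

Lemma mom_cst c q : mom (cst c) q = (`|c| ^+ q)%:E.
Proof. rewrite /mom (eq_integral (cst (`|c| ^+ q)%:E)) // integral_cst //.
by rewrite [X in (_ * X)%E]probability_setT mule1. Qed.

End Mom.
Section Families.
Context {dX : nat -> measure_display} {X : forall n, measurableType (dX n)}.
Context (P : forall n, probability (X n) R).
Implicit Types (Y : forall n, X n -> R).

Definition measf Y := forall n, measurable_fun setT (Y n).
Definition bddm (q : nat) Y := exists C : R, \forall n \near \oo, (mom (P n) (Y n) q <= C%:E)%E.
Definition vanm (q : nat) Y := forall e : R, 0 < e -> \forall n \near \oo, (mom (P n) (Y n) q <= e%:E)%E.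

Lemma vanm_bddm q Y : vanm q Y -> bddm q Y.
Proof. by move=> v; exists 1; exact: v. Qed.

Lemma bddm_add q Y Z : measf Y -> measf Z -> bddm q.+1 Y -> bddm q.+1 Z ->
  bddm q.+1 (fun n x => Y n x + Z n x).
Proof.
move=> mY mZ [C HC] [C' HC']; exists (2 ^+ q.+1 * C + 2 ^+ q.+1 * C'); near=> n.
apply: (le_trans (mom_add (P n) q (mY n) (mZ n))).
rewrite EFinD !EFinM leeD // lee_wpmul2l ?lee_fin ?exprn_ge0 //; near: n; assumption.
Unshelve. all: by end_near. Qed.

Lemma vanm_add q Y Z : measf Y -> measf Z -> vanm q.+1 Y -> vanm q.+1 Z ->
  vanm q.+1 (fun n x => Y n x + Z n x).
Proof.
move=> mY mZ vY vZ e e0.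
have e'0 : 0 < e / (2 * 2 ^+ q.+1) by rewrite divr_gt0 // mulr_gt0 // exprn_gt0.
near=> n.
apply: (le_trans (mom_add (P n) q (mY n) (mZ n))).
have -> : e = 2 ^+ q.+1 * (e / (2 * 2 ^+ q.+1)) + 2 ^+ q.+1 * (e / (2 * 2 ^+ q.+1)).
  by field; rewrite expf_neq0 // pnatr_eq0.
rewrite EFinD [in leRHS]EFinM leeD // lee_wpmul2l ?lee_fin ?exprn_ge0 //;
  near: n; [exact: vY|exact: vZ].
Unshelve. all: by end_near. Qed.

Lemma vanm_sum (I : finType) q (Y : I -> forall n, X n -> R) :
  (forall i, measf (Y i)) -> (forall i, vanm q.+1 (Y i)) ->
  vanm q.+1 (fun n x => \sum_i `|Y i n x|).
Proof.
move=> mY vY e e0.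
pose c : R := #|I|%:R ^+ q.+1 * #|I|%:R + 1.
have c0 : 0 < c by rewrite ltr_wpDl // mulr_ge0 // exprn_ge0.
have H : \forall n \near \oo, forall i, (mom (P n) (Y i n) q.+1 <= (e / c)%:E)%E.
  by apply: filter_forall => i; apply: vY; rewrite divr_gt0.
near=> n.
apply: (le_trans (mom_sum (P n) q (fun i => mY i n))).
apply: (@le_trans _ _ ((#|I|%:R ^+ q.+1)%:E * \sum_(i : I) (e / c)%:E)%E).
  rewrite lee_wpmul2l ?lee_fin ?exprn_ge0 //; apply: lee_sum => i _.
  by move: i; near: n.
have -> : (\sum_(i : I) (e / c)%:E = (#|I|%:R * (e / c))%:E)%E.
  by rewrite sumEFin sumr_const mulr_natl.
rewrite -EFinM lee_fin.
have -> : #|I|%:R ^+ q.+1 * (#|I|%:R * (e / c)) = e * (#|I|%:R ^+ q.+1 * #|I|%:R / c) by ring.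
by rewrite ler_piMr ?ltW // ltr_pdivrMr // mul1r /c ltrDl.
Unshelve. all: by end_near. Qed.

Lemma bddm_sum (I : finType) q (Y : I -> forall n, X n -> R) :
  (forall i, measf (Y i)) -> (forall i, bddm q.+1 (Y i)) ->
  bddm q.+1 (fun n x => \sum_i `|Y i n x|).
Proof.
move=> mY bY; have [C HC] := choice bY.
exists (#|I|%:R ^+ q.+1 * \sum_i C i).
have H : \forall n \near \oo, forall i, (mom (P n) (Y i n) q.+1 <= (C i)%:E)%E.
  by apply: filter_forall => i; exact: HC.
near=> n.
apply: (le_trans (mom_sum (P n) q (fun i => mY i n))).
rewrite EFinM -sumEFin lee_wpmul2l ?lee_fin ?exprn_ge0 //; apply: lee_sum => i _.
by move: i; near: n.
Unshelve. all: by end_near. Qed.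

Lemma bddm_cst q (c : R) : bddm q (fun n => cst c).
Proof. by exists (`|c| ^+ q); near=> n; rewrite mom_cst. Unshelve. all: by end_near. Qed.

Lemma vanm_seq q (c : nat -> R) : c n @[n --> \oo] --> 0 -> vanm q.+1 (fun n => cst (c n)).
Proof.
move=> c0 e e0.
have m0 : 0 < Num.min 1 e by rewrite lt_min ltr01.
have hc : \forall n \near \oo, `|c n| <= Num.min 1 e by move/cvgr0_norm_le : c0; exact.
near=> n; rewrite mom_cst lee_fin.
have : `|c n| <= Num.min 1 e.
  by near: n; exact: hc.
rewrite le_min => /andP[c1 ce].
by rewrite exprSr (le_trans _ ce) // ler_piMl // exprn_ile1.
Unshelve. all: by end_near. Qed.

(* The product structure of the remainder: a part that is small uniformly as [r -> 0]
   and a part that vanishes for each fixed [r], times a factor with bounded moments. *)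
Lemma vanishing_remainder (q M : nat) (C1 r0 : R) (S : R -> forall n, X n -> R)
    (T vp Y : forall n, X n -> R) : 0 <= C1 -> 0 < r0 ->
  (forall r, 0 < r -> r <= r0 -> measf (S r)) -> measf T -> measf vp ->
  (forall e : R, 0 < e -> exists2 r, 0 < r <= r0 &
     \forall n \near \oo, (mom (P n) (S r n) (2 * q.+1) <= e%:E)%E) ->
  bddm (M * (2 * q.+1)) T -> vanm (2 * q.+1) vp ->
  (forall r, 0 < r -> r <= r0 -> exists2 K : R, 0 <= K & \forall n \near \oo,
     forall x, `|Y n x| <= (C1 * S r n x + K * vp n x) * T n x ^+ M) ->
  vanm q.+1 Y.
Proof.
move=> C10 r00 mS mT mvp hS [C hT] hvp hY e e0.
have C'0 : 0 <= `|C| + 1 by rewrite addr_ge0.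
(* [lam] lets the [T]-part cost [e / 2]; then [e1] lets the small and the vanishing part cost
   [e / 2] together. The added 1 in [lam], [c1] and [k1] keeps the divisors positive. *)
pose lam := e / (2 * (`|C| + 1)).
have lam0 : 0 < lam by rewrite divr_gt0 // mulr_gt0 // ltr_wpDl.
pose w : R := 2 ^+ (2 * q.+1).
have w0 : 0 < w by rewrite exprn_gt0.
pose e1 := lam * e / (4 * w).
have e10 : 0 < e1 by rewrite !divr_gt0 // ?mulr_gt0.
pose c1 := C1 ^+ (2 * q.+1) + 1.
have c10 : 0 < c1 by rewrite ltr_wpDl // exprn_ge0.
have [r /andP[rp rr0] hSr] := hS (e1 / c1) (divr_gt0 e10 c10).
have [K K0 hK] := hY r rp rr0.
pose k1 := K ^+ (2 * q.+1) + 1.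
have k10 : 0 < k1 by rewrite ltr_wpDl // exprn_ge0.
have hv := hvp (e1 / k1) (divr_gt0 e10 k10).
near=> n.
have mSr := mS r rp rr0 n.
have m1 : measurable_fun setT (fun x => C1 * S r n x) by exact: measurable_funM.
have m2 : measurable_fun setT (fun x => K * vp n x) by exact: measurable_funM.
have m12 : measurable_fun setT (fun x => C1 * S r n x + K * vp n x) by exact: measurable_funD.
have mTM : measurable_fun setT (fun x => T n x ^+ M) by exact: measurable_funX.
apply: (@le_trans _ _ (mom (P n) (fun x => (C1 * S r n x + K * vp n x) * T n x ^+ M) q.+1)).
  by apply: mom_mono => x; apply: le_trans (ler_norm _); move: x; near: n.
apply: (le_trans (mom_young (P n) q.+1 lam0 m12 mTM)).
have B1 : (mom (P n) (fun x => C1 * S r n x + K * vp n x)%R (2 * q.+1) <= (w * e1 + w * e1)%:E)%E.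
  have -> : (2 * q.+1 = (2 * q.+1).-1.+1)%N by rewrite mulnS.
  apply: (le_trans (mom_add (P n) _ m1 m2)).
  have -> : ((2 * q.+1).-1.+1 = 2 * q.+1)%N by rewrite mulnS.
  have -> : (w * e1 + w * e1)%:E = (w%:E * e1%:E + w%:E * e1%:E)%E by [].
  rewrite momZ // momZ // !ger0_norm //.
  apply: leeD; apply: lee_wpmul2l; rewrite ?lee_fin ?exprn_ge0 //.
    apply: (@le_trans _ _ ((C1 ^+ (2 * q.+1))%:E * (e1 / c1)%:E)%E).
      by rewrite lee_wpmul2l ?lee_fin ?exprn_ge0 //; near: n.
    rewrite -EFinM lee_fin mulrA ler_pdivrMr // mulrC.
    by apply: ler_wpM2l; [exact: ltW|rewrite /c1 lerDl].
  apply: (@le_trans _ _ ((K ^+ (2 * q.+1))%:E * (e1 / k1)%:E)%E).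
    by rewrite lee_wpmul2l ?lee_fin ?exprn_ge0 //; near: n.
  rewrite -EFinM lee_fin mulrA ler_pdivrMr // mulrC.
  by apply: ler_wpM2l; [exact: ltW|rewrite /k1 lerDl].
have B2 : (mom (P n) (fun x => T n x ^+ M)%R (2 * q.+1) <= (`|C| + 1)%:E)%E.
  rewrite mom_pow; apply: (@le_trans _ _ C%:E); first by near: n.
  by rewrite lee_fin (le_trans (ler_norm _)) // lerDl.
apply: (@le_trans _ _ ((lam^-1)%:E * (w * e1 + w * e1)%:E + lam%:E * (`|C| + 1)%:E)%E).
  by apply: leeD; apply: lee_wpmul2l => //; rewrite lee_fin ?invr_ge0 ltW.
rewrite -!EFinM -EFinD lee_fin le_eqVlt; apply/orP; left; apply/eqP.
rewrite /e1 /lam; field.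
by rewrite !gt_eqF // ltr_wpDl.
Unshelve. all: by end_near. Qed.

End Families.
End Moments.

(** * Between [L^q] norms and natural moments *)

Section NormConversion.
Context {R : realType}.

(** [G] is extended real and arbitrary because in [A1] it is a supremum over a Riemannian ball, not
    known to be measurable in the sample. *)
Lemma mom_le_Lnorm d (T : measurableType d) (P : probability T R) (f : T -> R)
    (G : T -> \bar R) (q : nat) (C : R) :
  (forall x, (`|f x|%:E <= G x)%E) -> 0 <= C -> (Lnorm P (q.+1%:R)%:E G <= C%:E)%E ->
  (mom P f q.+1 <= (C ^+ q.+1)%:E)%E.
Proof.
move=> fG C0 LC.
have q0 : (q.+1%:R : R) != 0 by rewrite pnatr_eq0.
have G0 x : (0 <= G x)%E by apply: le_trans (fG x); rewrite lee_fin.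
apply: (@le_trans _ _ (\int[P]_x (`|G x| `^ q.+1%:R))%E).
  apply: ge0_integral_mono => x; first by rewrite lee_fin exprn_ge0.
  rewrite -powR_mulrn // -poweR_EFin gee0_abs //.
  by apply: gt0_ler_poweR => //; rewrite in_itv /= ?leey ?andbT // lee_fin.
rewrite -poweR_Lnorm // -powR_mulrn // -poweR_EFin.
by apply: gt0_ler_poweR => //; rewrite in_itv /= ?leey ?andbT ?Lnorm_ge0 // lee_fin.
Qed.

(** Below the level [e] the constant dominates, above it [(y / e)^q <= (y / e)^N]; real exponents
    are thus reached from natural ones. *)
Lemma powR_le_scaled (y e q : R) (N : nat) : 0 <= y -> 0 < e -> 1 <= q -> q <= N%:R ->
  y `^ q <= e `^ q * 1 + e `^ q * (e ^- N) * y ^+ N.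
Proof.
move=> y0 e0 q1 qN.
have q0 : 0 <= q by lra.
have eq0 : 0 <= e `^ q by exact: powR_ge0.
have [ye|ey] := leP y e.
  rewrite ler_wpDr // ?mulr1; first by rewrite !mulr_ge0 // ?invr_ge0 exprn_ge0 // ltW.
  by rewrite ge0_ler_powR // ?nnegrE // ltW.
have e0' := ltW e0; have ye0 : 0 <= y / e by rewrite divr_ge0.
apply: (@le_trans _ _ (e `^ q * (e ^- N) * y ^+ N)); last by rewrite lerDr mulr1.
rewrite -[y in leLHS](divfK (lt0r_neq0 e0)) powRM // mulrC -[leRHS]mulrA; apply: ler_wpM2l => //.
have -> : e ^- N * y ^+ N = (y / e) ^+ N by rewrite exprMn mulrC exprVn.
by rewrite -powR_mulrn // ler_powR // ler_pdivlMr // mul1r ltW.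
Qed.

Context {dX : nat -> measure_display} {X : forall n, measurableType (dX n)}.
Context (P : forall n, probability (X n) R).

Lemma bigO_bddm (W : normedModType R) (Y : forall n, X n -> W) (r : nat -> R) (q : nat)
    (f : forall n, X n -> R) :
  (forall n x, `|f n x| <= `|Y n x| / r n) ->
  bigO_Linf P Y r -> bddm P q.+1 f.
Proof.
move=> fY /(_ q.+1%:R) [|C HC]; first by rewrite ler1n.
exists (`|C| ^+ q.+1); near=> n.
apply: (mom_le_Lnorm (G := fun x => (`|Y n x| / r n)%:E)) => [x||] //.
  by rewrite lee_fin.
apply: (@le_trans _ _ C%:E); first by near: n.
by rewrite lee_fin ler_norm.
Unshelve. all: by end_near. Qed.

Lemma littleo_vanm (W : normedModType R) (Y : forall n, X n -> W) (r : nat -> R) (q : nat)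
    (f : forall n, X n -> R) :
  (forall n x, `|f n x| <= `|Y n x| / r n) ->
  littleo_Linf P Y r -> vanm P q.+1 f.
Proof.
move=> fY Hl e e0.
have q1 : 1 <= q.+1%:R :> R by rewrite ler1n.
have /fine_cvgP[fn cv] := Hl _ q1.
have m0 : 0 < Num.min 1 e by rewrite lt_min ltr01.
have hc : \forall n \near \oo, `|fine (normLq P q.+1%:R (Y n) (r n))| <= Num.min 1 e.
  by move/cvgr0_norm_le : cv; exact.
near=> n.
have : `|fine (normLq P q.+1%:R (Y n) (r n))| <= Num.min 1 e by near: n.
set c := Num.min 1 e in m0 *; move=> Hn.
have c1 : c <= 1 by rewrite /c ge_min lexx.
apply: (@le_trans _ _ (c ^+ q.+1)%:E).
  apply: (mom_le_Lnorm (G := fun x => (`|Y n x| / r n)%:E)) => [x||] //.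
  - by rewrite lee_fin.
  - exact: ltW.
  have fnn : normLq P q.+1%:R (Y n) (r n) \is a fin_num by near: n.
  by rewrite -[leLHS]fineK // lee_fin (le_trans (ler_norm _)).
rewrite lee_fin exprSr (le_trans (ler_piMl _ _)) //; first exact: ltW.
  by rewrite exprn_ile1 // ltW.
by rewrite /c ge_min lexx orbT.
Unshelve. all: by end_near. Qed.

(** An integer exponent [N + 1] above [q] suffices. The level [e] is fixed first and the moment is
    then made smaller than [e^(N+1)], so both halves of [powR_le_scaled] contribute [e^q]. *)
Lemma vanm_littleo (W : normedModType R) (Y : forall n, X n -> W) (r : nat -> R)
    (Z : forall n, X n -> R) : measf Z -> (forall n, 0 < r n) ->
  (\forall n \near \oo, forall x, `|Y n x| / r n <= `|Z n x|) ->
  (forall q, vanm P q.+1 Z) -> littleo_Linf P Y r.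
Proof.
move=> mZ r0 YZ vZ q q1.
have [N qN] : exists N : nat, q <= N.+1%:R.
  by exists (Num.truncn q); exact/ltW/truncnS_gt.
have q0 : 0 < q by lra.
have key (e : R) : 0 < e -> \forall n \near \oo, (normLq P q (Y n) (r n) <= (2 * e)%:E)%E.
  move=> e0; have eN : 0 < e ^+ N.+1 by rewrite exprn_gt0.
  have := vZ N _ eN => hv; near=> n.
  have Hn : forall x, `|Y n x| / r n <= `|Z n x| by near: n.
  have eq0 : 0 <= e `^ q by exact: powR_ge0.
  have I : (\int[P n]_x (`|(`|Y n x| / r n)%:E| `^ q) <= (2 * e `^ q)%:E)%E.
    have y0 x : 0 <= `|Y n x| / r n by rewrite divr_ge0 // ltW.
    apply: (@le_trans _ _ (mom (P n) (fun x => (`|Y n x| / r n) `^ q)%R 1)).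
      rewrite /mom; apply: ge0_integral_mono => x; first exact: poweR_ge0.
      by rewrite abse_EFin poweR_EFin lee_fin expr1 !ger0_norm // powR_ge0.
    have c20 : 0 <= e `^ q * e ^- N.+1 by rewrite mulr_ge0 // invr_ge0 ltW.
    have m1 : measurable_fun setT (cst 1 : X n -> R) by [].
    have := @mom_dom2 R _ _ (P n) (fun x => (`|Y n x| / r n) `^ q) (cst 1) (Z n)
      (e `^ q) (e `^ q * e ^- N.+1) 1 1 N.+1 eq0 c20 m1 (mZ n).
    move=> H; apply: (le_trans (H _)) => [x|].
      rewrite !expr1 normr1 ger0_norm ?powR_ge0 //.
      rewrite (le_trans (ge0_ler_powR (ltW q0) _ _ (Hn x))) ?nnegrE //.
      exact: powR_le_scaled.
    rewrite mom_cst normr1 expr1 mule1.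
    have -> : 2 * e `^ q = e `^ q + (e `^ q * e ^- N.+1) * e ^+ N.+1.
      by rewrite divfK ?gt_eqF //; ring.
    rewrite [leRHS]EFinD [X in (_ <= _ + X)%E]EFinM; apply: leeD => //.
    apply: lee_wpmul2l; first by rewrite lee_fin.
    by near: n.
  rewrite /normLq unlock.
  apply: (@le_trans _ _ ((2 * e `^ q)%:E `^ q^-1)%E).
    apply: gt0_ler_poweR => //; first by rewrite invr_ge0 ltW.
    - by rewrite in_itv /= leey andbT integral_ge0 // => x _; exact: poweR_ge0.
    - by rewrite in_itv /= leey andbT lee_fin mulr_ge0.
  rewrite poweR_EFin lee_fin powRM // -powRrM mulfV ?gt_eqF // (powRr1 (ltW e0)).
  apply: ler_wpM2r; first exact: ltW.
  rewrite -[leRHS]powRr1 // ler_powR // ?ler1n //.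
  by rewrite invf_le1.
have N0 n : (0 <= normLq P q (Y n) (r n))%E by exact: Lnorm_ge0.
apply/fine_cvgP; split.
  have := key 1 ltr01; apply: filterS => n Hn.
  by rewrite ge0_fin_numE // (le_lt_trans Hn) // ltry.
apply/cvgr0Pnorm_le => e e0; have e2 : 0 < e / 2 by rewrite divr_gt0.
have := key _ e2; apply: filterS => n Hn.
rewrite /= ger0_norm ?fine_ge0 // -lee_fin fineK; last first.
  by rewrite ge0_fin_numE // (le_lt_trans Hn) // ltry.
by move: Hn; rewrite mulrCA divff ?mulr1 // mulrC divfK.
Unshelve. all: by end_near. Qed.

End NormConversion.

(** * Measurability in the sample *)

Section Measurability.
Context {R : realType} {p : nat}.
Local Notation pt := 'rV[R]_p.

Lemma derivable_seq (f : pt -> R) (t v : pt) : differentiable f t ->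
  (fun k : nat => k.+1%:R * (f (t + k.+1%:R^-1 *: v) - f t)) @ \oo --> 'D_v f t.
Proof.
move=> df; have dv : derivable f t v by exact: diff_derivable.
have cv : (fun h : R => h^-1 *: (f (h *: v + t) - f t)) @ 0^' --> 'D_v f t by [].
have := (cvgr_dnbhsP _ _ _).1 cv (@harmonic R).
move=> /(_ (conj _ cvg_harmonic)) H.
have {}H := H (fun k => lt0r_neq0 (harmonic_gt0 k)).
apply: cvg_trans H; apply: near_eq_cvg; near=> k.
by rewrite /harmonic /= invrK [_ + t]addrC.
Unshelve. all: by end_near. Qed.

(** Limit of difference quotients with steps [1/(k+1)]; points that fall outside [O] are replaced by
    [t], which affects finitely many [k]. *)
Lemma derive_measurable d (T : measurableType d) (F : T -> pt -> R) (O : set pt) (v t : pt) :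
  open O -> O t -> (forall s, O s -> measurable_fun setT (fun x => F x s)) ->
  (forall x, differentiable (F x) t) -> measurable_fun setT (fun x => 'D_v (F x) t).
Proof.
move=> oO Ot mF dF.
pose s k := if `[< O (t + k.+1%:R^-1 *: v) >] then t + k.+1%:R^-1 *: v else t.
have Os k : O (s k) by rewrite /s; case: asboolP.
apply: (@measurable_fun_cvg _ _ _ _ (fun k x => k.+1%:R * (F x (s k) - F x t))).
  move=> k; apply: measurable_funM => //; apply: measurable_funB; exact: mF.
have ev : \forall k \near \oo, O (t + (k.+1%:R^-1 : R) *: v).
  have cu : (fun k : nat => t + (k.+1%:R^-1 : R) *: v) @ \oo --> t.
    rewrite -[X in _ --> X]addr0 -[X in _ + X](scale0r v).
    apply: cvgD; first exact: cvg_cst.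
    by apply: cvgZr_tmp; exact: cvg_harmonic.
  by apply: cu; apply: open_nbhs_nbhs.
move=> x _; have H := derivable_seq (v := v) (dF x); apply: cvg_trans H; apply: near_eq_cvg.
by near=> k; rewrite /s asboolT //; near: k.
Unshelve. all: by end_near. Qed.

(** The integral of a continuous function is weakly continuous, so its superlevel sets are weakly
    open. *)
Lemma mI_measurable (Theta : set pt) (cT : compact Theta) d (T : measurableType d)
    (mu : T -> probability (borelV R p) R) (f : pt -> R) :
  (forall W, weakly_open Theta W -> measurable (mu @^-1` W)) ->
  continuous f -> measurable_fun setT (fun x => mI Theta (mu x) f).
Proof.
move=> mW cf; apply: (measurability _ (RGenOInfty.measurableE R)) => //.
move=> _ [_ [c ->] <-]; rewrite setTI.
rewrite (_ : _ @^-1` _ = mu @^-1` [set m | c < mI Theta m f]); last first.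
  by apply/seteqP; split=> x /=; rewrite in_itv /= andbT.
apply: mW => m mT /= cm.
exists 1%N, (fun=> f), (mI Theta m f - c); split; first by rewrite subr_gt0.
- by move=> _; exact: continuous_subspaceT.
- move=> m' m'T /(_ ord0) /=; rewrite -/(mI Theta m' f) -/(mI Theta m f).
  by rewrite ltr_distl => /andP[]; rewrite subKr.
Qed.

End Measurability.

Lemma rat_dense_row {R : realType} {p : nat} (t : 'rV[R]_p) (A : set 'rV[R]_p) :
  nbhs t A -> exists q : 'rV[rat]_p, A (map_mx ratr q).
Proof.
move=> /cball_sub_nbhs[r r0 rA].
have H (i : 'I_p) : exists q : rat, t 0 i - r < ratr q < t 0 i + r.
  have lt : t 0 i - r < t 0 i + r by lra.
  by have [q] := rat_in_itvoo lt; rewrite in_itv /=; exists q.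
have [q Hq] := choice H; exists (\row_i q i); apply: rA.
rewrite /cball /=; apply: norm_le_coord; first exact: ltW.
by move=> i; rewrite !mxE ler_distl; have /andP[/ltW -> /ltW ->] := Hq i.
Qed.

Section MomSum.
Context {R : realType} d (T : measurableType d) (P : probability T R).
Lemma mom_sum_small (I : finType) (F : I -> T -> R) q (e : R) : 0 < e ->
  (forall i, measurable_fun setT (F i)) ->
  (forall i, (mom P (F i) q.+1 <= (e / (#|I|%:R ^+ q.+1 * #|I|%:R + 1))%:E)%E) ->
  (mom P (fun x => \sum_i `|F i x|)%R q.+1 <= e%:E)%E.
Proof.
move=> e0 mF HF.
set c := _ + 1 in HF.
have c0 : 0 < c by rewrite /c ltr_wpDl // mulr_ge0 // exprn_ge0.
apply: (le_trans (mom_sum P q mF)).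
apply: (@le_trans _ _ ((#|I|%:R ^+ q.+1)%:E * \sum_(i : I) (e / c)%:E)%E).
  by rewrite lee_wpmul2l ?lee_fin ?exprn_ge0 //; apply: lee_sum => i _.
have -> : (\sum_(i : I) (e / c)%:E = (#|I|%:R * (e / c))%:E)%E.
  by rewrite sumEFin sumr_const mulr_natl.
rewrite -EFinM lee_fin.
have -> : #|I|%:R ^+ q.+1 * (#|I|%:R * (e / c)) = e * (#|I|%:R ^+ q.+1 * #|I|%:R / c) by ring.
by rewrite ler_piMr ?ltW // ltr_pdivrMr // mul1r /c ltrDl.
Qed.
End MomSum.

Section SupOverBall.
Context {R : realType} {p : nat}.
Local Notation pt := 'rV[R]_p.
Context (t0 : pt) (U : set pt) (oU : open U) (rb : R) (rU : cball t0 rb `<=` U).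

(** Rational points of the ball of radius [2 r], enumerated by [unpickle], with [t0] as default. A
    countable supremum is measurable in the sample; the doubled radius makes every point with
    [|t - t0| <= r] a limit of enumerated points. *)
Definition ball_point (r : R) (m : nat) : pt :=
  if unpickle m is Some q then
    let s := map_mx ratr (q : 'rV[rat]_p) in if `|s - t0| < 2 * r then s else t0
  else t0.

Lemma ball_point_in r m : 0 < r -> `|ball_point r m - t0| < 2 * r.
Proof.
move=> r0; have H : `|t0 - t0| < 2 * r by rewrite subrr normr0 mulr_gt0.
by rewrite /ball_point; case: unpickle => // q; case: ifP.
Qed.

Definition ball_sup (r : R) (W : pt -> R) : R :=
  fine (esups (fun m => (`|W (ball_point r m)|)%:E) 0%N).

Lemma esups0_ub (u : nat -> \bar R) m : (u m <= esups u 0%N)%E.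
Proof. by apply: ereal_sup_ubound; exists m. Qed.

Lemma ball_sup_fin (r : R) (W : pt -> R) : 0 < r -> 2 * r <= rb ->
  (forall t, U t -> {for t, continuous W}) ->
  esups (fun m => (`|W (ball_point r m)|)%:E) 0%N \is a fin_num.
Proof.
move=> r0 rrb cW.
have [C C0 HC] : exists2 C : R, 0 <= C & forall t, cball t0 rb t -> `|W t| <= C.
  apply: compact_bounded_fun; first exact: compact_cball.
  by apply: continuous_in_subspaceT => t; rewrite inE => /rU; exact: cW.
rewrite ge0_fin_numE; last first.
  by apply: le_trans (esups0_ub _ 0%N); rewrite lee_fin.
apply: (@le_lt_trans _ _ C%:E); last by rewrite ltry.
apply: ge_ereal_sup => _ [m _ <-]; rewrite lee_fin; apply: HC.
by rewrite /cball /= (le_trans (ltW (ball_point_in m r0))).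
Qed.

Lemma ball_sup_ub (r : R) (W : pt -> R) t : 0 < r -> 2 * r <= rb ->
  (forall t, U t -> {for t, continuous W}) -> `|t - t0| <= r -> `|W t| <= ball_sup r W.
Proof.
move=> r0 rrb cW tr; rewrite leNgt; apply/negP => lt.
have Ut : U t by apply: rU; rewrite /cball /= (le_trans tr) // (le_trans _ rrb) // mulr2n mulrDl mul1r lerDl ltW.
have cNW : {for t, continuous (fun s => `|W s|)} by exact: (cvg_norm (cW t Ut)).
have N1 : nbhs t [set s | ball_sup r W < `|W s|].
  apply: (cNW [set x | ball_sup r W < x]).
  exact: (open_nbhs_nbhs (conj (@open_gt _ (ball_sup r W)) lt)).
have N2 : nbhs t [set s | `|s - t0| < 2 * r].
  have tr2 : `|t - t0| < 2 * r by rewrite (le_lt_trans tr) // mulr2n mulrDl mul1r ltrDl.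
  apply: open_nbhs_nbhs; split; last exact: tr2.
  apply: (@open_comp _ _ (fun s : pt => `|s - t0|) [set x | x < 2 * r]); last exact: open_lt.
  by move=> s _; exact: norm_sub_continuous.
have [q [q1 q2]] := rat_dense_row (filterI N1 N2).
have := esups0_ub (fun m => (`|W (ball_point r m)|)%:E) (pickle q).
rewrite -(fineK (ball_sup_fin r0 rrb cW)) lee_fin -/(ball_sup r W) leNgt => /negP; apply.
by rewrite /ball_point pickleK /=; move: q2 => /= ->.
Qed.

Lemma ball_sup_le_esup (r : R) (W : pt -> R) (A : set pt) : 0 < r -> 2 * r <= rb ->
  (forall t, U t -> {for t, continuous W}) ->
  (forall t, `|t - t0| <= 2 * r -> A t) ->
  ((`|ball_sup r W|)%:E <= ereal_sup [set (`|W t|)%:E | t in A])%E.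
Proof.
move=> r0 rrb cW HA.
rewrite ger0_norm; last first.
  rewrite /ball_sup fine_ge0 //.
  by apply: le_trans (esups0_ub _ 0%N); rewrite lee_fin.
rewrite /ball_sup fineK; last exact: ball_sup_fin.
apply: ge_ereal_sup => _ [m _ <-]; apply: ereal_sup_ubound.
by exists (ball_point r m) => //; apply: HA; exact: ltW (ball_point_in m r0).
Qed.

Lemma ball_sup_measurable d (T : measurableType d) (W : T -> pt -> R) (r : R) : 0 < r -> 2 * r <= rb ->
  (forall t, U t -> measurable_fun setT (fun x => W x t)) ->
  measurable_fun setT (fun x => ball_sup r (W x)).
Proof.
move=> r0 rrb mW; apply: (measurableT_comp (fine_measurable _)) => //.
apply: (measurable_fun_esups (f := fun m x => (`|W x (ball_point r m)|)%:E)) => m.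
apply/measurable_EFinP; apply: measurableT_comp => //; apply: mW; apply: rU.
by rewrite /cball /= (le_trans (ltW (ball_point_in m r0))).
Qed.


End SupOverBall.

(** * A continuous cutoff for the tail *)

Section Cutoff.
Context {R : realType} {p : nat}.
Local Notation pt := 'rV[R]_p.

(** Truncation to [[0, 1]] by absolute values, so that continuity is immediate: [z] is the positive
    part of [y], and the outer formula is the minimum of 1 and [z]. *)
Definition clamp (y : R) : R :=
  let z := 2^-1 * (y + `|y|) in 2^-1 * (1 + z - `|1 - z|).

Lemma clamp_bounds y : 0 <= clamp y <= 1.
Proof.
rewrite /clamp; case: (ler0P y) => y0; rewrite ?subrr ?mulr0.
  by rewrite addr0 subr0 normr1 subrr mulr0 lexx ler01.
have -> : 2^-1 * (y + y) = y by field.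
by case: (ler0P (1 - y)) => H; apply/andP; split; lra.
Qed.

Lemma clamp0 y : y <= 0 -> clamp y = 0.
Proof. by move=> y0; rewrite /clamp ler0_norm // subrr mulr0 addr0 subr0 normr1 subrr mulr0. Qed.

Lemma clamp1 y : 1 <= y -> clamp y = 1.
Proof.
move=> y1; rewrite /clamp ger0_norm; last by lra.
have -> : 2^-1 * (y + y) = y by field.
by rewrite ler0_norm; [field|lra].
Qed.

Lemma clamp_continuous (f : pt -> R) : continuous f -> continuous (fun t => clamp (f t)).
Proof.
move=> cf; have c1 : continuous (cst 1 : pt -> R) by move=> t; exact: cst_continuous.
have cz : continuous (fun t => 2^-1 * (f t + `|f t|)).
  by apply: contZ; apply: contD => //; exact: cont_norm.
apply: contZ; apply: contB; first exact: contD.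
by apply: cont_norm; exact: contB.
Qed.

(** It is 0 on the ball of radius [del] and 1 off the ball of radius [2 del]. It replaces the
    indicator of the tail because integrals of continuous functions depend measurably on the
    sample. *)
Definition cutoff (t0 : pt) (del : R) (t : pt) : R := clamp (del^-1 * `|t - t0| - 1).

Lemma cutoff_continuous t0 del : continuous (cutoff t0 del).
Proof.
apply: clamp_continuous; apply: contB; last by move=> t; exact: cst_continuous.
by apply: contZ; exact: norm_sub_continuous.
Qed.

Lemma cube_le_cutoff (t0 t : pt) (del D : R) : 0 < del -> `|t - t0| <= D ->
  `|t - t0| ^+ 3 <= 2 * del * `|t - t0| ^+ 2 + D ^+ 3 * cutoff t0 del t.
Proof.
move=> d0 tD; have /andP[c0 c1] := clamp_bounds (del^-1 * `|t - t0| - 1).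
have [small|big] := leP `|t - t0| (2 * del).
  rewrite ler_wpDr //; first by rewrite mulr_ge0 // exprn_ge0 // (le_trans _ tD).
  by rewrite exprS ler_wpM2r // exprn_ge0.
rewrite /cutoff clamp1; last first.
  by rewrite lerBrDr mulrC ler_pdivlMr //; exact: ltW.
rewrite mulr1 ler_wpDl // ?lerXn2r ?nnegrE // ?(le_trans _ tD) //.
by rewrite !mulr_ge0 ?exprn_ge0 // ltW.
Qed.

Lemma cutoff_eq0 (t0 t : pt) del : 0 < del -> `|t - t0| <= del -> cutoff t0 del t = 0.
Proof.
by move=> d0 td; rewrite /cutoff clamp0 // subr_le0 mulrC ler_pdivrMr // mul1r.
Qed.

End Cutoff.

Section LimsupExtraction.
Context {R : realType}.

Lemma limn_esup_lt (u : nat -> \bar R) (e : \bar R) : (limn_esup u < e)%E ->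
  \forall n \near \oo, (u n <= e)%E.
Proof.
rewrite /limn_esup limf_esupE => /ereal_inf_lt[_ [V [N _ NV] <-]] lt.
exists N => // n Nn; apply: (le_trans _ (ltW lt)).
by apply: ereal_sup_ubound; exists n => //; exact: NV.
Qed.

Lemma limsup_small (u : R -> nat -> \bar R) :
  limn_esup (u r) @[r --> (0 : R)^'+] --> 0%E ->
  forall e : R, 0 < e -> exists2 rho : R, 0 < rho &
    forall r, 0 < r -> r < rho -> \forall n \near \oo, (u r n <= e%:E)%E.
Proof.
move=> H e e0.
have /H : nbhs (0%E : \bar R) [set x | (x < e%:E)%E].
  apply: open_nbhs_nbhs; split; last by rewrite /= lte_fin.
  exact: open_ereal_lt_ereal.
move=> [rho /= rho0 Hrho]; exists rho => // r r0 rr.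
apply: limn_esup_lt; apply: Hrho => //=.
by rewrite sub0r normrN gtr0_norm.
Qed.

End LimsupExtraction.

(** * Size variables of the jets under [A1] *)

Section Families.
Context {R : realType} {p : nat}.
Local Notation pt := 'rV[R]_p.
Context {Theta : set pt} (cT : compact Theta) {g : pt -> 'M[R]_p} (hg : metric_on Theta g).
Context {dX : nat -> measure_display} {X : forall n, measurableType (dX n)}.
Context (P : forall n, probability (X n) R) {Psi : forall n, X n -> pt -> pt}.
Context (hPsi : random_one_form Theta Psi) {a : nat -> R} (a0 : forall n, 0 < a n).
Context {Pc : pt -> pt -> pt} (hPc : precontrast Theta g Pc).
Context {t0 : pt} (It : interior Theta t0).
Context {U : set pt} {phi sigma : pt -> pt} (hch : chart Theta t0 U phi sigma).
Local Notation E := (chart_field phi sigma).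

Lemma chart_sub_interior : U `<=` interior Theta.
Proof.
have [[oU _] [_ UT] _ _ _] := hch.
by move=> t Ut; apply: (filterS UT); exact: (open_nbhs_nbhs (conj oU Ut)).
Qed.

Lemma one_form_Ck_chart n (x : X n) m l : Ck m U (fun t => Psi x t 0 l).
Proof. by apply: smooth_near_Ck (hPsi.2 n x l); have [_ []] := hch. Qed.

Lemma form_app_measurable n k t : U t ->
  measurable_fun setT (fun x : X n => form_app (Psi x) (E k) t).
Proof.
move=> Ut; apply: measurable_sum => i; apply: measurable_funM => //.
by apply: hPsi.1; have [_ [_ UT] _ _ _] := hch; exact: UT.
Qed.

Lemma form_app_dirder_measurable n j k t : U t ->
  measurable_fun setT (fun x : X n => dirder (E j) (form_app (Psi x) (E k)) t).
Proof.
move=> Ut; have [[oU _] _ _ _ _] := hch.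
apply: (@derive_measurable _ _ _ _ (fun (x : X n) s => form_app (Psi x) (E k) s) U (E j t) t oU Ut) => [s Us|x].
  exact: form_app_measurable.
by have F := form_app_Ck hch (n := 0%N) k (one_form_Ck_chart x 0); exact: F.
Qed.

Definition second_jet n (x : X n) (ijk : 'I_p * 'I_p * 'I_p) : pt -> R := fun t =>
  dirder (E ijk.1.1) (dirder (E ijk.1.2) (form_app (Psi x) (E ijk.2))) t
  - dirder (E ijk.1.1) (dirder (E ijk.1.2) (form_app (Pc t0) (E ijk.2))) t.

Lemma second_jet_measurable n ijk t : U t ->
  measurable_fun setT (fun x : X n => second_jet x ijk t).
Proof.
move=> Ut; have [[oU _] _ _ _ _] := hch.
apply: measurable_funB => //.
apply: (@derive_measurable _ _ _ _ (fun (x : X n) => dirder (E ijk.1.2) (form_app (Psi x) (E ijk.2))) U (E ijk.1.1 t) t oU Ut) => [s Us|x].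
  exact: form_app_dirder_measurable.
have F := form_app_Ck hch (n := 1) ijk.2 (one_form_Ck_chart x 1).
by have F1 := dirder_chart_Ck hch (n := 0%N) ijk.1.2 F; exact: F1.
Qed.

Lemma second_jet_continuous n (x : X n) ijk t : U t -> {for t, continuous (second_jet x ijk)}.
Proof.
move=> Ut; have D (al : pt -> pt) : (forall l, Ck 2 U (fun t : pt => al t 0 l)) ->
    Ck 0 U (dirder (E ijk.1.1) (dirder (E ijk.1.2) (form_app al (E ijk.2)))).
  move=> Hal; have F := form_app_Ck hch (n := 2) ijk.2 Hal.
  have F1 := dirder_chart_Ck hch (n := 1) ijk.1.2 F.
  exact: (dirder_chart_Ck hch (n := 0) ijk.1.1 F1).
apply: differentiable_continuous; apply: differentiableB; apply: D Ut => l.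
  exact: one_form_Ck_chart.
apply: (Ck_sub chart_sub_interior); exact: (pc_Ck1 hPc 2 l It).
Qed.

Definition jet_sup (r : R) n (x : X n) : R := \sum_ijk `|ball_sup t0 r (second_jet x ijk)|.

Lemma jet_sup_ge0 r n (x : X n) : 0 <= jet_sup r x.
Proof. exact: sumr_ge0. Qed.

Context {rb : R} (rb0 : 0 < rb) (rU : cball t0 rb `<=` U).

Lemma jet_sup_measurable r : 0 < r -> 2 * r <= rb -> measf (jet_sup r).
Proof.
move=> r0 rr n; apply: measurable_sum => ijk; apply: measurableT_comp => //.
apply: (ball_sup_measurable rU r0 rr) => t Ut; exact: second_jet_measurable.
Qed.

Lemma second_jet_le_sup r n (x : X n) i j k t : 0 < r -> 2 * r <= rb -> `|t - t0| <= r ->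
  `|second_jet x (i, j, k) t| <= jet_sup r x.
Proof.
move=> r0 rr tr.
have := ball_sup_ub rU r0 rr (second_jet_continuous (x := x) (ijk := (i, j, k))) tr.
move=> /le_trans; apply; rewrite /jet_sup (bigD1 (i, j, k)) //=.
by apply: ler_wpDr; [exact: sumr_ge0 | exact: ler_norm].
Qed.

(** Two kinds of balls are compared: [A1] uses a Riemannian radius, [jet_sup] the maximum norm with
    radius [2 r]. Segments inside the chart ball give [d <= C |h|], hence Riemannian radius
    [2 C r]. *)
Lemma jet_sup_small :
  (forall q : R, 1 <= q ->
        limn_esup (fun n =>
          \big[maxe/0%E]_(ijk : 'I_p * 'I_p * 'I_p)
            let: (i, j, k) := ijk in
            Lnorm (P n) q%:E (fun x =>
              ereal_sup [set `|dirder (E i) (dirder (E j) (form_app (Psi x) (E k))) t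
                         - dirder (E i) (dirder (E j) (form_app (Pc t0) (E k))) t|%:E
                        | t in [set t | Theta t /\ riem_dist Theta g t t0 <= r]]))
        @[r --> (0 : R)^'+] --> 0%E) ->
  forall (q : nat) (e : R), 0 < e -> exists2 r1 : R, 0 < r1 &
    forall r, 0 < r -> r <= r1 -> \forall n \near \oo, (mom (P n) (jet_sup r (n:=n)) q.+1 <= e%:E)%E.
Proof.
move=> H q e e0; have [C C0 HC] := riem_dist_upper hg cT.
have [_ [_ UT] _ _ _] := hch.
set c := (e / (#|{: 'I_p * 'I_p * 'I_p}|%:R ^+ q.+1 * #|{: 'I_p * 'I_p * 'I_p}|%:R + 1)).
have c0 : 0 < c by rewrite /c divr_gt0 // ltr_wpDl // mulr_ge0 // exprn_ge0.
pose eta := Num.min 1 c.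
have eta0 : 0 < eta by rewrite lt_min ltr01 c0.
have etac : eta ^+ q.+1 <= c.
  apply: (@le_trans _ _ eta); last by rewrite ge_min lexx orbT.
  by rewrite exprS ler_piMr ?(ltW eta0) // exprn_ile1 ?(ltW eta0) // ge_min lexx.
have q1 : 1 <= q.+1%:R :> R by rewrite ler1n.
have [rho rho0 Hrho] := limsup_small (H _ q1) eta0.
(* The factor 1/4 leaves [2 C r <= rho / 2 < rho]; the other entry keeps the doubled ball inside the
   chart. *)
exists (Num.min (2^-1 * rb) (4^-1 * (C^-1 * rho))).
  by rewrite lt_min; apply/andP; split; rewrite !mulr_gt0 // invr_gt0.
move=> r r0; rewrite le_min => /andP[r1 r2].
have rr : 2 * r <= rb by lra.
have rC : 2 * (C * r) < rho.
  have : C * r <= 4^-1 * rho.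
    by have := ler_wpM2l (ltW C0) r2; rewrite mulrCA mulVKf ?gt_eqF.
  lra.
have rC0 : 0 < 2 * (C * r) by rewrite !mulr_gt0.
near=> n.
apply: mom_sum_small => // ijk.
  apply: (ball_sup_measurable rU r0 rr) => t Ut; exact: second_jet_measurable.
apply: (@le_trans _ _ (eta ^+ q.+1)%:E); last by rewrite lee_fin.
have Hn : (\big[maxe/0%E]_(ijk : 'I_p * 'I_p * 'I_p)
            (let: (i, j, k) := ijk in
            Lnorm (P n) (q.+1%:R)%:E (fun x : X n =>
              ereal_sup [set (`|dirder (E i) (dirder (E j) (form_app (Psi x) (E k))) t
                         - dirder (E i) (dirder (E j) (form_app (Pc t0) (E k))) t|%R)%:E
                        | t in [set t : pt | Theta t /\ (riem_dist Theta g t t0 <= 2 * (C * r))%R]])) <= eta%:E)%E.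
  by near: n; exact: Hrho.
apply: (mom_le_Lnorm (G := fun x =>
              ereal_sup [set `|second_jet x ijk t|%:E
                        | t in [set t : pt | Theta t /\ riem_dist Theta g t t0 <= 2 * (C * r)]])) => //.
- move=> x; apply: (ball_sup_le_esup rU r0 rr).
    exact: second_jet_continuous.
  move=> t tr; have Bt : cball t0 rb t by rewrite /cball /= (le_trans tr).
  split; first exact/UT/rU.
  apply: (le_trans (HC t t0 _)).
    move=> s /andP[s0 s1]; apply: UT; apply: rU; rewrite /cball /=.
    have -> : t + s *: (t0 - t) - t0 = (1 - s) *: (t - t0).
      by rewrite scalerBl scale1r -[t0 - t]opprB scalerN addrAC.
    rewrite normrZ ger0_norm; last by rewrite subr_ge0.
    by rewrite (le_trans _ Bt) // ler_piMl // lerBlDr lerDl.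
  by rewrite distrC; have := ler_wpM2l (ltW C0) tr; rewrite mulrCA.
- exact: ltW.
- apply: (le_trans _ Hn); case: ijk => [[i j] k].
  exact: (le_trans _ (le_bigmax _ _ (i, j, k))).
Unshelve. all: by end_near.
Qed.

Definition score_size n (x : X n) : R := \sum_k `|form_app (Psi x) (E k) t0 / a n|.
Definition info_error n (x : X n) : R :=
  \sum_ij `|(dirder (E ij.1) (form_app (Psi x) (E ij.2)) t0
             - ip g t0 (E ij.1 t0) (E ij.2 t0)) / a n `^ 2^-1|.

Lemma chart_center : U t0. Proof. by have [_ []] := hch. Qed.

Lemma score_size_measurable : measf score_size.
Proof.
move=> n; apply: measurable_sum => k; apply: measurableT_comp => //.
by apply: measurable_funM => //; apply: form_app_measurable; exact: chart_center.
Qed.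

Lemma info_error_measurable : measf info_error.
Proof.
move=> n; apply: measurable_sum => k; apply: measurableT_comp => //.
apply: measurable_funM => //; apply: measurable_funB => //.
by apply: form_app_dirder_measurable; exact: chart_center.
Qed.

Lemma score_size_bddm : bigO_Linf P (fun n x => \row_i form_app (Psi x) (E i) t0) a ->
  forall q, bddm P q.+1 score_size.
Proof.
move=> H q; apply: bddm_sum => k.
  move=> n; apply: measurable_funM => //; apply: form_app_measurable; exact: chart_center.
have K := bigO_bddm q (f := fun n (x : X n) => form_app (Psi x) (E k) t0 / a n) _ H.
apply: K => n x; rewrite normrM normfV (gtr0_norm (a0 n)).
rewrite ler_pM2r ?invr_gt0 //.
by have := coord_le_norm (\row_i form_app (Psi x) (E i) t0) k; rewrite mxE.
Qed.

Lemma info_error_vanm : littleo_Linf P (fun n x => \matrix_(i, j)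
          (dirder (E i) (form_app (Psi x) (E j)) t0 - ip g t0 (E i t0) (E j t0)))
        (fun n => a n `^ 2^-1) -> forall q, vanm P q.+1 info_error.
Proof.
move=> H q; apply: vanm_sum => ij.
  move=> n; apply: measurable_funM => //; apply: measurable_funB => //.
  by apply: form_app_dirder_measurable; exact: chart_center.
have s0 n : 0 < a n `^ 2^-1 by rewrite powR_gt0.
have K := littleo_vanm q (f := fun n (x : X n) => (dirder (E ij.1) (form_app (Psi x) (E ij.2)) t0
   - ip g t0 (E ij.1 t0) (E ij.2 t0)) / a n `^ 2^-1) _ H.
apply: K => n x; rewrite normrM normfV (gtr0_norm (s0 n)).
rewrite ler_pM2r ?invr_gt0 //.
set A := (\matrix_(i, j) _ : 'M[R]_p).
have -> : dirder (E ij.1) (form_app (Psi x) (E ij.2)) t0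
  - ip g t0 (E ij.1 t0) (E ij.2 t0) = A ij.1 ij.2 by rewrite mxE.
rewrite [leRHS]/Num.norm/= mx_normrE.
exact: (le_bigmax _ (fun i : 'I_p * 'I_p => `|A i.1 i.2|) ij).
Qed.

End Families.

Section Rates.
Context {R : realType}.

Lemma powR_cvg0 (a : nat -> R) (k : R) : 0 < k -> (forall n, 0 < a n) ->
  a n @[n --> \oo] --> 0 -> a n `^ k @[n --> \oo] --> 0.
Proof.
move=> k0 a0 al; apply/cvgrPdist_lt => e e0.
have ek0 : 0 < e `^ k^-1 by rewrite powR_gt0.
near=> n; rewrite sub0r normrN gtr0_norm ?powR_gt0 //.
have -> : e = (e `^ k^-1) `^ k by rewrite -powRrM mulVf ?gt_eqF // powRr1 // ltW.
apply: gt0_ltr_powR => //; rewrite ?nnegrE ?powR_ge0 ?(ltW (a0 _)) //.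
have : `|0 - a n| < e `^ k^-1 by near: n; move/cvgrPdist_lt: al; apply.
by rewrite sub0r normrN gtr0_norm.
Unshelve. all: by end_near.
Qed.

(** One scale [b] dominates both the first jet rate [s = a^(1/2)] and the localisation radius [a^k]
    of [A2], and a fixed power of [b] is below [a^2]. *)
Lemma rate_comparison (a k : R) : 0 < a -> a <= 1 -> 0 < k ->
  let s := a `^ 2^-1 in let b := a `^ (Num.min k 2^-1) in
  [/\ a = s ^+ 2, a <= s, s <= b, b <= 1 & a `^ k <= b] /\
  forall N : nat, 2 <= N%:R * Num.min k 2^-1 -> b ^+ N <= a ^+ 2.
Proof.
move=> a0 a1 k0 s b; have aa : 0 < a <= 1 by rewrite a0 a1.
have p1 : a `^ 1 = a by rewrite powRr1 // ltW.
split; [split|].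
- by rewrite -powR_mulrn ?powR_ge0 // -powRrM mulVf // p1.
- by rewrite -[leLHS]p1; apply: (ger_powR aa); lra.
- by apply: (ger_powR aa); rewrite ge_min lexx orbT.
- have <- : a `^ 0 = 1 by rewrite powRr0.
  by apply: (ger_powR aa); rewrite le_min (ltW k0) /=; lra.
- by apply: (ger_powR aa); rewrite ge_min lexx.
move=> N HN; rewrite -powR_mulrn ?powR_ge0 // -powRrM -[leRHS]powR_mulrn ?(ltW a0) //.
by apply: (ger_powR aa); rewrite mulrC.
Qed.

End Rates.

(** * The tail of the invariant measures *)

Section Tail.
Context {R : realType} {p : nat}.
Local Notation pt := 'rV[R]_p.
Context {Theta : set pt} (cT : compact Theta) (kT : connected Theta) (sb : smooth_boundary Theta).
Context {g : pt -> 'M[R]_p} (hg : metric_on Theta g).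
Context {dX : nat -> measure_display} {X : forall n, measurableType (dX n)}.
Context (P : forall n, probability (X n) R) {a : nat -> R} (a0 : forall n, 0 < a n).
Context (al : a n @[n --> \oo] --> 0).
Context {t0 : pt} (T0 : Theta t0).
Context (mu : forall n, X n -> probability (borelV R p) R).
Context (mum : forall n W, weakly_open Theta W -> measurable (@mu n @^-1` W)).
Context (muT : forall n (x : X n), mu x Theta = 1%E).

Lemma mI_cutoff_bounds (m : probability (borelV R p) R) del : m Theta = 1%E ->
  0 <= mI Theta m (cutoff t0 del) <= 1.
Proof.
move=> mT; have cc := @cutoff_continuous R p t0 del.
have k1 (c : R) : continuous (cst c : pt -> R) by move=> t; exact: cst_continuous.
have B t : 0 <= cutoff t0 del t <= 1 by exact: clamp_bounds.
apply/andP; split.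
  rewrite -[leLHS](mI_cst cT mT); apply: (mI_le cT mT) => // t _.
  by have /andP[] := B t.
by rewrite -[leRHS](mI_cst cT mT); apply: (mI_le cT mT) => // t _; have /andP[] := B t.
Qed.

Lemma far_set_measurable (r : R) :
  measurable ([set t | Theta t /\ r <= riem_dist Theta g t t0] : set (borelV R p)).
Proof. by apply: closed_measurable_borelV; exact: closed_dist_ge. Qed.

(** The radius [r / c] is dictated by [c |h| <= d]: wherever the cutoff is nonzero, the Riemannian
    distance is at least [r]. *)
Lemma mI_cutoff_tail (m : probability (borelV R p) R) (c r : R) : m Theta = 1%E -> 0 < c -> 0 < r ->
  (forall x y, Theta x -> Theta y -> c * `|y - x| <= riem_dist Theta g x y) ->
  ((mI Theta m (cutoff t0 (r / c)))%:E <= m [set t | Theta t /\ (r <= riem_dist Theta g t t0)%R])%E.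
Proof.
move=> mT c0 r0 Hc; set B := [set t | _].
have mB : measurable (B : set (borelV R p)) by exact: far_set_measurable.
have mTh := @measurable_Theta R p Theta cT.
have ci := mI_integrable cT mT (@cutoff_continuous R p t0 (r / c)).
rewrite /mI /Rintegral fineK; last exact: integrable_fin_num.
rewrite -[leRHS](_ : (\int[m]_(t in Theta) (\1_B t)%:E)%E = _); last first.
  by rewrite integral_indic //; congr (m _); apply/seteqP; split => [t []|t [? ?]].
apply: ge0_le_integral => //.
- by move=> t _; rewrite lee_fin; have /andP[] := clamp_bounds ((r / c)^-1 * `|t - t0| - 1).
- exact: measurable_int ci.
- by apply/measurable_EFinP; exact: measurable_indic.
move=> t Tt; rewrite lee_fin indicE.
have [tB|tB] := boolP (t \in B).
  by have /andP[] := clamp_bounds ((r / c)^-1 * `|t - t0| - 1).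
rewrite cutoff_eq0 ?divr_gt0 // leNgt ltr_pdivrMr //.
apply/negP => lt; move/negP: tB; apply; rewrite inE; split => //.
by apply: le_trans (Hc t t0 Tt T0); rewrite distrC mulrC ltW.
Qed.

Definition tail_mass (c k : R) n (x : X n) : R :=
  mI Theta (mu x) (cutoff t0 (a n `^ k / c)) / a n ^+ 2.

Lemma tail_mass_ge0 c k n (x : X n) : 0 <= tail_mass c k x.
Proof.
apply: divr_ge0; last by rewrite exprn_ge0 // ltW.
by have /andP[] := mI_cutoff_bounds (a n `^ k / c) (muT x).
Qed.

Lemma tail_mass_measurable c k : measf (tail_mass c k).
Proof.
move=> n; apply: measurable_funM => //.
by apply: (mI_measurable cT (@mum n)); exact: cutoff_continuous.
Qed.

(** [A2] is a statement on expectations. The cutoff mass lies in [[0, 1]], so its powers are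
    dominated by itself, and the arbitrary rate [a_n^L] gives all moments even after division by
    [a_n^2]. *)
Lemma tail_mass_vanm : A2 Theta g P a mu t0 -> exists k c : R,
  [/\ 0 < k, 0 < c & forall q, vanm P q.+1 (tail_mass c k)].
Proof.
move=> [k [/andP[k0 _] H]].
have [c c0 Hc] := riem_dist_lower sb hg cT kT.
exists k, c; split => // q e e0.
(* One power of [a_n] more than the [a_n^(2 (q+1))] in the denominator of the moment of order
   [q + 1]. *)
have L0 : 0 < (2 * q.+1).+1%:R :> R by rewrite ltr0n.
have /eqO_exP[C /= C0 HC] := H _ L0.
have Ca : C * a n @[n --> \oo] --> 0 by rewrite -[X in _ --> X](mulr0 C); exact: cvgMr.
near=> n.
have B1 : `|fine (\int[P n]_x mu x [set t | Theta t /\ (a n `^ k <= riem_dist Theta g t t0)%R])%E|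
    <= C * `|a n `^ (2 * q.+1).+1%:R| by near: n; exact: HC.
have a2 : 0 < a n ^+ (2 * q.+1) by rewrite exprn_gt0.
set B := fun x : X n => mu x [set t | Theta t /\ (a n `^ k <= riem_dist Theta g t t0)%R].
pose f (x : X n) := mI Theta (mu x) (cutoff t0 (a n `^ k / c)).
have mf : measurable_fun setT f by apply: (mI_measurable cT (@mum n)); exact: cutoff_continuous.
have fb x : 0 <= f x <= 1 by exact: mI_cutoff_bounds.
apply: (@le_trans _ _ ((a n ^+ (2 * q.+1))^-1%:E * \int[P n]_x (f x)%:E)%E).
  rewrite -ge0_integralZl //; last 3 first.
  - exact/measurable_EFinP.
  - by move=> x _; rewrite lee_fin; have /andP[] := fb x.
  - by rewrite lee_fin invr_ge0 ltW.
  apply: ge0_integral_mono => x; first by rewrite lee_fin exprn_ge0.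
  rewrite -EFinM lee_fin /tail_mass -/(f x) ger0_norm; last first.
    by apply: divr_ge0; [have /andP[] := fb x | rewrite exprn_ge0 // ltW].
  rewrite expr_div_n -exprM mulrC; apply: ler_wpM2l; first by rewrite invr_ge0 ltW.
  by have /andP[f0 f1] := fb x; rewrite exprS ler_piMr // exprn_ile1.
have Bfin : (\int[P n]_x B x \is a fin_num)%E.
  rewrite ge0_fin_numE; last by apply: integral_ge0.
  apply: (@le_lt_trans _ _ (\int[P n]_x 1)%E); last first.
    by rewrite integral_cst // mul1e (le_lt_trans (probability_le1 _ _)) // ltry.
  apply: ge0_integral_mono => x; first exact: measure_ge0.
  by apply: probability_le1; exact: far_set_measurable.
apply: (@le_trans _ _ ((a n ^+ (2 * q.+1))^-1%:E * \int[P n]_x B x)%E).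
  apply: lee_wpmul2l; first by rewrite lee_fin invr_ge0 ltW.
  apply: ge0_integral_mono => x; first by rewrite lee_fin; have /andP[] := fb x.
  by apply: mI_cutoff_tail => //; rewrite powR_gt0.
rewrite -(fineK Bfin) -EFinM lee_fin mulrC ler_pdivrMr //.
apply: (le_trans (ler_norm _)); apply: (le_trans B1).
rewrite ger0_norm ?powR_ge0 // powR_mulrn ?(ltW (a0 _)) // exprS mulrA ler_wpM2r ?(ltW a2) //.
apply: (le_trans (ler_norm _)); apply: ltW.
have : `|0 - C * a n| < e by near: n; move/cvgrPdist_lt: Ca; apply.
by rewrite sub0r normrN.
Unshelve. all: by end_near.
Qed.

End Tail.

Section NormMoments.
Context {R : realType} {p : nat}.
Local Notation pt := 'rV[R]_p.
Context {Theta : set pt} (cT : compact Theta) {t0 : pt} {D : R} (TD : Theta `<=` cball t0 D).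
Context {m : probability (borelV R p) R} (mT : m Theta = 1%E).
Local Notation N d := (Nmom (Theta := Theta) (t0 := t0) m d).

Let cN d : continuous (fun t : pt => `|t - t0| ^+ d). Proof. exact: norm_pow_continuous. Qed.

Lemma Nmom0 : N 0 = 1.
Proof. by rewrite -[RHS](mI_cst cT mT); apply: mI_eq => t _; rewrite expr0. Qed.

Lemma Nmom1_le : N 1 <= D.
Proof. by have := NmomS cT TD 0 mT; rewrite Nmom0 mulr1. Qed.

(** A root-free form of [N 1 <= sqrt (N 2)], equivalent to it up to a factor 2; [y] is chosen at
    each use. *)
Lemma Nmom1_young y : 0 < y -> N 1 <= y + N 2 / y.
Proof.
move=> y0.
have -> : y + N 2 / y = mI Theta m (fun t : pt => y + y^-1 * `|t - t0| ^+ 2).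
  rewrite (mID cT mT (f := cst y)); last 2 first.
  - by move=> t; exact: cst_continuous.
  - by apply: contZ; exact: cN.
  by rewrite mI_cst // (mIZ cT mT) 1?mulrC //; exact: cN.
apply: (mI_le cT mT); first exact: cN.
  by apply: contD; [move=> t; exact: cst_continuous | apply: contZ; exact: cN].
move=> t _; rewrite expr1; set h := `|t - t0|.
have h0 : 0 <= h by exact: normr_ge0.
have -> : y + y^-1 * h ^+ 2 = h + y^-1 * ((h - y) ^+ 2 + h * y) by field; rewrite gt_eqF.
by rewrite lerDl mulr_ge0 ?invr_ge0 ?(ltW y0) // addr_ge0 ?sqr_ge0 // mulr_ge0 // (ltW y0).
Qed.

Lemma Nmom3_cutoff del : 0 < del ->
  N 3 <= 2 * del * N 2 + D ^+ 3 * mI Theta m (cutoff t0 del).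
Proof.
move=> d0; have cc := @cutoff_continuous R p t0 del.
rewrite -(mIZ cT mT _ (@cN 2)) -(mIZ cT mT _ cc) -(mID cT mT); last 2 first.
- by apply: contZ; exact: cN.
- exact: contZ.
apply: (mI_le cT mT); first exact: cN.
  by apply: contD; apply: contZ => //; exact: cN.
by move=> t Tt; apply: cube_le_cutoff => //; exact: TD.
Qed.

End NormMoments.

(** * Expansion of the mean *)

Lemma norm_le_scaled {R : realFieldType} (c y z : R) : 0 < c -> 0 <= z ->
  `|y| <= c * `|y / c| + c * z.
Proof.
move=> c0 z0; rewrite normrM normfV (gtr0_norm c0) mulrCA mulfV ?gt_eqF // mulr1.
by rewrite lerDl mulr_ge0 // ltW.
Qed.

Section RescaledRemainder.
Context {R : realType} {p : nat}.
Local Notation pt := 'rV[R]_p.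
Context {Theta : set pt} (cT : compact Theta) (kT : connected Theta) (sb : smooth_boundary Theta).
Context {g : pt -> 'M[R]_p} (hg : metric_on Theta g).
Context {dX : nat -> measure_display} {X : forall n, measurableType (dX n)}.
Context (P : forall n, probability (X n) R) {Psi : forall n, X n -> pt -> pt}.
Context (hPsi : random_one_form Theta Psi) {a : nat -> R} (a0 : forall n, 0 < a n).
Context (al : a n @[n --> \oo] --> 0).
Context {nabla : connection R p} (cn : connection_on Theta nabla) (nu : pt -> pt).
Context {Pc : pt -> pt -> pt} (hPc : precontrast Theta g Pc).
Context {D1 Dm1 : connection R p}.
Context (h1 : connection_D1 Theta g Pc D1) (hm1 : connection_Dm1 Theta g Pc Dm1).
Context {t0 : pt} (It : interior Theta t0).
Context (tau : R) (V : pt -> pt) (sV : smoothv_near Theta V).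
Context (mu : forall n, X n -> probability (borelV R p) R).
Context (sel : invariant_selection Theta g nabla nu a Psi tau V mu).
Context (hA1 : A1 Theta g P Psi a Pc t0) (hA2 : A2 Theta g P a mu t0).

Definition sharp_value n (x : X n) (k : 'I_p) : R := sharp g t0 (Psi x t0) 0 k.
Definition sharp_grad n (x : X n) (i k : 'I_p) : R :=
  partial i (fun t => sharp g t (Psi x t) 0 k) t0.
Definition sample_datum n (x : X n) (u e S : R) : datum :=
  Datum (mu x) (Psi x) (a n) u e S (sharp_value x) (sharp_grad x).

(** [expansion] reads only the jet and the scale of the datum; the zeros fill the size fields. *)
Definition rescaled_remainder k n (x : X n) : R :=
  (H1m (Theta := Theta) (t0 := t0) (mu x) k
   - expansion (g := g) (nabla := nabla) (t0 := t0) tau V (hess_coef (Dm1 := Dm1) (t0 := t0))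
       (sample_datum x 0 0 0) k) / a n ^+ 2.

(** The order of choices is what matters: [r0] is fixed first and gives [T] bounded moments; for a
    given accuracy [r] then makes [S r] small; finally [n] makes [vp] small against the
    [r]-dependent constant. *)
Lemma rescaled_remainder_vanm k q : vanm P q.+1 (rescaled_remainder k).
Proof.
have [U [phi [sigma [hch [A1a A1b A1c]]]]] := hA1.
have muT n (x : X n) : mu x Theta = 1%E by have [] := sel.2 n x.
have T0 := interior_subset It.
have [[oU _] [Ut0 UT] _ _ _] := hch.
have [rb rb0 rU] := cball_sub_nbhs (open_nbhs_nbhs (conj oU Ut0)).
have rI : cball t0 rb `<=` interior Theta by move=> t /rU; exact: chart_sub_interior hch t.
have [D D0 TD] : exists2 D : R, 0 <= D & Theta `<=` cball t0 D.
  have [D D0 HD] := compact_bounded_fun cT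
    (continuous_subspaceT (A := Theta) (@norm_sub_continuous R p t0)).
  by exists D => // t /HD; rewrite normr_id.
have [C0 C00 HC0] := chart_jet_bound hg hPc h1 hm1 hch rb0 rU.
pose c := hess_coef (Dm1 := Dm1) (t0 := t0).
have [C2 C20 Hc2] : exists2 C2 : R, 0 <= C2 & forall i j k, `|c i j k| <= C2.
  exists (\sum_(ijk : 'I_p * 'I_p * 'I_p) `|c ijk.1.1 ijk.1.2 ijk.2|); first exact: sumr_ge0.
  by move=> i j l; rewrite (bigD1 (i, j, l)) //= lerDl sumr_ge0.
have [kk [ct [kk0 ct0 Vrho]]] := tail_mass_vanm cT kT sb hg a0 al T0 sel.1 muT hA2.
(* This [N] gives [b^N <= a^2], as the dichotomy for the second moment requires. *)
have [N HN] : exists N : nat, 2 <= N%:R * Num.min kk 2^-1.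
  have m0 : 0 < Num.min kk 2^-1 by rewrite lt_min kk0 invr_gt0 ltr0n.
  exists (Num.bound (2 / Num.min kk 2^-1)); rewrite -ler_pdivrMr //.
  by apply: ltW; apply: archi_boundP; rewrite divr_ge0 // ltW.
(* [N + 2] powers of [T] come from the second moment bound, three more from the remainder. *)
pose M0 := N.+2.+3.
have [r1 r10 Hr1] := jet_sup_small cT hg hPsi hPc It hch rb0 rU A1c
  (M0 * (2 * q.+1)).-1 ltr01.
pose r0 := Num.min (2^-1 * rb) r1.
have r00 : 0 < r0 by rewrite lt_min r10 mulr_gt0 // invr_gt0.
have r02 r : r <= r0 -> 2 * r <= rb by rewrite le_min => /andP[H _]; lra.
have r0b r : r <= r0 -> r <= rb by rewrite le_min => /andP[H _]; lra.
have [K0 K00 HK0] := second_moment_bound cT hg cn nu It rI D0 TD tau sV C00 C20 Hc2 r00 (r0b _ (lexx _)).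
have Cd0 : 0 <= ct^-1 by rewrite invr_ge0 ltW.
have [L L0 HL] := bootstrap_second_moment N K00 Cd0 D0.
pose Sj r n (x : X n) := jet_sup (Psi := Psi) (Pc := Pc) (t0 := t0) (phi := phi) (sigma := sigma) r x.
(* Both members bound the second jet on the [r]-ball; the minimum makes [S r <= Sj r0] immediate for
   every [r], so that [T], built with [r0], dominates [S r] uniformly. *)
pose S r n (x : X n) := Num.min (Sj r n x) (Sj r0 n x).
pose b n : R := a n `^ (Num.min kk 2^-1).
pose sc n (x : X n) := score_size (Psi := Psi) (a := a) (t0 := t0) (phi := phi) (sigma := sigma) x.
pose ie n (x : X n) := info_error (g := g) (Psi := Psi) (a := a) (t0 := t0) (phi := phi) (sigma := sigma) x.
pose rho n (x : X n) := tail_mass (Theta := Theta) (a := a) (t0 := t0) mu ct kk x.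
pose T n (x : X n) := 1 + Sj r0 n x + sc n x + ie n x + rho n x.
pose vp n (x : X n) := b n + ie n x + rho n x.
have rr0 r : r <= r0 -> r <= r1 by rewrite le_min => /andP[].
have mSj r : 0 < r -> r <= r0 -> measf (Sj r).
  by move=> r0' rr; apply: (jet_sup_measurable hPsi hch rU r0'); exact: r02.
have mS r : 0 < r -> r <= r0 -> measf (S r).
  move=> r0' rr n; apply: (@measurable_minr _ _ _ _ (Sj r n) (Sj r0 n)); exact: mSj.
have msc : measf sc := score_size_measurable hPsi (a := a) hch.
have mie : measf ie := info_error_measurable hPsi (g := g) (a := a) hch.
have mrho : measf rho := tail_mass_measurable cT (a := a) (t0 := t0) sel.1 ct kk.
have mT : measf T.
  move=> n; apply: measurable_funD (mrho n); apply: measurable_funD (mie n).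
  apply: measurable_funD (msc n); apply: measurable_funD; first exact: measurable_cst.
  by apply: mSj.
have mvp : measf vp.
  move=> n; apply: measurable_funD (mrho n); apply: measurable_funD (mie n).
  exact: measurable_cst.
have Sj0 r n (x : X n) : 0 <= Sj r n x by exact: jet_sup_ge0.
have S0 r n (x : X n) : 0 <= S r n x.
  rewrite /S; move: (Sj r n x) (Sj r0 n x) (Sj0 r n x) (Sj0 r0 n x) => y z y0 z0.
  by rewrite le_min y0 z0.
have SL r n (x : X n) : S r n x <= Sj r n x /\ S r n x <= Sj r0 n x.
  by rewrite /S; move: (Sj r n x) (Sj r0 n x) => y z; rewrite !ge_min !lexx orbT.
have Vie q' : vanm P q'.+1 ie by exact: (info_error_vanm hPsi a0 hch A1b q').
have Bsc q' : bddm P q'.+1 sc by exact: (score_size_bddm hPsi a0 hch A1a q').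
have Qpos : (M0 * (2 * q.+1)).-1.+1 = (M0 * (2 * q.+1))%N by rewrite prednK // muln_gt0.
have BT : bddm P (M0 * (2 * q.+1)) T.
  rewrite -Qpos; apply: bddm_add; [|exact: mrho| |exact/vanm_bddm/Vrho].
    move=> n; apply: measurable_funD (mie n); apply: measurable_funD (msc n).
    by apply: measurable_funD; [exact: measurable_cst | exact: mSj].
  apply: bddm_add; [|exact: mie| |exact/vanm_bddm/Vie].
    move=> n; apply: measurable_funD (msc n).
    by apply: measurable_funD; [exact: measurable_cst | exact: mSj].
  apply: bddm_add; [|exact: msc| |exact: Bsc].
    by move=> n; apply: measurable_funD; [exact: measurable_cst | exact: mSj].
  apply: bddm_add; [by move=> n; exact: measurable_cst | exact: mSj | exact: bddm_cst |].
  by exists 1; apply: Hr1 => //; exact: rr0.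
have Vvp : vanm P (2 * q.+1) vp.
  have -> : (2 * q.+1 = (2 * q.+1).-1.+1)%N by rewrite prednK // muln_gt0.
  apply: vanm_add; [|exact: mrho| |exact: Vrho].
    by move=> n; apply: measurable_funD (mie n); exact: measurable_cst.
  apply: vanm_add; [by move=> n; exact: measurable_cst | exact: mie | | exact: Vie].
  apply: vanm_seq; apply: powR_cvg0 => //.
  by rewrite lt_min kk0 invr_gt0 ltr0n.
have SV e : 0 < e -> exists2 r : R, 0 < r <= r0 &
    \forall n \near \oo, (mom (P n) (S r n) (2 * q.+1) <= e%:E)%E.
  move=> e0.
  have [r2 r20 Hr2] := jet_sup_small cT hg hPsi hPc It hch rb0 rU A1c (2 * q.+1).-1 e0.
  have H2 : (2 * q.+1).-1.+1 = (2 * q.+1)%N by rewrite prednK // muln_gt0.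
  rewrite H2 in Hr2.
  exists (Num.min r2 r0); first by rewrite lt_min r20 r00 ge_min lexx orbT.
  near=> n; apply: (@le_trans _ _ (mom (P n) (Sj (Num.min r2 r0) n) (2 * q.+1))).
    apply: mom_mono => x; rewrite (ger0_norm (S0 _ n x)) (ger0_norm (Sj0 _ n x)).
    exact: (SL _ n x).1.
  near: n; apply: Hr2; first by rewrite lt_min r20.
  by rewrite ge_min lexx.
have c00 : 0 <= 2 * p%:R * C0 by rewrite !mulr_ge0.
have C10 : 0 <= 2 * p%:R * C0 * L by rewrite mulr_ge0.
apply: (vanishing_remainder C10 r00 mS mT mvp SV BT Vvp) => r r_gt0 rr.
have [K1 K10 HK1] := expansion_error cT hg cn nu It rI D0 TD tau sV C00 C20 Hc2 r_gt0 (r0b _ rr).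
have [C C0' HC] := remainder_scale N.+2 L0 K10 c00 Cd0 D0.
exists C => //.
near=> n => x.
have a1 : a n <= 1.
  have : `|0 - a n| < 1 by near: n; move/cvgrPdist_lt: al; apply.
  by rewrite sub0r normrN gtr0_norm // => /ltW.
have [] := rate_comparison (a0 n) a1 kk0.
set s := a n `^ 2^-1; rewrite -/(b n) => -[as2 as1 sb1 b1 kb] /(_ N HN) bN.
have s0 : 0 <= s by exact: powR_ge0.
have mT1 := muT n x.
have rho0 : 0 <= rho n x by exact: tail_mass_ge0.
have sc0 : 0 <= sc n x by exact: sumr_ge0.
have ie0 : 0 <= ie n x by exact: sumr_ge0.
have u0 : 0 <= a n * sc n x by rewrite mulr_ge0 // ltW.
have e0 : 0 <= s * ie n x by rewrite mulr_ge0.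
have sPsi m l : Ck m (interior Theta) (fun t => Psi x t 0 l) by apply: one_form_Ck (hPsi.2 n x) m l.
have valid_at r' S' : 0 < r' -> r' <= rb -> 0 <= S' ->
    (forall i j l t, `|t - t0| <= r' -> `|second_jet (Psi := Psi) (Pc := Pc) (t0 := t0)
      (phi := phi) (sigma := sigma) x (i, j, l) t| <= S') ->
    valid (Theta := Theta) (g := g) (nabla := nabla) (t0 := t0) nu tau V C0 c r'
      (sample_datum x (a n * sc n x) (s * ie n x) S').
  move=> r'0 r'b S'0 HS'; split; [exact: mT1 | exact: a0 | by move=> i; exact: sPsi | exact: (sel.2 n x) |].
  split; [exact: u0 | exact: e0 | exact: S'0 |]; apply: (HC0 (Psi x) r' _ _ S') => //.
  - move=> l; rewrite /sc /score_size (bigD1 l) //= mulrDr.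
    by apply: norm_le_scaled; [exact: a0 | exact: sumr_ge0].
  - move=> i j; rewrite /ie /info_error (bigD1 (i, j)) //= mulrDr -/s.
    have s1 : 0 < s by rewrite powR_gt0.
    by apply: norm_le_scaled; [exact: s1 | exact: sumr_ge0].
set n1 := Nmom (Theta := Theta) (t0 := t0) (mu x) 1.
set n2 := Nmom (Theta := Theta) (t0 := t0) (mu x) 2.
set n3 := Nmom (Theta := Theta) (t0 := t0) (mu x) 3.
pose del := a n `^ kk / ct.
have del0 : 0 < del by rewrite divr_gt0 // powR_gt0.
have delb : del <= ct^-1 * b n by rewrite /del mulrC ler_wpM2l.
have n10 : 0 <= n1 by exact: Nmom_ge0.
have n20 : 0 <= n2 by exact: Nmom_ge0.
have n30 : 0 <= n3 by exact: Nmom_ge0.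
have n1D : n1 <= D by exact: Nmom1_le.
have n2D : n2 <= D ^+ 2.
  by apply: (le_trans (NmomS cT TD 1 mT1)); rewrite expr2 ler_wpM2l.
have n1y y : 0 < y -> n1 <= y + n2 / y by exact: Nmom1_young.
have n3b : n3 <= 2 * del * n2 + D ^+ 3 * (a n ^+ 2 * rho n x).
  rewrite /rho /tail_mass [a n ^+ 2 * _]mulrC divfK ?expf_neq0 ?gt_eqF //.
  exact: Nmom3_cutoff.
have n2L : n2 <= L * (a n ^+ 2 * T n x ^+ N.+2).
  apply: (HL (a n) s (b n) (sc n x) (ie n x) (Sj r0 n x) (rho n x) del n1 n2 n3) => //.
    exact: ltW.
  apply: (HK0 (sample_datum x (a n * sc n x) (s * ie n x) (Sj r0 n x))).
  apply: valid_at => //; first exact: r0b.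
  by move=> i j l t tr; apply: (second_jet_le_sup hPsi hPc It hch rU x i j l r00 _ tr); exact: r02.
have HSr i j l t : `|t - t0| <= r -> `|second_jet (Psi := Psi) (Pc := Pc) (t0 := t0)
      (phi := phi) (sigma := sigma) x (i, j, l) t| <= S r n x.
  move=> tr; have key (y z w : R) : w <= y -> w <= z -> w <= Num.min y z by move=> ? ?; rewrite le_min; apply/andP.
  apply: key.
    by apply: (second_jet_le_sup hPsi hPc It hch rU x i j l r_gt0 _ tr); exact: r02.
  apply: (second_jet_le_sup hPsi hPc It hch rU x i j l r00 _ (le_trans tr rr)); exact: r02.
have Hrem := HK1 k _ (valid_at r (S r n x) r_gt0 (r0b _ rr) (S0 _ _ _) HSr).
have TS : 1 + S r n x + sc n x + ie n x + rho n x <= T n x.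
  by rewrite /T !lerD2r lerD2l; exact: (SL r n x).2.
have Hfin := HC (a n) s (b n) (sc n x) (ie n x) (S r n x) (rho n x) del n1 n2 n3 (T n x) _
  (a0 n) as2 s0 sb1 b1 sc0 ie0 (S0 _ _ _) rho0 (ltW del0) delb TS n10 n20 n2L n1y n30 n3b Hrem.
have a20 : 0 < a n ^+ 2 by rewrite exprn_gt0.
rewrite /rescaled_remainder normrM normfV (gtr0_norm a20) ler_pdivrMr //.
by rewrite mulrC; exact: Hfin.
Unshelve. all: by end_near.
Qed.

End RescaledRemainder.

(** * The expansion in the form of (a) and (b) *)

Section MeanExpansion.
Context {R : realType} {p : nat}.
Local Notation pt := 'rV[R]_p.
Context {Theta : set pt} (cT : compact Theta) (kT : connected Theta) (sb : smooth_boundary Theta).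
Context {g : pt -> 'M[R]_p} (hg : metric_on Theta g).
Context {dX : nat -> measure_display} {X : forall n, measurableType (dX n)}.
Context {P : forall n, probability (X n) R} {Psi : forall n, X n -> pt -> pt}.
Context (hPsi : random_one_form Theta Psi) {a : nat -> R} (a0 : forall n, 0 < a n).
Context (al : a n @[n --> \oo] --> 0).
Context {nabla : connection R p} (cn : connection_on Theta nabla) {nu : pt -> pt}.
Context {Pc : pt -> pt -> pt} (hPc : precontrast Theta g Pc).
Context {D1 Dm1 : connection R p}.
Context (h1 : connection_D1 Theta g Pc D1) (hm1 : connection_Dm1 Theta g Pc Dm1).
Context {t0 : pt} (It : interior Theta t0).

Lemma gamma_contractE (D : connection R p) t S k :
  gamma_contract D t S 0 k = \sum_i \sum_j S i j * D t i j 0 k.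
Proof.
rewrite /gamma_contract summxE; apply: eq_bigr => i _; rewrite summxE.
by apply: eq_bigr => j _; rewrite mxE.
Qed.

Lemma gamma_contract_comb (D D' : connection R p) (u v : R) t S k :
  gamma_contract (fun t i j => u *: D t i j + v *: D' t i j) t S 0 k
  = u * gamma_contract D t S 0 k + v * gamma_contract D' t S 0 k.
Proof.
rewrite !gamma_contractE !mulr_sumr -big_split /=; apply: eq_bigr => i _.
rewrite !mulr_sumr -big_split /=; apply: eq_bigr => j _.
by rewrite !mxE; ring.
Qed.

Lemma gamma_contractB (D : connection R p) t (S S' : 'M[R]_p) k :
  gamma_contract D t (S - S') 0 k = gamma_contract D t S 0 k - gamma_contract D t S' 0 k.
Proof.
rewrite !gamma_contractE -sumrB; apply: eq_bigr => i _.
by rewrite -sumrB; apply: eq_bigr => j _; rewrite !mxE mulrBl.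
Qed.

Lemma mI_coord (m : probability (borelV R p) R) k : m Theta = 1%E ->
  mI Theta m (fun t : pt => t 0 k) = t0 0 k + H1m (Theta := Theta) (t0 := t0) m k.
Proof.
move=> mT; have ck : continuous (fun t : pt => (t - t0) 0 k) by exact: cont_coord.
have c1 : continuous (cst (t0 0 k) : pt -> R) by move=> t; exact: cst_continuous.
rewrite -[X in _ = X + _](mI_cst cT mT) -(mID cT mT c1 ck).
by apply: mI_eq => t _; rewrite !mxE /=; ring.
Qed.

Lemma mean_remainder_coord (m t z u v c w : pt) (b : R) k :
  (m - (t + b *: (z + u) + b ^+ 2 *: (v - c - 2^-1 *: w))) 0 k
  = m 0 k - (t 0 k + b * (z 0 k + u 0 k) + b ^+ 2 * (v 0 k - c 0 k - 2^-1 * w 0 k)).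
Proof. by rewrite !mxE. Qed.

Section Single.
Context {tau : R} {V : pt -> pt} (sV : smoothv_near Theta V).
Context {mu : forall n, X n -> probability (borelV R p) R}.
Context (sel : invariant_selection Theta g nabla nu a Psi tau V mu).

Definition mean_remainder n (x : X n) : pt :=
  let z := zeta g a Psi x in
  post_mean Theta mu x
  - (t0 + a n *: (z t0 + Upsilon g D1 Psi x z t0)
     + (a n) ^+ 2 *:
       (V t0
        - gamma_contract (fun t i j => tau *: nabla t i j + ((1 - tau) / 2) *: Dm1 t i j) t0 (ginv g t0)
        - 2^-1 *: gamma_contract Dm1 t0 ((z t0)^T *m z t0 - ginv g t0))).

Local Notation rr := (rescaled_remainder (Theta := Theta) (g := g) (Psi := Psi) (a := a)
  (nabla := nabla) (Dm1 := Dm1) (t0 := t0) tau V mu).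

Lemma mean_remainder_entry n (x : X n) k :
  mean_remainder x 0 k = post_mean Theta mu x 0 k
  - (t0 0 k + a n * (zeta g a Psi x t0 0 k + Upsilon g D1 Psi x (zeta g a Psi x) t0 0 k)
     + a n ^+ 2 * (V t0 0 k
       - (tau * gamma_contract nabla t0 (ginv g t0) 0 k
          + (1 - tau) / 2 * gamma_contract Dm1 t0 (ginv g t0) 0 k)
       - 2^-1 * gamma_contract Dm1 t0 ((zeta g a Psi x t0)^T *m zeta g a Psi x t0 - ginv g t0) 0 k)).
Proof. by rewrite /mean_remainder mean_remainder_coord gamma_contract_comb. Qed.

(** Write [Q] and [W] for [Gamma^(-1)] contracted with [zeta] twice and with [g^-1]. [Upsilon_dual]
    contributes [+ Q] at order [a^2], which with the [- Q / 2] of the statement gives the [+ Q / 2]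
    of [expansion], whose Hessian is [- Gamma^(-1)]. The multiples [- (1 - tau) / 2] and [1 / 2] of
    [W] add up to [tau / 2]. *)
Lemma mean_remainderE n (x : X n) k : mean_remainder x 0 k = a n ^+ 2 * rr k x.
Proof.
have mT : mu x Theta = 1%E by have [] := sel.2 n x.
have an0 : a n != 0 by rewrite gt_eqF.
set z := fun i => zeta g a Psi x t0 0 i.
have zA i : sharp_value (g := g) (Psi := Psi) (t0 := t0) x i = - (a n * z i).
  by rewrite /z /zeta mxE mulNr mulrN opprK mulrA mulfV // mul1r.
pose M i := sharp_grad (g := g) (Psi := Psi) (t0 := t0) x i k.
pose zM := \sum_i z i * M i.
pose Q := \sum_i \sum_j z i * z j * Dm1 t0 i j 0 k.
pose W := \sum_i \sum_j ginv g t0 i j * Dm1 t0 i j 0 k.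
have UE : Upsilon g D1 Psi x (zeta g a Psi x) t0 0 k = z k - zM + a n * Q.
  rewrite (Upsilon_dual hg hPc (hPsi.2 n x) h1 hm1) // -/(z k); congr (_ + _).
  rewrite /Q mulr_sumr -sumrN; apply: eq_bigr => i _.
  rewrite mulr_sumr -sumrN; apply: eq_bigr => j _.
  by have := zA j; rewrite /sharp_value => ->; rewrite -/(z i); ring.
have GE : gamma_contract Dm1 t0 ((zeta g a Psi x t0)^T *m zeta g a Psi x t0 - ginv g t0) 0 k = Q - W.
  rewrite gamma_contractB !gamma_contractE; congr (_ - _).
  by apply: eq_bigr => i _; apply: eq_bigr => j _; rewrite mxE big_ord1 [_^T _ _]mxE.
have EE : expansion (g := g) (nabla := nabla) (t0 := t0) tau V (hess_coef (Dm1 := Dm1) (t0 := t0))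
    (sample_datum (g := g) (Psi := Psi) (a := a) (t0 := t0) mu x 0 0 0) k
  = a n * z k + a n * (z k - zM) + 2^-1 * (a n ^+ 2 * (Q + tau * W))
    + a n ^+ 2 * (V t0 0 k - tau * gamma_contract nabla t0 (ginv g t0) 0 k).
  rewrite /expansion /=; congr (_ + _ + _ + _); first by rewrite zA opprK.
    rewrite -[z k](sum_delta z) /zM -sumrB mulr_sumr; apply: eq_bigr => i _.
    by rewrite zA opprK -/(M i) /evec mxE eqxx /=; ring.
  rewrite -mulrN; congr (_ * _).
  rewrite /Q /W [tau * (\sum_i _)]mulr_sumr -big_split /= mulr_sumr -sumrN; apply: eq_bigr => i _.
  rewrite [tau * (\sum_j _)]mulr_sumr -big_split /= mulr_sumr -sumrN; apply: eq_bigr => j _.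
  by rewrite !zA /hess_coef; ring.
rewrite /rescaled_remainder EE [RHS]mulrC divfK ?expf_neq0 //.
have PE : post_mean Theta mu x 0 k = t0 0 k + H1m (Theta := Theta) (t0 := t0) (mu x) k.
  by rewrite mxE; exact: mI_coord.
rewrite mean_remainder_entry PE GE UE -/(z k).
have -> : gamma_contract Dm1 t0 (ginv g t0) 0 k = W by rewrite gamma_contractE.
clear UE GE EE PE; clearbody zM Q W.
move: (H1m _ _) (gamma_contract nabla _ _ _ _) (V t0 0 k) (z k) (t0 0 k) => H Ga v zk tk.
by field.
Qed.

Lemma rescaled_remainder_measurable k : measf (rr k).
Proof.
move=> n; have T0 := interior_subset It.
have oI : open (interior Theta) by exact: open_interior.
have mS (t : pt) : interior Theta t -> forall l,
    measurable_fun setT (fun x : X n => sharp g t (Psi x t) 0 l).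
  move=> It' l; under eq_fun do rewrite sharpE.
  apply: measurable_sum => i; apply: measurable_funM => //.
  by apply: hPsi.1; exact: interior_subset.
have mA l : measurable_fun setT (fun x : X n => sharp_value (g := g) (Psi := Psi) (t0 := t0) x l).
  exact: mS.
have mM i l : measurable_fun setT (fun x : X n => sharp_grad (g := g) (Psi := Psi) (t0 := t0) x i l).
  apply: (@derive_measurable _ _ _ _ (fun (x : X n) s => sharp g s (Psi x s) 0 l)
    (interior Theta) (evec i) t0 oI It) => [s Is|x]; first exact: mS.
  have sP m j : Ck m (interior Theta) (fun t => Psi x t 0 j) by apply: one_form_Ck (hPsi.2 n x) m j.
  by have F := sharp_Ck hg (n := 0%N) l oI (@subset_refl _ _) (sP 0%N); exact: F.
apply: measurable_funM => //; apply: measurable_funB.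
  by apply: (mI_measurable cT (sel.1 n)); exact: cont_coord.
have mN l : measurable_fun setT (fun x : X n => - sharp_value (g := g) (Psi := Psi) (t0 := t0) x l).
  by apply: measurableT_comp => //; exact: mA.
rewrite /expansion /=; apply: measurable_funD => //; apply: measurable_funB.
  apply: measurable_funD; first exact: mN.
  apply: measurable_sum => i; apply: measurable_funM; first exact: mN.
  exact: measurable_funB.
apply: measurable_funM => //; apply: measurable_sum => i; apply: measurable_sum => j.
apply: measurable_funM => //; apply: measurable_funD => //.
by apply: measurable_funM; exact: mN.
Qed.

Context (hA1 : A1 Theta g P Psi a Pc t0) (hA2 : A2 Theta g P a mu t0).

Lemma mean_remainder_vanm k q : vanm P q.+1 (rr k).
Proof. exact: (rescaled_remainder_vanm cT kT sb hg hPsi a0 al cn hPc h1 hm1 It sV sel hA1 hA2). Qed.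

End Single.

Lemma row_littleo (Y : forall n, X n -> pt) (F : 'I_p -> forall n, X n -> R) :
  (forall k, measf (F k)) -> (forall k q, vanm P q.+1 (F k)) ->
  (forall n (x : X n) k, Y n x 0 k = a n ^+ 2 * F k n x) ->
  littleo_Linf P Y (fun n => a n ^+ 2).
Proof.
move=> mF vF YF; have a20 n : 0 < a n ^+ 2 by rewrite exprn_gt0.
apply: (vanm_littleo (Z := fun n (x : X n) => \sum_k `|F k n x|)) => //.
- by move=> n; apply: measurable_sum => k; apply: measurableT_comp => //; exact: mF.
- near=> n => x; have Z0 : 0 <= \sum_k `|F k n x| by exact: sumr_ge0.
  rewrite ler_pdivrMr // (ger0_norm Z0).
  apply: norm_le_coord; first by rewrite mulr_ge0 ?sumr_ge0 // ltW.
  move=> k; rewrite YF normrM gtr0_norm // mulrC ler_pM2r //.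
  by rewrite (bigD1 k) //= lerDl sumr_ge0.
- by move=> q; apply: vanm_sum => k; [exact: mF | exact: vF].
Unshelve. all: by end_near.
Qed.

Context (hA1 : A1 Theta g P Psi a Pc t0).

Theorem mean_expansion (tau : R) (V : pt -> pt) (mu : forall n, X n -> probability (borelV R p) R) :
  smoothv_near Theta V -> invariant_selection Theta g nabla nu a Psi tau V mu ->
  A2 Theta g P a mu t0 ->
  littleo_Linf P (mean_remainder (tau := tau) (V := V) (mu := mu)) (fun n => a n ^+ 2).
Proof.
move=> sV sel hA2; apply: (row_littleo (F := rescaled_remainder (Theta := Theta) (g := g)
  (Psi := Psi) (a := a) (nabla := nabla) (Dm1 := Dm1) (t0 := t0) tau V mu)).
- by move=> k; exact: (rescaled_remainder_measurable sel k).
- by move=> k q; exact: (mean_remainder_vanm sV sel hA1 hA2).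
- by move=> n x k; exact: mean_remainderE.
Qed.

Theorem mean_difference (tau1 tau2 : R) (V1 V2 : pt -> pt)
    (mu1 mu2 : forall n, X n -> probability (borelV R p) R) :
  smoothv_near Theta V1 -> smoothv_near Theta V2 ->
  invariant_selection Theta g nabla nu a Psi tau1 V1 mu1 ->
  invariant_selection Theta g nabla nu a Psi tau2 V2 mu2 ->
  A2 Theta g P a mu1 t0 -> A2 Theta g P a mu2 t0 ->
  littleo_Linf P (fun n x =>
    post_mean Theta mu1 x - post_mean Theta mu2 x
    - (a n) ^+ 2 *: (V1 t0 - V2 t0 - (tau1 - tau2) *:
      gamma_contract (fun t i j => nabla t i j - 2^-1 *: Dm1 t i j) t0 (ginv g t0)))
    (fun n => a n ^+ 2).
Proof.
move=> sV1 sV2 sel1 sel2 hA21 hA22.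
pose F1 := rescaled_remainder (Theta := Theta) (g := g) (Psi := Psi) (a := a)
  (nabla := nabla) (Dm1 := Dm1) (t0 := t0) tau1 V1 mu1.
pose F2 := rescaled_remainder (Theta := Theta) (g := g) (Psi := Psi) (a := a)
  (nabla := nabla) (Dm1 := Dm1) (t0 := t0) tau2 V2 mu2.
have mF1 k : measf (F1 k) := rescaled_remainder_measurable sel1 k.
have mF2 k : measf (fun n x => - F2 k n x).
  by move=> n; apply: measurableT_comp => //; exact: (rescaled_remainder_measurable sel2 k).
apply: (row_littleo (F := fun k n x => F1 k n x + - F2 k n x)).
- by move=> k n; apply: measurable_funD; [exact: mF1 | exact: mF2].
- move=> k q; apply: vanm_add => //; first exact: (mean_remainder_vanm sV1 sel1 hA1 hA21).
  move=> e e0; have vF : vanm P q.+1 (F2 k) by exact: (mean_remainder_vanm sV2 sel2 hA1 hA22).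
  have V2' := vF e e0.
  near=> n; apply: (@le_trans _ _ (mom (P n) (F2 k n) q.+1)).
    by apply: mom_mono => x; rewrite normrN.
  by near: n; exact: V2'.
move=> n x k; rewrite mulrDr mulrN.
have E1 : a n ^+ 2 * F1 k n x = _ := etrans (esym (mean_remainderE sel1 x k)) (mean_remainder_entry x k).
have E2 : a n ^+ 2 * F2 k n x = _ := etrans (esym (mean_remainderE sel2 x k)) (mean_remainder_entry x k).
have gE : gamma_contract (fun t i j => nabla t i j - 2^-1 *: Dm1 t i j) t0 (ginv g t0) 0 k
    = gamma_contract nabla t0 (ginv g t0) 0 k - 2^-1 * gamma_contract Dm1 t0 (ginv g t0) 0 k.
  rewrite -[X in X - _]mul1r -mulNr -gamma_contract_comb.
  by congr (gamma_contract _ _ _ _ _); do 3! apply/funext => ?; rewrite scale1r scaleNr.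
have key (m m' v v' c : pt) (b s : R) : (m - m' - b *: (v - v' - s *: c)) 0 k
  = m 0 k - m' 0 k - b * (v 0 k - v' 0 k - s * c 0 k) by rewrite !mxE.
rewrite E1 E2; apply: (etrans (key _ _ _ _ _ _ _)); rewrite gE; clear E1 E2.
move: (post_mean Theta mu1 x 0 k) (post_mean Theta mu2 x 0 k) => m1 m2.
move: (zeta g a Psi x t0 0 k) (Upsilon g D1 Psi x (zeta g a Psi x) t0 0 k) => z u.
move: (gamma_contract Dm1 t0 (_ - _) 0 k) (gamma_contract nabla t0 _ 0 k) => w w1.
move: (gamma_contract Dm1 t0 _ 0 k) (V1 t0 0 k) (V2 t0 0 k) (t0 0 k) (a n) => w2 v1 v2 tk b.
by field.
Unshelve. all: by end_near.
Qed.

End MeanExpansion.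

(** * Bias *)

Section SquareIntegrable.
Context {R : realType} d (T : measurableType d) (P : probability T R).
Implicit Types f h : T -> R.

Definition sq_int f := measurable_fun setT f /\ (mom P f 2 < +oo)%E.

Lemma sq_int_mul f h : sq_int f -> sq_int h -> P.-integrable setT (EFin \o (fun x => f x * h x)).
Proof.
move=> [mf Hf] [mh Hh]; apply/integrableP; split.
  by apply/measurable_EFinP; exact: measurable_funM.
have m2 (k : T -> R) : measurable_fun setT k -> measurable_fun setT (fun x => (`|k x| ^+ 2)%:E).
  by move=> mk; apply: mom_measurable.
apply: (@le_lt_trans _ _ (mom P f 2 + mom P h 2)%E); last exact: lte_add_pinfty.
rewrite /mom -ge0_integralD //; last 2 first.
- exact: m2.
- exact: m2.
apply: ge0_integral_mono => x //=; rewrite -EFinD lee_fin normrM.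
move: (`|f x|) (`|h x|) (normr_ge0 (f x)) (normr_ge0 (h x)) => y z y0 z0.
have -> : y ^+ 2 + z ^+ 2 = y * z + ((y - z) ^+ 2 + y * z) by ring.
by rewrite lerDl addr_ge0 ?sqr_ge0 // mulr_ge0.
Qed.

Lemma sq_int_cst c : sq_int (cst c).
Proof. by split; [exact: measurable_cst | rewrite mom_cst ltry]. Qed.

Lemma sq_int_integrable f : sq_int f -> P.-integrable setT (EFin \o f).
Proof.
move=> sf; have := sq_int_mul sf (sq_int_cst 1).
by congr (P.-integrable setT _); apply/funext => x /=; rewrite mulr1.
Qed.

Lemma covariance_real f h : sq_int f -> sq_int h ->
  covariance P f h = (\int[P]_x (f x * h x) - (\int[P]_x f x) * (\int[P]_x h x))%:E.
Proof.
move=> sf sh; have If := sq_int_integrable sf; have Ih := sq_int_integrable sh.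
have Im := sq_int_mul sf sh.
rewrite covarianceE; [|exact/Lfun1_integrable|exact/Lfun1_integrable|exact/Lfun1_integrable].
rewrite !unlock EFinB EFinM /Rintegral !fineK //; exact: integrable_fin_num.
Qed.

Lemma norm_Rintegral_le_mom f : P.-integrable setT (EFin \o f) ->
  ((`|\int[P]_x f x|)%:E <= mom P f 1)%E.
Proof.
move=> If; have /integrableP[_ fin] := If.
have -> : mom P f 1 = (\int[P]_x (`|f x|)%:E)%E by apply: eq_integral => x _; rewrite expr1.
have F : (\int[P]_x (`|f x|)%:E)%E \is a fin_num.
  by rewrite ge0_fin_numE //; apply: integral_ge0 => x _; rewrite lee_fin.
by rewrite -(fineK F) lee_fin; exact: le_normr_Rintegral.
Qed.
End SquareIntegrable.

Section ScaledLimit.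
Context {R : realType} {dX : nat -> measure_display} {X : forall n, measurableType (dX n)}.
Context (P : forall n, probability (X n) R) (a : nat -> R) (a0 : forall n, 0 < a n).
Implicit Types (f h : forall n, X n -> R).

(** A linear calculus for the limit of [E[f_n] / a_n^2]; integrability is only eventual because [A1]
    controls moments for large [n]. *)
Definition scaled_lim f (L : R) :=
  (\forall n \near \oo, (P n).-integrable setT (EFin \o f n)) /\
  (\int[P n]_x f n x) / a n ^+ 2 @[n --> \oo] --> L.

Lemma scaled_lim_eq f h L L' : scaled_lim h L' -> (forall n x, f n x = h n x) -> L = L' ->
  scaled_lim f L.
Proof. by move=> H fh ->; have -> : f = h by apply/functional_extensionality_dep => n; apply/funext. Qed.

Lemma scaled_limD f h L L' : scaled_lim f L -> scaled_lim h L' ->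
  scaled_lim (fun n x => f n x + h n x) (L + L').
Proof.
move=> [If cf] [Ih ch]; split.
  near=> n; have I1 : (P n).-integrable setT (EFin \o f n) by near: n.
  have I2 : (P n).-integrable setT (EFin \o h n) by near: n.
  exact: (integrableD _ I1 I2).
apply: cvg_trans (cvgD cf ch); apply: near_eq_cvg; near=> n.
have I1 : (P n).-integrable setT (EFin \o f n) by near: n.
have I2 : (P n).-integrable setT (EFin \o h n) by near: n.
by rewrite -[LHS]mulrDl RintegralD.
Unshelve. all: by end_near.
Qed.

Lemma scaled_limZ (c : R) f L : scaled_lim f L -> scaled_lim (fun n x => c * f n x) (c * L).
Proof.
move=> [If cf]; split.
  near=> n; have I1 : (P n).-integrable setT (EFin \o f n) by near: n.
  exact: (integrableZl _ c I1).
have cc : c * (\int[P n]_x f n x / a n ^+ 2) @[n --> \oo] --> c * L by exact: cvgMr.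
apply: cvg_trans cc; apply: near_eq_cvg; near=> n.
have I1 : (P n).-integrable setT (EFin \o f n) by near: n.
by rewrite RintegralZl // mulrA.
Unshelve. all: by end_near.
Qed.

Lemma scaled_lim_cst (c : R) : scaled_lim (fun n (_ : X n) => a n ^+ 2 * c) c.
Proof.
split; first by near=> n; exact: finite_measure_integrable_cst.
have cc : (fun=> c) n @[n --> \oo] --> c by exact: cvg_cst.
apply: cvg_trans cc; apply: near_eq_cvg; near=> n.
rewrite Rintegral_cst // [X in fine X](_ : _ = 1%E) ?mulr1; last exact: probability_setT.
by rewrite mulrC mulKf // expf_neq0 // gt_eqF.
Unshelve. all: by end_near.
Qed.

Lemma scaled_lim0 : scaled_lim (fun n (_ : X n) => 0) 0.
Proof. by apply: (scaled_lim_eq (scaled_lim_cst 0)) => // n x; rewrite mulr0. Qed.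

Lemma scaled_lim_sum (I : Type) (r : seq I) (F : I -> forall n, X n -> R) (L : I -> R) :
  (forall i, scaled_lim (F i) (L i)) ->
  scaled_lim (fun n x => \sum_(i <- r) F i n x) (\sum_(i <- r) L i).
Proof.
move=> H; elim: r => [|i r IH].
  by apply: (scaled_lim_eq scaled_lim0) => [n x|]; rewrite big_nil.
by apply: (scaled_lim_eq (scaled_limD (H i) IH)) => [n x|]; rewrite big_cons.
Qed.

Lemma scaled_lim_vanm f : measf f -> vanm P 1 f -> vanm P 2 f ->
  scaled_lim (fun n x => a n ^+ 2 * f n x) 0.
Proof.
move=> mf v1 v2.
have I : \forall n \near \oo, (P n).-integrable setT (EFin \o f n).
  near=> n; apply: sq_int_integrable; split; first exact: mf.
  by apply: (@le_lt_trans _ _ 1%:E); rewrite ?ltry //; near: n; exact: v2.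
split.
  near=> n; have I1 : (P n).-integrable setT (EFin \o f n) by near: n.
  exact: (integrableZl _ (a n ^+ 2) I1).
apply/cvgrPdist_le => e e0; near=> n; rewrite sub0r normrN.
have I1 : (P n).-integrable setT (EFin \o f n) by near: n.
rewrite RintegralZl // mulrC mulKf ?expf_neq0 ?gt_eqF // -lee_fin.
apply: le_trans (norm_Rintegral_le_mom I1) _.
by near: n; exact: v1.
Unshelve. all: by end_near.
Qed.

End ScaledLimit.

(** * The first jet of [A1] in standard coordinates *)

Section ChartGradient.
Context {R : realType} {p : nat}.
Local Notation pt := 'rV[R]_p.
Context {Theta : set pt} {g : pt -> 'M[R]_p} (hg : metric_on Theta g).
Context {Pc : pt -> pt -> pt} (hPc : precontrast Theta g Pc).
Context {t0 : pt} {U : set pt} {phi sigma : pt -> pt} (hch : chart Theta t0 U phi sigma).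
Local Notation E := (chart_field phi sigma).

(** The precontrast is subtracted first, because its chart derivatives reproduce the metric.
    Differentiating the change of components then brings second derivatives of the chart times the
    fluctuation itself, hence [u + e] and not [e] alone. *)
Lemma chart_gradient_bound : exists2 C : R, 0 <= C & forall (al : pt -> pt) (u e : R),
  (forall i, Ck 2 (interior Theta) (fun t => al t 0 i)) ->
  (forall k, `|form_app al (E k) t0| <= u) ->
  (forall i j, `|dirder (E i) (form_app al (E j)) t0 - ip g t0 (E i t0) (E j t0)| <= e) ->
  (forall l, `|al t0 0 l| <= C * u) /\
  (forall i l, `|partial i (fun t => al t 0 l) t0 - g t0 i l| <= C * (u + e)).
Proof.
have [[oU _] [Ut0 UT] _ _ _] := hch.
have UI := chart_sub_interior hch; have It := UI _ Ut0; have Tt := interior_subset It.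
pose ph k (s : pt) := phi s 0 k.
pose B := (\sum_(kl : 'I_p * 'I_p) `|partial kl.2 (ph kl.1) t0|)
  + \sum_(kli : 'I_p * 'I_p * 'I_p) `|partial kli.2 (partial kli.1.2 (ph kli.1.1)) t0|.
have B0 : 0 <= B by apply: addr_ge0; exact: sumr_ge0.
have HB1 k l : `|partial l (ph k) t0| <= B.
  apply: ler_wpDr; first exact: sumr_ge0.
  by rewrite (bigD1 (k, l)) //= lerDl sumr_ge0.
have HB2 k l i : `|partial i (partial l (ph k)) t0| <= B.
  apply: ler_wpDl; first exact: sumr_ge0.
  by rewrite (bigD1 (k, l, i)) //= lerDl sumr_ge0.
pose q : R := p%:R; have q0 : 0 <= q by exact: ler0n.
exists (q * B + q * (B * (q * B))).
  by rewrite addr_ge0 // !mulr_ge0.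
move=> al u e Cal Hu He.
have qBB0 : 0 <= q * (B * (q * B)) by rewrite !mulr_ge0.
split=> [l|i l].
  have u0 : 0 <= u by exact: le_trans (Hu l).
  rewrite (form_app_chart hch al l Ut0); apply: (@le_trans _ _ (q * (B * u))).
    apply: norm_sum_le_card => k; rewrite normrM.
    by apply: ler_pM => //; exact: HB1.
  by rewrite mulrA ler_wpM2r // lerDl.
have u0 : 0 <= u by exact: le_trans (Hu l).
have e0 : 0 <= e by exact: le_trans (He l l).
pose be := fluct (Pc := Pc) (t0 := t0) al.
pose w k := form_app be (E k).
have Cbe n m : (forall j, Ck n (interior Theta) (fun t => al t 0 j)) -> Ck n U (fun t => be t 0 m).
  by move=> Ha; exact: (fluct_Ck hPc hch Ha).
have Cal0 m : Ck 0 (interior Theta) (fun t => al t 0 m) := CkW (CkW (Cal m)).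
have Cw k : Ck 0 U (w k) by apply: (form_app_Ck hch) => m; exact: Cbe.
have dw k : differentiable (w k) t0 by have F := Cw k; exact: F.
have Hw0 k : `|w k t0| <= u.
  rewrite /w /be /fluct form_appB; have -> : form_app (Pc t0) (E k) t0 = 0.
    by rewrite /form_app big1 // => ? _; have [_ -> //] := hPc; rewrite mxE mul0r.
  by rewrite subr0.
have Hw1 m k : `|dirder (E m) (w k) t0| <= e.
  rewrite /w /be /fluct form_appB dirderB.
  - by rewrite (dirder_pc_chart hg hPc hch).
  - apply: (Ck_diff (n := 0) (U := U)) Ut0; apply: (form_app_Ck hch) => j.
    exact: (Ck_sub UI (Cal0 j)).
  - apply: (Ck_diff (n := 0) (U := U)) Ut0; apply: (form_app_Ck hch) => j.
    by apply: (Ck_sub UI); exact: (pc_Ck1 hPc).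
have -> : partial i (fun t => al t 0 l) t0 - g t0 i l = partial i (fun t => be t 0 l) t0.
  rewrite -(metric_sym hg l i Tt) -(pc_partial1 hPc i l Tt).
  have d1 : differentiable (fun t : pt => al t 0 l) t0 by exact: Ck_diff (Cal0 l) It.
  have d2 : differentiable (fun t : pt => Pc t0 t 0 l) t0 by exact: Ck_diff (pc_Ck1 hPc 0 l It) It.
  have -> : (fun t => be t 0 l) = (fun t => al t 0 l) - (fun t => Pc t0 t 0 l).
    by apply/funext => t; rewrite /be /fluct !mxE.
  by rewrite /partial deriveB //; exact: diff_derivable.
have dph k : differentiable (partial l (ph k)) t0.
  have [_ F] := chart_Ck hch 1 k.
  by have F0 : Ck 0 U (partial l (ph k)) := F l; exact: F0.
rewrite (partial_eq_on (U := U) (h := fun t => \sum_k partial l (ph k) t * w k t) i oU) //; last first.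
  by move=> s Us; exact: (form_app_chart hch be l Us).
rewrite partial_sum; last by move=> k; exact: differentiableM.
apply: (@le_trans _ _ (q * (B * u + B * (q * (B * e))))).
  apply: norm_sum_le_card => k; rewrite partialM //.
  apply: (le_trans (ler_normD _ _)); apply: lerD; rewrite normrM; apply: ler_pM => //.
  rewrite (dirder_chart hch i Ut0 (dw k)); apply: norm_sum_le_card => m.
  by rewrite normrM; apply: ler_pM => //; exact: HB1.
have key (s b x y : R) : 0 <= s -> 0 <= b -> 0 <= x -> 0 <= y ->
    s * (b * x + b * (s * (b * y))) <= (s * b + s * (b * (s * b))) * (x + y).
  move=> s0 b0 x0 y0; rewrite -subr_ge0.
  have -> : (s * b + s * (b * (s * b))) * (x + y) - s * (b * x + b * (s * (b * y)))
    = s * b * y + s * (b * (s * b)) * x by ring.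
  by apply: addr_ge0; rewrite !mulr_ge0.
exact: key.
Qed.
End ChartGradient.

Section Families.
Context {R : realType} {dX : nat -> measure_display} {X : forall n, measurableType (dX n)}.
Context (P : forall n, probability (X n) R).
Implicit Types (Y Z : forall n, X n -> R).

Lemma scaled_lim_fsum (a : nat -> R) (a0 : forall n, 0 < a n) (I : finType) (F : I -> forall n, X n -> R) (L : I -> R) :
  (forall i, scaled_lim P a (F i) (L i)) ->
  scaled_lim P a (fun n x => \sum_i F i n x) (\sum_i L i).
Proof. exact: (scaled_lim_sum a0). Qed.

Lemma vanm_mono q Y Z : (forall n x, `|Y n x| <= `|Z n x|) -> vanm P q Z -> vanm P q Y.
Proof.
move=> YZ vZ e e0; near=> n; apply: (@le_trans _ _ (mom (P n) (Z n) q)); first exact: mom_mono.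
by near: n; exact: vZ.
Unshelve. all: by end_near.
Qed.

Lemma vanm_scale q (c : nat -> R) Y : c n @[n --> \oo] --> 0 -> measf Y -> bddm P q.+1 Y ->
  vanm P q.+1 (fun n x => c n * Y n x).
Proof.
move=> c0 mY [C HC] e e0.
have C1 : 0 < `|C| + 1 by rewrite ltr_wpDl.
have d0 : 0 < Num.min 1 (e / (`|C| + 1)) by rewrite lt_min ltr01 divr_gt0.
near=> n.
have cn : `|c n| <= Num.min 1 (e / (`|C| + 1)).
  have : `|0 - c n| <= Num.min 1 (e / (`|C| + 1)) by near: n; move/cvgrPdist_le: c0; apply.
  by rewrite sub0r normrN.
have HCn : (mom (P n) (Y n) q.+1 <= C%:E)%E by near: n.
rewrite momZ //; apply: (@le_trans _ _ ((`|c n| ^+ q.+1)%:E * C%:E)%E).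
  by rewrite lee_wpmul2l // lee_fin exprn_ge0.
rewrite -EFinM lee_fin; move: cn; rewrite le_min => /andP[cn1 cn2].
apply: (@le_trans _ _ (`|c n| * (`|C| + 1))).
  apply: (@le_trans _ _ (`|c n| ^+ q.+1 * (`|C| + 1))).
    by rewrite ler_wpM2l ?exprn_ge0 // (le_trans (ler_norm _)) // lerDl.
  by rewrite ler_wpM2r ?(ltW C1) // exprS ler_piMr // exprn_ile1.
by rewrite -ler_pdivlMr.
Unshelve. all: by end_near.
Qed.

Lemma bddm_sq_int Y : measf Y -> bddm P 2 Y -> \forall n \near \oo, sq_int (P n) (Y n).
Proof.
move=> mY [C HC]; near=> n; split; first exact: mY.
by apply: (@le_lt_trans _ _ C%:E); rewrite ?ltry //; near: n.
Unshelve. all: by end_near.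
Qed.

Lemma cvg_real_of_ereal (u : nat -> \bar R) (v : nat -> R) (L : R) :
  u n @[n --> \oo] --> L%:E -> (\forall n \near \oo, u n = (v n)%:E) -> v n @[n --> \oo] --> L.
Proof.
move=> uL uv; have H : (fun n => (v n)%:E) n @[n --> \oo] --> L%:E.
  by apply: cvg_trans uL; apply: near_eq_cvg; near=> n; near: n.
exact: (fine_cvg H).
Unshelve. all: by end_near.
Qed.
End Families.

(** * Limits under [A3] *)

Section Bias.
Context {R : realType} {p : nat}.
Local Notation pt := 'rV[R]_p.
Context {Theta : set pt} (cT : compact Theta) (kT : connected Theta) (sb : smooth_boundary Theta).
Context {g : pt -> 'M[R]_p} (hg : metric_on Theta g).
Context {dX : nat -> measure_display} {X : forall n, measurableType (dX n)}.
Context {P : forall n, probability (X n) R} {Psi : forall n, X n -> pt -> pt}.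
Context (hPsi : random_one_form Theta Psi) {a : nat -> R} (a0 : forall n, 0 < a n).
Context (al : a n @[n --> \oo] --> 0).
Context {nabla : connection R p} (cn : connection_on Theta nabla) {nu : pt -> pt}.
Context {Pc : pt -> pt -> pt} (hPc : precontrast Theta g Pc).
Context {D1 Dm1 : connection R p}.
Context (h1 : connection_D1 Theta g Pc D1) (hm1 : connection_Dm1 Theta g Pc Dm1).
Context {t0 : pt} (It : interior Theta t0) (hA1 : A1 Theta g P Psi a Pc t0).

Definition score j n (x : X n) : R := Psi x t0 0 j.
Definition score_grad i l n (x : X n) : R := partial i (fun t => Psi x t 0 l) t0.
Local Notation G := (ginv g t0).

Lemma score_measurable j : measf (score j).
Proof. by move=> n; apply: hPsi.1; exact: interior_subset. Qed.

Lemma score_grad_measurable i l : measf (score_grad i l).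
Proof.
move=> n; have oI : open (interior Theta) by exact: open_interior.
apply: (@derive_measurable _ _ _ _ (fun (x : X n) s => Psi x s 0 l)
  (interior Theta) (evec i) t0 oI It) => [s Is|x].
  by apply: hPsi.1; exact: interior_subset.
by have F := one_form_Ck (hPsi.2 n x) 0 l; exact: (Ck_diff F It).
Qed.

(** Only convergence to 0 and to [g] is kept, without rates: it supplies square integrability and
    the limit mean of the gradient, while the order [a_n^2] comes from [A3]. *)
Lemma score_limits q : (forall j, vanm P q.+1 (score j)) /\
  (forall i l, vanm P q.+1 (fun n x => score_grad i l x - g t0 i l)).
Proof.
have [U [phi [sigma [hch [A1a A1b A1c]]]]] := hA1.
have [C C0 HC] := chart_gradient_bound hg hPc hch.
pose sc n (x : X n) := score_size (Psi := Psi) (a := a) (t0 := t0) (phi := phi) (sigma := sigma) x.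
pose ie n (x : X n) := info_error (g := g) (Psi := Psi) (a := a) (t0 := t0) (phi := phi) (sigma := sigma) x.
have msc : measf sc := score_size_measurable hPsi (a := a) hch.
have mie : measf ie := info_error_measurable hPsi (g := g) (a := a) hch.
have Bsc : bddm P q.+1 sc by exact: (score_size_bddm hPsi a0 hch A1a q).
have Vie : vanm P q.+1 ie by exact: (info_error_vanm hPsi a0 hch A1b q).
pose s n := a n `^ 2^-1.
have s0 : s n @[n --> \oo] --> 0 by apply: powR_cvg0; rewrite ?invr_gt0.
have Ca : C * a n @[n --> \oo] --> 0 by rewrite -[X in _ --> X](mulr0 C); exact: cvgMr.
have Cs : C * s n @[n --> \oo] --> 0 by rewrite -[X in _ --> X](mulr0 C); exact: cvgMr.
have V1 := vanm_scale Ca msc Bsc.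
have V2 := vanm_scale Cs mie (vanm_bddm Vie).
have bound n (x : X n) : (forall l, `|score l x| <= C * (a n * sc n x)) /\
    (forall i l, `|score_grad i l x - g t0 i l| <= C * (a n * sc n x + s n * ie n x)).
  apply: HC.
  - by move=> i; apply: one_form_Ck (hPsi.2 n x) 2 i.
  - move=> l; rewrite /sc /score_size (bigD1 l) //= mulrDr.
    by apply: norm_le_scaled; [exact: a0 | exact: sumr_ge0].
  - move=> i j; rewrite /ie /info_error (bigD1 (i, j)) //= mulrDr.
    by apply: norm_le_scaled; [rewrite powR_gt0 | exact: sumr_ge0].
split=> [j|i l].
  apply: vanm_mono V1 => n x; apply: (le_trans ((bound n x).1 j)).
  by rewrite mulrA; exact: ler_norm.
have V3 := vanm_add (fun n => measurable_funM (measurable_cst (C * a n)) (msc n))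
  (fun n => measurable_funM (measurable_cst (C * s n)) (mie n)) V1 V2.
apply: vanm_mono V3 => n x; apply: (le_trans ((bound n x).2 i l)).
by rewrite mulrDr !mulrA; exact: ler_norm.
Qed.

Lemma score_sq_int j : \forall n \near \oo, sq_int (P n) (score j (n := n)).
Proof. by apply: bddm_sq_int (score_measurable j) _; exact/vanm_bddm/(score_limits 1).1. Qed.

Lemma score_grad_sq_int i l : \forall n \near \oo, sq_int (P n) (score_grad i l (n := n)).
Proof.
have mc : measf (fun n (_ : X n) => g t0 i l) by move=> n; exact: measurable_cst.
have md : measf (fun n (x : X n) => score_grad i l x - g t0 i l).
  by move=> n; apply: measurable_funB => //; exact: score_grad_measurable.
have B := bddm_add md mc (vanm_bddm ((score_limits 1).2 i l)) (bddm_cst P 2 (g t0 i l)).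
have := bddm_sq_int (fun n => measurable_funD (md n) (mc n)) B.
apply: filterS => n; congr (sq_int (P n) _); apply/funext => x /=.
by rewrite subrK.
Qed.

Lemma score_grad_mean i l : \int[P n]_x score_grad i l x @[n --> \oo] --> g t0 i l.
Proof.
apply/cvgrPdist_le => e e0; near=> n.
have sq : sq_int (P n) (score_grad i l (n := n)) by near: n; exact: score_grad_sq_int.
have I1 := sq_int_integrable sq.
have Ic : (P n).-integrable setT (EFin \o cst (- g t0 i l)) by exact: finite_measure_integrable_cst.
have I2 : (P n).-integrable setT (EFin \o (fun x => score_grad i l x - g t0 i l)).
  exact: (integrableD _ I1 Ic).
have M : \int[P n]_x (score_grad i l x - g t0 i l) = \int[P n]_x score_grad i l x - g t0 i l.
  rewrite (RintegralD _ I1 Ic) // Rintegral_cst // [X in fine X](_ : _ = 1%E) ?mulr1 //.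
  exact: probability_setT.
rewrite distrC -M -lee_fin; apply: le_trans (norm_Rintegral_le_mom I2) _.
by near: n; exact: (score_limits 0).2.
Unshelve. all: by end_near.
Qed.

Context {beta : pt -> pt} {DB : connection R p} (hA3 : A3 g P Psi a beta DB t0).

Lemma score_scaled_lim j : scaled_lim P a (score j) (beta t0 0 j).
Proof.
split; first by apply: filterS (score_sq_int j) => n; exact: sq_int_integrable.
have [H _ _] := hA3; apply: cvg_real_of_ereal (H j) _; near=> n.
have sq : sq_int (P n) (score j (n := n)) by near: n; exact: score_sq_int.
have fn : (\int[P n]_x (score j x)%:E \is a fin_num)%E.
  by apply: integrable_fin_num => //; exact: sq_int_integrable.
by rewrite unlock mulrC EFinM /Rintegral fineK.
Unshelve. all: by end_near.
Qed.

Lemma score_mean0 j : \int[P n]_x score j x @[n --> \oo] --> 0.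
Proof.
have [_ H] := score_scaled_lim j.
have a2 : a n ^+ 2 @[n --> \oo] --> 0.
  by rewrite -[X in _ --> X](mulr0 0); under eq_fun do rewrite expr2; exact: cvgM.
have H2 : (\int[P n]_x score j x / a n ^+ 2) * a n ^+ 2 @[n --> \oo] --> 0.
  by rewrite -[X in _ --> X](mulr0 (beta t0 0 j)); exact: cvgM.
apply: cvg_trans H2; apply: near_eq_cvg; near=> n.
by rewrite divfK // expf_neq0 // gt_eqF.
Unshelve. all: by end_near.
Qed.

(** [E[f h]] is the covariance plus the product of the means. The mean of [h] is of order [a_n^2]
    and that of [f] tends to [c], so the product of means survives with weight [c]. *)
Lemma scaled_lim_product (f h : forall n, X n -> R) (K B c : R) :
  (\forall n \near \oo, sq_int (P n) (f n)) -> (\forall n \near \oo, sq_int (P n) (h n)) ->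
  (((a n) ^- 2)%:E * covariance (P n) (f n) (h n))%E @[n --> \oo] --> K%:E ->
  \int[P n]_x f n x @[n --> \oo] --> c -> scaled_lim P a h B ->
  scaled_lim P a (fun n x => f n x * h n x) (K + c * B).
Proof.
move=> sf sh Hcov Hc [_ HB]; split.
  near=> n; have s1 : sq_int (P n) (f n) by near: n.
  have s2 : sq_int (P n) (h n) by near: n.
  exact: sq_int_mul.
have H1 : (a n ^- 2 * (\int[P n]_x (f n x * h n x) - (\int[P n]_x f n x) * \int[P n]_x h n x))
    @[n --> \oo] --> K.
  apply: cvg_real_of_ereal Hcov _; near=> n.
  have s1 : sq_int (P n) (f n) by near: n.
  have s2 : sq_int (P n) (h n) by near: n.
  by rewrite covariance_real // EFinM.
have H2 : (a n ^- 2 * (\int[P n]_x (f n x * h n x) - (\int[P n]_x f n x) * \int[P n]_x h n x)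
    + (\int[P n]_x f n x) * (\int[P n]_x h n x / a n ^+ 2)) @[n --> \oo] --> K + c * B.
  exact: (cvgD H1 (cvgM Hc HB)).
apply: cvg_trans H2; apply: near_eq_cvg; near=> n.
have key (w x y z : R) : w * (x - y * z) + y * (z * w) = x * w by ring.
exact: key.
Unshelve. all: by end_near.
Qed.

Lemma score_product_lim j m : scaled_lim P a (fun n x => score j x * score m x) (g t0 j m).
Proof.
have [_ H _] := hA3.
have Hc : (((a n) ^- 2)%:E * covariance (P n) (score j (n := n)) (score m (n := n)))%E
    @[n --> \oo] --> (ip g t0 (evec j) (evec m))%:E.
  have := H (cst (evec j)) (cst (evec m)) (smoothv_near_cst _ _) (smoothv_near_cst _ _).
  apply: cvg_trans; apply: near_eq_cvg; near=> n; congr (_ * covariance _ _ _)%E.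
    by apply/funext => x; rewrite form_app_evec.
  by apply/funext => x; rewrite form_app_evec.
have := scaled_lim_product (score_sq_int j) (score_sq_int m) Hc (score_mean0 j) (score_scaled_lim m).
by rewrite mul0r addr0 ip_evec.
Unshelve. all: by end_near.
Qed.

Lemma score_grad_product_lim i l j : scaled_lim P a (fun n x => score_grad i l x * score j x)
  (\sum_m DB t0 i l 0 m * g t0 m j + g t0 i l * beta t0 0 j).
Proof.
have [_ _ H] := hA3.
have Hc : (((a n) ^- 2)%:E * covariance (P n) (score_grad i l (n := n)) (score j (n := n)))%E
    @[n --> \oo] --> (ip g t0 (cov DB (cst (evec i)) (cst (evec l)) t0) (evec j))%:E.
  have := H (cst (evec i)) (cst (evec l)) (cst (evec j)) (smoothv_near_cst _ _)
    (smoothv_near_cst _ _) (smoothv_near_cst _ _).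
  apply: cvg_trans; apply: near_eq_cvg; near=> n; congr (_ * covariance _ _ _)%E.
    by apply/funext => x; rewrite form_app_evec dirder_evec.
  by apply/funext => x; rewrite form_app_evec.
have := scaled_lim_product (score_grad_sq_int i l) (score_sq_int j) Hc
  (score_grad_mean (i := i) (l := l))  (score_scaled_lim j).
by rewrite cov_evec ip_evecr.
Unshelve. all: by end_near.
Qed.

Definition raised_beta i : R := sharp g t0 (beta t0) 0 i.
(** This is [a_n * zeta_n(theta0)], written linearly in the score so that the limits above apply. *)
Definition raised_score i n (x : X n) : R := - \sum_j score j x * G j i.
Local Notation B := raised_beta.
Local Notation s := raised_score.

Lemma raised_scoreE i n (x : X n) : s i x = \sum_j (- G j i) * score j x.
Proof. by rewrite /raised_score -sumrN; apply: eq_bigr => j _; rewrite mulNr mulrC. Qed.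

Lemma raised_score_lim i : scaled_lim P a (s i) (- B i).
Proof.
apply: (scaled_lim_eq (scaled_lim_fsum a0 (fun j => scaled_limZ (- G j i) (score_scaled_lim j)))) => [n x|]; first exact: raised_scoreE.
by rewrite /raised_beta sharpE -sumrN; apply: eq_bigr => j _; rewrite mulNr mulrC.
Qed.

Lemma raised_score_product_lim i m : scaled_lim P a (fun n x => s i x * score m x) (- (i == m)%:R).
Proof.
apply: (scaled_lim_eq (scaled_lim_fsum a0 (fun j => scaled_limZ (- G j i) (score_product_lim j m)))) => [n x|].
  by rewrite raised_scoreE mulr_suml; apply: eq_bigr => j _; rewrite mulrA.
have Tt := interior_subset It.
rewrite -(ginvK hg i m Tt) -sumrN; apply: eq_bigr => j _.
by rewrite (ginv_sym hg i j Tt) mulNr.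
Qed.

Lemma raised_score_square_lim i j : scaled_lim P a (fun n x => s i x * s j x) (G i j).
Proof.
apply: (scaled_lim_eq (scaled_lim_fsum a0 (fun m => scaled_limZ (- G m j) (raised_score_product_lim i m)))) => [n x|].
  by rewrite [s j x]raised_scoreE mulr_sumr; apply: eq_bigr => m _; rewrite mulrCA.
rewrite -(sum_delta (fun m => G m j) i); apply: eq_bigr => m _.
by rewrite /evec mxE eqxx /= eq_sym mulrNN mulrC.
Qed.

Lemma raised_score_grad_lim i l : scaled_lim P a (fun n x => s i x * score_grad i l x)
  (- (DB t0 i l 0 i + g t0 i l * B i)).
Proof.
apply: (scaled_lim_eq (scaled_lim_fsum a0 (fun j => scaled_limZ (- G j i) (score_grad_product_lim i l j)))) => [n x|].
  by rewrite raised_scoreE mulr_suml; apply: eq_bigr => j _; rewrite -mulrA [score j x * _]mulrC.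
have Tt := interior_subset It.
rewrite -(flat_sharp hg (DB t0 i l) i Tt) /raised_beta sharpE mulr_sumr -big_split -sumrN /=.
by apply: eq_bigr => j _; ring.
Qed.

Context {tau : R} {V : pt -> pt} (sV : smoothv_near Theta V).
Context {mu : forall n, X n -> probability (borelV R p) R}.
Context (sel : invariant_selection Theta g nabla nu a Psi tau V mu).
Context (hA2 : A2 Theta g P a mu t0).
Let coef (t : pt) i j := tau *: nabla t i j + ((1 - tau) / 2) *: Dm1 t i j.

(** [L1] is [a_n zeta_n] taken twice, once by itself and once from the identity part of [Upsilon],
    and gives [- 2 B]. [L2], the gradient term, gives [B] plus the raised trace of [DB]: the mean of
    the gradient tends to [g], not to 0. [L3] gives minus the raised trace of [D1]. Together they
    are [- b]. [L4] tends to [- W / 2] and cancels the [W / 2] in [c0]; [L6] is the remainder of the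
    expansion in (a). *)
Lemma bias_scaled_lim k : scaled_lim P a (fun n x => post_mean Theta mu x 0 k - t0 0 k)
  ((V t0 - bias_field g beta D1 DB t0 - gamma_contract coef t0 G) 0 k).
Proof.
have Tt := interior_subset It.
pose W := \sum_i \sum_j G i j * Dm1 t0 i j 0 k.
pose c0 := V t0 0 k - gamma_contract coef t0 G 0 k + 2^-1 * W.
pose rr := rescaled_remainder (Theta := Theta) (g := g) (Psi := Psi) (a := a)
  (nabla := nabla) (Dm1 := Dm1) (t0 := t0) tau V mu.
have L1 := scaled_limZ 2 (raised_score_lim k).
have L2 := scaled_limZ (-1) (scaled_lim_fsum a0 (fun l =>
  scaled_lim_fsum a0 (fun i => scaled_limZ (G l k) (raised_score_grad_lim i l)))).
have L3 := scaled_lim_fsum a0 (fun l => scaled_lim_fsum a0 (fun i =>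
  scaled_lim_fsum a0 (fun m => scaled_limZ (D1 t0 i l 0 m * G l k) (raised_score_product_lim i m)))).
have L4 := scaled_limZ (- 2^-1) (scaled_lim_fsum a0 (fun i =>
  scaled_lim_fsum a0 (fun j => scaled_limZ (Dm1 t0 i j 0 k) (raised_score_square_lim i j)))).
have L5 := scaled_lim_cst P a0 c0.
have L6 : scaled_lim P a (fun n x => a n ^+ 2 * rr k n x) 0.
  apply: scaled_lim_vanm => //; first exact: (rescaled_remainder_measurable cT hg hPsi It sel k).
    exact: (mean_remainder_vanm cT kT sb hg hPsi a0 al cn hPc h1 hm1 It sV sel hA1 hA2).
  exact: (mean_remainder_vanm cT kT sb hg hPsi a0 al cn hPc h1 hm1 It sV sel hA1 hA2).
apply: (scaled_lim_eq (scaled_limD (scaled_limD (scaled_limD (scaled_limD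
  (scaled_limD L1 L2) L3) L4) L5) L6)) => [n x|].
  have an0 : a n != 0 by rewrite gt_eqF.
  have zs i : a n * zeta g a Psi x t0 0 i = s i x.
    by rewrite /zeta mxE sharpE mulNr mulrN mulrA mulfV // mul1r.
  rewrite /rr -(mean_remainderE cT hg hPsi a0 hPc h1 hm1 It sel) /mean_remainder mean_remainder_coord.
  have -> : gamma_contract Dm1 t0 ((zeta g a Psi x t0)^T *m zeta g a Psi x t0 - G) 0 k
      = \sum_i \sum_j Dm1 t0 i j 0 k * (zeta g a Psi x t0 0 i * zeta g a Psi x t0 0 j) - W.
    rewrite gamma_contractB !gamma_contractE; congr (_ - _).
    by apply: eq_bigr => i _; apply: eq_bigr => j _; rewrite mxE big_ord1 [_^T _ _]mxE mulrC.
  have -> : \sum_i \sum_j Dm1 t0 i j 0 k * (s i x * s j x)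
      = a n ^+ 2 * \sum_i \sum_j Dm1 t0 i j 0 k * (zeta g a Psi x t0 0 i * zeta g a Psi x t0 0 j).
    rewrite mulr_sumr; apply: eq_bigr => i _; rewrite mulr_sumr; apply: eq_bigr => j _.
    by rewrite -!zs; ring.
  have UE : a n * Upsilon g D1 Psi x (zeta g a Psi x) t0 0 k
      = s k x - \sum_l \sum_i G l k * (s i x * score_grad i l x)
        + \sum_l \sum_i \sum_m D1 t0 i l 0 m * G l k * (s i x * score m x).
    rewrite (Upsilon_coord (hPsi.2 n x)) // mulr_sumr.
    rewrite -zs -[zeta g a Psi x t0 0 k](flat_sharp hg _ k Tt) mulr_sumr -sumrB -big_split /=.
    apply: eq_bigr => l _.
    have -> : \sum_i \sum_m D1 t0 i l 0 m * G l k * (s i x * score m x)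
        = G l k * \sum_i s i x * \sum_m D1 t0 i l 0 m * score m x.
      rewrite mulr_sumr; apply: eq_bigr => i _; rewrite !mulr_sumr; apply: eq_bigr => m _; ring.
    rewrite -mulr_sumr.
    have -> : \sum_i zeta g a Psi x t0 0 i * (partial i (fun t => Psi x t 0 l) t0
        - \sum_m D1 t0 i l 0 m * Psi x t0 0 m)
      = (a n)^-1 * (\sum_i s i x * score_grad i l x - \sum_i s i x * \sum_m D1 t0 i l 0 m * score m x).
      rewrite -sumrB mulr_sumr; apply: eq_bigr => i _; rewrite -zs /score_grad /score.
      move: (zeta _ _ _ _ _ _ _) (partial _ _ _) (\sum_m _) => z1 z2 z3.
      by field.
    move: (\sum_j _) (\sum_i s i x * score_grad i l x) (\sum_i s i x * _) (G l k) => z1 z2 z3 z4.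
    by field.
  rewrite [a n * (_ + _)]mulrDr UE zs /c0.
  have -> : gamma_contract (fun t i j => tau *: nabla t i j + ((1 - tau) / 2) *: Dm1 t i j) t0 G 0 k
    = gamma_contract coef t0 G 0 k by [].
  clear L1 L2 L3 L4 L5 L6 UE c0.
  set z1 := \sum_l \sum_i \sum_m D1 t0 i l 0 m * G l k * (s i x * score m x).
  set z2 := \sum_l \sum_i G l k * (s i x * score_grad i l x).
  set z3 := \sum_i \sum_j Dm1 t0 i j 0 k * (zeta g a Psi x t0 0 i * zeta g a Psi x t0 0 j).
  clearbody z1 z2 z3 W.
  move: (s k x) (gamma_contract coef t0 G 0 k) (V t0 0 k) (t0 0 k) (post_mean Theta mu x 0 k) => z5 z6 z7 z8 z9.
  by field.
have -> : (V t0 - bias_field g beta D1 DB t0 - gamma_contract coef t0 G) 0 k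
    = V t0 0 k - bias_field g beta D1 DB t0 0 k - gamma_contract coef t0 G 0 k by rewrite !mxE.
have bE : bias_field g beta D1 DB t0 0 k
    = B k + \sum_l \sum_i G l k * (D1 t0 i l 0 i - DB t0 i l 0 i).
  rewrite /bias_field sharpE /raised_beta sharpE -big_split /=; apply: eq_bigr => l _.
  by rewrite !mxE mulrDl -mulr_sumr [G l k * _]mulrC.
have E2 : \sum_l \sum_i G l k * - (DB t0 i l 0 i + g t0 i l * B i)
    = - (\sum_l \sum_i G l k * DB t0 i l 0 i) - B k.
  have -> : B k = \sum_l (\sum_i B i * g t0 i l) * G l k by rewrite (flat_sharp hg _ k Tt).
  rewrite -!sumrN -big_split /=; apply: eq_bigr => l _.
  rewrite mulr_suml -!sumrN -big_split /=; apply: eq_bigr => i _; ring.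
have E3 : \sum_l \sum_i \sum_m D1 t0 i l 0 m * G l k * - (i == m)%:R
    = - \sum_l \sum_i G l k * D1 t0 i l 0 i.
  rewrite -sumrN; apply: eq_bigr => l _; rewrite -sumrN; apply: eq_bigr => i _.
  rewrite (bigD1 i) //= big1 ?addr0; first by rewrite eqxx /=; ring.
  by move=> m mi; rewrite eq_sym (negbTE mi) mulr0n oppr0 mulr0.
have E4 : \sum_i \sum_j Dm1 t0 i j 0 k * G i j = W.
  by apply: eq_bigr => i _; apply: eq_bigr => j _; rewrite mulrC.
have E5 : \sum_l \sum_i G l k * (D1 t0 i l 0 i - DB t0 i l 0 i)
   = \sum_l \sum_i G l k * D1 t0 i l 0 i - \sum_l \sum_i G l k * DB t0 i l 0 i.
  by rewrite -sumrB; apply: eq_bigr => l _; rewrite -sumrB; apply: eq_bigr => i _; rewrite mulrBr.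
rewrite bE E2 E3 E4 E5 /c0; clear L1 L2 L3 L4 L5 L6 E4 c0.
move: (\sum_l \sum_i G l k * D1 t0 i l 0 i) (\sum_l \sum_i G l k * DB t0 i l 0 i) => z1 z2.
move: (B k) W (V t0 0 k) (gamma_contract coef t0 G 0 k) => z3 z4 z5 z6.
by field.
Qed.

Theorem bias_expansion :
  (fun n => (\row_i (\int[P n]_x post_mean Theta mu x 0 i) - t0) - (a n) ^+ 2 *:
     (V t0 - bias_field g beta D1 DB t0 - gamma_contract coef t0 G))
  =o_\oo (fun n => (a n) ^+ 2).
Proof.
apply/eqoP => e e0; set c := V t0 - _ - _.
have H k : \forall n \near \oo, `|\int[P n]_x post_mean Theta mu x 0 k - t0 0 k - a n ^+ 2 * c 0 k|
    <= e * a n ^+ 2.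
  have [I HL] := bias_scaled_lim k; near=> n.
  have I1 : (P n).-integrable setT (EFin \o (fun x => post_mean Theta mu x 0 k - t0 0 k)) by near: n.
  have Ic : (P n).-integrable setT (EFin \o cst (t0 0 k)) by exact: finite_measure_integrable_cst.
  have a20 : 0 < a n ^+ 2 by rewrite exprn_gt0.
  have -> : \int[P n]_x post_mean Theta mu x 0 k
      = \int[P n]_x (post_mean Theta mu x 0 k - t0 0 k) + t0 0 k.
    rewrite -[X in _ + X](_ : \int[P n]_x cst (t0 0 k) x = _); last first.
      by rewrite Rintegral_cst // [X in fine X](_ : _ = 1%E) ?mulr1 //; exact: probability_setT.
    by rewrite -RintegralD //; apply: eq_Rintegral => x _; rewrite /= subrK.
  rewrite addrK -ler_pdivrMr // -[X in _ / X]gtr0_norm // -normf_div.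
  rewrite mulrBl [a n ^+ 2 * _]mulrC mulfK ?gt_eqF // distrC.
  by near: n; move/cvgrPdist_le: HL; apply.
near=> n.
rewrite [X in _ <= _ * X]ger0_norm ?exprn_ge0 ?(ltW (a0 _)) //.
apply: norm_le_coord; first by rewrite mulr_ge0 ?exprn_ge0 // ltW.
move=> k.
have key (m t v : pt) (b : R) : (m - t - b *: v) 0 k = m 0 k - t 0 k - b * v 0 k by rewrite !mxE.
rewrite key [(\row_i _) 0 k]mxE.
have Hn : forall k, `|\int[P n]_x post_mean Theta mu x 0 k - t0 0 k - a n ^+ 2 * c 0 k| <= e * a n ^+ 2.
  by near: n; apply: filter_forall.
exact: Hn.
Unshelve. all: by end_near.
Qed.

Theorem bias_vanishes :
  V t0 = bias_field g beta D1 DB t0 + gamma_contract coef t0 G ->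
  (fun n => (\row_i (\int[P n]_x post_mean Theta mu x 0 i) - t0)) =o_\oo (fun n => (a n) ^+ 2).
Proof.
move=> VE; have := bias_expansion; rewrite VE [X in X - _]addrAC subrr add0r subrr.
by under eq_fun do rewrite scaler0 subr0.
Qed.

End Bias.

Unset Implicit Arguments.

Theorem corollary4p4 (R : realType) (p : nat)
  (Theta : set 'rV[R]_p) (theta0 : 'rV[R]_p)
  (dX : nat -> measure_display) (X : forall n, measurableType (dX n))
  (P : forall n, 'rV[R]_p -> probability (X n) R)
  (Psi : forall n, X n -> 'rV[R]_p -> 'rV[R]_p)
  (a : nat -> R)
  (g : 'rV[R]_p -> 'M[R]_p)
  (nu : 'rV[R]_p -> 'rV[R]_p)
  (Pc : 'rV[R]_p -> 'rV[R]_p -> 'rV[R]_p)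
  (nabla D1 Dm1 : connection R p)
  (hcompact : compact Theta) (hconnected : connected Theta)
  (hboundary : smooth_boundary Theta)
  (htheta0 : interior Theta theta0)
  (hPsi : random_one_form Theta Psi)
  (ha_pos : forall n, 0 < a n)
  (ha_dec : forall m n, (m <= n)%N -> a n <= a m)
  (ha_lim : a n @[n --> \oo] --> 0)
  (hg : metric_on Theta g)
  (hnu : outward_unit_normal Theta g nu)
  (hnabla : levi_civita Theta g nabla)
  (hPc : precontrast Theta g Pc)
  (hD1 : connection_D1 Theta g Pc D1)
  (hDm1 : connection_Dm1 Theta g Pc Dm1) :
  let P0 := fun n => P n theta0 in
  let coef := fun tau : R => fun t i j =>
    tau *: nabla t i j + ((1 - tau) / 2) *: Dm1 t i j in
  (* (a) *)
  (forall (tau : R) (V : 'rV[R]_p -> 'rV[R]_p)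
     (mu : forall n, X n -> probability (borelV R p) R),
     0 <= tau -> smoothv_near Theta V ->
     invariant_selection Theta g nabla nu a Psi tau V mu ->
     A1 Theta g P0 Psi a Pc theta0 ->
     A2 Theta g P0 a mu theta0 ->
     littleo_Linf P0
       (fun n x =>
          let z := zeta g a Psi x in
          post_mean Theta mu x
          - (theta0
             + a n *: (z theta0 + Upsilon g D1 Psi x z theta0)
             + (a n) ^+ 2 *:
               (V theta0
                - gamma_contract (coef tau) theta0 (ginv g theta0)
                - 2^-1 *: gamma_contract Dm1 theta0
                    ((z theta0)^T *m z theta0 - ginv g theta0))))
       (fun n => (a n) ^+ 2))
  /\
  (* (b) *)
  ((forall (tau1 tau2 : R) (V1 V2 : 'rV[R]_p -> 'rV[R]_p)
     (mu1 mu2 : forall n, X n -> probability (borelV R p) R),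
     0 <= tau1 -> 0 <= tau2 ->
     smoothv_near Theta V1 -> smoothv_near Theta V2 ->
     invariant_selection Theta g nabla nu a Psi tau1 V1 mu1 ->
     invariant_selection Theta g nabla nu a Psi tau2 V2 mu2 ->
     A1 Theta g P0 Psi a Pc theta0 ->
     A2 Theta g P0 a mu1 theta0 ->
     A2 Theta g P0 a mu2 theta0 ->
     littleo_Linf P0
       (fun n x =>
          post_mean Theta mu1 x - post_mean Theta mu2 x
          - (a n) ^+ 2 *:
            (V1 theta0 - V2 theta0
             - (tau1 - tau2) *:
               gamma_contract (fun t i j => nabla t i j - 2^-1 *: Dm1 t i j)
                 theta0 (ginv g theta0)))
       (fun n => (a n) ^+ 2))
   /\ (torsion_free Theta D1 ->
       forall t i j, Theta t ->
         nabla t i j - 2^-1 *: Dm1 t i j = 2^-1 *: D1 t i j))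
  /\
  (* (c) *)
  (forall (tau : R) (V : 'rV[R]_p -> 'rV[R]_p)
     (mu : forall n, X n -> probability (borelV R p) R)
     (beta : 'rV[R]_p -> 'rV[R]_p) (DB : connection R p),
     0 <= tau -> smoothv_near Theta V ->
     invariant_selection Theta g nabla nu a Psi tau V mu ->
     smoothv_near Theta beta -> connection_on Theta DB ->
     A1 Theta g P0 Psi a Pc theta0 ->
     A2 Theta g P0 a mu theta0 ->
     A3 g P0 Psi a beta DB theta0 ->
     let b := bias_field g beta D1 DB in
     let bias := fun n : nat =>
       \row_i (\int[P0 n]_x post_mean Theta mu x 0 i) - theta0 in
     (fun n => bias n - (a n) ^+ 2 *:
        (V theta0 - b theta0 - gamma_contract (coef tau) theta0 (ginv g theta0)))
       =o_\oo (fun n => (a n) ^+ 2)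
     /\ ((forall t, Theta t ->
            V t = b t + gamma_contract (coef tau) t (ginv g t)) ->
         bias =o_\oo (fun n => (a n) ^+ 2))).
Proof.
move=> P0 coef; have cn : connection_on Theta nabla by case: hnabla.
split; [|split; [split|]].
- move=> tau V mu _ sV sel hA1 hA2.
  exact: (mean_expansion hcompact hconnected hboundary hg hPsi ha_pos ha_lim cn hPc
    hD1 hDm1 htheta0 hA1 sV sel hA2).
- move=> tau1 tau2 V1 V2 mu1 mu2 _ _ sV1 sV2 sel1 sel2 hA1 hA21 hA22.
  exact: (mean_difference hcompact hconnected hboundary hg hPsi ha_pos ha_lim cn hPc
    hD1 hDm1 htheta0 hA1 sV1 sV2 sel1 sel2 hA21 hA22).
- move=> tf t i j Tt.
  exact: (lc_boundary hg hPc i j hboundary hnabla hD1 hDm1 tf Tt).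
move=> tau V mu beta DB _ sV sel _ _ hA1 hA2 hA3 b bias; split.
  exact: (bias_expansion hcompact hconnected hboundary hg hPsi ha_pos ha_lim cn hPc
    hD1 hDm1 htheta0 hA1 hA3 sV sel hA2).
move=> VE; apply: (bias_vanishes hcompact hconnected hboundary hg hPsi ha_pos ha_lim cn hPc
  hD1 hDm1 htheta0 hA1 hA3 sV sel hA2).
by apply: VE; exact: interior_subset.
Qed.
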